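(* Let $\Omega$ be a smooth bounded domain of $\mathbb{R}^N$, $T\in(0,\infty]$, $p,q>1$, and let $\mathrm{A}$ and $g$ be Caratheodory functions such that, for any $(u,\eta)\in\mathbb{R}\times\mathbb{R}^N$ and a.e. $(x,t)\in\Omega\times(0,\infty)$, $$|\mathrm{A}(x,t,u,\eta)|\le C(|\eta|^{p-1}+b(x,t)),\quad C>0,\ b\in L^{p'}(\Omega\times(0,\infty)),$$ $$\mathrm{A}(x,t,u,\eta)\cdot\eta\ge\nu|\eta|^p,\quad\nu\ge0,$$ $$g(x,t,u,\eta)\,u\ge\gamma|u|^{\lambda+1}|\eta|^q,\quad\lambda\ge0,\ \gamma\ge0.$$ Consider the problem $$(P_{\Omega,T})\qquad u_t-\operatorname{div}(\mathrm{A}(x,t,u,\nabla u))+g(x,t,u,\nabla u)=0\ \text{in }\Omega\times(0,T),\quad u=0\ \text{on }\partial\Omega\times(0,T),\quad u(\cdot,0)=u_0.$$ 1) Let $u_0\in L^r(\Omega)$, $r\ge1$, and let $u$ be any renormalized solution of $(P_{\Omega,T})$. Then for any $t\in[0,T)$, $$\int_\Omega|u|^r(\cdot,t)\,dx\le\int_\Omega|u_0|^r\,dx.$$ Moreover if $r>1$, or if $g$ is coercive (i.e. $\gamma>0$), then $\gamma|u|^{\lambda+r-1}|\nabla u|^q+\nu|u|^{r-2}|\nabla u|^p\in L^1_{loc}([0,T);L^1(\Omega))$, and $$\int_\Omega|u|^r(\cdot,t)\,dx+r\gamma\int_0^t\!\!\int_\Omega|u|^{\lambda+r-1}|\nabla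 u|^q\,dx\,dt+r(r-1)\nu\int_0^t\!\!\int_\Omega|u|^{r-2}|\nabla u|^p\,dx\,dt\le\int_\Omega|u_0|^r\,dx.$$ 2) Let $u_0\in\mathcal{M}_b^+(\Omega)$ and let $u$ be any nonnegative renormalized solution of $(P_{\Omega,T})$. Then the same conclusions hold (for $t\in(0,T)$) as in the case $u_0\in L^1(\Omega)$, that is, with $r=1$, where the norm $\|u_0\|_{L^1(\Omega)}$ is replaced by $\int_\Omega du_0$.
   Context: Notation: $Q_{\Omega,s,\tau}=\Omega\times(s,\tau)$; $T_k(\theta)=\max(-k,\min(k,\theta))$; $p'=p/(p-1)$; $\mathcal{M}_b(\Omega)$ is the set of bounded Radon measures on $\Omega$ and $\mathcal{M}_b^+(\Omega)$ the cone of nonnegative ones; $C_b(\Omega)$ is the space of bounded continuous functions on $\Omega$; $L^1_{loc}([0,T);X)$ means integrability on $(0,\tau)$ with values in $X$ for every $\tau<T$. For measurable $u$ with $T_k(u)\in L^p((s,\tau);W_0^{1,p}(\Omega))$ for all $k>0$, $\nabla u$ is defined by $\nabla u=\nabla(T_k(u))$ on $\{|u|\le k\}$. Renormalized solution with $L^1$ data: given $f\in L^1(Q_{\Omega,s,\tau})$ and $u_s\in L^1(\Omega)$, a function $u\in L^\infty((s,\tau);L^1(\Omega))$ is a renormalized solution in $Q_{\Omega,s,\tau}$ of $u_t-\operatorname{div}(\mathrm{A}(x,t,u,\nabla u))=f$, $u=0$ on $\partial\Omega\times(s,\tau)$, $u(\cdot,s)=u_s$, if $T_k(u)\in L^p((s,\tau);W_0^{1,p}(\Omega))$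 for any $k\ge0$; for any $S\in W^{2,\infty}(\mathbb{R})$ such that $S'$ has compact support, $$(S(u))_t-\operatorname{div}(\mathrm{A}(x,t,u,\nabla u)S'(u))+S''(u)\,\mathrm{A}(x,t,u,\nabla u)\cdot\nabla u-S'(u)f=0\quad\text{in }\mathcal{D}'(Q_{\Omega,s,\tau});$$ $u(\cdot,s)=u_s$ (in the sense $S(u)(\cdot,s)=S(u_s)$, meaningful since $S(u)\in C([s,\tau];L^1(\Omega))$); and $$\lim_{n\to\infty}\iint_{Q_{\Omega,s,\tau}\cap\{n\le|u|\le n+1\}}|\nabla u|^p\,dx\,dt=0.$$ Renormalized solution of $(P_{\Omega,T})$: (i) $u\in C((0,T);L^1(\Omega))$, $T_k(u)\in L^p_{loc}((0,T);W_0^{1,p}(\Omega))$ for any $k\ge0$, and $g(x,t,u,\nabla u)\in L^1_{loc}((0,T);L^1(\Omega))$; (ii) for any $0<s<\tau<T$, $u$ is a renormalized solution with $L^1$ data in $Q_{\Omega,s,\tau}$ of $u_t-\operatorname{div}(\mathrm{A}(x,t,u,\nabla u))=f$, $u=0$ on $\partial\Omega\times(s,\tau)$, with $f=-g(x,t,u,\nabla u)$ and initial data $u(\cdot,s)$ at time $s$; (iii) if $u_0\in L^r(\Omega)$, the extension of $u$ by $u_0$ at time $0$ belongs to $C([0,T);L^r(\Omega))$; if $u_0\in\mathcal{M}_b(\Omega)$, then $\lim_{t\to0}\int_\Omega u(\cdot,t)\psi\,dx=\int_\Omega\psi\,du_0$ for all $\psi\in C_b(\Omega)$.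
   Formalization: For r=1 and γ>0 (also in part 2) only γ|u|^λ|∇u|^q is claimed to be in L^1_loc([0,T);L^1(Ω)); the term ν|u|^{-1}|∇u|^p is dropped, since it can fail to be integrable near ∂Ω (e.g. p=q=2, A=∇u, g=u|∇u|² on (0,1)). *)

(* Defs.v *)
From HB Require Import structures.
From mathcomp Require Import all_boot all_order all_algebra.
From mathcomp Require Import all_classical all_reals all_analysis.
Set Implicit Arguments.
Unset Strict Implicit.
Unset Printing Implicit Defensive.
Import Order.TTheory GRing.Theory Num.Theory numFieldNormedType.Exports.
Local Open Scope classical_set_scope.
Local Open Scope ring_scope.

Section measurable_rV.
Context {R : realType} (n : nat).

Let coors : 'I_n -> 'rV[R]_n -> R := fun i x => x ord0 i.

Let rV_set0 : g_sigma_preimage coors set0.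
Proof. exact: sigma_algebra0. Qed.

Let rV_setC A : g_sigma_preimage coors A -> g_sigma_preimage coors (~` A).
Proof. exact: sigma_algebraC. Qed.

Let rV_bigcup (F : _^nat) : (forall i, g_sigma_preimage coors (F i)) ->
  g_sigma_preimage coors (\bigcup_i (F i)).
Proof. exact: sigma_algebra_bigcup. Qed.

HB.instance Definition _ := @isMeasurable.Build default_measure_display
  'rV[R]_n (g_sigma_preimage coors) rV_set0 rV_setC rV_bigcup.

Lemma measurable_coor (i : 'I_n) :
  measurable_fun [set: 'rV[R]_n] (fun x : 'rV[R]_n => x ord0 i : R).
Proof.
move=> _ Y mY; rewrite setTI; apply: sub_sigma_algebra => /=.
rewrite -bigcup_seq/=; exists i => /=; first by rewrite mem_index_enum.
by exists Y => //; rewrite setTI.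
Qed.

Lemma measurable_fun_rVP d (T : measurableType d) (f : T -> 'rV[R]_n) :
  (forall i, measurable_fun [set: T] (fun x => f x ord0 i : R)) ->
  measurable_fun [set: T] f.
Proof.
move=> mf _ Y mY; rewrite setTI; move: Y mY.
apply: smallest_sub.
  split; rewrite /= ?preimage_set0//.
  - by move=> A mA; rewrite setTD preimage_setC; exact: measurableC.
  - by move=> F mF; rewrite preimage_bigcup; exact: bigcup_measurable.
move=> A; rewrite -bigcup_seq/= => -[i /= _ [B mB <-]].
by rewrite setTI -[X in measurable X]setTI; exact: mf.
Qed.

End measurable_rV.

Section lebesgue_rV.
Context {R : realType}.

Definition rV_cons n (z : R * 'rV[R]_n) : 'rV[R]_n.+1 :=
  \row_i (if unlift ord0 i is Some j then z.2 ord0 j else z.1).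

Definition rV_uncons n (x : 'rV[R]_n.+1) : R * 'rV[R]_n :=
  (x ord0 ord0, \row_j x ord0 (lift ord0 j)).

Lemma rV_consK n : cancel (@rV_cons n) (@rV_uncons n).
Proof.
case=> a v; rewrite /rV_uncons /rV_cons; congr pair.
  by rewrite mxE unlift_none.
by apply/rowP => j; rewrite !mxE liftK.
Qed.

Lemma measurable_rV_cons n :
  measurable_fun [set: measurableTypeR R * 'rV[R]_n] (@rV_cons n).
Proof.
apply: measurable_fun_rVP => i; rewrite /rV_cons.
case: (unliftP ord0 i) => [j ->|->].
- under eq_fun do rewrite mxE liftK.
  have mj : measurable_fun [set: 'rV[R]_n] (fun x : 'rV[R]_n => x ord0 j : R).
    exact: measurable_coor.
  exact: (measurableT_comp mj measurable_snd).
- under eq_fun do rewrite mxE unlift_none.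
  exact: measurable_fst.
Qed.

Lemma measurable_rV_uncons n : measurable_fun [set: 'rV[R]_n.+1]
  (@rV_uncons n : _ -> measurableTypeR R * 'rV[R]_n).
Proof.
apply/measurable_fun_pairP; split; first exact: measurable_coor.
apply: measurable_fun_rVP => i /=.
by under eq_fun do rewrite mxE; exact: measurable_coor.
Qed.

Section step.
Variables (n : nat) (mu : {sigma_finite_measure set 'rV[R]_n -> \bar R}).

Definition lebesgue_step : set 'rV[R]_n.+1 -> \bar R :=
  pushforward (lebesgue_measure \x mu)%E (@rV_cons n).

Let preimage_rV_cons A : measurable A -> measurable (@rV_cons n @^-1` A).
Proof.
by move=> mA; rewrite -[X in measurable X]setTI; exact: measurable_rV_cons.
Qed.

Let lebesgue_step0 : lebesgue_step set0 = 0%E.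
Proof. by rewrite /lebesgue_step /pushforward preimage_set0 measure0. Qed.

Let lebesgue_step_ge0 A : (0 <= lebesgue_step A)%E.
Proof. exact: (measure_ge0 (lebesgue_measure \x mu)%E). Qed.

Let lebesgue_step_sigma_additive : semi_sigma_additive lebesgue_step.
Proof.
move=> F mF tF mUF; rewrite /lebesgue_step /pushforward preimage_bigcup.
apply: measure_semi_sigma_additive.
- by move=> k; exact: preimage_rV_cons.
- apply/trivIsetP => /= i j _ _ ij; rewrite -preimage_setI.
  by move/trivIsetP : tF => /(_ _ _ _ _ ij) ->//; rewrite preimage_set0.
- by rewrite -preimage_bigcup; exact: preimage_rV_cons.
Qed.

HB.instance Definition _ := isMeasure.Build _ _ _ lebesgue_step
  lebesgue_step0 lebesgue_step_ge0 lebesgue_step_sigma_additive.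

Let lebesgue_step_sigma_finite : sigma_finite setT lebesgue_step.
Proof.
have [F TF Foo] : sigma_finite setT (@lebesgue_measure R \x mu)%E.
  have /sigma_finiteP[F [TF ndF Foo]] := sigma_finiteT (@lebesgue_measure R).
  have /sigma_finiteP[G [TG ndG Goo]] := sigma_finiteT mu.
  exists (fun k => F k `*` G k).
    rewrite -setXTT TF TG predeqE => -[x y]; split.
      move=> [/= [k _ Fkx] [l _ Gly]]; exists (maxn k l) => //; split.
      - by move: x Fkx; exact/subsetPset/ndF/leq_maxl.
      - by move: y Gly; exact/subsetPset/ndG/leq_maxr.
    by move=> [k _ []/= ? ?]; split; exists k.
  move=> k; have [? ?] := Foo k; have [? ?] := Goo k.
  split; first exact: measurableX.
  by rewrite product_measure1E// lte_mul_pinfty// ge0_fin_numE.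
exists (fun k => @rV_uncons n @^-1` F k).
  by rewrite -preimage_bigcup -TF preimage_setT.
move=> k; have [mFk Fkoo] := Foo k; split.
  by rewrite -[X in measurable X]setTI; exact: measurable_rV_uncons.
rewrite /lebesgue_step /pushforward -comp_preimage.
rewrite (_ : _ \o _ = id) ?preimage_id//.
by apply/funext => z /=; rewrite rV_consK.
Qed.

HB.instance Definition _ := Measure_isSigmaFinite.Build _ _ _ lebesgue_step
  lebesgue_step_sigma_finite.

End step.

Fixpoint lebesgue_rV n : {sigma_finite_measure set 'rV[R]_n -> \bar R} :=
  match n with
  | 0 => [the {sigma_finite_measure set 'rV[R]_0 -> \bar R} of
           \d_(0 : 'rV[R]_0)]
  | n'.+1 => [the {sigma_finite_measure set 'rV[R]_n'.+1 -> \bar R} of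
               lebesgue_step (lebesgue_rV n')]
  end.

End lebesgue_rV.

Lemma lebesgue_rV_box (R : realType) n (A : 'I_n -> set R) :
  (forall i, measurable (A i)) ->
  lebesgue_rV n [set x | forall i, A i (x ord0 i)] =
  (\prod_(i < n) @lebesgue_measure R (A i))%E.
Proof.
elim: n A => [|n IH] A mA.
  rewrite big_ord0 /= diracE (_ : _ \in _ = true)//.
  by apply/mem_set => -[].
rewrite big_ord_recl -IH//= /lebesgue_step /pushforward.
pose B := [set x : 'rV[R]_n | forall i, A (lift ord0 i) (x ord0 i)].
have mB : measurable B.
  rewrite (_ : B = \bigcap_(i in [set: 'I_n])
      ((fun x : 'rV[R]_n => x ord0 i : R) @^-1` A (lift ord0 i))).
    apply: fin_bigcap_measurable => // i _.
    rewrite -[X in measurable X]setTI.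
    by apply: measurable_coor => //; exact: mA.
  apply/seteqP; split => x /= h; first by move=> i _; exact: h.
  by move=> i; exact: (h i I).
rewrite (_ : _ @^-1` _ = A ord0 `*` B).
  exact: (product_measure1E (@lebesgue_measure R) (lebesgue_rV n) (mA ord0) mB).
rewrite predeqE => -[a v] /=; split.
  move=> h; split => [|i]; first by have := h ord0; rewrite mxE unlift_none.
  by have := h (lift ord0 i); rewrite mxE liftK.
by move=> [h0 h] i; rewrite mxE; case: unliftP => [j ->|->]; [exact: h|].
Qed.

Section vectors.
Context {R : realType} {N : nat}.
Implicit Types x y : 'rV[R]_N.

Definition dotv x y : R := \sum_(i < N) x ord0 i * y ord0 i.
(* the library's norm on 'rV[R]_N is the sup norm *)
Definition enorm x : R := Num.sqrt (dotv x x).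

End vectors.

Section calculus.
Context {R : realType}.

(* C^oo on a finite-dimensional space: all iterated directional derivatives
   exist and are continuous *)
Definition smooth (V : normedModType R) (f : V -> R) : Prop :=
  forall vs : seq V, let h := foldr (fun v h => 'D_v h) f vs in
    continuous h /\ (forall x v, derivable h x v).

Definition test_function (V : normedModType R) (U : set V) (f : V -> R) : Prop :=
  smooth f /\ (exists K : set V, [/\ compact K, K `<=` U &
                                   forall x, ~ K x -> f x = 0]).

Definition grad N (f : 'rV[R]_N -> R) (x : 'rV[R]_N) : 'rV[R]_N :=
  \row_i 'D_(delta_mx ord0 i) f x.

Definition xgrad N (f : 'rV[R]_N * R -> R) (z : 'rV[R]_N * R) : 'rV[R]_N :=
  \row_i 'D_((delta_mx ord0 i, 0) : 'rV[R]_N * R) f z.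

Definition tderiv N (f : 'rV[R]_N * R -> R) (z : 'rV[R]_N * R) : R :=
  'D_((0, 1) : 'rV[R]_N * R) f z.

(* the boundary is locally the zero set of a smooth function with nonzero
   gradient, the domain lying locally on one side of it *)
Definition smooth_boundary N (Om : set 'rV[R]_N) : Prop :=
  forall x, (closure Om `\` Om) x ->
    exists phi : 'rV[R]_N -> R,
      [/\ smooth phi, grad phi x != 0 &
          \forall y \near x, Om y <-> phi y < 0].

Definition smooth_bounded_domain N (Om : set 'rV[R]_N) : Prop :=
  [/\ open Om, Om !=set0, connected Om, bounded_set Om & smooth_boundary Om].

End calculus.

Section lebesgue_spaces.
Context {R : realType} d {T : measurableType d}.
Variable mu : {measure set T -> \bar R}.
Implicit Types (D : set T) (f : T -> R).

(* measurability with respect to the mu-completed sigma-algebra *)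
Definition cmeasurable D f : Prop :=
  exists2 h : T -> R, measurable_fun D h & {ae mu, forall z, D z -> f z = h z}.

Definition in_Lp (p : R) D f : Prop :=
  cmeasurable D f /\ (\int[mu]_(z in D) (`|f z| `^ p)%:E < +oo)%E.

Definition in_Loo D f : Prop :=
  cmeasurable D f /\ exists M : R, {ae mu, forall z, D z -> `|f z| <= M}.

Definition in_Lp_vec N (p : R) D (F : T -> 'rV[R]_N) : Prop :=
  (forall i, cmeasurable D (fun z => F z ord0 i)) /\
  (\int[mu]_(z in D) (enorm (F z) `^ p)%:E < +oo)%E.

End lebesgue_spaces.

Section parabolic.
Context {R : realType} {N : nat}.
Implicit Types (Om : set 'rV[R]_N) (s tau p q k lambda gamma nu : R) (T : \bar R).

Local Notation E := 'rV[R]_N.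
Local Notation leb := (lebesgue_rV N : {measure set E -> \bar R}).

Definition spacetime_measure :
    {measure set (E * measurableTypeR R)%type -> \bar R} :=
  (lebesgue_rV N \x @lebesgue_measure R)%E.
Local Notation leb2 := spacetime_measure.

Definition cylinder Om (s tau : \bar R) : set (E * R) :=
  [set z | Om z.1 /\ (s < z.2%:E < tau)%E].

Definition extend0 (u0 : E -> R) (u : E * R -> R) (t : R) (x : E) : R :=
  if t == 0 then u0 x else u (x, t).

(* C(I; L^r(Om)); the slices w t are defined for every t in I *)
Definition continuous_Lr Om (r : R) (I : set R) (w : R -> E -> R) : Prop :=
  (forall t, I t -> in_Lp leb r Om (w t)) /\
  (forall t, I t ->
    (fun t' => \int[leb]_(x in Om) (`|w t' x - w t x| `^ r)%:E)%E
      @ within I (nbhs t) --> 0%E).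

Definition in_Loo_L1 Om s tau (u : E * R -> R) : Prop :=
  cmeasurable leb2 (cylinder Om s%:E tau%:E) u /\
  exists M : R, {ae @lebesgue_measure R, forall t, s < t < tau ->
    (\int[leb]_(x in Om) `|u (x, t)|%:E <= M%:E)%E}.

(* v belongs to W_0^{1,p}(Om), the closure of C_c^oo(Om) in W^{1,p}(Om),
   and its gradient is G *)
Definition in_W0 Om p (v : E -> R) (G : E -> E) : Prop :=
  [/\ in_Lp leb p Om v, in_Lp_vec leb p Om G &
    exists phi : nat -> E -> R,
      [/\ forall n, test_function Om (phi n),
          (fun n => \int[leb]_(x in Om) (`|phi n x - v x| `^ p)%:E)%E
            @ \oo --> 0%E &
          (fun n => \int[leb]_(x in Om) (enorm (grad (phi n) x - G x) `^ p)%:E)%E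
            @ \oo --> 0%E]].

(* v belongs to the Bochner space L^p((s, tau); W_0^{1,p}(Om)), seen as a space
   of functions on Om x (s, tau), and its space gradient is G *)
Definition in_Lp_W0 Om s tau p (v : E * R -> R) (G : E * R -> E) : Prop :=
  [/\ in_Lp leb2 p (cylinder Om s%:E tau%:E) v,
      in_Lp_vec leb2 p (cylinder Om s%:E tau%:E) G &
      {ae @lebesgue_measure R, forall t, s < t < tau ->
        in_W0 Om p (fun x => v (x, t)) (fun x => G (x, t))}].

Definition trunc k (y : R) : R := Num.max (- k) (Num.min k y).

(* T_k(u) belongs to L^p((s, tau); W_0^{1,p}(Om)) for all k >= 0, and Du is
   the gradient of u, i.e. the gradient of T_k(u) on {|u| <= k} *)
Definition trunc_in_Lp_W0 Om s tau p (u : E * R -> R) (Du : E * R -> E) : Prop :=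
  forall k, 0 <= k -> exists G : E * R -> E,
    in_Lp_W0 Om s tau p (fun z => trunc k (u z)) G /\
    {ae leb2, forall z, cylinder Om s%:E tau%:E z -> `|u z| <= k ->
      G z = Du z}.

Definition weak_derivative (f g : R -> R) : Prop :=
  forall phi : R -> R, test_function [set: R] phi ->
    (\int[@lebesgue_measure R]_y (f y * derive1 phi y)%:E =
     - \int[@lebesgue_measure R]_y (g y * phi y)%:E)%E.

(* S belongs to W^{2,oo}(R), with derivatives S' = S1 and S'' = S2; S and S1
   are the continuous representatives, S2 is any representative *)
Definition in_W2oo (S S1 S2 : R -> R) : Prop :=
  [/\ continuous S /\ continuous S1,
      in_Loo (@lebesgue_measure R) setT S,
      in_Loo (@lebesgue_measure R) setT S1,
      in_Loo (@lebesgue_measure R) setT S2 &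
      weak_derivative S S1 /\ weak_derivative S1 S2].

Definition admissible (S S1 S2 : R -> R) : Prop :=
  in_W2oo S S1 S2 /\ exists M : R, forall y, M < `|y| -> S1 y = 0.

(* (S(u))_t - div(A(x,t,u,Du) S'(u)) + S''(u) A(x,t,u,Du).Du - S'(u) f = 0
   in D'(Om x (s, tau)) *)
Definition renormalized_equation Om (A : E -> R -> R -> E -> E) s tau
    (f u : E * R -> R) (Du : E * R -> E) (S S1 S2 : R -> R) : Prop :=
  forall phi : E * R -> R, test_function (cylinder Om s%:E tau%:E) phi ->
    (\int[leb2]_(z in cylinder Om s%:E tau%:E)
      (let Az := A z.1 z.2 (u z) (Du z) in
       - S (u z) * tderiv phi z + S1 (u z) * dotv Az (xgrad phi z)
       + S2 (u z) * dotv Az (Du z) * phi z - S1 (u z) * f z * phi z)%:E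
     = 0)%E.

(* S(u)(., s) = S(us), for the representative w of S(u) in
   C([s, tau]; L^1(Om)) *)
Definition renormalized_initial Om s tau (u : E * R -> R) (us : E -> R)
    (S : R -> R) : Prop :=
  exists w : R -> E -> R,
    [/\ continuous_Lr Om 1 `[s, tau] w,
        {ae leb2, forall z, cylinder Om s%:E tau%:E z -> S (u z) = w z.2 z.1} &
        {ae leb, forall x, Om x -> w s x = S (us x)}].

Definition renormalized_solution_L1 Om (A : E -> R -> R -> E -> E) p s tau
    (f u : E * R -> R) (Du : E * R -> E) (us : E -> R) : Prop :=
  [/\ in_Lp leb2 1 (cylinder Om s%:E tau%:E) f /\ in_Lp leb 1 Om us,
      in_Loo_L1 Om s tau u /\ trunc_in_Lp_W0 Om s tau p u Du,
      forall S S1 S2, admissible S S1 S2 ->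
        renormalized_equation Om A s tau f u Du S S1 S2,
      forall S S1 S2, admissible S S1 S2 ->
        renormalized_initial Om s tau u us S &
      (fun n : nat =>
        \int[leb2]_(z in cylinder Om s%:E tau%:E `&`
                         [set z : E * R | (n%:R <= `|u z| <= n.+1%:R)%R])
          (enorm (Du z) `^ p)%:E)%E @ \oo --> 0%E].

(* renormalized solution of u_t - div(A(x,t,u,Du)) + g(x,t,u,Du) = 0 in
   Om x (0, T), u = 0 on dOm x (0, T), without its initial condition; the
   condition initial_Lr or initial_measure is imposed separately *)
Definition renormalized_solution Om T (A : E -> R -> R -> E -> E)
    (g : E -> R -> R -> E -> R) p (u : E * R -> R) (Du : E * R -> E) : Prop :=
  let gu z := g z.1 z.2 (u z) (Du z) in
  continuous_Lr Om 1 [set t | (0 < t%:E < T)%E] (fun t x => u (x, t)) /\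
  forall s tau, 0 < s -> s < tau -> (tau%:E < T)%E ->
    [/\ trunc_in_Lp_W0 Om s tau p u Du,
        in_Lp leb2 1 (cylinder Om s%:E tau%:E) gu &
        renormalized_solution_L1 Om A p s tau (fun z => - gu z) u Du
          (fun x => u (x, s))].

Definition initial_Lr Om T (r : R) (u : E * R -> R) (u0 : E -> R) : Prop :=
  continuous_Lr Om r [set t | (0%:E <= t%:E < T)%E] (extend0 u0 u).

(* a nonnegative bounded Radon measure on Om is the restriction to Om of a
   finite Borel measure on R^N *)
Definition initial_measure Om (u : E * R -> R)
    (u0 : {finite_measure set E -> \bar R}) : Prop :=
  forall psi : E -> R, {within Om, continuous psi} ->
    (exists M : R, forall x, Om x -> `|psi x| <= M) ->
    (fun t => \int[leb]_(x in Om) (u (x, t) * psi x)%:E)%E @ 0^'+ -->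
    (\int[u0]_(x in Om) (psi x)%:E)%E.

Definition in_L1loc0 Om T (F : E * R -> R) : Prop :=
  forall tau, 0 < tau -> (tau%:E < T)%E ->
    in_Lp leb2 1 (cylinder Om 0%E tau%:E) F.

(* measurable in (x, t), continuous in (u, eta) *)
Definition caratheodory Om (F : E -> R -> R -> E -> R) : Prop :=
  (forall y eta, cmeasurable leb2 (cylinder Om 0%E +oo%E)
                   (fun z => F z.1 z.2 y eta)) /\
  {ae leb2, forall z, cylinder Om 0%E +oo%E z ->
    continuous (fun w : R * E => F z.1 z.2 w.1 w.2)}.

(* The estimates of order r on u, for times in I, in terms of the size M of the
   initial data. At r = 1 the weight r (r - 1) nu of the diffusion term is 0
   (0 * +oo = 0 in \bar R), and only the absorption term is claimed to be
   integrable: |u|^-1 |Du|^p need not be integrable near the boundary. *)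
Definition energy_estimates Om T p q lambda gamma nu (r : R) (I : set R)
    (w : R -> E -> R) (u : E * R -> R) (Du : E * R -> E) (M : \bar R) : Prop :=
  let absorption z := `|u z| `^ (lambda + r - 1) * enorm (Du z) `^ q in
  let diffusion z := `|u z| `^ (r - 2) * enorm (Du z) `^ p in
  [/\ forall t, I t -> (\int[leb]_(x in Om) (`|w t x| `^ r)%:E <= M)%E,
      1 < r ->
        in_L1loc0 Om T (fun z => gamma * absorption z + nu * diffusion z),
      0 < gamma -> in_L1loc0 Om T (fun z => gamma * absorption z) &
      1 < r \/ 0 < gamma -> forall t, I t ->
        (\int[leb]_(x in Om) (`|w t x| `^ r)%:E
         + (r * gamma)%:E *
           \int[leb2]_(z in cylinder Om 0%E t%:E) (absorption z)%:E
         + (r * (r - 1) * nu)%:E *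
           \int[leb2]_(z in cylinder Om 0%E t%:E) (diffusion z)%:E <= M)%E].

End parabolic.

(* Main.v *)
Require Import Defs.
From mathcomp Require Import all_boot all_order all_algebra.
From mathcomp Require Import all_classical all_reals all_analysis.
From mathcomp Require Import measurable_realfun.
From mathcomp Require Import ring lra.
Set Implicit Arguments.
Unset Strict Implicit.
Unset Printing Implicit Defensive.
Import Order.TTheory GRing.Theory Num.Theory numFieldNormedType.Exports.
Import HBNNSimple.
Local Open Scope classical_set_scope.
Local Open Scope ring_scope.

(** Formally the estimate results from multiplying the equation by
    r |u|^(r-2) u and integrating over Om x (0, t): the time derivative yields
    the increment of the integral of |u|^r, the flux yields at least
    r (r - 1) nu |u|^(r-2) |Du|^p, and the sign condition on g yields at least
    r gamma |u|^(lambda+r-1) |Du|^q. What stands in the way is that the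
    equation only holds for S(u), with S' of compact support, against smooth
    test functions, that it is only given on windows Om x (s, t) with s > 0,
    and that r |y|^(r-2) y is not smooth at 0 (for r = 1 it is a sign).

    Regularisation in u. The power is replaced by H_e(y) zeta_n(y), where H_e
    is smooth, odd, bounded by r |y|^(r-1), and tends to r |y|^(r-2) y as e
    tends to 0, and where zeta_n is a cutoff at height n. It factors as
    S' theta_e with theta_e(y) = y^2 / (y^2 + e) and S' continuously
    differentiable of compact support; Psi denotes the primitive of S' theta_e
    that vanishes at 0.

    Testing in one time slice. Fix a time sg. The function
    theta_e(T_k(u(., sg))) belongs to W_0^{1,p} and vanishes where u does; it is
    the limit of theta_e o phi_n for test functions phi_n that approximate
    T_k(u(., sg)), hence the equation for S(u) on (sg - d, sg) can be tested
    with this function of x alone. As theta_e increases with |y|,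
      Psi(y) - Psi(z) <= (S(y) - S(z)) theta_e(T_k(y)),
    so the increment of S(u) against this function controls the increment of
    the integral of Psi(u) from above ([slice_ineq]).

    Averaging in time. These inequalities are divided by d and integrated over
    sg in (a, b). As d tends to 0 the increments become Steklov averages, while
    the integrand, in which the equation is read at time t and the test function
    at time sg, tends to the integrand read at a single time, because
    translations in time are continuous in L^1 and, in duality with L^p, in
    L^{p'} ([averaged_ineq]). The result is the energy inequality for Psi
    between two positive times ([window_ineq]).

    Passage to the limit. The cutoff contributes an error which is carried by
    the region n <= |u| <= n + 1 and is controlled by the integrals of |Du|^p
    and of |b|^{p'} there; the definition of renormalized solutions makes the
    first one tend to 0. For each e the Lipschitz constant of Psi is finite, so
    that the continuity at time 0 allows a starting time a for which the
    integral of Psi(u(., a)) exceeds the size of the initial data by little;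
    then n is chosen, depending on a ([diagonal_step]). Fatou's lemma along this
    diagonal sequence gives the estimate ([energy_limit]). On the set u = 0,
    where the regularised powers carry no information, Du vanishes almost
    everywhere ([Du_zero]), because the zero function of W_0^{1,p} has gradient
    zero ([zero_gradient]). For measures as initial data, r = 1 and u >= 0: the
    integral of Psi(u) is at most the integral of u, whose limit at time 0 is
    obtained with the test function 1 ([initial_bound_measure]). *)

(** * Integrals, almost everywhere statements, measurability *)

Section ae.
Context {R : realType} d {T : measurableType d}.
Variable mu : {measure set T -> \bar R}.

(** The integral of a nonnegative function, measurable or not, is a supremum over simple
    functions, and one that lies below f lies below g once it is set to 0 on a null set. *)
Lemma ge0_le_integral_ae (D : set T) (f g : T -> \bar R) :
  measurable D -> (forall x, D x -> 0 <= f x)%E -> (forall x, D x -> 0 <= g x)%E ->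
  {ae mu, forall x, D x -> f x <= g x}%E ->
  (\int[mu]_(x in D) f x <= \int[mu]_(x in D) g x)%E.
Proof.
move=> mD f0 g0 [N [mN N0 sN]].
rewrite integral_mkcond [leRHS]integral_mkcond.
have f0' x : (0 <= (f \_ D) x)%E by rewrite patchE; case: ifPn => // /set_mem/f0.
have g0' x : (0 <= (g \_ D) x)%E by rewrite patchE; case: ifPn => // /set_mem/g0.
rewrite ge0_integralTE// ge0_integralTE//.
apply: ge_ereal_sup => _ [h /= hf <-].
pose h' := proj_nnsfun h (measurableC mN).
have -> : sintegral mu h = sintegral mu h'.
  rewrite -!integralT_nnsfun.
  rewrite [LHS](ge0_negligible_integral mN)//; last 2 first.
  - exact/measurable_EFinP.
  - by move=> x _; rewrite lee_fin.
  rewrite [RHS](ge0_negligible_integral mN)//; last 2 first.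
  - exact/measurable_EFinP.
  - by move=> x _; rewrite lee_fin.
  apply: eq_integral => x; rewrite inE => -[_ Nx] /=.
  by rewrite mindicE mem_set// mulr1.
apply: ereal_sup_ubound; exists h' => //= x.
rewrite mindicE; case: (boolP (x \in ~` N)) => [|_]; last by rewrite mulr0.
rewrite inE mulr1 => Nx; apply: (le_trans (hf x)).
rewrite !patchE; case: ifPn => // /set_mem Dx.
by apply: contrapT => fg; apply: Nx; apply: sN => /= /(_ Dx).
Qed.

Lemma integral_eq_ae (D : set T) (f g : T -> \bar R) :
  measurable D -> {ae mu, forall x, D x -> f x = g x} ->
  (\int[mu]_(x in D) f x = \int[mu]_(x in D) g x)%E.
Proof.
move=> mD fg; rewrite integralE [RHS]integralE.
congr (_ - _)%E; apply/eqP; rewrite eq_le; apply/andP; split;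
  apply: ge0_le_integral_ae => //; apply: filterS fg => x /= fg Dx;
  by rewrite ?(funeposE, funenegE) fg.
Qed.

Section real_integrals.
Variables (D : set T) (mD : measurable D).
Implicit Types f g : T -> R.

Lemma intD f g : measurable_fun D f -> measurable_fun D g ->
  (forall x, D x -> 0 <= f x) -> (forall x, D x -> 0 <= g x) ->
  (\int[mu]_(x in D) (f x + g x)%:E =
   \int[mu]_(x in D) (f x)%:E + \int[mu]_(x in D) (g x)%:E)%E.
Proof.
move=> mf mg f0 g0; under eq_integral do rewrite EFinD.
by apply: ge0_integralD => //; exact/measurable_EFinP.
Qed.

Lemma intZ (k : R) f : 0 <= k -> measurable_fun D f ->
  (forall x, D x -> 0 <= f x) ->
  (\int[mu]_(x in D) (k * f x)%:E = k%:E * \int[mu]_(x in D) (f x)%:E)%E.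
Proof.
move=> k0 mf f0; under eq_integral do rewrite EFinM.
by apply: ge0_integralZl_EFin => //; exact/measurable_EFinP.
Qed.

Lemma int_le f g : (forall x, D x -> 0 <= f x) -> (forall x, D x -> f x <= g x) ->
  (\int[mu]_(x in D) (f x)%:E <= \int[mu]_(x in D) (g x)%:E)%E.
Proof.
move=> f0 fg; apply: ge0_le_integral_ae => //.
- by move=> x Dx; rewrite lee_fin (le_trans (f0 x Dx))// fg.
- by apply: nearW => x Dx; rewrite lee_fin fg.
Qed.

Lemma int_ge0 f : (forall x, D x -> 0 <= f x) -> (0 <= \int[mu]_(x in D) (f x)%:E)%E.
Proof. by move=> f0; apply: integral_ge0 => x Dx; rewrite lee_fin f0. Qed.

Lemma integrable_real f : measurable_fun D f ->
  (\int[mu]_(x in D) `|f x|%:E < +oo)%E -> mu.-integrable D (EFin \o f).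
Proof. by move=> mf fi; apply/integrableP; split => //; exact/measurable_EFinP. Qed.

End real_integrals.

(** Properties that hold up to null sets are transferred to this representative,
    to which Fubini's theorem and composition apply; its value 0 outside D turns
    integrals over D into integrals over the whole space. *)
Lemma cmeasurable_rep (D : set T) (f : T -> R) : measurable D ->
  cmeasurable mu D f -> exists h : T -> R,
    [/\ measurable_fun setT h, (forall z, ~ D z -> h z = 0) &
        {ae mu, forall z, D z -> f z = h z}].
Proof.
move=> mD [h mh fh]; exists (h \_ D); split.
- by apply/(measurable_restrictT h mD).
- by move=> z Dz; rewrite patchE memNset.
- by apply: filterS fh => z fh Dz; rewrite patchE mem_set// fh.
Qed.

Lemma ae_countable (I : countType) (P : I -> T -> Prop) :
  (forall i, {ae mu, forall x, P i x}) -> {ae mu, forall x, forall i, P i x}.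
Proof.
move=> Pi; pose Q n x := if unpickle n is Some i then P i x else True.
have : {ae mu, forall x, forall n, Q n x}.
  apply: ae_foralln => n; rewrite /Q; case: (unpickle n) => [i|]; first exact: Pi.
  exact: nearW.
by apply: filterS => x Qx i; have := Qx (pickle i); rewrite /Q pickleK.
Qed.

(** The pieces are first made disjoint, so that their representatives glue. *)
Lemma cmeasurable_bigcup (F : nat -> set T) (f : T -> R) :
  (forall n, measurable (F n)) -> (forall n, cmeasurable mu (F n) f) ->
  cmeasurable mu (\bigcup_n F n) f.
Proof.
move=> mF cf.
have /choice[h hP] n : exists h : T -> R, measurable_fun setT h /\
    {ae mu, forall z, F n z -> f z = h z}.
  by have [h [? _ ?]] := cmeasurable_rep (mF n) (cf n); exists h.
have mD n : measurable (seqDU F n).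
  by apply: measurableD => //; exact: bigsetU_measurable.
pose k z : R := if pselect (exists n, seqDU F n z) is left e
                then h (projT1 (cid e)) z else 0.
have kE n z : seqDU F n z -> k z = h n z.
  move=> Fz; rewrite /k; case: pselect => [e|]; last by move=> /(_ (ex_intro _ n Fz)).
  case: cid => m Fm /=; suff -> : m = n by [].
  apply: contrapT => /eqP mn.
  have /trivIsetP/(_ _ _ I I mn) := trivIset_seqDU F.
  by rewrite -subset0; apply; split; [exact: Fm|exact: Fz].
exists k.
  rewrite (seqDU_bigcup_eq F); apply/measurable_fun_bigcup => // n.
  apply: (eq_measurable_fun (h n)).
    by move=> z; rewrite inE => /kE.
  exact: measurable_funS (proj1 (hP n)).
have : {ae mu, forall z, forall n, F n z -> f z = h n z}.
  by apply: ae_foralln => n; case: (hP n).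
apply: filterS => z hz; rewrite (seqDU_bigcup_eq F) => -[n _ Fn].
rewrite (kE _ _ Fn); apply: hz; exact: (@subset_seqDU _ F n).
Qed.

Lemma cmeasurableS (D E : set T) (f : T -> R) : measurable D -> E `<=` D ->
  cmeasurable mu D f -> cmeasurable mu E f.
Proof.
move=> mD ED [h mh fh]; exists h; first exact: measurable_funS mh.
by apply: filterS fh => z + /ED Dz; apply.
Qed.

End ae.

Section slices.
Context {R : realType} d1 d2 {T1 : measurableType d1} {T2 : measurableType d2}.
Variables (m1 : {sigma_finite_measure set T1 -> \bar R})
          (m2 : {sigma_finite_measure set T2 -> \bar R}).

Lemma ae_slices (P : T1 * T2 -> Prop) : {ae (m1 \x m2)%E, forall z, P z} ->
  {ae m2, forall t, {ae m1, forall x, P (x, t)}}.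
Proof.
move=> [N [mN N0 sN]].
have mN1 : measurable_fun setT (EFin \o \1_N : T1 * T2 -> \bar R).
  by apply/measurable_EFinP; exact: measurable_indic.
have H : (\int[m2]_y \int[m1]_x (\1_N (x, y))%:E = 0)%E.
  by rewrite -(@fubini_tonelli2 _ _ _ _ _ m1 m2 (EFin \o \1_N))//= integral_indic// setIT.
have mG : measurable_fun setT (fun y => \int[m1]_x (\1_N (x, y))%:E)%E.
  have := @measurable_fun_fubini_tonelli_G _ _ _ _ _ m1 _ mN1; apply => x.
  by rewrite lee_fin.
have : ae_eq m2 setT (fun y => \int[m1]_x (\1_N (x, y))%:E)%E (cst 0%E).
  apply/ae_eq_integral_abs => //.
  rewrite -[RHS]H; apply: eq_integral => y _; rewrite gee0_abs//.
  by apply: integral_ge0 => x _; rewrite lee_fin.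
apply: filterS => t /(_ I) /= Ht.
exists (ysection N t); split.
- exact: measurable_ysection.
- rewrite -[RHS]Ht.
  rewrite -[X in m1 X]setIT -integral_indic//; last exact: measurable_ysection.
  by apply: eq_integral => x _; rewrite !indicE mem_ysection.
- by move=> x /= nP; rewrite /ysection/= inE; apply: sN.
Qed.

(** Tonelli's theorem for the indicator of the exceptional set, whence the
    measurability hypothesis. *)
Lemma slices_ae (P : T1 * T2 -> Prop) : measurable [set z | P z] ->
  {ae m2, forall t, {ae m1, forall x, P (x, t)}} ->
  {ae (m1 \x m2)%E, forall z, P z}.
Proof.
move=> mP H; pose N := ~` [set z | P z].
have mN : measurable N by exact: measurableC.
exists N; split => //.
have mN1 : measurable_fun setT (EFin \o \1_N : T1 * T2 -> \bar R).
  by apply/measurable_EFinP; exact: measurable_indic.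
transitivity (\int[(m1 \x m2)%E]_z (\1_N z)%:E)%E.
  by rewrite integral_indic// setIT.
rewrite (@fubini_tonelli2 _ _ _ _ _ m1 m2 (EFin \o \1_N))//=.
rewrite -[RHS](integral0 m2 setT); apply: integral_eq_ae => //.
apply: filterS H => t Ht _.
rewrite -[RHS](integral0 m1 setT); apply: integral_eq_ae => //.
apply: filterS Ht => x Px _; rewrite /= indicE /N memNset//.
Qed.

End slices.

Section opens.
Context {R : realType}.

(** The sigma-algebra is generated by the coordinates; an open set is a countable
    union of boxes with rational ends. *)
Lemma open_measurable_rV n (U : set 'rV[R]_n) : open U -> measurable U.
Proof.
move=> oU.
pose box (i : {ffun 'I_n -> rat * rat}) : set 'rV[R]_n :=
  [set x | forall j, ratr (i j).1 < x ord0 j < ratr (i j).2].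
have mbox i : measurable (box i).
  rewrite (_ : box i = \bigcap_(j in [set: 'I_n])
      ((fun x : 'rV[R]_n => x ord0 j : R) @^-1` `]ratr (i j).1, ratr (i j).2[)).
    apply: fin_bigcap_measurable => // j _; rewrite -[X in measurable X]setTI.
    exact: measurable_coor.
  apply/seteqP; split => x /= h; first by move=> j _; rewrite /= in_itv/= h.
  by move=> j; have := h j I; rewrite /= in_itv.
rewrite (_ : U = \bigcup_(i in [set i | box i `<=` U]) box i).
  rewrite bigcup_mkcond; apply: countable_bigcupT_measurable => // i.
  by case: ifPn => // _; exact: mbox.
apply/seteqP; split=> [x Ux|x [i]]; last by move=> /= bU bx; exact: bU.
have /nbhs_ballP[e /= e0 eU] : nbhs x U by exact: open_nbhs_nbhs.
have /choice[q1 q1P] j : exists q : rat, x ord0 j - e < ratr q < x ord0 j.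
  have [|q] := @rat_in_itvoo R (x ord0 j - e) (x ord0 j); first by rewrite ltrBlDr ltrDl.
  by rewrite in_itv/=; exists q.
have /choice[q2 q2P] j : exists q : rat, x ord0 j < ratr q < x ord0 j + e.
  have [|q] := @rat_in_itvoo R (x ord0 j) (x ord0 j + e); first by rewrite ltrDl.
  by rewrite in_itv/=; exists q.
exists [ffun j => (q1 j, q2 j)] => /=.
- move=> y yb; apply: eU; split => // i j; rewrite !ord1.
  have := yb j; rewrite ffunE/= => /andP[y1 y2].
  have /andP[a1 _] := q1P j; have /andP[_ a2] := q2P j.
  rewrite /ball/= distrC ltr_norml; apply/andP; split.
    by rewrite ltrBrDr addrC (lt_trans a1).
  by rewrite ltrBlDr addrC (lt_trans y2).
- move=> j; rewrite ffunE/=.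
  by have /andP[_ ->] := q1P j; have /andP[-> _] := q2P j.
Qed.

Lemma continuous_measurable_rV n (f : 'rV[R]_n -> R) : continuous f ->
  measurable_fun setT f.
Proof.
move=> cf; apply: (measurability _ (RGenOpens.measurableE R)) => _ [_ [x [y ->]] <-].
rewrite setTI; apply: open_measurable_rV.
by move/continuousP : cf; apply; exact: interval_open.
Qed.

Lemma bounded_finite_rV n (U : set 'rV[R]_n) : open U -> bounded_set U ->
  (lebesgue_rV n U < +oo)%E.
Proof.
move=> oU [M [Mr MU]].
pose K : R := `|M| + 1.
have UK : U `<=` [set x | forall i, `[-K, K]%classic (x ord0 i)].
  move=> x Ux i /=; rewrite in_itv/= -ler_norml.
  have /MU/(_ x Ux) h : M < K by rewrite (le_lt_trans (ler_norm M))// ltrDl.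
  apply: le_trans h; rewrite [leRHS]mx_normrE.
  by apply: le_trans (le_bigmax _ _ (ord0, i)).
have mK : measurable [set x : 'rV[R]_n | forall i, `[-K, K]%classic (x ord0 i)].
  rewrite (_ : [set x | _] = \bigcap_(j in [set: 'I_n])
      ((fun x : 'rV[R]_n => x ord0 j : R) @^-1` `[-K, K])).
    apply: fin_bigcap_measurable => // j _; rewrite -[X in measurable X]setTI.
    exact: measurable_coor.
  by apply/seteqP; split => x /= h; [move=> j _; exact: h|move=> j; exact: (h j I)].
apply: (@le_lt_trans _ _ (lebesgue_rV n
    [set x : 'rV[R]_n | forall i, `[-K, K]%classic (x ord0 i)])).
  by apply: le_measure; rewrite ?inE//; exact: open_measurable_rV.
rewrite (lebesgue_rV_box (A := fun _ => `[-K, K]%classic))//.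
rewrite ltey_eq; apply/orP; left; elim/big_ind : _ => //.
- by move=> x y; exact: fin_numM.
- move=> i _; rewrite lebesgue_measure_itv/=; case: ifP => // _.

Qed.

End opens.

(** * Smooth functions *)

Section Ck.
Context {R : realType}.

(** A form of smoothness suited to induction on the order of differentiation, for
    products and compositions. *)
Fixpoint Ck (V : normedModType R) (k : nat) (f : V -> R) : Prop :=
  [/\ continuous f, forall x v, derivable f x v &
      if k is k'.+1 then forall v, Ck k' ('D_v f) else True].

Lemma CkS (V : normedModType R) k (f : V -> R) : Ck k.+1 f -> Ck k f.
Proof.
elim: k f => [|k IH] f [cf df Df]; split => // v.
exact/IH/Df.
Qed.

Lemma smoothP (V : normedModType R) (f : V -> R) :
  smooth f <-> forall k, Ck k f.
Proof.
split => [sf k|Cf].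
  elim: k f sf => [|k IH] f sf; first by have [] := sf [::].
  split; [by have [] := sf [::]|by have [] := sf [::]|move=> v].
  by apply: IH => vs; have := sf (rcons vs v); rewrite foldr_rcons.
move=> vs; elim/last_ind: vs f Cf => [|vs v IH] f Cf /=.
  by have [] := Cf 0%N.
rewrite foldr_rcons; apply: IH => k.
by have [_ _ H] := Cf k.+1; exact: H.
Qed.

Lemma smoothD1 (V : normedModType R) (f : V -> R) v : smooth f -> smooth ('D_v f).
Proof. by move=> /smoothP Cf; apply/smoothP => k; have [_ _ H] := Cf k.+1; exact: H. Qed.

Lemma smooth_continuous (V : normedModType R) (f : V -> R) : smooth f -> continuous f.
Proof. by move=> /(_ [::])[]. Qed.

Lemma smooth_derivable (V : normedModType R) (f : V -> R) x v :
  smooth f -> derivable f x v.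
Proof. by move=> /(_ [::])[_]; exact. Qed.

Lemma Ck_cst (V : normedModType R) k (c : R) : Ck k (cst c : V -> R).
Proof.
elim: k c => [|k IH] c; (split => //; first by move=> x; exact: cvg_cst).
move=> v; rewrite (_ : 'D_v _ = cst 0); first exact: IH.
by apply/funext => x; exact: derive_cst.
Qed.

Lemma smooth_cst (V : normedModType R) (c : R) : smooth (cst c : V -> R).
Proof. by apply/smoothP => k; exact: Ck_cst. Qed.

Lemma CkD (V : normedModType R) k (f g : V -> R) : Ck k f -> Ck k g -> Ck k (f \+ g).
Proof.
have c (f' g' : V -> R) : continuous f' -> continuous g' -> continuous (f' \+ g').
  by move=> cf cg x; exact: (cvgD (cf x) (cg x)).
have dd (f' g' : V -> R) : (forall x v, derivable f' x v) ->
    (forall x v, derivable g' x v) -> forall x v, derivable (f' \+ g') x v.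
  by move=> df dg x v; exact: (@derivableD _ _ _ f' g' x v (df x v) (dg x v)).
elim: k f g => [|k IH] f g [cf df Df] [cg dg Dg].
  by split; [exact: c|exact: dd|exact: I].
split; [exact: c|exact: dd|move=> v].
rewrite (_ : 'D_v _ = 'D_v f \+ 'D_v g).
  by apply: IH; [exact: Df|exact: Dg].
by apply/funext => x; exact: (@deriveD _ _ _ f g x v (df x v) (dg x v)).
Qed.

Lemma CkM (V : normedModType R) k (f g : V -> R) : Ck k f -> Ck k g -> Ck k (f \* g).
Proof.
have c (f' g' : V -> R) : continuous f' -> continuous g' -> continuous (f' \* g').
  by move=> cf cg x; exact: (cvgM (cf x) (cg x)).
have dd (f' g' : V -> R) : (forall x v, derivable f' x v) ->
    (forall x v, derivable g' x v) -> forall x v, derivable (f' \* g') x v.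
  by move=> df dg x v; exact: (@derivableM _ _ f' g' x v (df x v) (dg x v)).
elim: k f g => [|k IH] f g [cf df Df] [cg dg Dg].
  by split; [exact: c|exact: dd|exact: I].
split; [exact: c|exact: dd|move=> v].
rewrite (_ : 'D_v _ = (f \* 'D_v g) \+ (g \* 'D_v f)).
  by apply: CkD; apply: IH; [exact: (CkS (And3 cf df Df))|exact: Dg
    |exact: (CkS (And3 cg dg Dg))|exact: Df].
by apply/funext => x; exact: (@deriveM _ _ f g x v (df x v) (dg x v)).
Qed.

Lemma smoothD (V : normedModType R) (f g : V -> R) : smooth f -> smooth g -> smooth (f \+ g).
Proof. by move=> /smoothP Cf /smoothP Cg; apply/smoothP => k; exact: CkD. Qed.

Lemma smoothM (V : normedModType R) (f g : V -> R) : smooth f -> smooth g -> smooth (f \* g).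
Proof. by move=> /smoothP Cf /smoothP Cg; apply/smoothP => k; exact: CkM. Qed.

Lemma CkV (V : normedModType R) k (f : V -> R) : (forall x, f x != 0) ->
  Ck k f -> Ck k (fun x => (f x)^-1).
Proof.
move=> f0.
have c (f' : V -> R) : (forall x, f' x != 0) -> continuous f' ->
    continuous (fun x => (f' x)^-1).
  by move=> f'0 cf x; exact: (cvgV (f'0 x) (cf x)).
elim: k => [|k IH] Cf; have [cf df Df] := Cf.
  by split; [exact: c|move=> x v; exact: derivableV|exact: I].
split; [exact: c|move=> x v; exact: derivableV|].
- move=> v; have Ci := IH (CkS Cf).
  rewrite (_ : 'D_v _ = cst (-1) \* ((fun x => (f x)^-1) \* (fun x => (f x)^-1)) \* 'D_v f).
    apply: CkM; last exact: Df.
    by apply: CkM; [exact: Ck_cst|exact: CkM].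
  apply/funext => x; rewrite deriveV//= /GRing.scale/=.
  by rewrite mulN1r expr2 invfM.
Qed.

Lemma smoothV (V : normedModType R) (f : V -> R) : (forall x, f x != 0) ->
  smooth f -> smooth (fun x => (f x)^-1).
Proof. by move=> f0 /smoothP Cf; apply/smoothP => k; exact: CkV. Qed.

(** The chain rule for a derivative in one direction only, where f need not be
    differentiable. *)
Lemma is_derive_comp (V : normedModType R) (h : R -> R) (f : V -> R) x v df dh :
  is_derive x v f df -> is_derive (f x) 1 h dh ->
  is_derive x v (h \o f) (dh * df).
Proof.
move=> [dfx <-] [dhx <-].
pose l := fun t : R => f (t *: v + x).
have dl : derivable l 0 1 := (derivable1P f x v).1 dfx.
have l0 : l 0 = f x by rewrite /l scale0r add0r.
have dhl : derivable (h \o l) 0 1.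
  apply/derivable1_diffP; apply: differentiable_comp; first exact/derivable1_diffP.
  by apply/derivable1_diffP; rewrite l0; exact: dhx.
have E (k : V -> R) : 'D_v k x = derive1 (fun t : R => k (t *: v + x)) 0.
  rewrite derive1E /derive.
  rewrite (_ : (fun t : R => t^-1 *: ((k \o shift x) (t *: v) - k x)) =
    (fun t : R => t^-1 *:
      (((fun t : R => k (t *: v + x)) \o shift 0) (t *: 1) - k (0 *: v + x))))//.
  by apply/funext => t /=; rewrite addr0 scale0r add0r [_%:A]mulr1.
split; first exact: (derivable1P (h \o f) x v).2 dhl.
rewrite (E (h \o f)) (E f) (_ : (fun t => (h \o f) (t *: v + x)) = h \o l)//.
have dh0 : derivable h (l 0) 1 by rewrite l0; exact: dhx.
by rewrite (derive1_comp dl dh0) l0 !derive1E.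
Qed.

Lemma Ck_comp (V : normedModType R) k (h : R -> R) (f : V -> R) :
  Ck k h -> Ck k f -> Ck k (h \o f).
Proof.
elim: k h f => [|k IH] h f Ch Cf; have [cf df Df] := Cf; have [ch dh Dh] := Ch.
  split => //; first by move=> x; apply: continuous_comp; [exact: cf|exact: ch].
  move=> x v; by have [] := is_derive_comp (derivableP (df x v)) (derivableP (dh (f x) 1)).
split => //; first by move=> x; apply: continuous_comp; [exact: cf|exact: ch].
  move=> x v; by have [] := is_derive_comp (derivableP (df x v)) (derivableP (dh (f x) 1)).
move=> v; rewrite (_ : 'D_v _ = ('D_1 h \o f) \* 'D_v f).
  apply: CkM; last exact: Df.
  by apply: IH; [exact: Dh|exact: CkS].
apply/funext => x.
by have [_ ->] := is_derive_comp (derivableP (df x v)) (derivableP (dh (f x) 1)).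
Qed.

Lemma smooth_comp (V : normedModType R) (h : R -> R) (f : V -> R) :
  smooth h -> smooth f -> smooth (h \o f).
Proof. by move=> /smoothP Cf /smoothP Cg; apply/smoothP => k; exact: Ck_comp. Qed.

Lemma derive_comp (V : normedModType R) (h : R -> R) (f : V -> R) x v :
  smooth h -> smooth f -> 'D_v (h \o f) x = 'D_1 h (f x) * 'D_v f x.
Proof.
move=> sh sf.
by have [_ ->] := is_derive_comp (derivableP (@smooth_derivable _ f x v sf))
  (derivableP (@smooth_derivable _ h (f x) 1 sh)).
Qed.

(** L maps lines to lines, as projections and affine maps do, so that every
    directional derivative of f \o L is one of f. *)
Lemma smooth_precomp (V W : normedModType R) (L : V -> W) (f : W -> R) :
  continuous L -> (exists l : V -> W, forall x v (t : R), L (t *: v + x) = t *: l v + L x) ->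
  smooth f -> smooth (f \o L) /\
  forall l : V -> W, (forall x v (t : R), L (t *: v + x) = t *: l v + L x) ->
    forall x v, 'D_v (f \o L) x = 'D_(l v) f (L x).
Proof.
move=> cL [l hl] sf.
have key (g : W -> R) (m : V -> W) (x v : V) :
    (forall x v (t : R), L (t *: v + x) = t *: m v + L x) ->
    smooth g -> derivable (g \o L) x v /\ 'D_v (g \o L) x = 'D_(m v) g (L x).
  move=> hm sg.
  have := @smooth_derivable _ g (L x) (m v) sg.
  rewrite /derivable /derive.
  rewrite (_ : (fun h => _) = (fun h : R => h^-1 *: (((g \o L) \o shift x) (h *: v) - (g \o L) x)))//.
  by apply/funext => h /=; rewrite hm.
split; last by move=> m hm x v; have [] := key f m x v hm sf.
apply/smoothP => k; elim: k f sf => [|k IH] f sf; split => //.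
- by move=> x; apply: continuous_comp; [exact: cL|exact: smooth_continuous].
- by move=> x v; have [] := key f l x v hl sf.
- by move=> x; apply: continuous_comp; [exact: cL|exact: smooth_continuous].
- by move=> x v; have [] := key f l x v hl sf.
- move=> v; rewrite (_ : 'D_v _ = 'D_(l v) f \o L); first by apply: IH; exact: smoothD1.
  by apply/funext => x; have [] := key f l x v hl sf.
Qed.

Lemma smooth_id : smooth (id : R -> R).
Proof.
apply/smoothP => -[|k]; split => //; try by move=> x; exact: cvg_id.
move=> v; rewrite (_ : 'D_v _ = cst v); first exact: Ck_cst.
by apply/funext => x; rewrite derive_id.
Qed.

End Ck.

(** * A smooth step function *)

Section step.
Context {R : realType}.

Lemma is_derive_scal (f : R -> R) (x v df : R) :
  is_derive x 1 f df -> is_derive x v f (df * v).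
Proof.
by move=> h; exact: (is_derive_comp (f := id) (is_derive_id x v)).
Qed.

Lemma is_derive1_continuous (f g : R -> R) :
  (forall x : R, is_derive x 1 f (g x)) -> continuous f.
Proof.
by move=> fg x; apply/differentiable_continuous/derivable1_diffP; case: (fg x).
Qed.

(** Spares the computation of iterated derivatives: it is enough to exhibit a class of
    functions closed under differentiation. *)
Lemma smooth1 (P : set (R -> R)) (f : R -> R) :
  (forall f, P f -> exists2 g, P g & forall x : R, is_derive x 1 f (g x)) ->
  P f -> smooth f.
Proof.
move=> HP Pf; apply/smoothP => k; elim: k f Pf => [|k IH] f Pf;
  have [g Pg fg] := HP f Pf; split => //.
- exact: is_derive1_continuous fg.
- by move=> x v; have [] := is_derive_scal v (fg x).
- exact: is_derive1_continuous fg.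
- by move=> x v; have [] := is_derive_scal v (fg x).
- move=> v; rewrite (_ : 'D_v _ = g \* cst v).
    by apply: CkM; [exact: IH|exact: Ck_cst].
  by apply/funext => x; have [_ ->] := is_derive_scal v (fg x).
Qed.

(** The functions p(1/x) exp(-1/x), extended by 0: unlike exp(-1/x) alone, this family
    is closed under differentiation. *)
Definition flat (p : {poly R}) (x : R) : R :=
  if 0 < x then p.[x^-1] * expR (- x^-1) else 0.

(** The exponential beats every power: this makes [flat p] differentiable at 0. *)
Lemma poly_expR_bounded (p : {poly R}) n :
  exists C : R, forall y, 0 < y -> `|p.[y] * y ^+ n * expR (- y)| <= C.
Proof.
have pow m : exists C : R, forall y, 0 < y -> y ^+ m * expR (- y) <= C.
  exists (m`!%:R) => y y0; rewrite expRN ler_pdivrMr ?expR_gt0//.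
  case: m => [|m]; first by rewrite fact0 mul1r expr0 (le_trans _ (expR_ge1Dx _))// lerDl ltW.
  rewrite mulrC -ler_pdivrMr ?ltr0n ?fact_gt0//.
  by apply: le_trans (expR_ge1Dxn m (ltW y0)); rewrite lerDr.
elim/poly_ind: p n => [|p c IH] n.
  by exists 0 => y _; rewrite horner0 !mul0r normr0.
have [C1 H1] := IH n.+1; have [C2 H2] := pow n.
exists (C1 + `|c| * C2) => y y0.
rewrite hornerMXaddC.
rewrite (_ : _ * _ = p.[y] * y ^+ n.+1 * expR (- y) + c * (y ^+ n * expR (- y))); last first.
  by rewrite exprS; ring.
apply: le_trans (ler_normD _ _) _; apply: lerD; first exact: H1.
rewrite normrM ler_wpM2l// ger0_norm; first exact: H2.
by rewrite mulr_ge0 ?exprn_ge0 ?expR_ge0 ?ltW.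
Qed.

Lemma flat_derive (p : {poly R}) (x : R) :
  is_derive x 1 (flat p) (flat ('X ^+ 2 * (p - p^`())) x).
Proof.
have [x0|x0|->] := ltgtP x 0.
- rewrite /flat (ltNge 0 x) (ltW x0)/=.
  apply: (@near_eq_is_derive _ _ _ (cst 0)).
  near=> y; rewrite /flat ltNge (_ : y <= 0)//; apply/ltW.
  by near: y; exact: lt_nbhsl.
- have fE q : flat q x = q.[x^-1] * expR (- x^-1) by rewrite /flat x0.
  rewrite fE.
  apply: (@near_eq_is_derive _ _ _ (fun x : R => p.[x^-1] * expR (- x^-1) : R)).
    near=> y; rewrite /flat (_ : 0 < y)//.
    by near: y; exact: lt_nbhsr.
  have di : is_derive x 1 (fun y : R => y^-1) (- x ^- 2).
    split; first by apply: derivableV => //; rewrite gt_eqF.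
    by rewrite deriveV ?gt_eqF// derive_id /GRing.scale/= mulr1.
  have d1 := is_derive_comp di (is_derive_poly p x^-1).
  have d2 : is_derive x 1 (fun y : R => - y^-1) (x ^- 2).
    by have := @is_deriveN _ _ _ _ _ _ _ di; rewrite opprK.
  have d3 := is_derive_comp d2 (is_derive_expR (- x^-1)).
  have d4 := is_deriveM d1 d3.
  apply: (is_derive_eq (d4 : is_derive x 1 (fun x : R => p.[x^-1] * expR (- x^-1) : R) _)).
  rewrite [LHS](_ : _ = p.[x^-1] * (expR (- x^-1) / x ^+ 2) +
    expR (- x^-1) * (p^`().[x^-1] * - x ^- 2))// hornerM hornerD hornerN hornerXn.
  have x_n0 : x != 0 by rewrite gt_eqF.
  by field.
- have fE q : flat q 0 = 0 by rewrite /flat ltxx.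
  rewrite fE.
  have [C HC] := poly_expR_bounded p 2.
  have lim0 : (fun h : R => h^-1 *: ((flat p \o shift 0) (h *: 1) - flat p 0)) @ 0^' --> (0 : R).
    apply/cvgrPdist_le => e e0.
    near=> h; have hn0 : h != 0 by near: h; exact: nbhs_dnbhs_neq.
    rewrite sub0r normrN /= addr0 [_%:A]mulr1 /flat ltxx subr0.
    case: ifPn => h0; last by rewrite /GRing.scale/= mulr0 normr0 ltW.
    have := HC h^-1; rewrite invr_gt0 => /(_ h0) Hh.
    rewrite (_ : _ *: _ = h * (p.[h^-1] * h^-1 ^+ 2 * expR (- h^-1))); last first.
      by rewrite /GRing.scale/= ; field.
    rewrite normrM; apply: (@le_trans _ _ (`|h| * (`|C| + 1))).
      by rewrite ler_wpM2l// (le_trans Hh)// (le_trans (ler_norm C))// lerDl.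
    rewrite -ler_pdivlMr ?ltr_wpDl//; near: h; apply: dnbhs0_le.
    by rewrite divr_gt0// ltr_wpDl.
  by split; [apply/cvg_ex; exists 0|exact: cvg_lim lim0].
Unshelve. all: by end_near. Qed.

Lemma smooth_flat p : smooth (flat p).
Proof.
apply: (@smooth1 [set f | exists p, f = flat p]); last by exists p.
move=> _ [q ->]; exists (flat ('X ^+ 2 * (q - q^`()))); first by eexists.
by move=> x; exact: flat_derive.
Qed.

Definition step (t : R) : R := flat 1 t / (flat 1 t + flat 1 (1 - t)).

Lemma flat_ge0 t : 0 <= flat 1 t.
Proof. by rewrite /flat; case: ifP => // _; rewrite hornerC mul1r expR_ge0. Qed.

Lemma flat_gt0 t : 0 < t -> 0 < flat 1 t.
Proof. by rewrite /flat => ->; rewrite hornerC mul1r expR_gt0. Qed.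

Lemma flat_eq0 p t : t <= 0 -> flat p t = 0.
Proof. by rewrite /flat ltNge => ->. Qed.

Let den_gt0 t : 0 < flat 1 t + flat 1 (1 - t).
Proof.
have [t0|t0] := ltP 0 t; first by rewrite ltr_pwDl ?flat_gt0 ?flat_ge0.
by rewrite ltr_wpDl ?flat_ge0// flat_gt0// subr_gt0 (le_lt_trans t0).
Qed.

Lemma smooth_step : smooth step.
Proof.
apply: (@smoothM _ _ (flat 1) (fun t => (flat 1 t + flat 1 (1 - t))^-1)).
  exact: smooth_flat.
apply: smoothV; first by move=> t; rewrite gt_eqF.
apply: (@smoothD _ _ (flat 1)); first exact: smooth_flat.
apply: (@smooth_comp _ _ (flat 1) (fun t : R => 1 - t)); first exact: smooth_flat.
apply: (@smoothD _ _ (cst 1) (fun t : R => - t)); first exact: smooth_cst.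
rewrite (_ : (fun t : R => - t) = cst (-1) \* id); last first.
  by apply/funext => t /=; rewrite mulN1r.
by apply: smoothM; [exact: smooth_cst|exact: smooth_id].
Qed.

Lemma step0 t : t <= 0 -> step t = 0.
Proof. by move=> t0; rewrite /step flat_eq0// mul0r. Qed.

Lemma step1 t : 1 <= t -> step t = 1.
Proof.
move=> t1; rewrite /step (@flat_eq0 _ (1 - t)) ?subr_le0// addr0 divff// gt_eqF//.
by rewrite flat_gt0// (lt_le_trans ltr01).
Qed.

Lemma step_ge0 t : 0 <= step t.
Proof. by rewrite /step divr_ge0 ?flat_ge0// ltW. Qed.

Lemma step_le1 t : step t <= 1.
Proof. by rewrite /step ler_pdivrMr// mul1r lerDl flat_ge0. Qed.

Definition dstep : R -> R := 'D_1 step.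

Lemma is_derive_step (t : R) : is_derive t 1 step (dstep t).
Proof. exact/derivableP/smooth_derivable/smooth_step. Qed.

Lemma dstep_continuous : continuous dstep.
Proof. exact/smooth_continuous/smoothD1/smooth_step. Qed.

Lemma dstep0 t : t < 0 \/ 1 < t -> dstep t = 0.
Proof.
move=> t01; rewrite /dstep.
have [c ct] : exists c : R, \near t, step t = cst c t.
  case: t01 => t0; [exists 0|exists 1]; near=> u.
  - by rewrite /= step0//; apply/ltW; near: u; exact: lt_nbhsl.
  - by rewrite /= step1//; apply/ltW; near: u; exact: lt_nbhsr.
by rewrite (near_eq_derive _ ct) derive_cst.
Unshelve. all: by end_near. Qed.

Lemma dstep_bounded : exists2 C : R, 0 < C & forall t, `|dstep t| <= C.
Proof.
have c : {within `[0, 1], continuous (fun t => `|dstep t|)}.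
  apply: continuous_subspaceT => t; apply: continuous_comp; first exact: dstep_continuous.
  exact: norm_continuous.
have [a a01 H] := @EVT_max R _ 0 1 ler01 c.
exists (`|dstep a| + 1) => [|t]; first by rewrite ltr_wpDl.
have [t01|] := boolP (t \in `[0, 1]); first by rewrite (le_trans (H t t01))// lerDl.
rewrite in_itv/= negb_and -!ltNge => /orP tn.
by rewrite (dstep0 tn) normr0 addr_ge0.
Qed.

End step.

(** * Integrals of derivatives *)

Section FTC.
Context {R : realType}.
Local Notation leb := (@lebesgue_measure R).

Lemma is_derive_oo_LRcontinuous (F f : R -> R) a b :
  (forall x : R, is_derive x 1 F (f x)) -> derivable_oo_LRcontinuous F a b.
Proof.
move=> dF; have cF := is_derive1_continuous dF; split.
- by move=> x _; case: (dF x).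
- exact: (cvg_at_right_filter (cF a)).
- exact: (cvg_at_left_filter (cF b)).
Qed.

Lemma FTC2 (F f : R -> R) a b : a <= b ->
  (forall x : R, is_derive x 1 F (f x)) -> continuous f ->
  (\int[leb]_(x in `[a, b]) (f x)%:E = (F b - F a)%:E)%E.
Proof.
rewrite le_eqVlt => /predU1P[->|ab] dF cf.
  by rewrite set_itv1 integral_set1 subrr.
rewrite (@continuous_FTC2 _ f F a b ab)//.
- exact: continuous_subspaceT.
- exact: is_derive_oo_LRcontinuous.
- by move=> x _; rewrite derive1E; case: (dF x).
Qed.

Lemma FTC2_compact (F f : R -> R) (M : R) :
  (forall x : R, is_derive x 1 F (f x)) -> continuous f ->
  (forall x, M < `|x| -> F x = 0) -> (\int[leb]_x (f x)%:E = 0)%E.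
Proof.
move=> dF cf F0.
pose K : R := `|M| + 1.
have MK : M < K by rewrite (le_lt_trans (ler_norm M))// ltrDl.
have K0 : 0 < K by rewrite ltr_wpDl.
have f0 x : K < `|x| -> f x = 0.
  move=> Kx; have [_ <-] := dF x.
  rewrite (@near_eq_derive _ _ _ F (cst 0)) ?derive_cst//.
  have cx : {for x, continuous (fun y : R => `|y|)} by exact: norm_continuous.
  have := cx [set y | K < y] (lt_nbhsr Kx).
  rewrite nbhs_simpl/=; apply: filterS => y /= Ky.
  by rewrite F0// (lt_trans MK).
have -> : (\int[leb]_x (f x)%:E = \int[leb]_(x in `[(- K)%R, K]) (f x)%:E)%E.
  rewrite [RHS]integral_mkcond; apply: eq_integral => x _; rewrite patchE.
  case: ifPn => //; rewrite notin_setE/= in_itv/= -ler_norml => /negP.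
  by rewrite -ltNge => /f0 ->.
rewrite (@FTC2 F)//; last by rewrite ge0_cp// ltW.
by rewrite !F0 ?subrr// ?normrN gtr0_norm.
Qed.

End FTC.

Section divergence.
Context {R : realType}.

(** Supports are controlled by boxes, whose slices are boxes. *)
Definition supp_box n (M : R) (f : 'rV[R]_n -> R) :=
  forall x : 'rV[R]_n, (exists j, M < `|x ord0 j|) -> f x = 0.

Lemma supp_boxD n M (f : 'rV[R]_n -> R) v : supp_box M f -> supp_box M ('D_v f).
Proof.
move=> sf x [j Mj]; rewrite (@near_eq_derive _ _ _ f (cst 0)) ?derive_cst//.
have cj : {for x, continuous (fun y : 'rV[R]_n => `|y ord0 j|)}.
  apply: (@continuous_comp _ _ _ (fun y : 'rV[R]_n => y ord0 j) (fun t : R => `|t|)).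
    exact: coord_continuous.
  exact: norm_continuous.
have := cj [set y | M < y] (lt_nbhsr Mj); rewrite nbhs_simpl/=.
by apply: filterS => y /= My; rewrite sf//; exists j.
Qed.

Definition box n (M : R) : set 'rV[R]_n := [set x | forall i, `[- M, M]%classic (x ord0 i)].

Lemma measurable_box n M : measurable (@box n M).
Proof.
rewrite (_ : @box n M = \bigcap_(j in [set: 'I_n])
    ((fun x : 'rV[R]_n => x ord0 j : R) @^-1` `[(- M), M])).
  apply: fin_bigcap_measurable => // j _; rewrite -[X in measurable X]setTI.
  exact: measurable_coor.
by apply/seteqP; split => x /= h; [move=> j _; exact: h|move=> j; exact: (h j I)].
Qed.

Lemma box_lty n M : (lebesgue_rV n (@box n M) < +oo)%E.
Proof.
rewrite (lebesgue_rV_box (A := fun _ => `[- M, M]%classic))//.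
rewrite ltey_eq; apply/orP; left; elim/big_ind : _ => //.
- by move=> x y; exact: fin_numM.
- by move=> i _; rewrite lebesgue_measure_itv/=; case: ifP.
Qed.

Lemma integrable_supp_box n M (f : 'rV[R]_n -> R) : continuous f ->
  supp_box M f -> (lebesgue_rV n).-integrable setT (EFin \o f).
Proof.
move=> cf sf.
have mf : measurable_fun setT f by exact: continuous_measurable_rV.
have cb : compact (@box n M) by apply: (@rV_compact _ n (fun=> `[- M, M]%classic)) => i; exact: segment_compact.
have [C HC] : exists C : R, forall x, box M x -> `|f x| <= C.
  have [x0|b0] := pselect (exists x, @box n M x); last first.
    by exists 0 => x bx; exfalso; apply: b0; exists x.
  have [|c _ Hc] := @compact_EVT_max _ R (fun x => `|f x|) (box M) x0 cb.
    apply: continuous_subspaceT => t.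
    apply: (@continuous_comp _ _ _ f (fun t : R => `|t|)); first exact: cf.
    exact: norm_continuous.
  by exists `|f c| => x bx; apply: Hc; rewrite inE.
have -> : EFin \o f = (EFin \o f) \_ (box M).
  apply/funext => x; rewrite patchE; case: ifPn => //; rewrite notin_setE => nb.
  rewrite /= sf//; apply: contrapT => h; apply: nb => j /=.
  by rewrite in_itv/= -ler_norml leNgt; apply/negP => Mj; apply: h; exists j.
apply/(integrable_mkcond _ (@measurable_box n M)).
apply: measurable_bounded_integrable => //; first exact: measurable_box.
- exact: box_lty.
- exact: measurable_funS mf.
- by exists C; split; [exact: num_real|] => y Cy x bx /=; rewrite (le_trans (HC x bx))// ltW.
Qed.

(** Unfolds one step of the recursive construction of the Lebesgue measure. *)
Lemma lebesgue_rVS n (f : 'rV[R]_n.+1 -> R) :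
  (lebesgue_rV n.+1).-integrable setT (EFin \o f) ->
  let m := (@lebesgue_measure R \x lebesgue_rV n)%E in
  m.-integrable setT (EFin \o (f \o @rV_cons R n)) /\
  (\int[lebesgue_rV n.+1]_x (f x)%:E = \int[m]_z (f (rV_cons z))%:E)%E.
Proof.
move=> /integrableP[/measurable_EFinP mf fi] m.
have mfc : measurable_fun setT (f \o @rV_cons R n : measurableTypeR R * 'rV[R]_n -> R).
  exact: (measurableT_comp mf (@measurable_rV_cons R n)).
have ii : m.-integrable setT (EFin \o (f \o @rV_cons R n)).
  apply/integrableP; split; first by apply/measurable_EFinP; exact: mfc.
  move: fi; rewrite [X in (X < _)%E](_ : _ =
    \int[pushforward m (@rV_cons R n)]_x `|(f x)%:E|)%E//.
  rewrite ge0_integral_pushforward//=.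
  - exact: measurable_rV_cons.
  - by do 2 apply: measurableT_comp => //.
split => //.
rewrite [LHS](_ : _ = \int[pushforward m (@rV_cons R n)]_x (f x)%:E)%E//.
rewrite (@integral_pushforward _ _ _ _ _ _ _ _ _ (EFin \o f))//.
- exact: measurable_rV_cons.
- exact/measurable_EFinP.
Qed.

(** By Fubini the derivative is integrated first along the lines parallel to the
    first coordinate axis, by the fundamental theorem, or first in the slices
    orthogonal to it, by induction on the dimension. *)
Lemma integral_deriv_coord n (i : 'I_n) (M : R) (f : 'rV[R]_n -> R) :
  continuous f -> (forall x, derivable f x (delta_mx ord0 i)) ->
  continuous ('D_(delta_mx ord0 i) f) -> supp_box M f ->
  (\int[lebesgue_rV n]_x ('D_(delta_mx ord0 i) f x)%:E = 0)%E.
Proof.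
elim: n i M f => [|n IH] i M f cf df cDf sf; first by case: i df cDf => -[].
set Df := 'D_(delta_mx ord0 i) f.
have iD : (lebesgue_rV n.+1).-integrable setT (EFin \o Df).
  by apply: (@integrable_supp_box _ M) => //; exact: supp_boxD.
have [im ->] := lebesgue_rVS iD.
have cons_cont0 (v : 'rV[R]_n) : continuous (fun a : R => rV_cons (a, v)).
  move=> a; apply/cvg_ballP => e e0.
  have H : \forall b \near a, ball a e b by exact: nbhsx_ballx.
  apply: (@filterS _ (nbhs a) _ _ _ _ H) => b abe.
  split => // k j; rewrite !mxE ord1 {k}; case: unliftP => [k _|_] /=.
    exact: ballxx.
  exact: abe.
have cons_contS (a : R) (v : 'rV[R]_n) : (fun v : 'rV[R]_n => rV_cons (a, v)) @ v --> rV_cons (a, v).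
  apply/(@cvg_ballP _ _ _ (nbhs v) (nbhs_filter v)) => e e0.
  have H : \forall w \near v, ball v e w by exact: nbhsx_ballx.
  apply: (@filterS _ (nbhs v) (nbhs_filter v) _ _ _ H) => w [_ vwe].
  split => // k j; rewrite !mxE ord1 {k}; case: unliftP => [k _|_] /=.
    exact: vwe.
  exact: ballxx.
case: (unliftP ord0 i) => [j ij|i0].
- rewrite -(integral12_prod_meas1 im) /fubini_F/=.
  rewrite -[RHS](integral0 (@lebesgue_measure R) setT).
  apply: eq_integral => a _ /=.
  pose h := fun v : 'rV[R]_n => f (rV_cons (a, v)).
  have shift_cons (v : 'rV[R]_n) (t : R) :
      rV_cons (a, t *: delta_mx ord0 j + v) = t *: delta_mx ord0 i + rV_cons (a, v).
    apply/rowP => k; rewrite !mxE ij; case: unliftP => [l ->|->] /=.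
      by rewrite !mxE (inj_eq lift_inj).
    by rewrite mulr0 add0r.
  have key (v : 'rV[R]_n) : derivable h v (delta_mx ord0 j) /\
      'D_(delta_mx ord0 j) h v = Df (rV_cons (a, v)).
    have := df (rV_cons (a, v)); rewrite /Df /derivable /derive.
    rewrite (_ : (fun t : R => t^-1 *: ((f \o shift (rV_cons (a, v))) (t *: delta_mx ord0 i) - _)) =
      (fun t : R => t^-1 *: ((h \o shift v) (t *: delta_mx ord0 j) - h v)))//.
    by apply/funext => t /=; rewrite /h shift_cons.
  rewrite -(IH j M h).
  + by apply: eq_integral => v _; have [_ ->] := key v.
  + by move=> v; apply: (@continuous_comp _ _ _ (fun v => rV_cons (a, v)) f);
      [exact: cons_contS|exact: cf].
  + by move=> v; have [] := key v.
  + rewrite (_ : 'D_(delta_mx ord0 j) h = Df \o (fun v => rV_cons (a, v))).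
      by move=> v; apply: continuous_comp; [exact: cons_contS|exact: cDf].
    by apply/funext => v; have [_ ->] := key v.
  + move=> v [k Mk]; apply: sf; exists (lift ord0 k).
    by rewrite mxE liftK.
- rewrite -(integral21_prod_meas1 im) /fubini_G/=.
  rewrite -[RHS](integral0 (lebesgue_rV n) setT).
  apply: eq_integral => v _ /=.
  pose h := fun a : R => f (rV_cons (a, v)).
  have shift_cons (a : R) (t : R) :
      rV_cons (t *: 1 + a, v) = t *: delta_mx ord0 i + rV_cons (a, v).
    apply/rowP => k; rewrite !mxE i0; case: unliftP => [l ->|->] /=.
      by rewrite mulr0 add0r.
    by rewrite ?eqxx.
  have key (a : R) : is_derive a 1 h (Df (rV_cons (a, v))).
    have := df (rV_cons (a, v)); rewrite /Df => d; split; move: d;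
    rewrite /derivable /derive.
      rewrite (_ : (fun t : R => t^-1 *: ((f \o shift (rV_cons (a, v))) (t *: delta_mx ord0 i) - _)) =
        (fun t : R => t^-1 *: ((h \o shift a) (t *: 1) - h a)))//.
      by apply/funext => t /=; rewrite /h shift_cons.
    rewrite (_ : (fun t : R => t^-1 *: ((f \o shift (rV_cons (a, v))) (t *: delta_mx ord0 i) - _)) =
      (fun t : R => t^-1 *: ((h \o shift a) (t *: 1) - h a)))//.
    by apply/funext => t /=; rewrite /h shift_cons.
  apply: (@FTC2_compact _ h _ M) => //.
    by move=> a; apply: (@continuous_comp _ _ _ (fun a => rV_cons (a, v)) Df);
      [exact: cons_cont0|exact: cDf].
  move=> a Ma; apply: sf; exists ord0.
  by rewrite mxE unlift_none.
Qed.

End divergence.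

(** * Convergence of integrals to 0 *)

Section cvg0.
Context {R : realType}.
Implicit Types (a b : nat -> \bar R).

Lemma cvge0P a : (forall n, 0 <= a n)%E ->
  (a @ \oo --> 0%E) <-> (forall e : R, 0 < e -> \forall n \near \oo, (a n <= e%:E)%E).
Proof.
move=> a0; split=> [/fine_cvgP[fa ca] e e0|H].
  move/cvgrPdist_le : ca => /(_ e e0) ca; near=> n.
  have fn : a n \is a fin_num by near: n.
  rewrite -(fineK fn) lee_fin.
  have : `|fine 0%E - fine (a n)| <= e by near: n; exact: ca.
  by rewrite sub0r normrN; apply: le_trans; rewrite ler_norm.
have fa : \forall n \near \oo, a n \is a fin_num.
  have := H 1 ltr01; apply: filterS => n an.
  by rewrite ge0_fin_numE//; apply: le_lt_trans an _; rewrite ltry.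
apply/fine_cvgP; split => //.
apply/cvgrPdist_le => e e0; near=> n.
have fn : a n \is a fin_num by near: n.
rewrite sub0r normrN ger0_norm ?fine_ge0//.
by rewrite -lee_fin fineK//; near: n; exact: H.
Unshelve. all: by end_near. Qed.

Lemma cvge0_le a b : (forall n, 0 <= a n)%E -> (forall n, a n <= b n)%E ->
  b @ \oo --> 0%E -> a @ \oo --> 0%E.
Proof.
move=> a0 ab b0; apply: (squeeze_cvge _ (cvg_cst _) b0).
by apply: nearW => n; rewrite a0 ab.
Qed.

Lemma cvge0D a b : a @ \oo --> 0%E -> b @ \oo --> 0%E -> (fun n => a n + b n)%E @ \oo --> 0%E.
Proof. by move=> ha hb; rewrite -[X in _ --> X]adde0; exact: cvgeD. Qed.

Lemma cvge0Z (k : R) a : a @ \oo --> 0%E -> (fun n => k%:E * a n)%E @ \oo --> 0%E.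
Proof. by move=> ha; rewrite -[X in _ --> X](mule0 k%:E); exact: cvgeZl. Qed.

Lemma ereal_le0_cvg (x : \bar R) a : (forall n, x <= a n)%E -> a @ \oo --> 0%E -> (x <= 0)%E.
Proof.
by move=> xa a0; apply: (cvge_ge _ a0); exact: nearW.
Qed.

End cvg0.

Section tails.
Context {R : realType} d {T : measurableType d}.
Variable mu : {measure set T -> \bar R}.
Variables (D : set T) (mD : measurable D).

(** Dominated convergence for the truncations of |f| from below at height n. *)
Lemma integrable_tail (f : T -> R) (e : R) : mu.-integrable D (EFin \o f) -> 0 < e ->
  exists2 m : R, 0 < m &
    (\int[mu]_(x in D) (`|f x| * (m < `|f x|)%R%:R)%:E <= e%:E)%E.
Proof.
move=> intf e0.
have mf : measurable_fun D f by case/integrableP : intf => /measurable_EFinP.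
pose h n := fun x : T => (`|f x| * (n%:R < `|f x|)%R%:R)%:E : \bar R.
have mh n : measurable_fun D (h n).
  apply/measurable_EFinP; apply: measurable_funM.
    exact: measurableT_comp.
  apply: (@measurableT_comp _ _ _ _ _ _ (fun b : bool => b%:R : R)) => //.
  by apply: measurable_fun_ltr => //; exact: measurableT_comp.
have hc : {ae mu, forall x, D x -> h n x @[n --> \oo] --> cst 0%E x}.
  apply: nearW => x Dx; apply/cvge0P; first by move=> n; rewrite lee_fin mulr_ge0.
  move=> e' e'0; near=> n.
  rewrite lee_fin (_ : (n%:R < `|f x|) = false) ?mulr0 ?ltW//.
  apply/negbTE; rewrite -leNgt; apply: (@le_trans _ _ (Num.truncn `|f x|).+1%:R).
    by rewrite ltW// truncnS_gt.
  by rewrite ler_nat; near: n; exact: nbhs_infty_ge.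
have hd : {ae mu, forall x n, D x -> (`|h n x| <= (EFin \o (Num.norm \o f)) x)%E}.
  apply: nearW => x n Dx; rewrite /h gee0_abs ?lee_fin ?mulr_ge0//=.
  by rewrite ler_piMr// lern1 leq_b1.
have [_ _] := dominated_convergence mD mh (measurable_cst _) hc (integrable_norm intf) hd.
rewrite integral0 => ic.
have H : \forall n \near \oo, (\int[mu]_(x in D) h n x <= e%:E)%E.
  apply: (proj1 (cvge0P _) ic) => // n.
  by apply: integral_ge0 => x _; rewrite lee_fin mulr_ge0.
have [N _ HN] := H.
exists (N.+1)%:R => //; apply: HN => /=; exact: leqnSn.
Unshelve. all: by end_near. Qed.

(** f need not be bounded: it is cut at a height above which its integral is small;
    the large values are paired with the bound C, the others with the L^1 norms. *)
Lemma pairing_cvg0 (f : T -> R) (c : nat -> T -> R) (C : R) :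
  mu.-integrable D (EFin \o f) -> (forall n, measurable_fun D (c n)) ->
  (forall n x, D x -> `|c n x| <= C) ->
  (fun n => \int[mu]_(x in D) `|c n x|%:E)%E @ \oo --> 0%E ->
  (fun n => \int[mu]_(x in D) (`|f x| * `|c n x|)%:E)%E @ \oo --> 0%E.
Proof.
move=> intf mc cC c0.
have mf : measurable_fun D f by case/integrableP : intf => /measurable_EFinP.
have pos n : (0 <= \int[mu]_(x in D) (`|f x| * `|c n x|)%:E)%E.
  by apply: integral_ge0 => x _; rewrite lee_fin mulr_ge0.
apply/(cvge0P pos) => e e0.
pose C' : R := `|C| + 1.
have C'0 : 0 < C' by rewrite ltr_wpDl.
have cC' n x : D x -> `|c n x| <= C'.
  by move=> /(cC n)/le_trans; apply; rewrite (le_trans (ler_norm C))// lerDl.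
have [|m m0 Hm] := @integrable_tail f (e / 2 / C') intf; first by rewrite !divr_gt0.
have : \forall n \near \oo, (\int[mu]_(x in D) `|c n x|%:E <= (e / 2 / m)%:E)%E.
  apply: (proj1 (cvge0P _)) => //; last by rewrite !divr_gt0.
  by move=> n; apply: integral_ge0 => x _; rewrite lee_fin.
apply: filterS => n Hn.
have mabs (g : T -> R) : measurable_fun D g -> measurable_fun D (fun x => `|g x|).
  by move=> mg; exact: measurableT_comp.
have mt : measurable_fun D (fun x => `|f x| * (m < `|f x|)%R%:R).
  apply: measurable_funM; first exact: mabs.
  apply: (@measurableT_comp _ _ _ _ _ _ (fun b : bool => b%:R : R)) => //.
  by apply: measurable_fun_ltr => //; exact: mabs.
have mmc : measurable_fun D (fun x => `|c n x|) by exact: mabs.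
apply: (@le_trans _ _ (\int[mu]_(x in D) (m * `|c n x| + C' * (`|f x| * (m < `|f x|)%R%:R))%:E)%E).
  apply: int_le => [//|x _|x Dx]; first by rewrite mulr_ge0.
  case: ltP => fm.
    rewrite mulr1 ler_wpDl ?mulr_ge0 ?(ltW m0)//.
    by rewrite mulrC ler_wpM2r// cC'.
  by rewrite !mulr0 addr0 ler_wpM2r.
have t0 x : D x -> 0 <= `|f x| * (m < `|f x|)%R%:R by move=> _; rewrite mulr_ge0.
rewrite intD//; do ?[exact: measurable_funM|by move=> x Dx; rewrite mulr_ge0 ?t0 ?(ltW m0) ?(ltW C'0)].
rewrite intZ ?(ltW m0)// intZ ?(ltW C'0)//.
have -> : e%:E = (m%:E * (e / 2 / m)%:E + C'%:E * (e / 2 / C')%:E)%E.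
  rewrite -!EFinM -EFinD; congr EFin.
  by have := C'0; have := m0; move=> /gt_eqF/negbT ? /gt_eqF/negbT ?; field; apply/andP.
by apply: leeD; apply: lee_wpmul2l => //; rewrite lee_fin ltW.
Qed.

(** Embeds L^p in L^1 on a set of finite measure, by integration: either
    x <= e, or x^(p-1) >= e^(p-1). *)
Lemma le_split_powR (p x e : R) : 1 <= p -> 0 <= x -> 0 < e ->
  x <= e + e `^ (1 - p) * x `^ p.
Proof.
move=> p1 x0 e0; have [xe|ex] := leP x e.
  by rewrite ler_wpDr// mulr_ge0 ?powR_ge0.
have xg0 : 0 < x by exact: lt_trans ex.
apply: (@le_trans _ _ (e `^ (1 - p) * x `^ p)); last by rewrite lerDr ltW.
rewrite [leLHS](_ : x = x `^ (1 - p) * x `^ p); last first.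
  by rewrite -powRD ?subrK ?powRr1// gt_eqF// implybT.
apply: ler_wpM2r; first exact: powR_ge0.
have -> : 1 - p = - (p - 1) by rewrite opprB.
rewrite !powRN lef_pV2 ?posrE ?powR_gt0//.
by apply: ge0_ler_powR; rewrite ?subr_ge0 ?nnegrE// ltW.
Qed.

Lemma Lp_L1_cvg0 (p : R) (c : nat -> T -> R) : 1 <= p -> (mu D < +oo)%E ->
  (forall n, measurable_fun D (c n)) ->
  (fun n => \int[mu]_(x in D) (`|c n x| `^ p)%:E)%E @ \oo --> 0%E ->
  (fun n => \int[mu]_(x in D) `|c n x|%:E)%E @ \oo --> 0%E.
Proof.
move=> p1 Doo mc cp.
apply/cvge0P; first by move=> n; apply: integral_ge0 => x _; rewrite lee_fin.
move=> e e0.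
have Df : mu D \is a fin_num by rewrite ge0_fin_numE.
have K0 : 0 < fine (mu D) + 1 by rewrite ltr_wpDl// fine_ge0.
pose dl := e / 2 / (fine (mu D) + 1).
have d0 : 0 < dl by rewrite !divr_gt0.
have k0 : 0 < dl `^ (1 - p) by rewrite powR_gt0.
have : \forall n \near \oo,
    (\int[mu]_(x in D) (`|c n x| `^ p)%:E <= (e / 2 / dl `^ (1 - p))%:E)%E.
  apply: (proj1 (cvge0P _)) => //; last by rewrite !divr_gt0.
  by move=> n; apply: integral_ge0 => x _; rewrite lee_fin powR_ge0.
apply: filterS => n Hn.
have mcp : measurable_fun D (fun x => `|c n x| `^ p).
  by apply: (measurableT_comp (measurable_powR _)); exact: measurableT_comp.
apply: (@le_trans _ _ (\int[mu]_(x in D) (dl + dl `^ (1 - p) * `|c n x| `^ p)%:E)%E).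
  by apply: int_le => // x Dx; exact: le_split_powR.
rewrite intD//; do ?[exact: measurable_funM|by move=> x _; rewrite ?mulr_ge0 ?powR_ge0 ?(ltW d0)].
rewrite (intZ mu mD (k := dl `^ (1 - p)) (powR_ge0 _ _) mcp); last first.
  by move=> x _; rewrite powR_ge0.
have -> : e%:E = ((e / 2)%:E + (dl `^ (1 - p))%:E * (e / 2 / dl `^ (1 - p))%:E)%E.
  rewrite -!EFinM -EFinD; congr EFin.
  by move: k0 => /gt_eqF/negbT ?; field.
  apply: leeD; last by apply: lee_wpmul2l => //; rewrite lee_fin powR_ge0.
  rewrite integral_cst// -(fineK Df) -EFinM lee_fin /dl.
  have e20 : 0 <= e / 2 by apply: divr_ge0 => //; exact: ltW.
  by rewrite mulrAC ler_pdivrMr// ler_wpM2l// lerDl.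
by move=> x _; exact: ltW.
Qed.

End tails.

(** * Test functions and gradients *)

Lemma le_powR {R : realType} (p x y : R) : 0 <= p -> 0 <= x -> x <= y -> x `^ p <= y `^ p.
Proof. by move=> p0 x0 xy; apply: ge0_ler_powR; rewrite ?nnegrE// (le_trans x0). Qed.

Section Rint.
Context {R : realType} d {T : measurableType d}.
Variable mu : {measure set T -> \bar R}.
Variables (D : set T) (mD : measurable D).

Lemma Rint_dist (f g : T -> R) : mu.-integrable D (EFin \o f) ->
  mu.-integrable D (EFin \o g) ->
  (`|\int[mu]_(x in D) f x - \int[mu]_(x in D) g x|%:E <=
   \int[mu]_(x in D) `|f x - g x|%:E)%E.
Proof.
move=> fi gi; rewrite -RintegralB//.
have fgi : mu.-integrable D (EFin \o (f \- g)).
  by rewrite (_ : _ \o _ = (EFin \o f) \- (EFin \o g))%E; [exact: integrableB|].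
by rewrite EFin_normr_Rintegral//; apply: le_abse_integral => //; case/integrableP : fgi.
Qed.

Lemma integrable_addr (f g : T -> R) : mu.-integrable D (EFin \o f) ->
  mu.-integrable D (EFin \o g) -> mu.-integrable D (EFin \o (fun x => f x + g x)).
Proof.
move=> fi gi; rewrite (_ : _ \o _ = (EFin \o f) \+ (EFin \o g))%E//.
exact: integrableD.
Qed.

Lemma Rint_norm_le (f : T -> R) : mu.-integrable D (EFin \o f) ->
  (`|\int[mu]_(x in D) f x|%:E <= \int[mu]_(x in D) `|f x|%:E)%E.
Proof.
move=> fi; rewrite EFin_normr_Rintegral//.
by apply: le_abse_integral => //; case/integrableP : fi.
Qed.

Lemma cvg0_eq0 (x : R) (a : nat -> \bar R) : (forall n, `|x|%:E <= a n)%E ->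
  a @ \oo --> 0%E -> x = 0.
Proof.
move=> xa a0; apply/eqP; rewrite -normr_le0 -lee_fin.
exact: (ereal_le0_cvg xa a0).
Qed.

Lemma integrable_le (f g : T -> R) : measurable_fun D f ->
  mu.-integrable D (EFin \o g) -> (forall x, D x -> `|f x| <= `|g x|) ->
  mu.-integrable D (EFin \o f).
Proof.
move=> mf gi fg; apply: (le_integrable mD _ _ gi); first exact/measurable_EFinP.
by move=> x Dx /=; rewrite lee_fin fg.
Qed.

Lemma ge0_int_eq0 (f : T -> R) : measurable_fun D f -> (forall x, D x -> 0 <= f x) ->
  (\int[mu]_(x in D) (f x)%:E)%E = 0%E -> {ae mu, forall x, D x -> f x = 0}.
Proof.
move=> mf f0 fi.
have /ae_eq_integral_abs : measurable_fun D (EFin \o f) by exact/measurable_EFinP.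
move=> /(_ mu mD)[+ _]; rewrite (_ : (\int[mu]_(x in D) _)%E = 0%E).
  by move=> /(_ erefl); apply: filterS => x fx Dx; have [] := fx Dx.
rewrite -[RHS]fi; apply: eq_integral => x; rewrite inE => Dx /=.
by rewrite ger0_norm ?f0.
Qed.

End Rint.

Section enorm.
Context {R : realType} {N : nat}.
Implicit Types v w : 'rV[R]_N.

Lemma dotv_ge0 v : 0 <= dotv v v.
Proof. by apply: sumr_ge0 => i _; rewrite -expr2 sqr_ge0. Qed.

Lemma enorm_ge0 v : 0 <= enorm v. Proof. exact: sqrtr_ge0. Qed.

Lemma sqr_enorm v : enorm v ^+ 2 = dotv v v.
Proof. by rewrite sqr_sqrtr// dotv_ge0. Qed.

Lemma coord_le_enorm v i : `|v ord0 i| <= enorm v.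
Proof.
rewrite -(@ler_pXn2r _ 2)// ?nnegrE ?enorm_ge0// sqr_enorm.
rewrite /dotv (bigD1 i)//= real_normK ?num_real// -expr2 lerDl.
by apply: sumr_ge0 => j _; rewrite -expr2 sqr_ge0.
Qed.

(** Cauchy-Schwarz, from the nonnegativity of the square of the projection residue. *)
Lemma dotv_le v w : `|dotv v w| <= enorm v * enorm w.
Proof.
have [w0|w0] := eqVneq (enorm w) 0.
  have wi i : w ord0 i = 0.
    by apply/eqP; rewrite -normr_le0 -w0 coord_le_enorm.
  rewrite w0 mulr0 /dotv big1 ?normr0// => i _.
  by rewrite wi mulr0.
have W0 : 0 < enorm w ^+ 2 by rewrite exprn_gt0// lt_neqAle eq_sym w0 enorm_ge0.
rewrite -(@ler_pXn2r _ 2)// ?nnegrE ?mulr_ge0 ?enorm_ge0// exprMn real_normK ?num_real//.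
pose t := dotv v w / enorm w ^+ 2.
have := dotv_ge0 (v - t *: w).
have -> : dotv (v - t *: w) (v - t *: w) = dotv v v - 2 * t * dotv v w + t ^+ 2 * dotv w w.
  rewrite /dotv !mulr_sumr -sumrB -big_split/=; apply: eq_bigr => i _.
  by rewrite !mxE; ring.
rewrite -!sqr_enorm /t => H.
have {H} : 0 <= (enorm v ^+ 2 - 2 * (dotv v w / enorm w ^+ 2) * dotv v w +
   (dotv v w / enorm w ^+ 2) ^+ 2 * enorm w ^+ 2) * enorm w ^+ 2.
  by rewrite mulr_ge0// ltW.
have W0' := gt_eqF W0.
rewrite (_ : _ * _ = enorm v ^+ 2 * enorm w ^+ 2 - dotv v w ^+ 2); last first.
  by field; apply/negP => /eqP e; move: w0; rewrite e eqxx.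
by rewrite subr_ge0.
Qed.

Lemma enorm0_eq v : enorm v = 0 <-> v = 0.
Proof.
split=> [v0|->].
  apply/rowP => i; rewrite mxE; apply/eqP; rewrite -normr_le0 -v0.
  exact: coord_le_enorm.
rewrite /enorm (_ : dotv 0 0 = 0) ?sqrtr0//.
by rewrite /dotv big1// => i _; rewrite mxE mul0r.
Qed.

End enorm.

Section vec_measurable.
Context {R : realType} {N : nat} d {T : measurableType d}.
Variable mu : {measure set T -> \bar R}.

Lemma measurable_powRl (D : set T) (f : T -> R) p : measurable_fun D f ->
  measurable_fun D (fun x => f x `^ p).
Proof. by move=> mf; exact: (measurableT_comp (measurable_powR p) mf). Qed.

Lemma measurable_abs (D : set T) (f : T -> R) : measurable_fun D f ->
  measurable_fun D (fun x => `|f x|).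
Proof. by move=> mf; exact: measurableT_comp. Qed.

Lemma measurable_enorm (D : set T) (F : T -> 'rV[R]_N) :
  (forall i, measurable_fun D (fun x => F x ord0 i)) ->
  measurable_fun D (fun x => enorm (F x)).
Proof.
move=> mF; apply: (@measurableT_comp _ _ _ _ _ _ (@Num.sqrt R) D (fun x => dotv (F x) (F x))).
  apply: continuous_measurable_fun; exact: sqrt_continuous.
by apply: measurable_sum => j; exact: measurable_funM.
Qed.

Lemma vec_rep (D : set T) (F : T -> 'rV[R]_N) : measurable D ->
  (forall i, cmeasurable mu D (fun x => F x ord0 i)) ->
  exists H : T -> 'rV[R]_N, [/\ forall i, measurable_fun setT (fun x => H x ord0 i),
    forall z, ~ D z -> H z = 0 & {ae mu, forall z, D z -> F z = H z}].
Proof.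
move=> mD cF.
have /choice[h hP] j : exists h : T -> R, [/\ measurable_fun setT h,
    (forall z, ~ D z -> h z = 0) & {ae mu, forall x, D x -> F x ord0 j = h x}].
  exact: cmeasurable_rep.
exists (fun x => \row_j h j x); split.
- by move=> i; under eq_fun do rewrite mxE; case: (hP i).
- by move=> z nD; apply/rowP => j; rewrite !mxE; case: (hP j) => _ + _; exact.
- have : {ae mu, forall x, forall j, D x -> F x ord0 j = h j x}.
    by apply: ae_countable => j; case: (hP j).
  by apply: filterS => x Hx Dx; apply/rowP => j; rewrite mxE; exact: Hx.
Qed.

End vec_measurable.

Section test_functions.
Context {R : realType} {N : nat}.
Local Notation E := 'rV[R]_N.

Lemma test_supp_box (Om : set E) (phi : E -> R) : test_function Om phi ->
  exists M, supp_box M phi.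
Proof.
move=> [_ [K [cK KO phi0]]].
have /(@compact_bounded _ _ K)[M [Mr HM]] := cK.
exists (`|M| + 1) => x [j Mj]; apply: phi0 => Kx.
have : `|x| <= `|M| + 1.
  by apply: HM => //; rewrite (le_lt_trans (ler_norm M))// ltrDl.
rewrite leNgt => /negP; apply; apply: lt_le_trans Mj _.
rewrite [leRHS]mx_normrE.
exact: (le_bigmax _ (fun ij : 'I_1 * 'I_N => `|x ij.1 ij.2|) (ord0, j)).
Qed.

Lemma test_out (V : normedModType R) (Om : set V) (phi : V -> R) : test_function Om phi ->
  forall x, ~ Om x -> phi x = 0.
Proof. by move=> [_ [K [_ KO phi0]]] x nO; apply: phi0 => /KO. Qed.

Lemma test_deriv (V : normedModType R) (Om : set V) (phi : V -> R) v :
  hausdorff_space V -> test_function Om phi -> test_function Om ('D_v phi).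
Proof.
move=> hV [sphi [K [cK KO phi0]]]; split; first exact: smoothD1.
exists K; split => // x nKx.
have oK : open (~` K) by rewrite openC; exact: compact_closed.
rewrite (@near_eq_derive _ _ _ phi (cst 0)) ?derive_cst//.
have : nbhs x (~` K) by exact: open_nbhs_nbhs.
by apply: filterS => y /= nK; exact: phi0.
Qed.

Lemma test_mul (V : normedModType R) (Om : set V) (phi h : V -> R) :
  test_function Om phi -> smooth h -> test_function Om (phi \* h).
Proof.
move=> [sphi [K [cK KO phi0]]] sh; split; first exact: smoothM.
by exists K; split => // x nK /=; rewrite phi0// mul0r.
Qed.

Lemma test_bounded (Om : set E) (phi : E -> R) : test_function Om phi ->
  exists C, forall x, `|phi x| <= C.
Proof.
move=> tp; have [M sM] := test_supp_box tp.
have cphi := smooth_continuous (proj1 tp).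
have cb : compact (@box R N M).
  by apply: (@rV_compact _ N (fun=> `[- M, M]%classic)) => i; exact: segment_compact.
have [[x0 bx0]|nb] := pselect (exists x, @box R N M x); last first.
  exists 0 => x; rewrite sM ?normr0//; apply: contrapT => h; apply: nb.
  exists x => j /=; rewrite in_itv/= -ler_norml leNgt.
  by apply/negP => Mj; apply: h; exists j.
have [||c _ Hc] := @EVT_max_rV R N (fun x => `|phi x|) (@box R N M) _ cb.
- by exists x0.
- apply: continuous_subspaceT => t.
  by apply: (@continuous_comp _ _ _ phi (fun t : R => `|t|)); [exact: cphi|exact: norm_continuous].
exists `|phi c| => x; have [bx|nbx] := pselect (@box R N M x).
  by apply: Hc; rewrite inE.
rewrite sM ?normr0//; apply: contrapT => h; apply: nbx => j /=.
by rewrite in_itv/= -ler_norml leNgt; apply/negP => Mj; apply: h; exists j.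
Qed.

Lemma test_integrable (Om : set E) (phi : E -> R) : test_function Om phi ->
  (lebesgue_rV N).-integrable setT (EFin \o phi).
Proof.
move=> tp; have [M sM] := test_supp_box tp.
exact: (integrable_supp_box (smooth_continuous (proj1 tp)) sM).
Qed.

Lemma test_integral_deriv (Om : set E) (phi : E -> R) i : test_function Om phi ->
  (\int[lebesgue_rV N]_x ('D_(delta_mx ord0 i) phi x)%:E = 0)%E.
Proof.
move=> tp; have [M sM] := test_supp_box tp; have [sp _] := tp.
apply: (@integral_deriv_coord _ _ _ M) => //.
- exact: smooth_continuous.
- by move=> x; exact: smooth_derivable.
- exact/smooth_continuous/smoothD1.
Qed.

Lemma hausdorff_rV : hausdorff_space E.
Proof. exact: norm_hausdorff. Qed.

End test_functions.

Section zero_gradient.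
Context {R : realType} {N : nat}.
Local Notation E := 'rV[R]_N.
Local Notation leb := (lebesgue_rV N).

Let m (y : R) : R := y / (1 + y ^+ 2).

Let den (y : R) : 0 < 1 + y ^+ 2. Proof. by rewrite ltr_pwDl// sqr_ge0. Qed.

Let m_lip a b : `|m a - m b| <= `|a - b|.
Proof.
have da := den a; have db := den b.
rewrite /m (_ : _ - _ = (a - b) * ((1 - a * b) / ((1 + a ^+ 2) * (1 + b ^+ 2)))); last first.
  by field; rewrite (gt_eqF da) (gt_eqF db).
rewrite normrM -[leRHS]mulr1 ler_wpM2l// normrM normfV.
rewrite (ger0_norm (mulr_ge0 (ltW da) (ltW db))) ler_pdivrMr ?mulr_gt0// mul1r.
rewrite ler_norml; apply/andP; split; rewrite -subr_ge0.
- rewrite (_ : _ - _ = 2 + (a ^+ 2 + b ^+ 2 - a * b) + (a * b) ^+ 2); last by ring.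
  by rewrite addr_ge0 ?sqr_ge0// addr_ge0//; nra.
- rewrite (_ : _ - _ = (a ^+ 2 + b ^+ 2 + a * b) + (a * b) ^+ 2); last by ring.
  by rewrite addr_ge0 ?sqr_ge0//; nra.
Qed.

Let m_le1 y : `|m y| <= 1.
Proof.
rewrite /m normrM normfV (gtr0_norm (den y)) ler_pdivrMr// mul1r.
by rewrite ler_norml; apply/andP; split; nra.
Qed.

Let m_smooth : smooth m.
Proof.
apply: (@smoothM _ _ id (fun y : R => (1 + y ^+ 2)^-1)); first exact: smooth_id.
apply: smoothV; first by move=> y; rewrite gt_eqF.
apply: (@smoothD _ _ (cst 1) (fun y : R => y ^+ 2)); first exact: smooth_cst.
by apply: (@smoothM _ _ id id); exact: smooth_id.
Qed.

Let mm : measurable_fun setT m.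
Proof. exact: (continuous_measurable_fun (smooth_continuous m_smooth)). Qed.

(** Let phi_n be test functions such that phi_n tends to 0 and d_i phi_n to G_i.
    The integral of d_i (phi_n h) vanishes; with h = m(d_i phi_k), m bounded and
    smooth, the limit n -> oo shows that G_i h has integral 0, and the limit k -> oo
    that m(G_i) G_i has integral 0. Now m(y) y > 0 for y <> 0. *)
Lemma zero_gradient (Om : set E) (p : R) (v : E -> R) (G : E -> E) (i : 'I_N) :
  open Om -> (leb Om < +oo)%E -> 1 <= p -> in_W0 Om p v G ->
  {ae leb, forall x, Om x -> v x = 0} ->
  {ae leb, forall x, Om x -> G x ord0 i = 0}.
Proof.
move=> oO Ofin p1 [_ [cG Gp] [phi [tphi c1 c2]]] v0.
have mO := open_measurable_rV oO.
have [G' [mG' _ GG']] := cmeasurable_rep mO (cG i).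
pose f n := 'D_(delta_mx ord0 i) (phi n).
have tf n : test_function Om (f n) by apply: test_deriv => //; exact: hausdorff_rV.
have mt (h : E -> R) : test_function Om h -> measurable_fun setT h.
  by move=> [sh _]; apply: continuous_measurable_rV; exact: smooth_continuous.
have mtO (h : E -> R) : measurable_fun setT h -> measurable_fun Om h by exact: measurable_funS.
have a1 : (fun n => \int[leb]_(x in Om) `|phi n x|%:E)%E @ \oo --> 0%E.
  apply: (@Lp_L1_cvg0 _ _ _ leb Om mO p phi p1 Ofin).
    by move=> n; apply: mtO; apply: mt; exact: tphi.
  apply: cvge0_le c1 => n; first by apply: int_ge0 => // x _; exact: powR_ge0.
  apply: ge0_le_integral_ae => //; try by move=> x _; rewrite lee_fin powR_ge0.
  by apply: filterS v0 => x v0 Ox; rewrite v0// subr0.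
have a2 : (fun n => \int[leb]_(x in Om) `|f n x - G' x|%:E)%E @ \oo --> 0%E.
  apply: (@Lp_L1_cvg0 _ _ _ leb Om mO p (fun n x => f n x - G' x) p1 Ofin).
    by move=> n; apply: measurable_funB; apply: mtO; [exact: mt (tf n)|exact: mG'].
  apply: cvge0_le c2 => n; first by apply: int_ge0 => // x _; exact: powR_ge0.
  apply: ge0_le_integral_ae => //; try by move=> x _; rewrite lee_fin powR_ge0.
  apply: filterS GG' => x GG' Ox; rewrite lee_fin.
  apply: le_powR => //; first exact: le_trans ler01 p1.
  have := coord_le_enorm (grad (phi n) x - G x) i.
  by rewrite !mxE GG'.
have iG : leb.-integrable Om (EFin \o G').
  apply: integrable_real; first exact: mtO.
  apply: (@le_lt_trans _ _ (\int[leb]_(x in Om) (1 + enorm (G x) `^ p)%:E)%E).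
    apply: ge0_le_integral_ae => //; try by move=> x _; rewrite lee_fin// addr_ge0// powR_ge0.
    apply: filterS GG' => x GG' Ox; rewrite lee_fin.
    apply: le_trans (le_split_powR p1 _ ltr01) _ => //.
    rewrite powR1 mul1r lerD2l; apply: le_powR => //; first exact: le_trans ler01 p1.
    by rewrite -GG'// coord_le_enorm.
  have cE : cmeasurable leb Om (fun x => enorm (G x) `^ p).
    have [H [mH _ HE]] := vec_rep mO cG.
    exists (fun x => enorm (H x) `^ p).
      by apply: mtO; apply: measurable_powRl; exact: (measurable_enorm mH).
    by apply: filterS HE => x HE Ox; rewrite HE.
  have [h [mh _ hE]] := cmeasurable_rep mO cE.
  rewrite (@integral_eq_ae _ _ _ _ _ _ (fun x => (1 + `|h x|)%:E))//; last first.
    apply: filterS hE => x hE Ox; rewrite -hE// ger0_norm//; exact: powR_ge0.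
  rewrite intD//; last first.
    by apply: mtO; exact: measurableT_comp.
  rewrite integral_cst// mul1e lte_add_pinfty//.
  rewrite (@integral_eq_ae _ _ _ _ _ _ (fun x => (enorm (G x) `^ p)%:E))//.
  apply: filterS hE => x hE Ox; rewrite -hE// ger0_norm//; exact: powR_ge0.
pose h k := m \o f k.
have sh k : smooth (h k) by apply: smooth_comp => //; case: (tf k).
have mh k : measurable_fun Om (h k).
  by apply: mtO; apply: continuous_measurable_rV; exact: smooth_continuous.
(* n -> oo with k fixed *)
have step1 k : \int[leb]_(x in Om) (h k x * G' x) = 0.
  pose Dh := 'D_(delta_mx ord0 i) (h k).
  have tpD n : test_function Om (phi n \* Dh) by apply: test_mul => //; exact: smoothD1.
  have tfh n : test_function Om (f n \* h k) by apply: test_mul.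
  have IBP n : \int[leb]_(x in Om) ((phi n \* Dh) x + (f n \* h k) x) = 0.
    have := @test_integral_deriv _ _ Om (phi n \* h k) i (test_mul (tphi n) (sh k)).
    rewrite /Rintegral => H; rewrite -[RHS]/(fine 0%E) -H; congr fine.
    rewrite integral_mkcond; apply: eq_integral => x _; rewrite patchE.
    have -> : 'D_(delta_mx ord0 i) (phi n \* h k) x = (phi n \* Dh) x + (f n \* h k) x.
      rewrite [LHS](@deriveM _ _ (phi n) (h k)).
      - by rewrite /= /Dh /f /GRing.scale/= [X in _ + X = _]mulrC.
      - by apply: smooth_derivable; case: (tphi n).
      - exact: smooth_derivable.
    case: ifPn => //; rewrite notin_setE => nO.
    by rewrite (test_out (tpD n) nO) (test_out (tfh n) nO) addr0.
  have [C HC] : exists C, forall x, `|Dh x| <= C.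
    have /test_bounded[C1 H1] := test_deriv (delta_mx ord0 i) hausdorff_rV (tf k).
    have sm1 : smooth ('D_1 m) by exact: smoothD1.
    exists (1 * C1) => x; rewrite /Dh /h derive_comp//; last by case: (tf k).
    rewrite normrM; apply: ler_pM => //.
    have lim : (fun t : R => t^-1 *: ((m \o shift (f k x)) (t *: 1) - m (f k x))) @ 0^' -->
        'D_1 m (f k x) by exact: smooth_derivable.
    have : `|'D_1 m (f k x)| <= 1.
      have nlim : (fun t : R => `|t^-1 *: ((m \o shift (f k x)) (t *: 1) - m (f k x))|) @ 0^' -->
        `|'D_1 m (f k x)| by exact: cvg_norm.
      rewrite -(cvg_lim _ nlim)//; apply: limr_le; first exact: cvgP nlim.
      near=> t; rewrite normrZ normfV /= [_%:A]mulr1.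
      have t0 : t != 0 by near: t; exact: nbhs_dnbhs_neq.
      rewrite mulrC ler_pdivrMr ?normr_gt0// mul1r.
      by apply: le_trans (m_lip _ _) _; rewrite addrK.
    by [].
  apply: (@cvg0_eq0 _ _ (fun n => \int[leb]_(x in Om) `|f n x - G' x|%:E +
      `|C|%:E * \int[leb]_(x in Om) `|phi n x|%:E)%E); last first.
    by apply: cvge0D => //; exact: cvge0Z.
  move=> n.
  have i1 : leb.-integrable Om (EFin \o (fun x => h k x * G' x)).
    apply: (integrable_le mO _ iG).
      by apply: measurable_funM => //; exact: mtO.
    by move=> x _; rewrite normrM ler_piMl// m_le1.
  have i2 : leb.-integrable Om (EFin \o (fun x => (phi n \* Dh) x + (f n \* h k) x)).
    apply: (integrableS measurableT mO) => //.
    by apply: integrable_addr => //; [exact: test_integrable (tpD n)|exact: test_integrable (tfh n)].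
  rewrite -[X in `|X|]subr0 -(IBP n); apply: le_trans (Rint_dist mO i1 i2) _.
  rewrite -intZ//; last first.
    by apply: mtO; apply: measurableT_comp => //; exact: mt.
  rewrite -intD//; last first.
  - by apply: measurable_funM => //; apply: mtO; apply: measurableT_comp => //; exact: mt.
  - apply: mtO; apply: measurableT_comp => //.
    by apply: measurable_funB => //; exact: mt.
  apply: int_le => // x Ox.
  rewrite (_ : _ - _ = - (h k x * (f n x - G' x)) - Dh x * phi n x); last by rewrite /=; ring.
  apply: le_trans (ler_normB _ _) _; rewrite normrN (normrM (h k x)) (normrM (Dh x)); apply: lerD.
    by rewrite ler_piMl// m_le1.
  by rewrite ler_wpM2r// (le_trans (HC x))// ler_norm.
(* k -> oo *)
have step2 : \int[leb]_(x in Om) (m (G' x) * G' x) = 0.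
  apply: (@cvg0_eq0 _ _ (fun k => \int[leb]_(x in Om) (`|G' x| * `|m (G' x) - h k x|)%:E)%E).
    move=> k; rewrite -[X in `|X|]subr0 -(step1 k).
    apply: le_trans (Rint_dist mO _ _) _.
    - apply: (integrable_le mO _ iG).
        by apply: measurable_funM; apply: mtO => //; exact: measurableT_comp.
      by move=> x _; rewrite normrM ler_piMl// m_le1.
    - apply: (integrable_le mO _ iG).
        by apply: measurable_funM => //; exact: mtO.
      by move=> x _; rewrite normrM ler_piMl// m_le1.
    by apply: int_le => // x Ox; rewrite -mulrBl normrM mulrC.
  apply: (@pairing_cvg0 _ _ _ leb Om mO G' (fun k x => m (G' x) - h k x) 2) => //.
  - by move=> n; apply: measurable_funB => //; apply: mtO; exact: measurableT_comp.
  - move=> n x Ox; apply: le_trans (ler_normB _ _) _.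
    by rewrite -[2]/(1 + 1) lerD// m_le1.
  - apply: cvge0_le a2 => n; first exact: int_ge0.
    apply: int_le => // x Ox; rewrite distrC; exact: m_lip.
have e0 : {ae leb, forall x, Om x -> m (G' x) * G' x = 0}.
  have mmG : measurable_fun Om (fun x => m (G' x) * G' x).
    by apply: measurable_funM; apply: mtO => //; exact: measurableT_comp.
  apply: ge0_int_eq0 => //.
    by move=> x _; rewrite /m mulrAC -expr2 divr_ge0 ?sqr_ge0// ltW.
  rewrite -[LHS]fineK; first by rewrite -[fine _]/(\int[leb]_(x in Om) (m (G' x) * G' x)) step2.
  apply: (@integrable_fin_num _ _ _ leb Om mO (EFin \o (fun x => m (G' x) * G' x))).
  apply: (integrable_le mO _ iG) => //.
  by move=> x _; rewrite normrM ler_piMl// m_le1.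
apply: filterS2 GG' e0 => x GG' e0 Ox; rewrite GG'//.
move: (e0 Ox); rewrite /m mulrAC -expr2 => /eqP; rewrite mulf_eq0 invr_eq0 (gt_eqF (den _)) orbF.
by rewrite sqrf_eq0 => /eqP.
Unshelve. all: by end_near. Qed.

End zero_gradient.

(** * Translations in time *)

Lemma measurable_slice2 d1 d2 d3 (T1 : measurableType d1) (T2 : measurableType d2)
    (T3 : measurableType d3) (f : T1 * T2 -> T3) (x : T1) :
  measurable_fun setT f -> measurable_fun setT (fun y => f (x, y)).
Proof.
move=> mf; apply: (measurableT_comp mf).
by apply: measurable_fun_pair => //; exact: measurable_cst.
Qed.

Section window.
Context {R : realType}.
Local Notation leb := (@lebesgue_measure R).
Local Notation RR := (measurableTypeR R).
Variables (a b : R).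
Hypothesis ab : a <= b.

(** The lengths of the time windows; the same sequence later drives the
    regularisation parameters to 0. *)
Definition dl (n : nat) : R := n.+1%:R^-1.

Lemma dl_gt0 n : 0 < dl n. Proof. by rewrite invr_gt0. Qed.

Lemma dl_le1 n : dl n <= 1.
Proof. by rewrite invf_le1// ler1n. Qed.

(** Indicator of the window of length dl n which ends at s, for s in [a, b]. *)
Definition W (n : nat) (t s : R) : R := ((a <= s <= b) && (s - dl n < t < s))%:R.

Lemma measurable_W d (T : measurableType d) n (t s : T -> R) :
  measurable_fun setT t -> measurable_fun setT s ->
  measurable_fun setT (fun z => W n (t z) (s z)).
Proof.
move=> mt ms; apply: (@measurableT_comp _ _ _ _ _ _ (fun b : bool => b%:R : R)) => //.
apply: measurable_and; apply: measurable_and.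
- exact: measurable_fun_ler.
- exact: measurable_fun_ler.
- by apply: measurable_fun_ltr => //; exact: measurable_funB.
- exact: measurable_fun_ltr.
Qed.

(** The integral over s in [a, b] of the mean of F(., s) over the window ending at s. *)
Definition U n (F : R -> R -> R) : \bar R :=
  (n.+1%:R%:E * \int[leb]_s \int[leb]_t (F t s * W n t s)%:E)%E.

Definition meas2 (F : R -> R -> R) := measurable_fun setT (fun z : RR * RR => F z.2 z.1).

Lemma meas2_slice F s : meas2 F -> measurable_fun setT (fun t : RR => F t s).
Proof. by move=> mF; exact: (@measurable_slice2 _ _ _ RR RR _ _ s mF). Qed.

Let mFW n F : meas2 F -> measurable_fun setT (fun z : RR * RR => F z.2 z.1 * W n z.2 z.1).
Proof.
by move=> mF; apply: measurable_funM => //; apply: measurable_W;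
  [exact: measurable_snd|exact: measurable_fst].
Qed.

Let inner_ge0 n F s : (forall t s, 0 <= F t s) ->
  (0 <= \int[leb]_t (F t s * W n t s)%:E)%E.
Proof. by move=> F0; apply: int_ge0 => // t _; rewrite mulr_ge0. Qed.

Lemma U_ge0 n F : (forall t s, 0 <= F t s) -> (0 <= U n F)%E.
Proof.
move=> F0; apply: mule_ge0; first by rewrite lee_fin.
by apply: integral_ge0 => s _; exact: inner_ge0.
Qed.

Lemma U_le n F G : (forall t s, 0 <= F t s) ->
  (forall t s, a <= s <= b -> s - dl n < t < s -> F t s <= G t s) ->
  (U n F <= U n G)%E.
Proof.
move=> F0 FG; apply: lee_wpmul2l; first by rewrite lee_fin.
have FGW t s : F t s * W n t s <= G t s * W n t s.
  rewrite /W; case: (boolP (_ && _)) => [/andP[h1 h2]|_]; last by rewrite !mulr0.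
  by rewrite !mulr1 FG.
apply: ge0_le_integral_ae => //.
- by move=> s _; exact: inner_ge0.
- move=> s _; apply: int_ge0 => // t _.
  by apply: le_trans (FGW t s); rewrite mulr_ge0.
- apply: nearW => s _; apply: int_le => // t _; by rewrite mulr_ge0.
Qed.

Lemma UD n F G : meas2 F -> meas2 G -> (forall t s, 0 <= F t s) ->
  (forall t s, 0 <= G t s) ->
  U n (fun t s => F t s + G t s) = (U n F + U n G)%E.
Proof.
move=> mF mG F0 G0; rewrite /U -ge0_muleDr; last 2 first.
- by apply: integral_ge0 => s _; exact: inner_ge0.
- by apply: integral_ge0 => s _; exact: inner_ge0.
congr (_ * _)%E.
have mI H : meas2 H -> (forall t s, 0 <= H t s) ->
    measurable_fun setT (fun s : RR => \int[leb]_t (H t s * W n t s)%:E)%E.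
  move=> mH H0.
  apply: (@measurable_fun_fubini_tonelli_F _ _ RR RR _ leb
    (fun z => (H z.2 z.1 * W n z.2 z.1)%:E)).
    by apply/measurable_EFinP; exact: mFW.
  by move=> z; rewrite lee_fin mulr_ge0.
rewrite -ge0_integralD//; last 4 first.
- by move=> s _; exact: inner_ge0.
- exact: mI.
- by move=> s _; exact: inner_ge0.
- exact: mI.
apply: eq_integral => s _.
rewrite -intD//; last 4 first.
- by apply: measurable_funM; [exact: meas2_slice|exact: measurable_W].
- by apply: measurable_funM; [exact: meas2_slice|exact: measurable_W].
- by move=> t _; rewrite mulr_ge0.
- by move=> t _; rewrite mulr_ge0.
by apply: eq_integral => t _; rewrite mulrDl.
Qed.

Let int_itv (c x : R) n : 0 <= c ->
  (\int[leb]_t (c * (x - dl n < t < x)%R%:R)%:E = (c * dl n)%:E)%E.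
Proof.
move=> c0.
transitivity (\int[leb]_t (c%:E * (\1_(`]x - dl n, x[%classic) t)%:E))%E.
  apply: eq_integral => t _; rewrite EFinM indicE; congr (_ * (_ %:R)%:E)%E.
  by rewrite mem_setE/= in_itv.
rewrite ge0_integralZl_EFin//; last exact/measurable_EFinP/measurable_indic.
rewrite integral_indic// setIT.
transitivity (c%:E * (dl n)%:E)%E; [congr (_ * _)%E|by rewrite -EFinM].
etransitivity; first exact: lebesgue_measure_itv.
rewrite /= -/(dl n) lte_fin ltrBlDr ltrDl dl_gt0 -EFinB.
by congr EFin; ring.
Qed.

Let ndl n : (n.+1%:R%:E * (dl n)%:E = 1 :> \bar R)%E.
Proof. by rewrite -EFinM divff. Qed.

Lemma U_arg2 n (u : R -> R) : measurable_fun setT u -> (forall s, 0 <= u s) ->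
  (U n (fun t s => u s) <= \int[leb]_s (u s)%:E)%E.
Proof.
move=> mu u0.
apply: (@le_trans _ _ (n.+1%:R%:E * \int[leb]_s (dl n * u s)%:E)%E).
  apply: lee_wpmul2l; first by rewrite lee_fin.
  apply: ge0_le_integral_ae => //.
  - by move=> s _; apply: int_ge0 => // t _; rewrite mulr_ge0.
  - by move=> s _; rewrite lee_fin mulr_ge0// ltW// dl_gt0.
  - apply: nearW => s _; rewrite mulrC -(int_itv s)//.
    apply: int_le => // t _; first by rewrite mulr_ge0.
    by rewrite ler_wpM2l// /W; case: (_ <= _ <= _).
rewrite intZ//; last exact/ltW/dl_gt0.
by rewrite muleA ndl mul1e.
Qed.

(** Tonelli: a time t belongs to the windows of the s in (t, t + dl n) only. *)
Lemma U_arg1 n (u : R -> R) : measurable_fun setT u -> (forall s, 0 <= u s) ->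
  (U n (fun t s => u t) <= \int[leb]_s (u s)%:E)%E.
Proof.
move=> mu u0; rewrite /U.
have m2 : meas2 (fun t s => u t) by exact: (measurableT_comp mu measurable_snd).
rewrite (@fubini_tonelli _ _ RR RR _ leb leb (fun z => (u z.2 * W n z.2 z.1)%:E))//=;
  last 2 first.
- by apply/measurable_EFinP; exact: (mFW n m2).
- by move=> z; rewrite lee_fin mulr_ge0.
apply: (@le_trans _ _ (n.+1%:R%:E * \int[leb]_s (dl n * u s)%:E)%E).
  apply: lee_wpmul2l; first by rewrite lee_fin.
  apply: ge0_le_integral_ae => //.
  - by move=> t _; apply: int_ge0 => // s _; rewrite mulr_ge0.
  - by move=> s _; rewrite lee_fin mulr_ge0// ltW// dl_gt0.
  - apply: nearW => t _; rewrite mulrC -(int_itv (t + dl n))//.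
    apply: int_le => // s _; first by rewrite mulr_ge0.
    rewrite ler_wpM2l// /W addrK; case: (_ <= _ <= _) => //=.
    by rewrite ltrBlDr andbC.
rewrite intZ//; last exact/ltW/dl_gt0.
by rewrite muleA ndl mul1e.
Qed.

Lemma U_cst n (c : R) : 0 <= c -> (U n (fun t s => c) <= (c * (b - a))%:E)%E.
Proof.
move=> c0.
have mu : measurable_fun setT (fun s : RR => c * \1_(`[a, b]%classic) s).
  by apply: measurable_funM => //; exact: measurable_indic.
have := U_arg2 n mu; rewrite (_ : \int[leb]_s (c * \1_(`[a, b]%classic) s)%:E = (c * (b - a))%:E)%E.
  move=> /(_ _) H; apply: le_trans (H _); last by move=> s; rewrite mulr_ge0.
  apply: U_le => // t s sab _.
  by rewrite indicE mem_set ?mulr1//= in_itv.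
rewrite intZ//.
rewrite integral_indic// setIT.
transitivity (c%:E * (b - a)%:E)%E; [congr (_ * _)%E|by rewrite -EFinM].
etransitivity; first exact: lebesgue_measure_itv.
rewrite /= lte_fin.
case: ifPn => [_|]; first by rewrite -EFinB.
by rewrite -leNgt => ba; rewrite (_ : b = a) ?subrr//; apply/eqP; rewrite eq_le ba ab.
Qed.

Lemma compact_unif (g : R -> R) (c d e : R) : continuous g -> 0 < e ->
  \forall n \near \oo, forall s, c <= s <= d -> forall t, `|t - s| <= dl n ->
    `|g t - g s| <= e.
Proof.
move=> cg e0.
have /compact_near_coveringP := @segment_compact R c d.
move=> /(_ nat \oo (fun n s => forall t, `|t - s| <= dl n -> `|g t - g s| <= e) _) H.
suff HP : forall x : R, `[c, d]%classic x -> \forall x' \near x & i \near \oo,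
    forall t : R, `|t - x'| <= dl i -> `|g t - g x'| <= e.
  by apply: filterS (H HP) => n Hn s scd t; apply: Hn; rewrite /= in_itv.
move=> x _.
have /cvgrPdist_le/(_ (e / 2)) : g @ x --> g x by exact: cg.
rewrite divr_gt0// => /(_ isT)/nbhs_ballP[r /= r0 hr].
have r2 : 0 < r / 2 by rewrite divr_gt0.
exists (ball x (r / 2), [set n | dl n <= r / 2 / 2]).
  split; first exact: nbhsx_ballx.
  have := @near_infty_natSinv_lt R (PosNum (divr_gt0 r2 (ltr0Sn R 1))).
  by apply: filterS => n /= /ltW.
move=> [s n] [/= xs dn] t ts.
have tx : ball x r t.
  rewrite /ball/= (_ : x - t = (x - s) + (s - t)); last by ring.
  apply: le_lt_trans (ler_normD _ _) _; rewrite (splitr r); apply: ltr_leD; first exact: xs.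
  rewrite distrC (le_trans ts)// (le_trans dn)// ler_pdivrMr// ler_peMr// ?ler1n//.
  exact: ltW.
have sx : ball x r s.
  by apply: lt_le_trans xs _; rewrite ler_pdivrMr// ler_peMr ?ltW// ltr1n.
rewrite (_ : g t - g s = (g x - g s) - (g x - g t)); last by ring.
apply: le_trans (ler_normB _ _) _; rewrite (splitr e).
by apply: lerD; apply: hr.
Qed.

(** f is approximated in L^1 on a neighbourhood of [a, b] by a continuous function g,
    which is uniformly continuous there; f - g only enters through [U_arg1] and
    [U_arg2]. *)
Lemma U_cvg0 (f : R -> R) : measurable_fun setT f ->
  (\int[leb]_t `|f t|%:E < +oo)%E ->
  (fun n => U n (fun t s => `|f t - f s|)) @ \oo --> 0%E.
Proof.
move=> mf fi.
pose K := `[a - 1, b + 1]%classic : set R.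
have mK : measurable K by exact: measurable_itv.
have Koo : (leb K < +oo)%E.
  by rewrite /K lebesgue_measure_itv/=; case: ifP => // _; rewrite -EFinB ltry.
have iK : leb.-integrable K (EFin \o f).
  by apply: (@integrableS _ _ _ leb setT K) => //; exact: integrable_real.
have [g_ [cg_ ig_ hg_]] := approximation_continuous_integrable mK Koo iK.
apply/cvge0P; first by move=> n; exact: U_ge0.
move=> e e0.
pose eta := e / (2 + (b - a)).
have D0 : 0 < 2 + (b - a) by rewrite ltr_wpDr// subr_ge0.
have eta0 : 0 < eta by rewrite divr_gt0.
have [m Hm] : exists m, (\int[leb]_(z in K) `|(f z - g_ m z)%:E| <= eta%:E)%E.
  have : \forall n \near \oo, (\int[leb]_(z in K) `|(f z - g_ n z)%:E| <= eta%:E)%E.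
    by apply: (proj1 (cvge0P _) hg_) => // n; exact: integral_ge0.
  by move=> [m _ H]; exists m; apply: H => /=.
pose g := g_ m; have cg : continuous g by exact: cg_.
have mg : measurable_fun setT g by exact: continuous_measurable_fun.
pose u t := `|f t - g t| * \1_K t.
have mu : measurable_fun setT u.
  apply: measurable_funM; last exact: measurable_indic.
  by apply: measurable_abs; exact: measurable_funB.
have u0 t : 0 <= u t by rewrite mulr_ge0.
have ui : (\int[leb]_t (u t)%:E <= eta%:E)%E.
  apply: le_trans Hm; rewrite [leRHS]integral_mkcond le_eqVlt; apply/orP; left; apply/eqP.
  apply: eq_integral => t _; rewrite /u patchE indicE.
  by case: ifPn => _; rewrite ?mulr1 ?mulr0.
near=> n.
apply: (@le_trans _ _ (U n (fun t s => (u t + u s) + eta))).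
  apply: U_le => // t s /andP[s1 s2] /andP[t1 t2].
  have d1 := dl_le1 n.
  have Kt : K t by rewrite /K/= in_itv/=; apply/andP; split; lra.
  have Ks : K s by rewrite /K/= in_itv/=; apply/andP; split; lra.
  rewrite /u !indicE !mem_set// !mulr1.
  rewrite (_ : f t - f s = (f t - g t) - (f s - g s) + (g t - g s)); last by ring.
  apply: le_trans (ler_normD _ _) _; apply: lerD; first exact: ler_normB.
  suff : forall s, a - 1 <= s <= b + 1 -> forall t, `|t - s| <= dl n -> `|g t - g s| <= eta.
    apply; first by move: Ks; rewrite /K/= in_itv.
    by rewrite distrC gtr0_norm ?subr_gt0// lerBlDl -lerBlDr ltW.
  by near: n; exact: compact_unif.
rewrite UD//; last 4 first.
- apply: measurable_funD; first exact: (measurableT_comp mu measurable_snd).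
  exact: (measurableT_comp mu measurable_fst).
- exact: measurable_cst.
- by move=> t s; rewrite addr_ge0.
- by move=> t s; exact: ltW.
rewrite UD//; last 2 first.
- exact: (measurableT_comp mu measurable_snd).
- exact: (measurableT_comp mu measurable_fst).
have -> : e%:E = (eta%:E + eta%:E + (eta * (b - a))%:E)%E.
  rewrite -!EFinD; congr EFin; rewrite /eta; field; exact: lt0r_neq0.
apply: leeD; last by apply: U_cst; exact: ltW.
apply: leeD; first exact: le_trans (U_arg1 n mu u0) ui.
exact: le_trans (U_arg2 n mu u0) ui.
Unshelve. all: by end_near. Qed.

Section product.
Context d {X : measurableType d}.
Variable m1 : {sigma_finite_measure set X -> \bar R}.
Local Notation m := (m1 \x leb)%E.

(** The same average for functions of a further variable x. The integral over (x, t)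
    is kept as a single integral since the slice inequalities are integrals over
    space and time; [V_Fubini] moves the integral over x outside. *)
Definition V n (k : X -> R -> R -> R) : \bar R :=
  (n.+1%:R%:E * \int[leb]_s \int[m]_z (k z.1 z.2 s * W n z.2 s)%:E)%E.

Definition meas3 (k : X -> R -> R -> R) :=
  measurable_fun setT (fun w : (X * RR) * RR => k w.1.1 w.2 w.1.2).

Lemma meas3_slice k s : meas3 k -> measurable_fun setT (fun z : X * RR => k z.1 z.2 s).
Proof.
move=> mk.
have m : measurable_fun setT (fun z : X * RR => ((z.1, s), z.2) : (X * RR) * RR).
  apply: measurable_fun_pair; last exact: measurable_snd.
  by apply: measurable_fun_pair; first exact: measurable_fst.
exact: (measurableT_comp mk m).
Qed.

Lemma meas3_meas2 k x : meas3 k -> meas2 (k x).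
Proof.
move=> mk.
have m : measurable_fun setT (fun z : RR * RR => ((x, z.1), z.2) : (X * RR) * RR).
  apply: measurable_fun_pair; last exact: measurable_snd.
  by apply: measurable_fun_pair; last exact: measurable_fst.
exact: (measurableT_comp mk m).
Qed.

Let mkW n k : meas3 k -> measurable_fun setT
  (fun w : (X * RR) * RR => k w.1.1 w.2 w.1.2 * W n w.2 w.1.2).
Proof.
move=> mk; apply: measurable_funM => //; apply: measurable_W; first exact: measurable_snd.
exact: (measurableT_comp measurable_snd measurable_fst).
Qed.

Let mK n k : meas3 k -> (forall x t s, 0 <= k x t s) ->
  measurable_fun setT (fun z : X * RR => \int[leb]_t (k z.1 t z.2 * W n t z.2)%:E)%E.
Proof.
move=> mk k0.
apply: (@measurable_fun_fubini_tonelli_F _ _ (X * RR)%type RR _ leb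
    (fun w => (k w.1.1 w.2 w.1.2 * W n w.2 w.1.2)%:E)).
  by apply/measurable_EFinP; exact: mkW.
by move=> w; rewrite lee_fin mulr_ge0.
Qed.

Lemma measurable_U n k : meas3 k -> (forall x t s, 0 <= k x t s) ->
  measurable_fun setT (fun x => U n (k x)).
Proof.
move=> mk k0; apply: measurable_funeM.
apply: (@measurable_fun_fubini_tonelli_F _ _ X RR _ leb _ (mK n mk k0)).
by move=> z; apply: int_ge0 => // t _; rewrite mulr_ge0.
Qed.

Lemma V_Fubini n k : meas3 k -> (forall x t s, 0 <= k x t s) ->
  V n k = (\int[m1]_x U n (k x))%E.
Proof.
move=> mk k0.
have K0 (z : X * RR) : (0 <= \int[leb]_t (k z.1 t z.2 * W n t z.2)%:E)%E.
  by apply: int_ge0 => // t _; rewrite mulr_ge0.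
rewrite /U ge0_integralZl_EFin//; last 2 first.
- by move=> x _; apply: integral_ge0 => s _; exact: (K0 (x, s)).
- by apply: (@measurable_fun_fubini_tonelli_F _ _ X RR _ leb _ (mK n mk k0)).
congr (_ * _)%E.
rewrite (@fubini_tonelli _ _ X RR _ m1 leb _ (mK n mk k0) K0)/=.
apply: eq_integral => s _.
rewrite (@fubini_tonelli1 _ _ X RR _ m1 leb (fun z => (k z.1 z.2 s * W n z.2 s)%:E))//.
- apply/measurable_EFinP; apply: measurable_funM; first exact: meas3_slice.
  by apply: measurable_W => //; exact: measurable_snd.
- by move=> z; rewrite lee_fin mulr_ge0.
Qed.

Lemma V_ge0 n k : (forall x t s, 0 <= k x t s) -> (0 <= V n k)%E.
Proof.
move=> k0; apply: mule_ge0; first by rewrite lee_fin.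
by apply: integral_ge0 => s _; apply: int_ge0 => // z _; rewrite mulr_ge0.
Qed.

Lemma V_le n k l : (forall x t s, 0 <= k x t s) ->
  (forall x t s, a <= s <= b -> s - dl n < t < s -> k x t s <= l x t s) ->
  (V n k <= V n l)%E.
Proof.
move=> k0 kl; apply: lee_wpmul2l; first by rewrite lee_fin.
have klW x t s : k x t s * W n t s <= l x t s * W n t s.
  rewrite /W; case: (boolP (_ && _)) => [/andP[h1 h2]|_]; last by rewrite !mulr0.
  by rewrite !mulr1 kl.
apply: ge0_le_integral_ae => //.
- by move=> s _; apply: int_ge0 => // z _; rewrite mulr_ge0.
- move=> s _; apply: int_ge0 => // z _.
  by apply: le_trans (klW z.1 z.2 s); rewrite mulr_ge0.
- by apply: nearW => s _; apply: int_le => // z _; rewrite mulr_ge0.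
Qed.

Lemma VD n k l : meas3 k -> meas3 l -> (forall x t s, 0 <= k x t s) ->
  (forall x t s, 0 <= l x t s) ->
  V n (fun x t s => k x t s + l x t s) = (V n k + V n l)%E.
Proof.
move=> mk ml k0 l0; rewrite !V_Fubini//; last 2 first.
- exact: measurable_funD.
- by move=> x t s; rewrite addr_ge0.
rewrite -ge0_integralD//; last 4 first.
- by move=> x _; exact: U_ge0.
- exact: measurable_U.
- by move=> x _; exact: U_ge0.
- exact: measurable_U.
by apply: eq_integral => x _; rewrite UD//; exact: meas3_meas2.
Qed.

Lemma VZ n (c : R) k : 0 <= c -> meas3 k -> (forall x t s, 0 <= k x t s) ->
  V n (fun x t s => c * k x t s) = (c%:E * V n k)%E.
Proof.
move=> c0 mk k0; rewrite /V muleCA; congr (_ * _)%E.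
have msW s : measurable_fun setT (fun z : X * RR => k z.1 z.2 s * W n z.2 s).
  apply: measurable_funM; first exact: meas3_slice.
  by apply: measurable_W => //; exact: measurable_snd.
rewrite -ge0_integralZl_EFin//; last 2 first.
- by move=> s _; apply: int_ge0 => // z _; rewrite mulr_ge0.
- have := mK n mk k0.
  have mG := @measurable_fun_fubini_tonelli_G _ _ X RR _ m1
    (fun z => \int[leb]_t (k z.1 t z.2 * W n t z.2)%:E)%E (mK n mk k0) _.
  move=> _; apply: (eq_measurable_fun _ _ (mG _)); last first.
    by move=> z; apply: int_ge0 => // t _; rewrite mulr_ge0.
  move=> s _; rewrite /fubini_G.
  rewrite (@fubini_tonelli1 _ _ X RR _ m1 leb (fun z => (k z.1 z.2 s * W n z.2 s)%:E))//.
    exact/measurable_EFinP.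
  by move=> z; rewrite lee_fin mulr_ge0.
apply: eq_integral => s _; rewrite -intZ//; last by move=> z _; rewrite mulr_ge0.
by apply: eq_integral => z _; rewrite mulrA.
Qed.

Variable f : X * RR -> R.
Hypothesis mf : measurable_fun setT f.

Lemma V_arg1 n : (forall z, 0 <= f z) ->
  (V n (fun x t s => f (x, t)) <= \int[m]_z (f z)%:E)%E.
Proof.
move=> f0; rewrite V_Fubini//; last first.
  have mm : measurable_fun setT (fun w : (X * RR) * RR => (w.1.1, w.2)).
    apply: measurable_fun_pair; last exact: measurable_snd.
    exact: (measurableT_comp measurable_fst measurable_fst).
  exact: (measurableT_comp mf mm).
rewrite (@fubini_tonelli1 _ _ X RR _ m1 leb (EFin \o f))//; last first.
  exact/measurable_EFinP.
apply: ge0_le_integral_ae => //.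
- by move=> x _; exact: U_ge0.
- by move=> x _; apply: integral_ge0 => t _; rewrite lee_fin.
- apply: nearW => x _; apply: (@U_arg1 n (fun t => f (x, t))) => //.
  exact: (@measurable_slice2 _ _ _ X RR _ _ x mf).
Qed.

Lemma V_arg2 n : (forall z, 0 <= f z) ->
  (V n (fun x t s => f (x, s)) <= \int[m]_z (f z)%:E)%E.
Proof.
move=> f0; rewrite V_Fubini//; last first.
  have mm : measurable_fun setT (fun w : (X * RR) * RR => (w.1.1, w.1.2)).
    by apply: measurable_fun_pair; apply: measurableT_comp.
  exact: (measurableT_comp mf mm).
rewrite (@fubini_tonelli1 _ _ X RR _ m1 leb (EFin \o f))//; last first.
  exact/measurable_EFinP.
apply: ge0_le_integral_ae => //.
- by move=> x _; exact: U_ge0.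
- by move=> x _; apply: integral_ge0 => t _; rewrite lee_fin.
- apply: nearW => x _; apply: (@U_arg2 n (fun t => f (x, t))) => //.
  exact: (@measurable_slice2 _ _ _ X RR _ _ x mf).
Qed.

Lemma meas3_diff : meas3 (fun x t s => `|f (x, t) - f (x, s)|).
Proof.
apply: measurable_abs; apply: measurable_funB; last first.
  have mm : measurable_fun setT (fun w : (X * RR) * RR => (w.1.1, w.1.2)).
    by apply: measurable_fun_pair; apply: measurableT_comp.
  exact: (measurableT_comp mf mm).
have mm : measurable_fun setT (fun w : (X * RR) * RR => (w.1.1, w.2)).
  apply: measurable_fun_pair; last exact: measurable_snd.
  exact: (measurableT_comp measurable_fst measurable_fst).
exact: (measurableT_comp mf mm).
Qed.

(** Dominated convergence in x, from [U_cvg0] in each line. *)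
Lemma V_cvg0 : (\int[m]_z `|f z|%:E < +oo)%E ->
  (fun n => V n (fun x t s => `|f (x, t) - f (x, s)|)) @ \oo --> 0%E.
Proof.
move=> fi.
have mfx x : measurable_fun setT (fun t : RR => f (x, t)).
  exact: (@measurable_slice2 _ _ _ X RR _ _ x mf).
have maf : measurable_fun setT (fun z => `|f z|) by exact: measurable_abs.
have mI : measurable_fun setT (fun x => \int[leb]_t `|f (x, t)|%:E)%E.
  apply: (@measurable_fun_fubini_tonelli_F _ _ X RR _ leb (fun z => `|f z|%:E)).
    exact/measurable_EFinP.
  by move=> z; rewrite lee_fin.
have fi' : (\int[m1]_x \int[leb]_t `|f (x, t)|%:E < +oo)%E.
  rewrite -(@fubini_tonelli1 _ _ X RR _ m1 leb (fun z => `|f z|%:E))//.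
  exact/measurable_EFinP.
pose G x := (2%:E * \int[leb]_t `|f (x, t)|%:E)%E.
have iI : m1.-integrable setT (fun x => \int[leb]_t `|f (x, t)|%:E)%E.
  apply/integrableP; split => //.
  by under eq_integral do rewrite gee0_abs ?int_ge0//.
have iG : m1.-integrable setT G by exact: integrableZl.
have ae_fin : {ae m1, forall x, (\int[leb]_t `|f (x, t)|%:E < +oo)%E}.
  have := integrable_ae measurableT iI; apply: filterS => x /(_ I).
  by rewrite ge0_fin_numE// int_ge0.
have c0 : {ae m1, forall x, setT x ->
    (fun n => U n (fun t s => `|f (x, t) - f (x, s)|)) @ \oo --> cst 0%E x}.
  by apply: filterS ae_fin => x fx _; exact: (@U_cvg0 (fun t => f (x, t)) (mfx x) fx).
have dom : {ae m1, forall (x : X) (n : nat), setT x -> (`|U n (fun t s => `|f (x, t) - f (x, s)|%R)| <= G x)%E}.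
  apply: nearW => x n _; rewrite gee0_abs; last exact: U_ge0.
  have max : measurable_fun setT (fun t : RR => `|f (x, t)|) by exact: measurable_abs.
  apply: (@le_trans _ _ (U n (fun t s => `|f (x, t)| + `|f (x, s)|))).
    by apply: U_le => // t s _ _; exact: ler_normB.
  rewrite UD//; last 2 first.
  - exact: (measurableT_comp max measurable_snd).
  - exact: (measurableT_comp max measurable_fst).
  rewrite /G -[2]/(1 + 1) EFinD ge0_muleDl// mul1e.
  by apply: leeD; [exact: (U_arg1 n max)|exact: (U_arg2 n max)].
have := @dominated_convergence _ _ _ m1 _ measurableT
  (fun n x => U n (fun t s => `|f (x, t) - f (x, s)|)) (cst 0%E) G
  (fun n => @measurable_U n (fun x t s => `|f (x, t) - f (x, s)|) meas3_diff _)
  (measurable_cst _) c0 iG dom.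
case=> [x t s //|_ _]; rewrite integral0.
by under eq_fun do rewrite -(V_Fubini _ meas3_diff)//.
Qed.

End product.

End window.

(** * Caratheodory functions *)

Lemma powR_norm_continuous {R : realType} (p : R) : 0 < p ->
  continuous (fun y : R => `|y| `^ p).
Proof.
move=> p0 y; have [->|y0] := eqVneq y 0.
  rewrite /continuous_at normr0 powR0 ?gt_eqF//.
  apply/cvgrPdist_le => e e0.
  have d0 : 0 < e `^ p^-1 by rewrite powR_gt0.
  apply/nbhs_ballP; exists (e `^ p^-1) => // t; rewrite /ball/= sub0r normrN => te.
  rewrite sub0r normrN ger0_norm ?powR_ge0//.
  have -> : e = (e `^ p^-1) `^ p by rewrite -powRrM mulVf ?gt_eqF// powRr1// ltW.
  by apply: le_powR => //; exact: ltW.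
have ny0 : 0 < `|y| by rewrite normr_gt0.
have H : \forall t \near y, expR (p * ln `|t|) = `|t| `^ p.
  have cn : {for y, continuous (fun t : R => `|t|)} by exact: norm_continuous.
  have := cn [set t | 0 < t] (lt_nbhsr ny0); rewrite nbhs_simpl/=.
  by apply: filterS => t /= t0; rewrite /powR gt_eqF.
rewrite /continuous_at -(nbhs_singleton H).
apply: cvg_trans; first exact: (near_eq_cvg H).
apply: (@continuous_comp _ _ _ (fun t : R => p * ln `|t|) expR); last exact: continuous_expR.
rewrite /continuous_at; apply: cvgM; first exact: cvg_cst.
apply: (@continuous_comp _ _ _ (fun t : R => `|t|) (@ln R)); first exact: norm_continuous.
exact: continuous_ln.
Qed.

Section dyadic.
Context {R : realType} {N : nat}.
Local Notation E := 'rV[R]_N.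
Local Notation Idx := (nat * int * {ffun 'I_N -> int})%type.

(** The grid point of mesh 1 / (n + 1) coded by an index; the indices are countable. *)
Definition gval (i : Idx) : R * E :=
  (i.1.2%:~R / i.1.1.+1%:R, \row_j ((i.2 j)%:~R / i.1.1.+1%:R)).

Definition gidx (n : nat) (w : R * E) : Idx :=
  (n, Num.floor (n.+1%:R * w.1), [ffun j => Num.floor (n.+1%:R * w.2 ord0 j)]).

Lemma floor_approx n (y : R) : `|y - (Num.floor (n.+1%:R * y))%:~R / n.+1%:R| <= n.+1%:R^-1.
Proof.
have n0 : 0 < n.+1%:R :> R by [].
have /andP[] := floor_itv (n.+1%:R * y); rewrite rmorphD/= mulrC.
set k := (Num.floor _)%:~R => f1 f2.
rewrite ger0_norm; last by rewrite subr_ge0 ler_pdivrMr.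
rewrite lerBlDr -[X in X + _]mul1r -mulrDl ler_pdivlMr// ltW//.
by rewrite addrC.
Qed.

Lemma gval_cvg (w : R * E) : (fun n => gval (gidx n w)) @ \oo --> w.
Proof.
apply/cvg_ballP => e e0.
have [m /= _ Hm] := @near_infty_natSinv_lt R (PosNum e0).
exists m => // n /= mn.
have ne : n.+1%:R^-1 < e by exact: Hm.
split => /=; first by apply: le_lt_trans ne; exact: floor_approx.
split => // i j; rewrite !mxE ord1 ffunE.
by apply: le_lt_trans ne; exact: floor_approx.
Qed.

Section transfer.
Context d {T : measurableType d}.
Variables (mu : {measure set T -> \bar R}) (D : set T).

(** The order of the quantifiers is exchanged for the countably many grid points,
    and continuity extends the inequality to all points. *)
Lemma ae_le_all (f1 f2 : T -> R * E -> R) :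
  {ae mu, forall z, D z -> continuous (f1 z)} ->
  {ae mu, forall z, D z -> continuous (f2 z)} ->
  (forall w, {ae mu, forall z, D z -> f1 z w <= f2 z w}) ->
  {ae mu, forall z, D z -> forall w, f1 z w <= f2 z w}.
Proof.
move=> c1 c2 H.
have : {ae mu, forall z, forall i : Idx, D z -> f1 z (gval i) <= f2 z (gval i)}.
  by apply: ae_countable => i; exact: H.
apply: filterS3 c1 c2 => z c1 c2 Hz Dz w.
have g1 : (fun n => f1 z (gval (gidx n w))) @ \oo --> f1 z w.
  apply: (@continuous_cvg _ _ _ _ _ (fun n => gval (gidx n w)) (f1 z) w); first exact: c1.
  exact: gval_cvg.
have g2 : (fun n => f2 z (gval (gidx n w))) @ \oo --> f2 z w.
  apply: (@continuous_cvg _ _ _ _ _ (fun n => gval (gidx n w)) (f2 z) w); first exact: c2.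
  exact: gval_cvg.
by apply: (ler_cvg_to g1 g2); apply: nearW => n; exact: Hz.
Qed.

(** F is evaluated at the grid point of mesh 1 / (n + 1) next to (u, v), which takes
    countably many values, and n tends to infinity. *)
Lemma superposition_cmeasurable (F : T -> R * E -> R) (Q : set T)
    (u : T -> R) (v : T -> E) :
  measurable D -> measurable Q -> Q `<=` D ->
  (forall w, cmeasurable mu D (fun z => F z w)) ->
  {ae mu, forall z, D z -> continuous (F z)} ->
  measurable_fun setT u -> (forall j, measurable_fun setT (fun z => v z ord0 j)) ->
  cmeasurable mu Q (fun z => F z (u z, v z)).
Proof.
move=> mD mQ QD cF contF mu_ mv.
pose w z := (u z, v z).
pose f n z := F z (gval (gidx n (w z))).
have cf n : cmeasurable mu Q (f n).
  pose S (i : Idx) : set T := Q `&` [set z | gidx n (w z) = i].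
  have mS i : measurable (S i).
    apply: measurableI => //.
    have mfl (h : T -> R) (k : int) : measurable_fun setT h ->
        measurable [set z | Num.floor (n.+1%:R * h z) = k].
      move=> mh.
      rewrite (_ : [set z | _] = (fun z => n.+1%:R * h z) @^-1` `[k%:~R, (k + 1)%:~R[%classic).
        rewrite -[X in measurable X]setTI.
        have mnh : measurable_fun setT (fun z => n.+1%:R * h z) by exact: measurable_funM.
        by apply: mnh => //; exact: measurable_itv.
      apply/seteqP; split => z /=; rewrite in_itv/=; first by move=> <-; exact: floor_itv.
      by move=> hz; exact: floor_def.
    case: i => [[n' k] kk].
    have [->|nn] := eqVneq n' n; last first.
      rewrite (_ : [set z | _] = set0)//; apply/seteqP; split => z //=.
      by rewrite /gidx => -[nn']; move: nn; rewrite nn' eqxx.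
    rewrite (_ : [set z | _] = [set z | Num.floor (n.+1%:R * u z) = k] `&`
        \bigcap_(j in [set: 'I_N]) [set z | Num.floor (n.+1%:R * v z ord0 j) = kk j]).
      apply: measurableI; first exact: mfl.
      by apply: fin_bigcap_measurable => // j _; exact: mfl.
    apply/seteqP; split => z /=.
      rewrite /gidx => -[<- <-]; split => // j _ /=.
      by rewrite ffunE.
    move=> [h1 h2]; rewrite /gidx /= h1; congr (_, _, _).
    by apply/ffunP => j; rewrite ffunE; exact: (h2 j I).
  pose G m := if unpickle m is Some i then S i else set0.
  have -> : Q = \bigcup_m G m.
    apply/seteqP; split => [z Qz|z [m _]].
      by exists (pickle (gidx n (w z))) => //; rewrite /G pickleK.
    by rewrite /G; case: unpickle => // i [].
  apply: cmeasurable_bigcup.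
    by move=> m; rewrite /G; case: unpickle => // i; exact: mS.
  move=> m; rewrite /G; case: unpickle => [i|]; last first.
    by exists (cst 0) => //; exact: nearW.
  have [h mh hE] := cF (gval i).
  exists h; first by apply: measurable_funS mh => // z [/QD].
  by apply: filterS hE => z hE [Qz /= gz]; rewrite /f gz hE//; exact: QD.
have /choice[h hP] n : exists h : T -> R, measurable_fun setT h /\
    {ae mu, forall z, Q z -> f n z = h z}.
  by have [h [? _ ?]] := cmeasurable_rep mQ (cf n); exists h.
exists (fun z => fine (limn_esup (fun n => (h n z)%:E))).
  apply: (@measurable_funS _ _ _ _ setT) => //.
  apply: (@measurableT_comp _ _ _ _ _ _ (@fine R) setT (fun z => limn_esup (fun n => (h n z)%:E))) => //.
  apply: measurable_fun_limn_esup => n; apply/measurable_EFinP; case: (hP n) => //.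
have hae : {ae mu, forall z, forall n, Q z -> f n z = h n z}.
  by apply: ae_foralln => n; case: (hP n).
apply: filterS2 contF hae => z cz hz Qz.
have lim : (fun n => (h n z)%:E) @ \oo --> (F z (w z))%:E.
  apply: cvg_EFin; first exact: nearW.
  rewrite (_ : fine \o _ = (fun n => f n z)); last first.
    by apply/funext => n /=; rewrite hz.
  apply: (@continuous_cvg _ _ _ _ _ (fun n => gval (gidx n (w z))) (F z) (w z)).
    exact: cz (QD _ Qz) (w z).
  exact: gval_cvg.
by have [_ ->] := cvg_limn_einf_sup lim.
Qed.

End transfer.

End dyadic.

(** * Evolution equations integrated between two times *)

Section time_line.
Context {R : realType}.
Local Notation leb := (@lebesgue_measure R).

Lemma leb_aeS (P Q : R -> Prop) : (forall t, P t -> Q t) ->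
  {ae leb, forall t, P t} -> {ae leb, forall t, Q t}.
Proof.
move=> PQ HP.
exact: (@filterS _ (almost_everywhere leb) (ae_filter_ringOfSetsType _) _ _ PQ HP).
Qed.

Lemma leb_aeI (P Q : R -> Prop) : {ae leb, forall t, P t} -> {ae leb, forall t, Q t} ->
  {ae leb, forall t, P t /\ Q t}.
Proof.
move=> HP HQ.
exact: (@filterI _ (almost_everywhere leb) (ae_filter_ringOfSetsType _) _ _ HP HQ).
Qed.

Lemma near_itvoo (a b x : R) : a < x < b -> \forall t \near x, a < t < b.
Proof.
move=> /andP[ax xb].
have H1 : \forall t \near x, a < t by exact: lt_nbhsr.
have H2 : \forall t \near x, t < b by exact: lt_nbhsl.
by apply: filterS2 H1 H2 => t -> ->.
Qed.

Lemma integrable_bounded_supp d (T : measurableType d) (mu : {measure set T -> \bar R})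
    (D : set T) (f : T -> R) (M : R) : measurable D -> (mu D < +oo)%E ->
  measurable_fun setT f -> (forall z, ~ D z -> f z = 0) -> (forall z, `|f z| <= M) ->
  mu.-integrable setT (EFin \o f).
Proof.
move=> mD Doo mf f0 fM.
have -> : EFin \o f = (EFin \o f) \_ D.
  apply/funext => x; rewrite patchE; case: ifPn => //; rewrite notin_setE => nO.
  by rewrite /= f0.
apply/(integrable_mkcond _ mD); apply: measurable_bounded_integrable => //.
  exact: measurable_funS mf.
by exists M; split; [exact: num_real|] => y yB x _ /=; rewrite (le_trans (fM x))// ltW.
Qed.

Lemma leb_itvoo_lty (a b : R) : (leb `]a, b[%classic < +oo)%E.
Proof.
have -> : leb `]a, b[%classic = (if (a%:E < b%:E)%E then (b%:E - a%:E)%E else 0%E).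
  exact: lebesgue_measure_itv.
by case: ifP => // _; rewrite -EFinB ltry.
Qed.

End time_line.

Section ramp.
Context {R : realType}.
Local Notation leb := (@lebesgue_measure R).
Local Notation RR := (measurableTypeR R).

Lemma is_derive_ramp (a r t : R) : r != 0 ->
  is_derive t 1 (fun t => step ((t - a) / r)) (r^-1 * dstep ((t - a) / r)).
Proof.
move=> r0.
have d0 : is_derive t 1 (fun u : R => u - a) 1.
  have := is_deriveB (is_derive_id t 1) (is_derive_cst a t 1).
  by rewrite subr0.
have d1 : is_derive t 1 (fun u : R => (u - a) / r) r^-1.
  have h := is_deriveM d0 (is_derive_cst (r^-1) t 1).
  apply: (is_derive_eq (h : is_derive t 1 (fun u : R => (u - a) / r) _)).
  by rewrite scaler0 add0r /GRing.scale/= mulr1.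
have := is_derive_comp d1 (is_derive_step ((t - a) / r)).
by rewrite mulrC.
Qed.

Lemma continuous_ramp (a r : R) : continuous (fun t : R => r^-1 * dstep ((t - a) / r)).
Proof.
move=> t; rewrite /continuous_at; apply: cvgM; first exact: cvg_cst.
apply: (@continuous_comp _ _ _ (fun t : R => (t - a) / r) dstep); last exact: dstep_continuous.
rewrite /continuous_at; apply: cvgM; last exact: cvg_cst.
by apply: cvgB; [exact: cvg_id|exact: cvg_cst].
Qed.

Lemma ramp_out (a r t : R) : 0 < r -> ~ (a <= t <= a + r) -> dstep ((t - a) / r) = 0.
Proof.
move=> r0 /negP; rewrite negb_and -!ltNge => /orP tn; apply: dstep0.
case: tn => tn; [left|right].
  by rewrite ltr_pdivrMr// mul0r subr_lt0.
by rewrite ltr_pdivlMr// mul1r ltrBrDl.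
Qed.

(** The functions dstep ((t - a_n) / r_n) / r_n are an approximate identity. *)
Lemma ramp_cvg (e : R -> R) (sg B : R) (a_ r_ : nat -> R) :
  measurable_fun setT e -> (forall t, `|e t| <= B) ->
  e @ sg --> e sg -> (forall n, 0 < r_ n) -> r_ @ \oo --> 0 ->
  (forall n, a_ n <= sg <= a_ n + r_ n) ->
  (fun n => \int[leb]_t (e t * ((r_ n)^-1 * dstep ((t - a_ n) / r_ n)))) @ \oo --> e sg.
Proof.
move=> me eB ce r0 rc ar.
have [C C0 HC] := @dstep_bounded R.
pose I n := `[a_ n, a_ n + r_ n]%classic : set RR.
have mI n : measurable (I n) by exact: measurable_itv.
have lI n : leb (I n) = (r_ n)%:E.
  etransitivity; first exact: lebesgue_measure_itv.
  by rewrite /= lte_fin ltrDl r0 -EFinB addrAC subrr add0r.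
have Ioo n : (leb (I n) < +oo)%E by rewrite lI ltry.
pose k n t := (r_ n)^-1 * dstep ((t - a_ n) / r_ n).
have mk n : @measurable_fun _ _ RR R setT (k n).
  by apply: continuous_measurable_fun; exact: continuous_ramp.
have meR : @measurable_fun _ _ RR R setT e by [].
have kB n t : `|k n t| <= C / r_ n.
  rewrite /k normrM (ger0_norm (_ : 0 <= (r_ n)^-1)) ?invr_ge0 ?(ltW (r0 n))// mulrC.
  by rewrite ler_wpM2r ?invr_ge0 ?(ltW (r0 n)).
have ik n : leb.-integrable (I n) (EFin \o k n).
  apply: measurable_bounded_integrable; [exact: mI|exact: Ioo| |].
    exact: (@measurable_funS _ _ RR R setT (I n) (k n) measurableT (@subsetT _ _) (mk n)).
  by exists (C / r_ n); split; [exact: num_real|] => y Cy t _ /=; rewrite (le_trans (kB n t))// ltW.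
have iek n : leb.-integrable (I n) (EFin \o (fun t => e t * k n t)).
  apply: measurable_bounded_integrable; [exact: mI|exact: Ioo| |].
    exact: (@measurable_funS _ _ RR R setT (I n) _ measurableT (@subsetT _ _) (measurable_funM meR (mk n))).
  exists (B * (C / r_ n)); split; [exact: num_real|] => y Cy t _ /=.
  rewrite normrM; apply: le_trans (ltW Cy).
  by apply: ler_pM.
have E1 n : \int[leb]_t (e t * k n t) = \int[leb]_(t in I n) (e t * k n t).
  rewrite [RHS]Rintegral_mkcond; apply: eq_Rintegral => t _; rewrite patchE.
  case: ifPn => //; rewrite notin_setE /I/= in_itv/= => nI.
  by rewrite /k ramp_out ?mulr0.
have E2 n : \int[leb]_(t in I n) (e sg * k n t) = e sg.
  rewrite RintegralZl// (_ : \int[leb]_(t in I n) k n t = 1) ?mulr1//.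
  have d n' : forall x : R, is_derive x 1 (fun t : R => step ((t - a_ n') / r_ n')) (k n' x).
    by move=> t; apply: is_derive_ramp; rewrite gt_eqF.
  have an : a_ n <= a_ n + r_ n by rewrite lerDl ltW.
  have H := FTC2 an (d n) (@continuous_ramp (a_ n) (r_ n)).
  rewrite /Rintegral; etransitivity; first exact: (congr1 fine H).
  have -> : (a_ n + r_ n - a_ n) / r_ n = 1 by rewrite addrAC subrr add0r divff ?gt_eqF.
  by rewrite /= step1 ?lexx// subrr mul0r step0 ?lexx// subr0.
under eq_fun do rewrite E1.
apply/cvgrPdist_le => d d0.
have dC : 0 < d / C by rewrite divr_gt0.
have /cvgrPdist_le/(_ _ dC)/nbhs_ballP[rho /= rho0 hrho] := ce.
have : \forall n \near \oo, `|r_ n| < rho.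
  move/cvgrPdist_lt : rc => /(_ _ rho0); apply: filterS => n.
  by rewrite sub0r normrN.
apply: filterS => n rn.
rewrite -[X in X - _](E2 n) -lee_fin.
have iesk : leb.-integrable (I n) (EFin \o (fun t => e sg * k n t)).
  apply: (integrable_le (mI n) _ (integrableZl (mI n) (e sg) (ik n))) => //.
  apply: (@measurable_funS _ _ RR R setT (I n) _ measurableT (@subsetT _ _)).
  exact: (measurable_funM (measurable_cst _) (mk n)).
apply: le_trans (Rint_dist (mI n) iesk (iek n)) _.
apply: (@le_trans _ _ (\int[leb]_(t in I n) (d / r_ n)%:E)%E).
  apply: int_le => // t; rewrite /I/= in_itv/= => /andP[t1 t2].
  rewrite -mulrBl normrM.
  have -> : d / r_ n = (d / C) * (C / r_ n).
    by field; rewrite !gt_eqF.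
  apply: ler_pM => //; apply: hrho; rewrite /ball/=.
  have /andP[a1 a2] := ar n.
  apply: le_lt_trans rn; rewrite (gtr0_norm (r0 n)) ler_norml; apply/andP; split; lra.
have -> : (\int[leb]_(_ in I n) (d / r_ n)%:E = (d / r_ n)%:E * leb (I n))%E.
  exact: (@integral_cst _ _ _ leb (I n) (mI n) ((d / r_ n)%:E)).
by rewrite lI -EFinM lee_fin mulfVK// gt_eqF.
Qed.

End ramp.

Section slice_identity.
Context {R : realType} {N : nat}.
Local Notation E := 'rV[R]_N.
Local Notation leb := (@lebesgue_measure R).
Local Notation RR := (measurableTypeR R).
Local Notation lebE := (lebesgue_rV N : {sigma_finite_measure set E -> \bar R}).
Local Notation m := (lebE \x leb)%E.
Variables (Om : set E) (s0 t0 B Be : R).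
Hypothesis oOm : open Om.
Hypothesis Omfin : (lebE Om < +oo)%E.
Variables (c : E * RR -> R) (C : R -> E -> R) (k : E * RR -> R) (eta : E -> R).
Hypothesis mc : measurable_fun setT c.
Hypothesis c0 : forall z, ~ (Om z.1 /\ s0 < z.2 < t0) -> c z = 0.
Hypothesis cB : forall z, `|c z| <= B.
Hypothesis mC : forall t, measurable_fun setT (C t).
Hypothesis CB : forall t x, `|C t x| <= B.
Hypothesis Ccont : forall sg, s0 < sg < t0 ->
  (fun t => \int[lebE]_(x in Om) `|C t x - C sg x|%:E)%E @ sg --> 0%E.
Hypothesis cC : {ae leb, forall t, s0 < t < t0 ->
  {ae lebE, forall x, Om x -> c (x, t) = C t x}}.
Hypothesis ik : m.-integrable setT (EFin \o k).
Hypothesis me : measurable_fun setT eta.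
Hypothesis eB : forall x, `|eta x| <= Be.
Hypothesis eqn : forall h : R -> R, test_function `]s0, t0[%classic h ->
  \int[m]_z (h z.2 * k z - c z * 'D_1 h z.2 * eta z.1) = 0.

Let mOm : measurable Om. Proof. exact: open_measurable_rV. Qed.
Let B0 : 0 <= B. Proof. exact: le_trans (CB 0 0). Qed.
Let Be0 : 0 <= Be. Proof. exact: le_trans (eB 0). Qed.

Let Q : set (E * RR) := Om `*` `]s0, t0[%classic.

Let integrable_Q (f : E * RR -> R) M : measurable_fun setT f ->
  (forall z, ~ (Om z.1 /\ s0 < z.2 < t0) -> f z = 0) -> (forall z, `|f z| <= M) ->
  m.-integrable setT (EFin \o f).
Proof.
move=> mf f0 fM.
have mQ : measurable Q by apply: measurableX => //; exact: measurable_itv.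
have mQfin : (m Q < +oo)%E.
  have -> : m Q = (lebE Om * leb `]s0, t0[%classic)%E.
    by apply: product_measure1E => //; exact: measurable_itv.
  by rewrite lte_mul_pinfty// ?leb_itvoo_lty// ge0_fin_numE.
apply: (integrable_bounded_supp mQ mQfin mf _ fM).
by move=> z nQ; apply: f0 => -[h1 h2]; apply: nQ; split => //=; rewrite in_itv.
Qed.

(** The mass against eta at time t, read on the slices C t; they are defined for every t
    and depend continuously on t, while the representative c agrees with them for
    almost every t. *)
Definition slice_mass (t : R) : R := \int[lebE]_(x in Om) (C t x * eta x).

Let iCe t : lebE.-integrable Om (EFin \o (fun x => C t x * eta x)).
Proof.
apply: measurable_bounded_integrable => //.
  by apply: measurable_funS (measurable_funM (mC t) me).
exists (B * Be); split; [exact: num_real|] => y yB x _ /=.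
by rewrite normrM; apply: le_trans (ltW yB); exact: ler_pM.
Qed.

Lemma slice_mass_cvg sg : s0 < sg < t0 -> slice_mass @ sg --> slice_mass sg.
Proof.
move=> sgI; apply/cvgrPdist_le => e e0.
have K0 : 0 < Be + 1 by rewrite ltr_wpDl.
have H := Ccont sgI.
have : \forall t \near sg, (\int[lebE]_(x in Om) `|C t x - C sg x|%:E <= (e / (Be + 1))%:E)%E.
  have /fine_cvgP[ff fc] := H.
  have e1 : 0 < e / (Be + 1) by rewrite divr_gt0.
  move/cvgrPdist_le : fc => /(_ _ e1); apply: filterS2 ff => t ff.
  rewrite sub0r normrN /= => h; rewrite -(fineK ff) lee_fin.
  by apply: le_trans h; rewrite ler_norm.
apply: filterS => t ht; rewrite -lee_fin.
apply: le_trans (Rint_dist mOm (iCe sg) (iCe t)) _.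
apply: (@le_trans _ _ ((Be + 1)%:E * (e / (Be + 1))%:E)%E); last first.
  by rewrite -EFinM lee_fin mulrC mulfVK// gt_eqF.
apply: (@le_trans _ _ (\int[lebE]_(x in Om) ((Be + 1) * `|C t x - C sg x|)%:E)%E).
  apply: int_le => // x Ox; rewrite -mulrBl normrM mulrC distrC ler_wpM2r//.
  by rewrite (le_trans (eB x))// lerDl.
rewrite intZ//; last 2 first.
- exact: ltW.
- by apply: measurable_abs; apply: measurable_funB; exact: measurable_funS (mC _).
by apply: lee_wpmul2l => //; rewrite lee_fin ltW.
Qed.

Let e1 (t : R) : R := \int[lebE]_x (c (x, t) * eta x).

Let ice t : lebE.-integrable setT (EFin \o (fun x => c (x, t) * eta x)).
Proof.
have mct : measurable_fun setT (fun x => c (x, t)).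
  by apply: (measurableT_comp mc); apply: measurable_fun_pair.
have -> : EFin \o (fun x => c (x, t) * eta x) = (EFin \o (fun x => c (x, t) * eta x)) \_ Om.
  apply/funext => x; rewrite patchE; case: ifPn => //; rewrite notin_setE => nO.
  by rewrite /= c0 ?mul0r// => -[].
apply/(integrable_mkcond _ mOm); apply: measurable_bounded_integrable => //.
  by apply: measurable_funS (measurable_funM mct me).
exists (B * Be); split; [exact: num_real|] => y yB x _ /=.
by rewrite normrM; apply: le_trans (ltW yB); exact: ler_pM.
Qed.

Let mass_bound : R := B * Be * fine (lebE Om).

Let Om_fin : lebE Om \is a fin_num. Proof. by rewrite ge0_fin_numE. Qed.

Let ae_e1 : {ae leb, forall t, s0 < t < t0 -> e1 t = slice_mass t}.
Proof.
apply: leb_aeS cC => t + tI => /(_ tI) H.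
rewrite /e1 /slice_mass /Rintegral; congr fine.
rewrite [RHS]integral_mkcond; apply: integral_eq_ae => //.
apply: filterS H => x H _; rewrite patchE; case: ifPn => [/set_mem Ox|].
  by rewrite H.
by rewrite notin_setE => nO; rewrite c0 ?mul0r// => -[].
Qed.

(** The continuous version of the mass, extended by 0 to the whole line. *)
Let e2 (t : R) : R := if s0 < t < t0 then slice_mass t else 0.

Let me2 : measurable_fun setT e2.
Proof.
pose D := `]s0, t0[%classic : set RR.
have mD : measurable D by exact: measurable_itv.
have -> : e2 = slice_mass \_ D.
  apply/funext => t; rewrite /e2 patchE mem_setE in_itv/=; by case: ifP.
apply/(measurable_restrictT _ mD).
apply: open_continuous_measurable_fun; first exact: interval_open.
move=> t /set_mem; rewrite /D/= in_itv/= => tI; exact: slice_mass_cvg.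
Qed.

Let e2_cvg sg : s0 < sg < t0 -> e2 @ sg --> e2 sg.
Proof.
move=> sgI; have -> : e2 sg = slice_mass sg by rewrite /e2 sgI.
apply: cvg_trans (slice_mass_cvg sgI).
apply: near_eq_cvg; have := near_itvoo sgI; apply: filterS => t tI.
by rewrite /e2 tI.
Qed.

Let e2_bound t : `|e2 t| <= mass_bound.
Proof.
rewrite /e2; case: ifP => tI; last first.
  by rewrite normr0 !mulr_ge0// fine_ge0.
rewrite -lee_fin; apply: le_trans (Rint_norm_le mOm (iCe t)) _.
apply: (@le_trans _ _ (\int[lebE]_(x in Om) (B * Be)%:E)%E).
  by apply: int_le => // x Ox; rewrite normrM; exact: ler_pM.
by rewrite integral_cst// [mass_bound%:E]EFinM fineK.
Qed.

(** The equation is tested with smooth approximations h_n of the indicator of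
    (s1, s2); their derivatives are differences of two approximate identities, which
    pick up the values of the continuous masses at s1 and s2. *)
Theorem slice_identity (s1 s2 : R) : s0 < s1 -> s1 < s2 -> s2 < t0 ->
  slice_mass s2 - slice_mass s1 + \int[m]_z (k z * (s1 < z.2 < s2)%R%:R) = 0.
Proof.
move=> s01 s12 s2t.
pose r n : R := (s2 - s1) / n.+1%:R.
have r0 n : 0 < r n by rewrite divr_gt0// subr_gt0.
have rle n : r n <= s2 - s1.
  by rewrite /r ler_pdivrMr// ler_peMr ?ler1n// subr_ge0 ltW.
have rc : r @ \oo --> 0.
  rewrite -[X in _ --> X](mulr0 (s2 - s1)); apply: cvgM; first exact: cvg_cst.
  exact: cvg_harmonic.
(* a plateau: h n rises from 0 to 1 next to s1 and falls back next to s2 *)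
pose h n t : R := step ((t - s1) / r n) - step ((t - (s2 - r n)) / r n).
pose k1 n t : R := (r n)^-1 * dstep ((t - s1) / r n).
pose k2 n t : R := (r n)^-1 * dstep ((t - (s2 - r n)) / r n).
have dh n (t : R) : is_derive t 1 (h n) (k1 n t - k2 n t).
  by apply: is_deriveB; apply: is_derive_ramp; rewrite gt_eqF.
have smooth_ramp a n : smooth (fun t : R => step ((t - a) / r n)).
  apply: (@smooth_comp _ _ step (fun t : R => (t - a) / r n)); first exact: smooth_step.
  apply: (@smoothM _ _ (fun t : R => t - a) (cst (r n)^-1)); last exact: smooth_cst.
  by apply: (@smoothD _ _ id (cst (- a))); [exact: smooth_id|exact: smooth_cst].
have test_h n : test_function `]s0, t0[%classic (h n).
  split.
    have -> : h n = (fun t : R => step ((t - s1) / r n)) \+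
        (cst (-1) \* (fun t : R => step ((t - (s2 - r n)) / r n))).
      by apply/funext => t /=; rewrite mulN1r.
    by apply: smoothD; [exact: smooth_ramp|apply: smoothM; [exact: smooth_cst|exact: smooth_ramp]].
  exists `[s1, s2]%classic; split; first exact: segment_compact.
    move=> t; rewrite /= !in_itv/= => /andP[h1 h2].
    by rewrite (lt_le_trans s01 h1) (le_lt_trans h2 s2t).
  move=> t /negP; rewrite /= in_itv/= negb_and -!ltNge => /orP[t1|t2].
    rewrite /h !step0 ?subrr// ler_pdivrMr// mul0r subr_le0; have := rle n; first lra.
    by move=> _; exact: ltW.
  rewrite /h !step1 ?subrr// ler_pdivlMr// mul1r; have := rle n; lra.
have h_norm n t : `|h n t| <= 1.
  have := step_ge0 ((t - s1) / r n); have := step_le1 ((t - s1) / r n).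
  have := step_ge0 ((t - (s2 - r n)) / r n); have := step_le1 ((t - (s2 - r n)) / r n).
  rewrite /h ler_norml => *; apply/andP; split; lra.
have mh n : measurable_fun setT (h n).
  by apply: continuous_measurable_fun; apply: smooth_continuous; case: (test_h n).
have mk1 n : measurable_fun setT (k1 n).
  by apply: continuous_measurable_fun; exact: continuous_ramp.
have mk2 n : measurable_fun setT (k2 n).
  by apply: continuous_measurable_fun; exact: continuous_ramp.
have mkz : measurable_fun setT k by case/integrableP : ik => /measurable_EFinP.
have ihk n : m.-integrable setT (EFin \o (fun z : E * RR => h n z.2 * k z)).
  apply: (integrable_le measurableT _ ik).
    by apply: measurable_funM => //; exact: (measurableT_comp (mh n) measurable_snd).
  by move=> z _; rewrite normrM ler_piMl.
have [Cd Cd0 HCd] := @dstep_bounded R.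
have kB n t : `|k1 n t - k2 n t| <= Cd / r n + Cd / r n.
  apply: le_trans (ler_normB _ _) _; apply: lerD; rewrite normrM mulrC;
  rewrite (@ger0_norm _ (r n)^-1) ?invr_ge0 ?(ltW (r0 n))//;
  by rewrite ler_wpM2r ?invr_ge0 ?(ltW (r0 n)).
have icn n : m.-integrable setT (EFin \o (fun z : E * RR => c z * (k1 n z.2 - k2 n z.2) * eta z.1)).
  apply: (@integrable_Q _ (B * (Cd / r n + Cd / r n) * Be)).
  - apply: measurable_funM.
      apply: measurable_funM => //; apply: measurable_funB.
        exact: (measurableT_comp (mk1 n) measurable_snd).
      exact: (measurableT_comp (mk2 n) measurable_snd).
    exact: (measurableT_comp me measurable_fst).
  - by move=> z nQ; rewrite c0 ?mul0r.
  - by move=> z; rewrite !normrM; apply: ler_pM => //; apply: ler_pM.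
(* for almost every t the representative may be replaced by the continuous mass *)
have time_part n : \int[m]_z (c z * (k1 n z.2 - k2 n z.2) * eta z.1) =
    \int[leb]_t (e2 t * k1 n t) - \int[leb]_t (e2 t * k2 n t).
  have ie2 (j : R -> R) (M : R) : measurable_fun setT j -> (forall t, `|j t| <= M) ->
      leb.-integrable setT (EFin \o (fun t : RR => e2 t * j t)).
    move=> mj jM.
    apply: (@integrable_bounded_supp _ _ _ leb `]s0, t0[%classic _ (mass_bound * M)).
    - exact: measurable_itv.
    - exact: leb_itvoo_lty.
    - exact: measurable_funM.
    - by move=> t nD; rewrite /e2 ifF ?mul0r//; apply/negP => tI; apply: nD; rewrite /= in_itv.
    - by move=> t; rewrite normrM; apply: ler_pM => //; exact: e2_bound.
  have kb a n' t : `|(r n')^-1 * dstep ((t - a) / r n')| <= Cd / r n'.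
    rewrite normrM (@ger0_norm _ (r n')^-1) ?invr_ge0 ?(ltW (r0 n'))// mulrC.
    by rewrite ler_wpM2r ?invr_ge0 ?(ltW (r0 n')).
  rewrite -RintegralB//; last 2 first.
  - exact: (ie2 _ _ (mk1 n) (kb _ n)).
  - exact: (ie2 _ _ (mk2 n) (kb _ n)).
  rewrite [LHS]/Rintegral -(integral21_prod_meas1 (icn n)) /fubini_G/= /Rintegral.
  congr fine; apply: integral_eq_ae => //.
  apply: leb_aeS ae_e1 => t te1 _.
  have -> : (\int[lebE]_x (c (x, t) * (k1 n t - k2 n t) * eta x)%:E =
     (k1 n t - k2 n t)%:E * \int[lebE]_x (c (x, t) * eta x)%:E)%E.
    rewrite -(integralZl measurableT (ice t)); apply: eq_integral => x _ /=.
    by rewrite -EFinM; congr EFin; ring.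
  have -> : (\int[lebE]_x (c (x, t) * eta x)%:E = (e2 t)%:E)%E.
    have fe : (\int[lebE]_x (c (x, t) * eta x)%:E)%E \is a fin_num.
      exact: (integrable_fin_num measurableT (ice t)).
    rewrite -(fineK fe) -[fine _]/(e1 t); congr EFin.
    rewrite /e2; case: ifP => [tI|tI]; first exact: te1.
    rewrite /e1 /Rintegral (eq_integral (cst 0%E)) ?integral0// => x _ /=.
    by rewrite c0 ?mul0r// tI => -[].
  by rewrite -EFinM; congr EFin; ring.
have id n : \int[leb]_t (e2 t * k1 n t) - \int[leb]_t (e2 t * k2 n t) =
    \int[m]_z (h n z.2 * k z).
  rewrite -time_part; apply/eqP; rewrite eq_sym -subr_eq0 -RintegralB//.
  apply/eqP; rewrite -[RHS](eqn (test_h n)); apply: eq_Rintegral => z _.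
  by have [_ ->] := dh n z.2.
have c1 : (fun n => \int[leb]_t (e2 t * k1 n t)) @ \oo --> e2 s1.
  apply: (@ramp_cvg _ e2 s1 mass_bound (fun=> s1) r) => //.
  - by apply: e2_cvg; rewrite s01 (lt_trans s12).
  - by move=> n; rewrite lexx lerDl ltW.
have c2 : (fun n => \int[leb]_t (e2 t * k2 n t)) @ \oo --> e2 s2.
  apply: (@ramp_cvg _ e2 s2 mass_bound (fun n => s2 - r n) r) => //.
  - by apply: e2_cvg; rewrite s2t (lt_trans s01).
  - by move=> n; rewrite subrK lexx gerBl ltW.
have c3 : (fun n => \int[m]_z (h n z.2 * k z)) @ \oo --> \int[m]_z (k z * (s1 < z.2 < s2)%R%:R).
  have mind : measurable_fun setT (fun z : E * RR => (s1 < z.2 < s2)%R%:R : R).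
    apply: (@measurableT_comp _ _ _ _ _ _ (fun b : bool => b%:R : R)) => //.
    by apply: measurable_and; apply: measurable_fun_ltr => //; exact: measurable_snd.
  have hc : {ae m, forall z, setT z ->
      (fun n => (h n z.2 * k z)%:E) @ \oo --> (k z * (s1 < z.2 < s2)%R%:R)%:E}.
    apply: nearW => z _; rewrite mulrC; apply: cvg_EFin; first exact: nearW.
    apply: cvgM; last exact: cvg_cst.
    apply: (@cvg_near_cst _ _ _ _ \oo).
    have [t1|t1] := leP z.2 s1.
      rewrite /=; apply: nearW => n.
      rewrite /h !step0 ?subrr// ler_pdivrMr// mul0r subr_le0//.
      by have := rle n; move: t1; set t := z.2 => ? ?; lra.
    have [t2|t2] := leP s2 z.2.
      apply: nearW => n.
      rewrite /h !step1 ?subrr// ler_pdivlMr// mul1r; have := rle n; move: t2; set t := z.2; lra.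
    rewrite /=.
    have : \forall n \near \oo, `|r n| < Num.min (z.2 - s1) (s2 - z.2).
      have p : 0 < Num.min (z.2 - s1) (s2 - z.2) by rewrite lt_min !subr_gt0 t1.
      by move/cvgrPdist_lt : rc => /(_ _ p); apply: filterS => n; rewrite sub0r normrN.
    apply: filterS => n; rewrite gtr0_norm// lt_min => /andP[q1 q2].
    rewrite /h step1; last by rewrite ler_pdivlMr// mul1r ltW.
    rewrite step0 ?subr0// ler_pdivrMr// mul0r; move: q2; set t := z.2; lra.
  have dom : {ae m, forall z n, setT z -> (`|(h n z.2 * k z)%:E| <= `|(k z)%:E|)%E}.
    by apply: nearW => z n _; rewrite lee_fin normrM ler_piMl.
  have mhk n : measurable_fun setT (fun z : E * RR => (h n z.2 * k z)%:E).
    by case/integrableP : (ihk n).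
  have mki : measurable_fun setT (fun z : E * RR => (k z * (s1 < z.2 < s2)%R%:R)%:E).
    by apply/measurable_EFinP; exact: measurable_funM.
  have [iki _ cc] := dominated_convergence measurableT mhk mki hc (integrable_abse ik) dom.
  have := fine_cvg (_ : _ @ \oo --> (\int[m]_z (k z * (s1 < z.2 < s2)%R%:R))%:E).
  apply; rewrite /Rintegral fineK//.
  exact: (integrable_fin_num measurableT iki).
have c3' : (fun n => \int[leb]_t (e2 t * k1 n t) - \int[leb]_t (e2 t * k2 n t)) @ \oo -->
    \int[m]_z (k z * (s1 < z.2 < s2)%R%:R).
  by under eq_fun do rewrite id; exact: c3.
have := cvg_unique (@Rhausdorff R) (cvgB c1 c2) c3'.
rewrite /e2 s01 s2t (lt_trans s12 s2t) (lt_trans s01 s12)/= => <-.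
by ring.
Qed.

End slice_identity.

(** * The inequality in one time slice *)

(** The weight e is free: a small one is put on a factor that is merely bounded in
    L^{p'}, at the price of a large constant before one that tends to 0 in L^p. *)
Lemma young {R : realType} (p e X Y : R) : 1 < p -> 0 < e -> 0 <= X -> 0 <= Y ->
  X * Y <= e * X `^ (p / (p - 1)) + e `^ (1 - p) * Y `^ p.
Proof.
move=> p1 e0 X0 Y0.
have p10 : 0 < p - 1 by rewrite subr_gt0.
have q1 : (p - 1)^-1 + 1 = p / (p - 1) by field; rewrite gt_eqF.
have [h|h] := leP Y (e * X `^ ((p - 1)^-1)).
  rewrite ler_wpDr ?mulr_ge0 ?powR_ge0//.
  rewrite -q1 [X `^ (_ + _)]powRD; last first.
    by apply/implyP => /eqP; have := invr_gt0 (p - 1); rewrite p10; lra.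
  rewrite powRr1// mulrA mulrC ler_wpM2r//.
have [->|Xn] := eqVneq X 0.
  by rewrite mul0r addr_ge0// mulr_ge0 ?powR_ge0 ?(ltW e0).
have XX : 0 < X by rewrite lt_neqAle eq_sym Xn.
have Xle : X <= (Y / e) `^ (p - 1).
  have -> : X = (X `^ (p - 1)^-1) `^ (p - 1) by rewrite -powRrM mulVf ?gt_eqF// powRr1.
  apply: le_powR; [exact: ltW|exact: powR_ge0|].
  by rewrite ler_pdivlMr// mulrC ltW.
rewrite ler_wpDl ?mulr_ge0 ?powR_ge0 ?(ltW e0)//.
apply: (le_trans (ler_wpM2r Y0 Xle)).
have YY : 0 < Y by apply: le_lt_trans h; rewrite mulr_ge0 ?powR_ge0 ?(ltW e0).
rewrite powRM ?invr_ge0 ?(ltW e0)//.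
have -> : e `^ (1 - p) = e^-1 `^ (p - 1) by rewrite -powR_inv1 ?(ltW e0)// -powRrM; congr (_ `^ _); ring.
have -> : Y `^ p = Y `^ (p - 1) * Y.
  by rewrite -[in RHS](powRr1 (ltW YY)) powRr1// -[X in _ * X](powRr1 (ltW YY)) -powRD ?subrK// (gt_eqF YY) implybT.
by rewrite le_eqVlt; apply/orP; left; apply/eqP; ring.
Qed.

Section tensor.
Context {R : realType} {N : nat}.
Local Notation E := 'rV[R]_N.
Local Notation leb := (@lebesgue_measure R).
Local Notation RR := (measurableTypeR R).
Local Notation lebE := (lebesgue_rV N : {sigma_finite_measure set E -> \bar R}).
Local Notation m := (lebE \x leb)%E.

Definition slab (al be : R) (z : E * RR) : R := (al < z.2 < be)%R%:R.

Lemma slab_ge0 al be z : 0 <= slab al be z. Proof. by []. Qed.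

Lemma slab_le1 al be z : slab al be z <= 1. Proof. by rewrite /slab; case: (_ < _ < _). Qed.

Lemma measurable_slab al be : measurable_fun setT (slab al be).
Proof.
apply: (@measurableT_comp _ _ _ _ _ _ (fun b : bool => b%:R : R)) => //.
by apply: measurable_and; apply: measurable_fun_ltr => //; exact: measurable_snd.
Qed.

Lemma int_window (al be : R) : al <= be ->
  (\int[leb]_t ((al < t < be)%R%:R : R)%:E = (be - al)%:E)%E.
Proof.
move=> ab; transitivity (\int[leb]_t (\1_(`]al, be[%classic) t)%:E)%E.
  by apply: eq_integral => t _; rewrite indicE mem_setE in_itv.
rewrite integral_indic//= setIT; etransitivity; first exact: lebesgue_measure_itv.
rewrite /= lte_fin; move: ab; rewrite le_eqVlt => /orP[/eqP->|->]; last by rewrite -EFinB.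
by rewrite ltxx subrr.
Qed.

Lemma int_tensor (w : E -> R) (al be : R) : measurable_fun setT w ->
  (forall x, 0 <= w x) -> al <= be ->
  (\int[m]_z (w z.1 * slab al be z)%:E = (be - al)%:E * \int[lebE]_x (w x)%:E)%E.
Proof.
move=> mw w0 ab.
have mwz : measurable_fun setT (fun z : E * RR => w z.1 * slab al be z).
  by apply: measurable_funM; [exact: (measurableT_comp mw measurable_fst)|exact: measurable_slab].
rewrite (@fubini_tonelli1 _ _ E RR _ lebE leb (fun z => (w z.1 * slab al be z)%:E))/=; last 2 first.
- by apply/measurable_EFinP.
- by move=> z; rewrite lee_fin mulr_ge0.
rewrite /fubini_F -(@intZ _ _ _ lebE setT measurableT (be - al) w)//; last by rewrite subr_ge0.
apply: eq_integral => x _ /=.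
have mslab : measurable_fun setT (fun t : RR => (al < t < be)%R%:R : R).
  exact: (@measurable_slice2 _ _ _ E RR _ _ 0 (measurable_slab al be)).
rewrite (@intZ _ _ _ leb setT measurableT (w x) (fun t => (al < t < be)%R%:R))//.
by rewrite int_window// -EFinM mulrC.
Qed.

(** Young's inequality with a small weight on the fixed factor F. *)
Lemma dual_pairing_cvg0 (p al be : R) (F : E * RR -> R) (w : nat -> E -> R) :
  1 < p -> al <= be -> measurable_fun setT F -> (forall z, ~ (al < z.2 < be) -> F z = 0) ->
  (\int[m]_z (`|F z| `^ (p / (p - 1)))%:E < +oo)%E ->
  (forall n, measurable_fun setT (w n)) ->
  (fun n => \int[lebE]_x (`|w n x| `^ p)%:E)%E @ \oo --> 0%E ->
  (fun n => \int[m]_z (`|F z| * `|w n z.1|)%:E)%E @ \oo --> 0%E.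
Proof.
move=> p1 ab mF F0 Foo mw wc.
have ge0 n : (0 <= \int[m]_z (`|F z| * `|w n z.1|)%:E)%E.
  by apply: int_ge0 => // z _; rewrite mulr_ge0.
apply/(cvge0P ge0) => e e0.
set CF := (\int[m]_z (`|F z| `^ (p / (p - 1)))%:E)%E in Foo.
have CF0 : (0 <= CF)%E by apply: int_ge0 => // z _; exact: powR_ge0.
have CFf : CF \is a fin_num by rewrite ge0_fin_numE.
pose K := fine CF + 1.
have K0 : 0 < K by rewrite ltr_wpDl// fine_ge0.
pose ka := e / 2 / K.
have ka0 : 0 < ka by rewrite divr_gt0// divr_gt0.
have := cvge0Z (ka `^ (1 - p) * (be - al)) wc.
have wge0 n : (0 <= (ka `^ (1 - p) * (be - al))%:E * \int[lebE]_x (`|w n x| `^ p)%:E)%E.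
  apply: mule_ge0; first by rewrite lee_fin mulr_ge0 ?powR_ge0// subr_ge0.
  by apply: int_ge0 => // x _; exact: powR_ge0.
have e20 : 0 < e / 2 by rewrite divr_gt0.
move=> /(cvge0P wge0)/(_ _ e20); apply: filterS => n hn.
have mFq : measurable_fun setT (fun z => `|F z| `^ (p / (p - 1))).
  exact: measurable_powRl (measurable_abs mF).
have mwp : measurable_fun setT (fun x => `|w n x| `^ p).
  exact: measurable_powRl (measurable_abs (mw n)).
have mwz : measurable_fun setT (fun z : E * RR => `|w n z.1| `^ p * slab al be z).
  by apply: measurable_funM; [exact: (measurableT_comp mwp measurable_fst)|exact: measurable_slab].
apply: (@le_trans _ _ (\int[m]_z (ka * `|F z| `^ (p / (p - 1)) +
   ka `^ (1 - p) * (`|w n z.1| `^ p * slab al be z))%:E)%E).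
  apply: int_le => // z _; have [zI|zI] := boolP (al < z.2 < be).
    by rewrite /slab zI mulr1; exact: young.
  rewrite F0; last exact/negP.
  rewrite normr0 mul0r; apply: addr_ge0; first exact: (mulr_ge0 (ltW ka0) (powR_ge0 _ _)).
  exact: (mulr_ge0 (powR_ge0 _ _) (mulr_ge0 (powR_ge0 _ _) (slab_ge0 _ _ _))).
rewrite intD//; last 4 first.
- by apply: measurable_funM.
- by apply: measurable_funM.
- by move=> z _; rewrite mulr_ge0 ?powR_ge0// ltW.
- by move=> z _; rewrite !mulr_ge0 ?powR_ge0.
rewrite intZ//; last exact: ltW.
rewrite intZ//; last by move=> z _; rewrite mulr_ge0 ?powR_ge0.
rewrite [X in (_ + _ * X)%E](_ : _ = ((be - al)%:E * \int[lebE]_x (`|w n x| `^ p)%:E)%E); last first.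
  exact: (int_tensor mwp (fun x => powR_ge0 _ _) ab).
rewrite muleA -EFinM [e in (_ <= e%:E)%E]splitr EFinD; apply: leeD => //.
rewrite -/CF -(fineK CFf) -EFinM lee_fin /ka mulrAC ler_pdivrMr// ler_wpM2l ?(ltW e20)//.
  by rewrite /K lerDl.
exact: powR_ge0.
Qed.

End tensor.

Section sums_and_products.
Context {R : realType}.

Lemma cvge0_sum (I : Type) (r : seq I) (a : I -> nat -> \bar R) :
  (forall i, a i @ \oo --> 0%E) -> (fun n => \sum_(i <- r) a i n)%E @ \oo --> 0%E.
Proof.
move=> ha; elim: r => [|i r IH].
  by under eq_fun do rewrite big_nil; exact: cvg_cst.
by under eq_fun do rewrite big_cons; exact: cvge0D.
Qed.

Context d {T : measurableType d}.
Variable mu : {measure set T -> \bar R}.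

Lemma integral_supp (D : set T) (f : T -> \bar R) : measurable D ->
  (forall x, ~ D x -> f x = 0%E) -> (\int[mu]_(x in D) f x = \int[mu]_x f x)%E.
Proof.
move=> mD f0; rewrite integral_mkcond; apply: eq_integral => x _.
by rewrite patchE; case: ifPn => //; rewrite notin_setE => /f0.
Qed.

Lemma integral_sum_le (I : finType) (f : I -> T -> R) : (forall i, measurable_fun setT (f i)) ->
  (forall i x, 0 <= f i x) ->
  (\int[mu]_x (\sum_i f i x)%:E = \sum_i \int[mu]_x (f i x)%:E)%E.
Proof.
move=> mf f0.
under eq_integral do rewrite -sumEFin.
rewrite ge0_integral_sum//; first by move=> i; apply/measurable_EFinP; exact: mf.
by move=> i x _; rewrite lee_fin.
Qed.

Lemma integrable_sum_real (I : finType) (f : I -> T -> R) :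
  (forall i, mu.-integrable setT (EFin \o f i)) ->
  mu.-integrable setT (EFin \o (fun x => \sum_i f i x)).
Proof.
move=> fi; have -> : EFin \o (fun x => \sum_i f i x) = (fun x => \sum_i (f i x)%:E)%E.
  by apply/funext => x /=; rewrite sumEFin.
exact: (@integrable_sum _ _ _ mu setT measurableT I (index_enum I) xpredT (fun i x => (f i x)%:E) (fun i _ => fi i)).
Qed.

Lemma integrable_mul_bounded (f g : T -> R) (B : R) : mu.-integrable setT (EFin \o f) ->
  measurable_fun setT g -> (forall x, `|g x| <= B) ->
  mu.-integrable setT (EFin \o (fun x => f x * g x)).
Proof.
move=> fi mg gB; have mf : measurable_fun setT f by case/integrableP : fi => /measurable_EFinP.
apply: (integrable_le measurableT _ (integrableZl measurableT B fi)); first exact: measurable_funM.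
move=> x _; rewrite !normrM mulrC ler_wpM2r//.
by rewrite (le_trans (gB x))// ler_norm.
Qed.

End sums_and_products.

Lemma trunc_lip {R : realType} (k y z : R) : `|trunc k y - trunc k z| <= `|y - z|.
Proof.
wlog yz : y z / z <= y.
  by move=> H; case: (leP z y) => h; [exact: H|rewrite distrC (distrC y); apply: H; exact: ltW].
rewrite [leRHS]ger0_norm ?subr_ge0// /trunc ler_norml.
rewrite /Num.max /Num.min.
case: (ltP k y) => h1; case: (ltP k z) => h2; case: ltP => h3; case: ltP => h4;
  by apply/andP; split; lra.
Qed.

Lemma lipschitz_continuous {R : realType} (f : R -> R) (L : R) :
  (forall y z, `|f y - f z| <= L * `|y - z|) -> continuous f.
Proof.
move=> fL x; apply/cvgrPdist_le => e e0.
have L1 : 0 < `|L| + 1 by rewrite ltr_wpDl.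
have d0 : 0 < e / (`|L| + 1) by rewrite divr_gt0.
have : \forall t \near x, `|x - t| <= e / (`|L| + 1).
  by apply/nbhs_ballP; exists (e / (`|L| + 1)) => //= t; rewrite /ball/= => /ltW.
apply: filterS => t ht; apply: le_trans (fL _ _) _.
apply: (@le_trans _ _ ((`|L| + 1) * `|x - t|)).
  by rewrite ler_wpM2r// (le_trans (ler_norm _))// lerDl.
by rewrite mulrC -ler_pdivlMr.
Qed.

Lemma measurable_trunc {R : realType} (k : R) : measurable_fun setT (trunc k).
Proof.
apply: continuous_measurable_fun; apply: (@lipschitz_continuous _ _ 1) => y z.
by rewrite mul1r; exact: trunc_lip.
Qed.

Section energy_slice.
Context {R : realType} {N : nat}.
Local Notation E := 'rV[R]_N.
Local Notation leb := (@lebesgue_measure R).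
Local Notation RR := (measurableTypeR R).
Local Notation lebE := (lebesgue_rV N : {sigma_finite_measure set E -> \bar R}).
Local Notation m := (lebE \x leb)%E.
Variables (Om : set E) (p s0 t0 kk BS LS B1 B2 : R).
Hypothesis oOm : open Om.
Hypothesis Omfin : (lebE Om < +oo)%E.
Hypothesis p1 : 1 < p.
Hypothesis s0t0 : s0 < t0.
Variables (u : E * RR -> R) (U : R -> E -> R).
Hypothesis mu : measurable_fun setT u.
Hypothesis u0 : forall z, ~ (Om z.1 /\ s0 < z.2 < t0) -> u z = 0.
Hypothesis mU : forall t, measurable_fun setT (U t).
Hypothesis Ucont : forall sg, s0 < sg < t0 ->
  (fun t => \int[lebE]_(x in Om) `|U t x - U sg x|%:E)%E @ sg --> 0%E.
Hypothesis uU : {ae leb, forall t, s0 < t < t0 ->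
  {ae lebE, forall x, Om x -> u (x, t) = U t x}}.
Variables S Psi th : R -> R.
Hypothesis LS0 : 0 <= LS.
Hypothesis SL : forall y z, `|S y - S z| <= LS * `|y - z|.
Hypothesis SB : forall y, `|S y| <= BS.
Hypothesis S00 : S 0 = 0.
Hypothesis mS : measurable_fun setT S.
Hypothesis PsiB : forall y, `|Psi y| <= BS.
Hypothesis mPsi : measurable_fun setT Psi.
Hypothesis sth : smooth th.
Hypothesis th0 : th 0 = 0.
Hypothesis thB : forall y, `|th y| <= 1.
Hypothesis dthB : forall y, `|'D_1 th y| <= B1.
Hypothesis thL : forall y z, `|th y - th z| <= B1 * `|y - z|.
Hypothesis dthL : forall y z, `|'D_1 th y - 'D_1 th z| <= B2 * `|y - z|.
Hypothesis Sineq : forall y z, Psi y - Psi z <= (S y - S z) * th (trunc kk y).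
Variables (F : 'I_N -> E * RR -> R) (K0 : E * RR -> R) (G : E * RR -> E).
Hypothesis mF : forall i, measurable_fun setT (F i).
Hypothesis F0 : forall i z, ~ (Om z.1 /\ s0 < z.2 < t0) -> F i z = 0.
Hypothesis Fq : forall i, (\int[m]_z (`|F i z| `^ (p / (p - 1)))%:E < +oo)%E.
Hypothesis iK0 : m.-integrable setT (EFin \o K0).
Hypothesis K00 : forall z, ~ (Om z.1 /\ s0 < z.2 < t0) -> K0 z = 0.
Hypothesis mG : forall i, measurable_fun setT (fun z => G z ord0 i).
Hypothesis G0 : forall z, ~ (Om z.1 /\ s0 < z.2 < t0) -> G z = 0.
Hypothesis eqn : forall (h : R -> R) (eta : E -> R),
  test_function `]s0, t0[%classic h -> test_function Om eta ->
  \int[m]_z (h z.2 * (\sum_i F i z * 'D_(delta_mx ord0 i) eta z.1 + K0 z * eta z.1)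
             - S (u z) * 'D_1 h z.2 * eta z.1) = 0.

Definition Phi (i : 'I_N) (w : E * RR) : R := 'D_1 th (trunc kk (u w)) * G w ord0 i.
(** The test function theta(T_k(u)); [Phi] is its gradient by the chain rule, G being the
    gradient of T_k(u). *)
Definition Th (w : E * RR) : R := th (trunc kk (u w)).
(** The spatial part of the equation at time z.2, tested with [Th] at time sg. *)
Definition kslice (sg : R) (z : E * RR) : R :=
  \sum_i F i z * Phi i (z.1, sg) + K0 z * Th (z.1, sg).
Definition energy (t : R) : R := \int[lebE]_(x in Om) Psi (U t x).

Let mOm : measurable Om. Proof. exact: open_measurable_rV. Qed.
Let s0t0' : s0 <= t0. Proof. exact: ltW. Qed.

Lemma Fint i : m.-integrable setT (EFin \o F i).
Proof.
apply: integrable_real => //.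
have mI : measurable_fun setT (\1_Om : E -> R) by exact: measurable_indic.
have mIz : measurable_fun setT (fun z : E * RR => \1_Om z.1 * slab s0 t0 z).
  by apply: measurable_funM; [exact: (measurableT_comp mI measurable_fst)|exact: measurable_slab].
apply: (@le_lt_trans _ _ (\int[m]_z (`|F i z| `^ (p / (p - 1)) + \1_Om z.1 * slab s0 t0 z)%:E)%E).
  apply: int_le => // z _.
  have [[z1 z2]|nz] := pselect (Om z.1 /\ s0 < z.2 < t0).
    rewrite /slab z2 mulr1 indicE mem_set//.
    have e1 (x : R) : 1 `^ x = 1 by rewrite powR1.
    have := young p1 (@ltr01 R) (normr_ge0 (F i z)) ler01.
    rewrite !e1 (_ : true%:R = 1 :> R)//; set X := `|F i z| `^ _; set Y := `|F i z|; lra.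
  by rewrite F0// normr0 addr_ge0 ?powR_ge0// mulr_ge0.
rewrite intD//; last 2 first.
- exact: measurable_powRl (measurable_abs (mF i)).
- by move=> z _; rewrite mulr_ge0.
rewrite lte_add_pinfty ?Fq// int_tensor// integral_indic// setIT.
by rewrite lte_mul_pinfty// lee_fin subr_ge0.
Qed.

Section fixed_time.
Variable sg : R.
Hypothesis sgI : s0 < sg < t0.
Hypothesis uUs : {ae lebE, forall x, Om x -> u (x, sg) = U sg x}.
Hypothesis W0s : in_W0 Om p (fun x => trunc kk (u (x, sg))) (fun x => G (x, sg)).

Let v x := trunc kk (u (x, sg)).
Let gi i x := G (x, sg) ord0 i.

Let mv : measurable_fun setT v.
Proof.
have mt : measurable_fun setT (trunc kk).
  exact: measurable_trunc.
have h : measurable_fun setT (fun x => u (x, sg)).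
  apply: (measurableT_comp mu); apply: measurable_fun_pair => //; exact: measurable_cst.
exact: (measurableT_comp mt h).
Qed.

Let mgi i : measurable_fun setT (gi i).
Proof.
apply: (@measurableT_comp _ _ _ _ _ _ (fun z => G z ord0 i) _ (fun x => (x, sg))) => //.
Qed.

Let gi_out i x : ~ Om x -> gi i x = 0.
Proof. by move=> nO; rewrite /gi G0 ?mxE// => -[]. Qed.

Let v_out x : ~ Om x -> v x = trunc kk 0.
Proof. by move=> nO; rewrite /v u0// => -[]. Qed.

Let gi_p i : (\int[lebE]_x (`|gi i x| `^ p)%:E < +oo)%E.
Proof.
have p0 : 0 < p by rewrite (lt_trans ltr01).
have [_ [_ GLp] _] := W0s.
apply: le_lt_trans GLp; rewrite -(@integral_supp _ _ _ lebE Om (fun x => (`|gi i x| `^ p)%:E) mOm); last first.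
  by move=> x nO; rewrite gi_out// normr0 powR0// gt_eqF.
apply: int_le => // x Ox; apply: le_powR => //; [exact: ltW|exact: coord_le_enorm].
Qed.

Let FG_int i : m.-integrable setT (EFin \o (fun z => F i z * gi i z.1)).
Proof.
have mgz : measurable_fun setT (fun z : E * RR => gi i z.1) by exact: (measurableT_comp (mgi i) measurable_fst).
apply: integrable_real => //; first exact: measurable_funM.
have mFq : measurable_fun setT (fun z => `|F i z| `^ (p / (p - 1))).
  exact: measurable_powRl (measurable_abs (mF i)).
have mgp : measurable_fun setT (fun x => `|gi i x| `^ p).
  exact: measurable_powRl (measurable_abs (mgi i)).
have mgz2 : measurable_fun setT (fun z : E * RR => `|gi i z.1| `^ p * slab s0 t0 z).
  by apply: measurable_funM; [exact: (measurableT_comp mgp measurable_fst)|exact: measurable_slab].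
apply: (@le_lt_trans _ _ (\int[m]_z (`|F i z| `^ (p / (p - 1)) + `|gi i z.1| `^ p * slab s0 t0 z)%:E)%E).
  apply: int_le => // z _; rewrite normrM.
  have [[z1 z2]|nz] := pselect (Om z.1 /\ s0 < z.2 < t0).
    rewrite /slab z2 mulr1.
    have e1 (x : R) : 1 `^ x = 1 by rewrite powR1.
    have := young p1 (@ltr01 R) (normr_ge0 (F i z)) (normr_ge0 (gi i z.1)).
    by rewrite !e1 !mul1r.
  rewrite F0// normr0 mul0r; apply: addr_ge0; rewrite ?powR_ge0//.
  by rewrite mulr_ge0 ?powR_ge0.
rewrite intD//; last by move=> z _; rewrite mulr_ge0 ?powR_ge0.
rewrite lte_add_pinfty ?Fq//.
have -> : (\int[m]_z (`|gi i z.1| `^ p * slab s0 t0 z)%:E = (t0 - s0)%:E * \int[lebE]_x (`|gi i x| `^ p)%:E)%E.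
  exact: (int_tensor mgp (fun x => powR_ge0 _ _) s0t0').
rewrite lte_mul_pinfty// lee_fin subr_ge0//.
Qed.

Let mdth : measurable_fun setT ('D_1 th).
Proof. by apply: continuous_measurable_fun; apply: smooth_continuous; exact: smoothD1. Qed.

Let mth : measurable_fun setT th.
Proof. by apply: continuous_measurable_fun; exact: smooth_continuous. Qed.

Lemma kslice_integrable : m.-integrable setT (EFin \o kslice sg).
Proof.
apply: (integrable_addr measurableT).
  apply: integrable_sum_real => i.
  have -> : EFin \o (fun z => F i z * Phi i (z.1, sg)) =
      EFin \o (fun z => (F i z * gi i z.1) * 'D_1 th (v z.1)).
    by apply/funext => z /=; rewrite /Phi -/(gi i z.1) -/(v z.1); congr EFin; ring.
  apply: (integrable_mul_bounded (FG_int i) _ (fun z => dthB (v z.1))).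
  exact: (measurableT_comp mdth (measurableT_comp mv measurable_fst)).
apply: (integrable_mul_bounded iK0 _ (fun z => thB (v z.1))).
exact: (measurableT_comp mth (measurableT_comp mv measurable_fst)).
Qed.

Section approx.
Variable phi : nat -> E -> R.
Hypothesis tphi : forall n, test_function Om (phi n).
Hypothesis c0 : (fun n => \int[lebE]_(x in Om) (`|phi n x - v x| `^ p)%:E)%E @ \oo --> 0%E.
Hypothesis c1 : (fun n => \int[lebE]_(x in Om)
   (enorm (grad (phi n) x - G (x, sg)) `^ p)%:E)%E @ \oo --> 0%E.
Hypothesis kk0 : 0 <= kk.

Let mphi n : measurable_fun setT (phi n).
Proof. by apply: continuous_measurable_rV; apply: smooth_continuous; case: (tphi n). Qed.

Let mdphi i n : measurable_fun setT ('D_(delta_mx ord0 i) (phi n)).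
Proof.
by apply: continuous_measurable_rV; apply: smooth_continuous; apply: smoothD1; case: (tphi n).
Qed.

Let trunc0 : trunc kk 0 = 0.
Proof.
rewrite /trunc /Num.min ltNge kk0/= /Num.max.
by case: ltP => //; rewrite oppr_ge0 => h; apply/eqP; rewrite oppr_eq0 eq_le h.
Qed.

Let eta n : E -> R := th \o phi n.

Let test_eta n : test_function Om (eta n).
Proof.
have [sp [K [cK KO K0']]] := tphi n.
split; first exact: smooth_comp.
by exists K; split => // x /K0' h; rewrite /eta /= h.
Qed.

Let eta_d n i x : 'D_(delta_mx ord0 i) (eta n) x =
  'D_1 th (phi n x) * 'D_(delta_mx ord0 i) (phi n) x.
Proof. by apply: derive_comp => //; case: (tphi n). Qed.

Let cc n x : R := phi n x - v x.

Let cc_out n x : ~ Om x -> cc n x = 0.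
Proof. by move=> nO; rewrite /cc (test_out (tphi n) nO) v_out// trunc0 subr0. Qed.

Let cc_L1 : (fun n => \int[lebE]_x `|cc n x|%:E)%E @ \oo --> 0%E.
Proof.
have H : (fun n => \int[lebE]_(x in Om) `|cc n x|%:E)%E @ \oo --> 0%E.
  apply: (@Lp_L1_cvg0 _ _ _ lebE Om mOm p cc (ltW p1) Omfin _ c0) => n.
  by apply: measurable_funS (measurable_funB (mphi n) mv).
suff E n : (\int[lebE]_(x in Om) `|cc n x|%:E = \int[lebE]_x `|cc n x|%:E)%E.
  by under eq_fun do rewrite -E.
by apply: integral_supp => // x nO; rewrite cc_out// normr0.
Qed.

Let eta_L1 : (fun n => \int[lebE]_x `|eta n x - Th (x, sg)|%:E)%E @ \oo --> 0%E.
Proof.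
apply: (cvge0_le _ _ (cvge0Z B1 cc_L1)).
- by move=> n; exact: int_ge0.
- move=> n; have B10 : 0 <= B1 by exact: le_trans (dthB 0).
  have mcc : measurable_fun setT (cc n) by exact: measurable_funB.
  rewrite -(@intZ _ _ _ lebE setT measurableT B1 (fun x => `|cc n x|))//; last exact: measurable_abs.
  by apply: int_le => // x _; exact: thL.
Qed.

Let wi i n x : R := 'D_(delta_mx ord0 i) (phi n) x - gi i x.

Let wi_Lp i : (fun n => \int[lebE]_x (`|wi i n x| `^ p)%:E)%E @ \oo --> 0%E.
Proof.
have p0 : 0 < p by rewrite (lt_trans ltr01).
apply: (cvge0_le _ _ c1).
- by move=> n; apply: int_ge0 => // x _; exact: powR_ge0.
move=> n; rewrite -(@integral_supp _ _ _ lebE Om (fun x => (`|wi i n x| `^ p)%:E) mOm); last first.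
  move=> x nO; rewrite /wi gi_out// (test_out (test_deriv _ hausdorff_rV (tphi n)) nO).
  by rewrite subr0 normr0 powR0// gt_eqF.
apply: int_le => // x Ox.
apply: le_powR => //; first exact: ltW.
by apply: le_trans (coord_le_enorm _ i); rewrite !mxE.
Qed.

Let Fpart i : (fun n => \int[m]_z (`|F i z| *
   `|'D_(delta_mx ord0 i) (eta n) z.1 - Phi i (z.1, sg)|)%:E)%E @ \oo --> 0%E.
Proof.
have B10 : 0 <= B1 by exact: le_trans (dthB 0).
have mwi n : measurable_fun setT (wi i n) by exact: measurable_funB.
have F0' z : ~ (s0 < z.2 < t0) -> F i z = 0 by move=> h; apply: F0 => -[].
have H1 := cvge0Z B1 (dual_pairing_cvg0 p1 s0t0' (mF i) F0' (Fq i) mwi (wi_Lp i)).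
pose cn n (z : E * RR) := ('D_1 th (phi n z.1) - 'D_1 th (v z.1)) * slab s0 t0 z.
have mcn n : measurable_fun setT (cn n).
  apply: measurable_funM; last exact: measurable_slab.
  apply: measurable_funB; apply: (measurableT_comp mdth).
    exact: (measurableT_comp (mphi n) measurable_fst).
  exact: (measurableT_comp mv measurable_fst).
have cnB n z : setT z -> `|cn n z| <= B1 + B1.
  move=> _; rewrite normrM (ger0_norm (slab_ge0 _ _ _)).
  apply: le_trans (ler_piMr _ (slab_le1 _ _ _)) _ => //.
  by apply: le_trans (ler_normB _ _) _; apply: lerD.
have cn0 : (fun n => \int[m]_z `|cn n z|%:E)%E @ \oo --> 0%E.
  apply: (cvge0_le _ _ (cvge0Z ((t0 - s0) * `|B2|) cc_L1)) => n; first exact: int_ge0.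
  have mcc : measurable_fun setT (fun x => `|cc n x|) by apply: measurable_abs; exact: measurable_funB.
  have mcc2 : measurable_fun setT (fun x => `|B2| * `|cc n x|) by exact: measurable_funM.
  rewrite EFinM -muleA -(@intZ _ _ _ lebE setT measurableT `|B2| (fun x => `|cc n x|))//.
  rewrite -(int_tensor mcc2 (fun x => mulr_ge0 (normr_ge0 _) (normr_ge0 _)) s0t0').
  apply: int_le => // z _; rewrite normrM (ger0_norm (slab_ge0 _ _ _)) ler_wpM2r//.
  by apply: le_trans (dthL _ _) _; rewrite ler_wpM2r// ler_norm.
have H2 := pairing_cvg0 measurableT (FG_int i) mcn cnB cn0.
apply: (cvge0_le _ _ (cvge0D H1 H2)) => n.
  by apply: int_ge0 => // z _; rewrite mulr_ge0.
have mwz : measurable_fun setT (fun z : E * RR => `|F i z| * `|wi i n z.1|).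
  apply: measurable_funM; first exact: measurable_abs.
  by apply: measurable_abs; exact: (measurableT_comp (mwi n) measurable_fst).
rewrite -(@intZ _ _ _ m setT measurableT B1 (fun z => `|F i z| * `|wi i n z.1|))//.
have mgz : measurable_fun setT (fun z : E * RR => gi i z.1) by exact: (measurableT_comp (mgi i) measurable_fst).
rewrite -(@intD _ _ _ m setT measurableT (fun z => B1 * (`|F i z| * `|wi i n z.1|))
   (fun z => `|F i z * gi i z.1| * `|cn n z|)); last 4 first.
- exact: measurable_funM.
- apply: measurable_funM; apply: measurable_abs => //; exact: measurable_funM.
- by move=> z _; rewrite !mulr_ge0.
- by move=> z _; rewrite !mulr_ge0.
apply: int_le => // z _.
have [zI|zI] := boolP (s0 < z.2 < t0); last first.
  by rewrite F0'; [rewrite normr0 !mul0r mulr0 add0r|exact/negP].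
rewrite /cn /slab zI mulr1 eta_d /Phi -/(v z.1) -/(gi i z.1).
rewrite normrM -mulrA mulrCA -mulrDr ler_wpM2l// -normrM.
have -> : 'D_1 th (phi n z.1) * 'D_(delta_mx ord0 i) (phi n) z.1 - 'D_1 th (v z.1) * gi i z.1 =
  'D_1 th (phi n z.1) * wi i n z.1 + gi i z.1 * ('D_1 th (phi n z.1) - 'D_1 th (v z.1)).
  by rewrite /wi; ring.
apply: le_trans (ler_normD _ _) _; rewrite lerD2r normrM ler_wpM2r//.
Qed.

Let Kpart : (fun n => \int[m]_z (`|K0 z| *
   `|eta n z.1 - Th (z.1, sg)|)%:E)%E @ \oo --> 0%E.
Proof.
pose cn n (z : E * RR) := (eta n z.1 - Th (z.1, sg)) * slab s0 t0 z.
have mTh : measurable_fun setT (fun x => Th (x, sg)) by exact: (measurableT_comp mth mv).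
have meta n : measurable_fun setT (eta n) by exact: (measurableT_comp mth (mphi n)).
have mcn n : measurable_fun setT (cn n).
  apply: measurable_funM; last exact: measurable_slab.
  apply: measurable_funB; first exact: (measurableT_comp (meta n) measurable_fst).
  exact: (measurableT_comp mTh measurable_fst).
have cnB n z : setT z -> `|cn n z| <= 1 + 1.
  move=> _; rewrite normrM (ger0_norm (slab_ge0 _ _ _)).
  apply: le_trans (ler_piMr _ (slab_le1 _ _ _)) _ => //.
  apply: le_trans (ler_normB _ _) _; apply: lerD; exact: thB.
have cn0 : (fun n => \int[m]_z `|cn n z|%:E)%E @ \oo --> 0%E.
  apply: (cvge0_le _ _ (cvge0Z (t0 - s0) eta_L1)) => n; first exact: int_ge0.
  have mcc : measurable_fun setT (fun x => `|eta n x - Th (x, sg)|) by apply: measurable_abs; exact: measurable_funB.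
  rewrite -(int_tensor mcc (fun x => normr_ge0 _) s0t0').
  by apply: int_le => // z _; rewrite normrM (ger0_norm (slab_ge0 _ _ _)).
have H2 := pairing_cvg0 measurableT iK0 mcn cnB cn0.
apply: (cvge0_le _ _ H2) => n; first by apply: int_ge0 => // z _; rewrite mulr_ge0.
apply: int_le => // z _.
have [zI|zI] := boolP (s0 < z.2 < t0); first by rewrite /cn /slab zI mulr1.
by rewrite K00; [rewrite normr0 !mul0r|move=> [_]; exact/negP].
Qed.

Let mass_j n t := \int[lebE]_(x in Om) (S (U t x) * eta n x).
Let mass_lim t := \int[lebE]_(x in Om) (S (U t x) * Th (x, sg)).
Let k_j n (z : E * RR) := \sum_i F i z * 'D_(delta_mx ord0 i) (eta n) z.1 + K0 z * eta n z.1.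

Let mSU t : measurable_fun setT (fun x => S (U t x)).
Proof. exact: (measurableT_comp mS (mU t)). Qed.

Let meta n : measurable_fun setT (eta n).
Proof. exact: (measurableT_comp mth (mphi n)). Qed.

Let mTh : measurable_fun setT (fun x => Th (x, sg)).
Proof. exact: (measurableT_comp mth mv). Qed.

Let BS0 : 0 <= BS. Proof. exact: le_trans (SB 0). Qed.

Let int_Om (f : E -> R) M : measurable_fun setT f -> (forall x, `|f x| <= M) ->
  lebE.-integrable Om (EFin \o f).
Proof.
move=> mf fM; apply: measurable_bounded_integrable.
- exact: mOm.
- exact: Omfin.
- exact: measurable_funS mf.
by exists M; split; [exact: num_real|] => y yM x _; apply: le_trans (fM x) _; exact: ltW.
Qed.

Let mass_dist n t : (`|mass_lim t - mass_j n t|%:E <=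
   BS%:E * \int[lebE]_x `|eta n x - Th (x, sg)|%:E)%E.
Proof.
have iA : lebE.-integrable Om (EFin \o (fun x => S (U t x) * Th (x, sg))).
  apply: (@int_Om _ (BS * 1)); first exact: measurable_funM.
  by move=> x; rewrite normrM; apply: ler_pM => //; exact: thB.
have iB : lebE.-integrable Om (EFin \o (fun x => S (U t x) * eta n x)).
  apply: (@int_Om _ (BS * 1)); first exact: measurable_funM.
  by move=> x; rewrite normrM; apply: ler_pM => //; exact: thB.
apply: le_trans (Rint_dist mOm iA iB) _.
have mcc : measurable_fun setT (fun x => `|eta n x - Th (x, sg)|) by apply: measurable_abs; exact: measurable_funB.
rewrite -(@intZ _ _ _ lebE setT measurableT BS (fun x => `|eta n x - Th (x, sg)|))//.
rewrite -(@integral_supp _ _ _ lebE Om (fun x => (BS * `|eta n x - Th (x, sg)|)%:E) mOm); last first.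
  move=> x nO; rewrite (test_out (test_eta n) nO) /Th -/(v x) v_out// trunc0 th0.
  by rewrite subrr normr0 mulr0.
apply: int_le => // x Ox; rewrite -mulrBr normrM distrC ler_wpM2r//.
Qed.

Let kj_int n : m.-integrable setT (EFin \o k_j n).
Proof.
apply: (integrable_addr measurableT).
  apply: integrable_sum_real => i.
  have td := test_deriv (delta_mx ord0 i) hausdorff_rV (test_eta n).
  have [B HB] := test_bounded td.
  apply: (@integrable_mul_bounded _ _ _ m _ (fun z : E * RR => 'D_(delta_mx ord0 i) (eta n) z.1) _ (Fint i)).
    have md : measurable_fun setT ('D_(delta_mx ord0 i) (eta n)).
      by apply: continuous_measurable_rV; apply: smooth_continuous; case: td.
    exact: (measurableT_comp md measurable_fst).
  by move=> z; exact: HB.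
apply: (@integrable_mul_bounded _ _ _ m _ (fun z : E * RR => eta n z.1) 1 iK0).
  exact: (measurableT_comp (meta n) measurable_fst).
by move=> z; exact: thB.
Qed.

Let k_dist n al be : (`|\int[m]_z (kslice sg z * slab al be z) - \int[m]_z (k_j n z * slab al be z)|%:E <=
  \sum_i \int[m]_z (`|F i z| * `|'D_(delta_mx ord0 i) (eta n) z.1 - Phi i (z.1, sg)|)%:E +
  \int[m]_z (`|K0 z| * `|eta n z.1 - Th (z.1, sg)|)%:E)%E.
Proof.
have sB (z : E * RR) : `|slab al be z| <= 1 by rewrite ger0_norm ?slab_ge0 ?slab_le1.
have i1 : m.-integrable setT (EFin \o (fun z => kslice sg z * slab al be z)).
  exact: (integrable_mul_bounded kslice_integrable (measurable_slab al be) sB).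
have i2 : m.-integrable setT (EFin \o (fun z => k_j n z * slab al be z)).
  exact: (integrable_mul_bounded (kj_int n) (measurable_slab al be) sB).
apply: le_trans (Rint_dist measurableT i1 i2) _.
have mg i : measurable_fun setT (fun z : E * RR =>
    `|F i z| * `|'D_(delta_mx ord0 i) (eta n) z.1 - Phi i (z.1, sg)|).
  apply: measurable_funM; first exact: measurable_abs.
  apply: measurable_abs; apply: measurable_funB.
    have td := test_deriv (delta_mx ord0 i) hausdorff_rV (test_eta n).
    have md : measurable_fun setT ('D_(delta_mx ord0 i) (eta n)).
      by apply: continuous_measurable_rV; apply: smooth_continuous; case: td.
    exact: (measurableT_comp md measurable_fst).
  apply: measurable_funM; first exact: (measurableT_comp mdth (measurableT_comp mv measurable_fst)).
  exact: (measurableT_comp (mgi i) measurable_fst).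
have mK0 : measurable_fun setT K0 by case/integrableP : iK0 => /measurable_EFinP.
have mg2 : measurable_fun setT (fun z : E * RR => `|K0 z| * `|eta n z.1 - Th (z.1, sg)|).
  apply: measurable_funM; first exact: measurable_abs.
  apply: measurable_abs; apply: measurable_funB; first exact: (measurableT_comp (meta n) measurable_fst).
  exact: (measurableT_comp mTh measurable_fst).
rewrite -(@integral_sum_le _ _ _ m _ _ mg); last by move=> i z; rewrite mulr_ge0.
rewrite -(@intD _ _ _ m setT measurableT); last 4 first.
- by apply: measurable_sum.
- exact: mg2.
- by move=> z _; apply: sumr_ge0 => i _; rewrite mulr_ge0.
- by move=> z _; rewrite mulr_ge0.
apply: int_le => // z _.
rewrite -mulrBl normrM (ger0_norm (slab_ge0 _ _ _)).
apply: le_trans (ler_piMr _ (slab_le1 _ _ _)) _ => //.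
rewrite distrC /kslice /k_j.
rewrite (_ : _ - _ = \sum_i F i z * ('D_(delta_mx ord0 i) (eta n) z.1 - Phi i (z.1, sg)) +
    K0 z * (eta n z.1 - Th (z.1, sg))); last first.
  under [X in _ = X + _]eq_bigr do rewrite mulrBr.
  by rewrite sumrB; ring.
apply: le_trans (ler_normD _ _) _; rewrite normrM lerD2r.
apply: le_trans (ler_norm_sum _ _ _) _.
by apply: ler_sum => i _; rewrite normrM.
Qed.

Let slice_id n al be : s0 < al -> al < be -> be < t0 ->
  mass_j n be - mass_j n al + \int[m]_z (k_j n z * slab al be z) = 0.
Proof.
move=> h1 h2 h3.
have c_cont sg' : s0 < sg' < t0 ->
   (fun t => \int[lebE]_(x in Om) `|S (U t x) - S (U sg' x)|%:E)%E @ sg' --> 0%E.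
  move=> /Ucont h.
  have {h} := cvgeZl (_ : LS%:E \is a fin_num) h; rewrite mule0 => /(_ isT) h.
  apply: (@squeeze_cvge _ _ _ _ (cst 0%E) _
     (fun t => LS%:E * \int[lebE]_(x in Om) `|U t x - U sg' x|%:E)%E) => //; last exact: cvg_cst.
  apply: nearW => t; rewrite /cst int_ge0//=.
  rewrite -(@intZ _ _ _ lebE Om mOm LS (fun x => `|U t x - U sg' x|))//.
    by apply: int_le => // x Ox.
  by apply: measurable_abs; apply: measurable_funB; exact: measurable_funS (mU _).
have cC : {ae leb, forall t, s0 < t < t0 ->
    {ae lebE, forall x, Om x -> S (u (x, t)) = S (U t x)}}.
  apply: leb_aeS uU => t + tI => /(_ tI); apply: filterS => x + Ox.
  by move=> /(_ Ox) ->.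
have := @slice_identity R N Om s0 t0 BS 1 oOm Omfin (S \o u) (fun t x => S (U t x)) (k_j n) (eta n)
  (measurableT_comp mS mu) _ _ mSU _ c_cont cC (kj_int n) (meta n) _ _ al be h1 h2 h3.
apply.
- by move=> z nQ; rewrite /= u0.
- by move=> z; exact: SB.
- by move=> t x; exact: SB.
- by move=> x; exact: thB.
- by move=> h /eqn/(_ (test_eta n)) <-.
Qed.

(** The equation holds for the test functions th \o phi_n, where phi_n
    approximates T_k(u(., sg)); their gradients converge in L^p up to the factor
    th'(phi_n), which is bounded and converges in L^1. *)
Lemma slice_id_lim al be : s0 < al -> al < be -> be < t0 ->
  mass_lim be - mass_lim al + \int[m]_z (kslice sg z * slab al be z) = 0.
Proof.
move=> h1 h2 h3.
pose a n := (BS%:E * \int[lebE]_x `|eta n x - Th (x, sg)|%:E +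
    BS%:E * \int[lebE]_x `|eta n x - Th (x, sg)|%:E +
  (\sum_i \int[m]_z (`|F i z| * `|'D_(delta_mx ord0 i) (eta n) z.1 - Phi i (z.1, sg)|)%:E +
  \int[m]_z (`|K0 z| * `|eta n z.1 - Th (z.1, sg)|)%:E))%E.
apply: (@cvg0_eq0 _ _ a); last first.
  apply: cvge0D; first by apply: cvge0D; exact: cvge0Z.
  by apply: cvge0D; [exact: (cvge0_sum _ Fpart)|exact: Kpart].
move=> n; have id0 := slice_id n h1 h2 h3.
have -> : mass_lim be - mass_lim al + \int[m]_z (kslice sg z * slab al be z) =
  (mass_lim be - mass_j n be) - (mass_lim al - mass_j n al) +
  (\int[m]_z (kslice sg z * slab al be z) - \int[m]_z (k_j n z * slab al be z)).
  by move: id0; lra.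
apply: (@le_trans _ _ (`|mass_lim be - mass_j n be|%:E + `|mass_lim al - mass_j n al|%:E +
   `|\int[m]_z (kslice sg z * slab al be z) - \int[m]_z (k_j n z * slab al be z)|%:E)%E).
  rewrite -!EFinD lee_fin; apply: le_trans (ler_normD _ _) _; rewrite lerD2r.
  exact: ler_normB.
by apply: leeD; [apply: leeD; exact: mass_dist|exact: k_dist].
Qed.

End approx.

Hypothesis kk0 : 0 <= kk.

(** Since Psi and S are only compared at the two times sg - de and sg, with the test
    function taken at the later one, the convexity inequality [Sineq] has the right
    sign. *)
Lemma slice_ineq_fixed de : 0 < de -> s0 < sg - de ->
  energy sg - energy (sg - de) + \int[m]_z (kslice sg z * slab (sg - de) sg z) <= 0.
Proof.
move=> de0 sde; have [_ _ [phi [tphi c0 c1]]] := W0s.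
have dd : sg - de < sg by rewrite ltrBlDr ltrDl.
have st : sg < t0 by case/andP : sgI.
have <- := slice_id_lim tphi c0 c1 kk0 sde dd st.
rewrite lerD2r.
have BS0 : 0 <= BS by exact: le_trans (SB 0).
have int_Om (f : E -> R) M : measurable_fun setT f -> (forall x, `|f x| <= M) ->
    lebE.-integrable Om (EFin \o f).
  move=> mf fM; apply: measurable_bounded_integrable.
  - exact: mOm.
  - exact: Omfin.
  - exact: measurable_funS mf.
  by exists M; split; [exact: num_real|] => y yM x _; apply: le_trans (fM x) _; exact: ltW.
have mTh : measurable_fun setT (fun x => Th (x, sg)) by exact: (measurableT_comp mth mv).
have iP t : lebE.-integrable Om (EFin \o (fun x => Psi (U t x))).
  by apply: (@int_Om _ BS) => //; exact: (measurableT_comp mPsi (mU t)).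
have iS t : lebE.-integrable Om (EFin \o (fun x => S (U t x) * Th (x, sg))).
  apply: (@int_Om _ (BS * 1)).
    by apply: measurable_funM => //; exact: (measurableT_comp mS (mU t)).
  by move=> x; rewrite normrM; apply: ler_pM => //; exact: thB.
rewrite /energy -(RintegralB mOm (iP _) (iP _)) -(RintegralB mOm (iS _) (iS _)).
pose l x := Psi (U sg x) - Psi (U (sg - de) x).
pose r x := S (U sg x) * Th (x, sg) - S (U (sg - de) x) * Th (x, sg).
have il : lebE.-integrable Om (EFin \o l) by exact: (integrableB mOm (iP _) (iP _)).
have ir : lebE.-integrable Om (EFin \o r) by exact: (integrableB mOm (iS _) (iS _)).
have ml : measurable_fun Om l by case/integrableP : il => /measurable_EFinP.
have mr : measurable_fun Om r by case/integrableP : ir => /measurable_EFinP.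
rewrite -lee_fin /Rintegral.
rewrite !fineK; last 2 first.
- exact: (integrable_fin_num mOm ir).
- exact: (integrable_fin_num mOm il).
have -> : (\int[lebE]_(x in Om) (r x)%:E = \int[lebE]_(x in Om) (Num.max (l x) (r x))%:E)%E.
  apply: integral_eq_ae => //; apply: filterS uUs => x + Ox => /(_ Ox) ux.
  congr EFin; apply/esym/max_idPr; rewrite /l /r -mulrBl.
  by rewrite /Th ux; exact: Sineq.
apply: le_integral => //; last by move=> x _; rewrite lee_fin le_max lexx.
have mx : measurable_fun Om (fun x => Num.max (l x) (r x)) by exact: measurable_maxr.
apply: (integrable_le mOm mx (integrableD mOm (integrable_norm il) (integrable_norm ir))).
move=> x _ /=; rewrite [leRHS]ger0_norm ?addr_ge0//.
by rewrite /Num.max; case: ifP => _; rewrite ?lerDr ?lerDl.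
Qed.

End fixed_time.

Hypothesis kk0 : 0 <= kk.
Hypothesis W0 : {ae leb, forall t, s0 < t < t0 ->
  in_W0 Om p (fun x => trunc kk (u (x, t))) (fun x => G (x, t))}.

Theorem slice_ineq : {ae leb, forall sg, s0 < sg < t0 ->
  m.-integrable setT (EFin \o kslice sg) /\
  forall de, 0 < de -> s0 < sg - de ->
    energy sg - energy (sg - de) + \int[m]_z (kslice sg z * slab (sg - de) sg z) <= 0}.
Proof.
apply: leb_aeS (leb_aeI uU W0) => sg [h1 h2] sgI.
split; first exact: (kslice_integrable (h2 sgI)).
move=> de; exact: (slice_ineq_fixed sgI (h1 sgI) (h2 sgI) kk0).
Qed.

End energy_slice.

(** * Averaging over the time slice *)

Section primitive.
Context {R : realType}.
Local Notation leb := (@lebesgue_measure R).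

(** As f vanishes on the left, its primitive may be defined by integration from a fixed
    point far to the left. *)
Lemma primitive_left (f : R -> R) (M : R) : continuous f ->
  (forall x, x < M -> f x = 0) ->
  exists F : R -> R, forall x : R, is_derive x 1 F (f x).
Proof.
move=> cf f0; pose F x := (\int[leb]_(t in [set` Interval -oo%O (BRight x)]) f t)%R.
exists F => x.
have int u : leb.-integrable [set` Interval -oo%O (BRight u)] (EFin \o f).
  have mI : measurable ([set` Interval -oo%O (BRight u)] : set (measurableTypeR R)) by exact: measurable_itv.
  have mJ : measurable (`[M, u]%classic : set (measurableTypeR R)) by exact: measurable_itv.
  have iJ : leb.-integrable `[M, u]%classic (EFin \o f).
    apply: continuous_compact_integrable; first exact: segment_compact.
    exact: continuous_subspaceT.
  have -> : EFin \o f = (EFin \o f) \_ `[M, +oo[%classic.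
    apply/funext => t; rewrite patchE; case: ifPn => //; rewrite notin_setE/= in_itv/= andbT => /negP.
    by rewrite -ltNge => /f0 ->.
  apply/integrable_restrict => //.
  rewrite (_ : _ `&` _ = `[M, u]%classic)//.
  apply/seteqP; split => t /=; rewrite !in_itv/= ?andbT; first by move=> [-> ->].
  by move=> /andP[].
have x1 : x < x + 1 by rewrite ltrDl.
have [dF F'] := continuous_FTC1 x1 (int (x + 1)) (ltNyr x) (cf x).
by apply: DeriveDef; rewrite -?derive1E.
Qed.

End primitive.

Section average.
Context {R : realType}.
Local Notation leb := (@lebesgue_measure R).
Local Notation RR := (measurableTypeR R).

(** e is continued continuously to the line; the integral of the difference quotient
    of e is the difference of two difference quotients of a primitive. *)
Lemma steklov_cvg (e : R -> R) (s0 t0 a b : R) : s0 < a -> a < b -> b < t0 ->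
  (forall sg, s0 < sg < t0 -> e @ sg --> e sg) ->
  (fun n => \int[leb]_(s in `[a, b]) (n.+1%:R * (e s - e (s - dl n)))) @ \oo --> e b - e a.
Proof.
move=> s0a ab bt0 ce.
(* times before a are needed, and stay in the interval where e is continuous *)
pose a' := (s0 + a) / 2.
have [a'1 a'2] : s0 < a' /\ a' < a by rewrite /a'; split; lra.
pose cl s := Num.max a' (Num.min b s).
have cl_lip y z : `|cl y - cl z| <= 1 * `|y - z|.
  rewrite mul1r; wlog yz : y z / z <= y.
    by move=> H; case: (leP z y) => h; [exact: H|rewrite distrC (distrC y); apply: H; exact: ltW].
  rewrite [leRHS]ger0_norm ?subr_ge0// /cl ler_norml /Num.max /Num.min.
  case: (ltP b y) => h1; case: (ltP b z) => h2; case: ltP => h3; case: ltP => h4;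
  by apply/andP; split; lra.
have cl_in s : s0 < cl s < t0.
  by rewrite /cl lt_max a'1 gt_max gt_min bt0/= (lt_trans a'2)// (lt_trans ab).
have clid s : a' <= s <= b -> cl s = s.
  by move=> /andP[h1 h2]; rewrite /cl min_r// max_r.
pose f s := e (cl s) - e a'.
have cf : continuous f.
  move=> s; apply: cvgB; last exact: cvg_cst.
  apply: (@continuous_comp _ _ _ cl e); last exact: ce.
  exact: (lipschitz_continuous cl_lip).
have f0 s : s < a' -> f s = 0.
  move=> sa; rewrite /f /cl min_r; last by lra.
  by rewrite max_l ?subrr// ltW.
have [F dF] := primitive_left cf f0.
have incr n : dl n < a - a' -> \int[leb]_(s in `[a, b]) (n.+1%:R * (e s - e (s - dl n))) =
    n.+1%:R * (F b - F (b - dl n)) - n.+1%:R * (F a - F (a - dl n)).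
  move=> da.
  have dshift (s : R) : is_derive s 1 (fun x : R => n.+1%:R * (F x - F (x - dl n)))
      (n.+1%:R * (f s - f (s - dl n))).
    have d1 : is_derive s 1 (fun x : R => x - dl n) 1.
      by have := is_deriveB (is_derive_id s 1) (is_derive_cst (dl n) s 1); rewrite subr0.
    have d2 := is_derive_comp d1 (dF (s - dl n)).
    have d3 := is_deriveB (dF s) d2.
    have d4 := is_deriveZ (n.+1%:R : R) d3.
    by apply: (is_derive_eq (d4 : is_derive s 1 (fun x : R => n.+1%:R * (F x - F (x - dl n))) _)); rewrite mulr1.
  have cshift : continuous (fun s => n.+1%:R * (f s - f (s - dl n))).
    move=> s; apply: cvgM; first exact: cvg_cst.
    apply: cvgB; first exact: cf.
    apply: (@continuous_comp _ _ _ (fun s => s - dl n) f); last exact: cf.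
    by apply: cvgB; [exact: cvg_id|exact: cvg_cst].
  have H := FTC2 (ltW ab) dshift cshift.
  rewrite /Rintegral.
  have -> : (\int[leb]_(s in `[a, b]) (n.+1%:R * (e s - e (s - dl n)))%:E =
     \int[leb]_(s in `[a, b]) (n.+1%:R * (f s - f (s - dl n)))%:E)%E.
    apply: eq_integral => s; rewrite inE/= in_itv/= => /andP[h1 h2].
    have dn := @dl_gt0 R n.
    rewrite /f !clid; last 2 first.
    - by apply/andP; split; lra.
    - by apply/andP; split; lra.
    by congr (_ * _)%:E; ring.
  by rewrite H.
have lim x : a' < x -> x <= b -> (fun n => n.+1%:R * (F x - F (x - dl n))) @ \oo --> e x - e a'.
  move=> ax xb.
  have -> : e x - e a' = f x by rewrite /f clid// (ltW ax) xb.
  have [dx Fx] := dF x.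
  have hd : (fun h : R => h^-1 *: (F (h *: (1 : R) + x) - F x)) @ 0^' --> f x.
    rewrite -Fx; exact: dx.
  have hn : (fun n => - dl n : R) @ \oo --> (0 : R)^'.
    have h0 : (fun n => - dl n : R) @ \oo --> (0 : R).
      rewrite -oppr0; apply: cvgN; exact: cvg_harmonic.
    move=> A hA; change (\forall n \near \oo, A (- dl n)).
    have hh : \forall n \near \oo, - dl n != 0 :> R -> A (- dl n).
      exact: (h0 _ (hA : nbhs (0 : R) (fun y => y != 0 -> A y))).
    apply: filterS hh => n; apply.
    by rewrite oppr_eq0 gt_eqF// dl_gt0.
  have := cvg_comp _ _ hn hd; apply: cvg_trans; apply: near_eq_cvg; apply: nearW => n /=.
  rewrite /GRing.scale/= mulr1 (addrC _ x) invrN /dl invrK; ring.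
have main : (fun n => n.+1%:R * (F b - F (b - dl n)) - n.+1%:R * (F a - F (a - dl n))) @ \oo
    --> e b - e a.
  have -> : e b - e a = (e b - e a') - (e a - e a') by ring.
  by apply: cvgB; apply: lim => //; [exact: lt_trans ab|exact: ltW].
apply: cvg_trans main; apply: near_eq_cvg.
have h0 : (fun n => dl n : R) @ \oo --> (0 : R) by exact: cvg_harmonic.
have aa : 0 < a - a' by rewrite subr_gt0.
move/cvgrPdist_lt : h0 => /(_ _ aa); apply: filterS => n; rewrite sub0r normrN => h.
by rewrite -incr// (le_lt_trans (ler_norm _)).
Qed.

Lemma meas3_arg1 d (X : measurableType d) (f : X * RR -> R) : measurable_fun setT f ->
  meas3 (fun x t s => f (x, t)).
Proof.
move=> mf.
have mm : measurable_fun setT (fun w : (X * RR) * RR => (w.1.1, w.2)).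
  apply: measurable_fun_pair; last exact: measurable_snd.
  by apply: measurableT_comp.
exact: (measurableT_comp mf mm).
Qed.

Lemma meas3_arg2 d (X : measurableType d) (f : X * RR -> R) : measurable_fun setT f ->
  meas3 (fun x t s => f (x, s)).
Proof.
move=> mf.
have mm : measurable_fun setT (fun w : (X * RR) * RR => (w.1.1, w.1.2)).
  by apply: measurable_fun_pair; apply: measurableT_comp.
exact: (measurableT_comp mf mm).
Qed.

Section pairing.
Context d {X : measurableType d}.
Variable m1 : {sigma_finite_measure set X -> \bar R}.
Local Notation m := (m1 \x leb)%E.
Variables (a b p : R).
Hypothesis ab : a <= b.
Hypothesis p1 : 1 < p.

(** Continuity of translations in duality with L^p. Where g is bounded it follows from
    the L^1 case; on the large values of g, Young's inequality with a small weight on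
    f leaves an arbitrarily small tail of |g|^p. *)
Lemma V_pairing (f g : X * RR -> R) : measurable_fun setT f -> measurable_fun setT g ->
  (\int[m]_z `|f z|%:E < +oo)%E ->
  (\int[m]_z (`|f z| `^ (p / (p - 1)))%:E < +oo)%E ->
  (\int[m]_z (`|g z| `^ p)%:E < +oo)%E ->
  (fun n => V a b m1 n (fun x t s => `|f (x, t) - f (x, s)| * `|g (x, s)|)) @ \oo --> 0%E.
Proof.
move=> mf mg f1 fq gp.
set q := p / (p - 1) in fq.
have p0 : 0 < p by rewrite (lt_trans ltr01).
have q0 : 0 < q by rewrite divr_gt0// subr_gt0.
set Cf := (\int[m]_z (`|f z| `^ q)%:E)%E in fq.
have Cf0 : (0 <= Cf)%E by apply: int_ge0 => // z _; exact: powR_ge0.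
have Cff : Cf \is a fin_num by rewrite ge0_fin_numE.
have k0 : forall x t s, 0 <= `|f (x, t) - f (x, s)| * `|g (x, s)| by move=> *; rewrite mulr_ge0.
apply/(cvge0P (fun n => @V_ge0 _ _ _ _ _ m1 n _ k0)) => e e0.
pose K := fine Cf + 1.
have K0 : 0 < K by rewrite ltr_wpDl// fine_ge0.
(* Young's inequality is used twice, at times t and s; each of the four terms gets e / 4 *)
pose ka := e / 4 / K.
have e40 : 0 < e / 4 by rewrite divr_gt0.
have ka0 : 0 < ka by rewrite divr_gt0.
have mgp : measurable_fun setT (fun z => `|g z| `^ p).
  exact: measurable_powRl (measurable_abs mg).
have igp : m.-integrable setT (EFin \o (fun z => `|g z| `^ p)).
  apply: integrable_real => //; apply: le_lt_trans gp; apply: int_le => // z _.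
  by rewrite ger0_norm// powR_ge0.
pose c := 2 * ka `^ (1 - p).
have c0 : 0 < c by rewrite mulr_gt0// powR_gt0.
have ec : 0 < e / 4 / c by rewrite divr_gt0.
have [M M0 HM] := integrable_tail measurableT igp ec.
pose h z := `|g z| `^ p * (M < `| `|g z| `^ p|)%R%:R.
have h0 z : 0 <= h z by rewrite mulr_ge0 ?powR_ge0.
have mh : measurable_fun setT h.
  apply: measurable_funM => //.
  apply: (@measurableT_comp _ _ _ _ _ _ (fun b : bool => b%:R : R)) => //.
  by apply: measurable_fun_ltr => //; exact: measurable_abs.
have Hh : (\int[m]_z (h z)%:E <= (e / 4 / c)%:E)%E.
  by apply: le_trans HM; apply: int_le => // z _; rewrite /h (ger0_norm (powR_ge0 _ _)).
pose mm := M `^ p^-1.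
have mm0 : 0 <= mm by exact: powR_ge0.
have bound x t s : `|f (x, t) - f (x, s)| * `|g (x, s)| <=
    mm * `|f (x, t) - f (x, s)| + (ka * `|f (x, t)| `^ q + (ka * `|f (x, s)| `^ q + c * h (x, s))).
  set F := `|f (x, t) - f (x, s)|.
  have [hM|hM] := leP (`|g (x, s)| `^ p) M.
    have gm : `|g (x, s)| <= mm.
      have -> : `|g (x, s)| = (`|g (x, s)| `^ p) `^ p^-1.
        by rewrite -powRrM divff ?gt_eqF// powRr1.
      by apply: le_powR; [rewrite invr_ge0 ltW|exact: powR_ge0|].
    apply: ler_wpDr; last by rewrite mulrC; exact: ler_wpM2r (normr_ge0 _) _ _ gm.
    by rewrite !addr_ge0// mulr_ge0 ?powR_ge0//; [exact: ltW|exact: ltW|exact: ltW].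
  apply: ler_wpDl; first exact: (mulr_ge0 mm0 (normr_ge0 _)).
  have hE : h (x, s) = `|g (x, s)| `^ p.
    by rewrite /h (ger0_norm (powR_ge0 _ _)) hM mulr1.
  rewrite hE.
  have y1 := young p1 ka0 (normr_ge0 (f (x, t))) (normr_ge0 (g (x, s))).
  have y2 := young p1 ka0 (normr_ge0 (f (x, s))) (normr_ge0 (g (x, s))).
  apply: (@le_trans _ _ (`|f (x, t)| * `|g (x, s)| + `|f (x, s)| * `|g (x, s)|)).
    by rewrite -mulrDl ler_wpM2r// ler_normB.
  by apply: le_trans (lerD y1 y2) _; rewrite -/q /c le_eqVlt; apply/orP; left; apply/eqP; ring.
have mfq : measurable_fun setT (fun z => `|f z| `^ q) by exact: measurable_powRl (measurable_abs mf).
have mq1 := meas3_arg1 mfq; have mq2 := meas3_arg2 mfq; have mh2 := meas3_arg2 mh.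
have mD := meas3_diff mf.
have D0 : forall (x : X) (t s : RR), 0 <= `|f (x, t) - f (x, s)| by [].
have Q0 : forall (z : X * RR), 0 <= `|f z| `^ q by move=> z; exact: powR_ge0.
have lim := cvge0Z mm (V_cvg0 ab mf f1 : (fun n => V a b m1 n _) @ \oo --> 0%E).
have Vge n : (0 <= mm%:E * V a b m1 n (fun x t s => `|f (x, t) - f (x, s)|%R))%E.
  by apply: mule_ge0; [rewrite lee_fin|apply: V_ge0].
move/(cvge0P Vge) : lim => /(_ _ e40); apply: filterS => n Hn.
apply: (le_trans (V_le m1 k0 (fun x t s _ _ => bound x t s))).
have T1 : forall (x : X) (t s : RR), 0 <= mm * `|f (x, t) - f (x, s)| by move=> *; rewrite mulr_ge0.
have T2 : forall (x : X) (t s : RR), 0 <= ka * `|f (x, t)| `^ q.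
  by move=> *; exact: (mulr_ge0 (ltW ka0) (powR_ge0 _ _)).
have T3 : forall (x : X) (t s : RR), 0 <= ka * `|f (x, s)| `^ q.
  by move=> *; exact: (mulr_ge0 (ltW ka0) (powR_ge0 _ _)).
have T4 : forall (x : X) (t s : RR), 0 <= c * h (x, s).
  by move=> *; exact: (mulr_ge0 (ltW c0) (h0 _)).
have M1 : meas3 (fun x (t s : R) => mm * `|f (x, t) - f (x, s)|) by exact: measurable_funM.
have M2 : meas3 (fun x (t s : R) => ka * `|f (x, t)| `^ q) by exact: measurable_funM.
have M3 : meas3 (fun x (t s : R) => ka * `|f (x, s)| `^ q) by exact: measurable_funM.
have M4 : meas3 (fun x (t s : R) => c * h (x, s)) by exact: measurable_funM.
have M34 : meas3 (fun x (t s : R) => ka * `|f (x, s)| `^ q + c * h (x, s)) by exact: measurable_funD.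
have M234 : meas3 (fun x (t s : R) => ka * `|f (x, t)| `^ q + (ka * `|f (x, s)| `^ q + c * h (x, s))).
  exact: measurable_funD.
rewrite (VD a b m1 n M1 M234 T1 (fun x t s => addr_ge0 (T2 x t s) (addr_ge0 (T3 x t s) (T4 x t s)))).
rewrite (VD a b m1 n M2 M34 T2 (fun x t s => addr_ge0 (T3 x t s) (T4 x t s))).
rewrite (VD a b m1 n M3 M4 T3 T4).
rewrite (VZ a b m1 n mm0 mD D0) (VZ a b m1 n (ltW ka0) mq1 (fun x t s => Q0 _)).
rewrite (VZ a b m1 n (ltW ka0) mq2 (fun x t s => Q0 _)) (VZ a b m1 n (ltW c0) mh2 (fun x t s => h0 _)).
have -> : e = e / 4 + (e / 4 + (e / 4 + e / 4)) by field.
have kCf (v : \bar R) : (v <= Cf)%E -> (ka%:E * v <= (e / 4)%:E)%E.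
  move=> vC; apply: (@le_trans _ _ (ka%:E * Cf)%E).
    by apply: lee_wpmul2l => //; rewrite lee_fin ltW.
  rewrite -(fineK Cff) -EFinM lee_fin /ka mulrAC ler_pdivrMr// ler_wpM2l ?(ltW e40)//.
  by rewrite /K lerDl.
rewrite !EFinD; apply: leeD => //; apply: leeD; first exact: kCf (V_arg1 a b m1 mfq n Q0).
apply: leeD; first exact: kCf (V_arg2 a b m1 mfq n Q0).
apply: (@le_trans _ _ (c%:E * (e / 4 / c)%:E)%E).
  apply: lee_wpmul2l; first by rewrite lee_fin ltW.
  exact: le_trans (V_arg2 a b m1 mh n h0) Hh.
by rewrite -EFinM lee_fin mulrC divfK ?gt_eqF.
Qed.

End pairing.
End average.

Section averaged.
Context {R : realType} {N : nat}.
Local Notation E := 'rV[R]_N.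
Local Notation leb := (@lebesgue_measure R).
Local Notation RR := (measurableTypeR R).
Local Notation lebE := (lebesgue_rV N : {sigma_finite_measure set E -> \bar R}).
Local Notation m := (lebE \x leb)%E.

Lemma Rint_tensor (w : E -> R) (al be : R) : lebE.-integrable setT (EFin \o w) -> al <= be ->
  m.-integrable setT (EFin \o (fun z : E * RR => w z.1 * slab al be z)) /\
  \int[m]_z (w z.1 * slab al be z) = (be - al) * \int[lebE]_x w x.
Proof.
move=> iw ab.
have mw : measurable_fun setT w by case/integrableP : iw => /measurable_EFinP.
have mwz : measurable_fun setT (fun z : E * RR => w z.1 * slab al be z).
  by apply: measurable_funM; [exact: (measurableT_comp mw measurable_fst)|exact: measurable_slab].
have iwz : m.-integrable setT (EFin \o (fun z : E * RR => w z.1 * slab al be z)).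
  apply: integrable_real => //.
  apply: (@le_lt_trans _ _ (\int[m]_z (`|w z.1| * slab al be z)%:E)%E).
    by apply: int_le => // z _; rewrite normrM (ger0_norm (slab_ge0 _ _ _)).
  have -> : (\int[m]_z (`|w z.1| * slab al be z)%:E = (be - al)%:E * \int[lebE]_x (`|w x|)%:E)%E.
    exact: (int_tensor (measurable_abs mw) (fun x => normr_ge0 _) ab).
  rewrite lte_mul_pinfty//; first by rewrite lee_fin subr_ge0.
  by case/integrableP : iw.
split => //.
rewrite [LHS]/Rintegral -(integral12_prod_meas1 iwz) /fubini_F/=.
rewrite /Rintegral -[RHS]/(fine (be - al)%:E * _) -fineM//; last exact: (integrable_fin_num measurableT iw).
congr fine; rewrite -(integralZl measurableT iw); apply: eq_integral => x _ /=.
have mslab : measurable_fun setT (fun t : RR => (al < t < be)%R%:R : R).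
  exact: (@measurable_slice2 _ _ _ E RR _ _ 0 (measurable_slab al be)).
have islab : leb.-integrable setT (EFin \o (fun t : RR => (al < t < be)%R%:R : R)).
  apply: integrable_real => //.
  have -> : (\int[leb]_t `|(al < t < be)%R%:R : R|%:E = \int[leb]_t ((al < t < be)%R%:R : R)%:E)%E.
    by apply: eq_integral => t _; rewrite ger0_norm.
  by rewrite int_window// ltry.
rewrite -[(be - al)%:E](int_window ab) muleC -(integralZl measurableT islab (w x)).
by apply: eq_integral => t _.
Qed.

Lemma V_sum (a b : R) n (r : seq 'I_N) (k : 'I_N -> E -> R -> R -> R) :
  (forall i, meas3 (k i)) -> (forall i x t s, 0 <= k i x t s) ->
  V a b lebE n (fun x t s => \sum_(i <- r) k i x t s) = (\sum_(i <- r) V a b lebE n (k i))%E.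
Proof.
move=> mk k0; elim: r => [|i r IH].
  rewrite big_nil /V (_ : (\int[leb]_s _)%E = 0%E) ?mule0//.
  apply: integral0_eq => s _; apply: integral0_eq => z _.
  by rewrite big_nil mul0r.
have mS : meas3 (fun x t s => \sum_(j <- r) k j x t s) by apply: measurable_sum => j; exact: mk.
have S0 x t s : 0 <= \sum_(j <- r) k j x t s by exact: sumr_ge0.
rewrite big_cons -IH -(VD a b lebE n (mk i) mS (k0 i) S0).
by congr V; apply/funext => x; apply/funext => t; apply/funext => s; rewrite big_cons.
Qed.

Variables (p s0 t0 a b : R) (F Ph : 'I_N -> E * RR -> R) (K0 Th : E * RR -> R) (e : R -> R).
Hypothesis p1 : 1 < p.
Hypothesis s0a : s0 < a.
Hypothesis ab : a < b.
Hypothesis bt0 : b < t0.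
Hypothesis mF : forall i, measurable_fun setT (F i).
Hypothesis F1 : forall i, (\int[m]_z `|F i z|%:E < +oo)%E.
Hypothesis Fq : forall i, (\int[m]_z (`|F i z| `^ (p / (p - 1)))%:E < +oo)%E.
Hypothesis mPh : forall i, measurable_fun setT (Ph i).
Hypothesis Php : forall i, (\int[m]_z (`|Ph i z| `^ p)%:E < +oo)%E.
Hypothesis iK0 : m.-integrable setT (EFin \o K0).
Hypothesis mTh : measurable_fun setT Th.
Hypothesis ThB : forall z, `|Th z| <= 1.
Let ks (sg : R) (z : E * RR) : R := \sum_i F i z * Ph i (z.1, sg) + K0 z * Th (z.1, sg).
Hypothesis ineq : {ae leb, forall sg, s0 < sg < t0 ->
  m.-integrable setT (EFin \o ks sg) /\
  forall de, 0 < de -> s0 < sg - de ->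
    e sg - e (sg - de) + \int[m]_z (ks sg z * slab (sg - de) sg z) <= 0}.
Hypothesis ce : forall sg, s0 < sg < t0 -> e @ sg --> e sg.

(** The integrand at the diagonal t = sg, where the equation and the test function are
    read at the same time. *)
Let kap (z : E * RR) : R := \sum_i F i z * Ph i z + K0 z * Th z.

Let mK0 : measurable_fun setT K0. Proof. by case/integrableP : iK0 => /measurable_EFinP. Qed.

Let iFPh i : m.-integrable setT (EFin \o (fun z => F i z * Ph i z)).
Proof.
apply: integrable_real => //; first exact: measurable_funM.
have mFq : measurable_fun setT (fun z => `|F i z| `^ (p / (p - 1))).
  exact: measurable_powRl (measurable_abs (mF i)).
have mPp : measurable_fun setT (fun z => `|Ph i z| `^ p).
  exact: measurable_powRl (measurable_abs (mPh i)).
apply: (@le_lt_trans _ _ (\int[m]_z (`|F i z| `^ (p / (p - 1)) + `|Ph i z| `^ p)%:E)%E).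
  apply: int_le => // z _; rewrite normrM.
  have e1 (x : R) : 1 `^ x = 1 by rewrite powR1.
  have := young p1 (@ltr01 R) (normr_ge0 (F i z)) (normr_ge0 (Ph i z)).
  by rewrite !e1 !mul1r.
by rewrite intD// lte_add_pinfty ?Fq// Php.
Qed.

Lemma integrable_kap : m.-integrable setT (EFin \o kap).
Proof.
apply: (integrable_addr measurableT); first exact: (integrable_sum_real iFPh).
exact: (integrable_mul_bounded iK0 mTh ThB).
Qed.

Let mkap : measurable_fun setT kap.
Proof. by case/integrableP : integrable_kap => /measurable_EFinP. Qed.

(** The distance of the integrand of the slice at time s, read at time t, to the
    diagonal. *)
Let k (x : E) (t s : R) : R := `|ks s (x, t) - kap (x, s)|.

Let mk : meas3 k.
Proof.
have mm1 : measurable_fun setT (fun w : (E * RR) * RR => (w.1.1, w.2)).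
  apply: measurable_fun_pair; last exact: measurable_snd.
  by apply: measurableT_comp.
have mm2 : measurable_fun setT (fun w : (E * RR) * RR => (w.1.1, w.1.2)).
  by apply: measurable_fun_pair; apply: measurableT_comp.
apply: measurable_abs; apply: measurable_funB; last exact: (measurableT_comp mkap mm2).
apply: measurable_funD.
  apply: measurable_sum => i; apply: measurable_funM.
    exact: (measurableT_comp (mF i) mm1).
  exact: (measurableT_comp (mPh i) mm2).
apply: measurable_funM; first exact: (measurableT_comp mK0 mm1).
exact: (measurableT_comp mTh mm2).
Qed.

Let Vk_cvg0 : (fun n => V a b lebE n k) @ \oo --> 0%E.
Proof.
have ab' := ltW ab.
pose d1 i (x : E) (t s : R) := `|F i (x, t) - F i (x, s)| * `|Ph i (x, s)|.
pose d2 (x : E) (t s : R) := `|K0 (x, t) - K0 (x, s)|.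
have md1 i : meas3 (d1 i).
  apply: measurable_funM; first exact: meas3_diff.
  exact: (meas3_arg2 (measurable_abs (mPh i))).
have md2 : meas3 d2 by exact: meas3_diff.
have d10 i x t s : 0 <= d1 i x t s by rewrite mulr_ge0.
have d20 x t s : 0 <= d2 x t s by exact: normr_ge0.
have k0 x t s : 0 <= k x t s by exact: normr_ge0.
have H1 : (fun n => \sum_i V a b lebE n (d1 i))%E @ \oo --> 0%E.
  by apply: cvge0_sum => i; exact: (V_pairing ab' p1).
have H2 : (fun n => V a b lebE n d2) @ \oo --> 0%E.
  by apply: V_cvg0 => //; case/integrableP : iK0.
apply: (cvge0_le _ _ (cvge0D H1 H2)) => n; first exact: V_ge0.
have mS : meas3 (fun x t s => \sum_j d1 j x t s) by exact: measurable_sum.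
have S0 x t s : 0 <= \sum_j d1 j x t s by exact: sumr_ge0.
rewrite -(V_sum _ _ _ _ md1 d10) -(VD a b lebE n mS md2 S0 d20).
apply: (V_le lebE k0) => x t s _ _; rewrite /k /ks /kap /=.
rewrite (_ : _ - _ = \sum_i (F i (x, t) - F i (x, s)) * Ph i (x, s) +
   (K0 (x, t) - K0 (x, s)) * Th (x, s)); last first.
  under [X in _ = X + _]eq_bigr do rewrite mulrBl.
  by rewrite sumrB; ring.
apply: le_trans (ler_normD _ _) _; apply: lerD; last first.
  by rewrite normrM ler_piMr.
apply: le_trans (ler_norm_sum _ _ _) _.
by apply: ler_sum => i _; rewrite normrM.
Qed.

Let kb (sg : R) : R := \int[lebE]_x kap (x, sg).

(** The slice inequality over a window of length dl n, divided by this length. Replacing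
    its integrand by the diagonal value at sg costs at most the integral of k over the
    window. *)
Let step_ineq n : dl n < a - s0 -> {ae leb, forall sg, a <= sg <= b ->
  ((n.+1%:R * (e sg - e (sg - dl n)) + kb sg)%:E <=
   n.+1%:R%:E * \int[m]_z (k z.1 z.2 sg * W a b n z.2 sg)%:E)%E}.
Proof.
move=> dn.
have H := ae_integrable2 integrable_kap.
apply: leb_aeS (leb_aeI ineq H) => sg [h1 h2] sgI.
have /andP[asg sgb] := sgI.
have [iks /(_ (dl n) (dl_gt0 n)) h3] : m.-integrable setT (EFin \o ks sg) /\
  forall de, 0 < de -> s0 < sg - de ->
    e sg - e (sg - de) + \int[m]_z (ks sg z * slab (sg - de) sg z) <= 0.
  by apply: h1; rewrite (lt_le_trans s0a)//= (le_lt_trans sgb).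
have {}h3 := h3 (_ : s0 < sg - dl n); have {h3} h4 := h3 ltac:(lra).
have dle : sg - dl n <= sg by rewrite lerBlDr lerDl ltW// dl_gt0.
have [ikz ekz] := Rint_tensor (h2 : lebE.-integrable setT (EFin \o (fun x => kap (x, sg)))) dle.
have sB (z : E * RR) : `|slab (sg - dl n) sg z| <= 1 by rewrite ger0_norm ?slab_ge0 ?slab_le1.
have iksz : m.-integrable setT (EFin \o (fun z => ks sg z * slab (sg - dl n) sg z)).
  exact: (integrable_mul_bounded iks (measurable_slab _ _) sB).
have ddl : sg - (sg - dl n) = dl n by ring.
rewrite ddl -/(kb sg) in ekz.
have n0 : 0 < n.+1%:R :> R by [].
have ndl : n.+1%:R * dl n = 1 :> R by rewrite /dl divff.
have dist := Rint_dist measurableT ikz iksz.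
have -> : (\int[m]_z (k z.1 z.2 sg * W a b n z.2 sg)%:E =
  \int[m]_z `|kap (z.1, sg) * slab (sg - dl n) sg z - ks sg z * slab (sg - dl n) sg z|%:E)%E.
  apply: eq_integral => -[x t] _ /=; rewrite -mulrBl normrM (ger0_norm (slab_ge0 _ _ _)) distrC.
  by rewrite /W sgI/=.
apply: le_trans (lee_wpmul2l _ dist); last by rewrite lee_fin.
rewrite -EFinM lee_fin.
have -> : n.+1%:R * (e sg - e (sg - dl n)) + kb sg =
   n.+1%:R * (e sg - e (sg - dl n) + dl n * kb sg).
  by rewrite [RHS]mulrDr [X in _ = _ + X]mulrA ndl mul1r.
rewrite ler_wpM2l// -ekz; apply: le_trans (ler_norm _); lra.
Qed.

Let win (z : E * RR) : R := (a <= z.2 <= b)%R%:R.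

Let mwin : measurable_fun setT win.
Proof.
apply: (@measurableT_comp _ _ _ _ _ _ (fun b : bool => b%:R : R)) => //.
by apply: measurable_and; apply: measurable_fun_ler => //; exact: measurable_snd.
Qed.

Let winB z : `|win z| <= 1.
Proof. by rewrite /win; case: (_ <= _ <= _); rewrite ?normr0 ?normr1. Qed.

Let mab : measurable (`[a, b]%classic : set RR). Proof. exact: measurable_itv. Qed.

Let kb_int : leb.-integrable `[a, b]%classic (EFin \o kb) /\
  \int[leb]_(s in `[a, b]) kb s = \int[m]_z (kap z * win z).
Proof.
have mkb : measurable_fun setT kb.
  have mG := measurable_fubini_G integrable_kap.
  exact: (measurableT_comp (@fine_measurable R setT measurableT) mG).
have H := ae_integrable2 integrable_kap.
have aek : {ae leb, forall s, (kb s)%:E = (\int[lebE]_x (kap (x, s))%:E)%E}.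
  apply: leb_aeS H => s is_; rewrite /kb /Rintegral fineK//.
  exact: (integrable_fin_num measurableT is_).
split.
  apply: integrable_real => //; first exact: measurable_funS mkb.
  have makap : measurable_fun setT (fun z => (`|kap z|)%:E).
    by apply/measurable_EFinP; exact: measurable_abs.
  have T2 := @fubini_tonelli2 _ _ E RR _ lebE leb (fun z => (`|kap z|)%:E) makap
    (fun z => (normr_ge0 (kap z) : (0 <= (`|kap z|)%:E)%E)).
  have /integrableP[_ kfin] := integrable_kap.
  apply: le_lt_trans kfin; rewrite [leRHS](_ : _ = \int[m]_z (`|kap z|)%:E)%E//.
  rewrite T2 [leLHS]integral_mkcond.
  apply: ge0_le_integral_ae => //.
  - by move=> s _; rewrite patchE; case: ifP => // _; rewrite lee_fin.
  - by move=> s _; exact: int_ge0.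
  apply: leb_aeS H => s is_ _; rewrite patchE; case: ifP => [_|_]; last exact: int_ge0.
  exact: (Rint_norm_le measurableT is_).
have ikw : m.-integrable setT (EFin \o (fun z => kap z * win z)).
  exact: (integrable_mul_bounded integrable_kap mwin winB).
rewrite /Rintegral -(integral21_prod_meas1 ikw) /fubini_G/=; congr fine.
rewrite integral_mkcond; apply: integral_eq_ae => //.
apply: leb_aeS aek => s hs _; rewrite patchE /win/=; case: ifPn => [|].
  rewrite inE/= in_itv/= => ->; rewrite hs; apply: eq_integral => x _.
  by rewrite mulr1.
rewrite notin_setE/= in_itv/= => /negP/negbTE ->.
by rewrite integral0_eq// => x _; rewrite mulr0.
Qed.

Let e_int (c : R) : 0 <= c -> c < a - s0 ->
  leb.-integrable `[a, b]%classic (EFin \o (fun s => e (s - c))).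
Proof.
move=> c0 ca.
have hh (s : R) : a <= s -> s <= b -> s0 < s - c < t0 .
  move=> as_ sb_; apply/andP; split.
    by rewrite ltrBrDr (lt_le_trans _ as_)// -ltrBrDl.
  by apply: le_lt_trans bt0; rewrite lerBlDr (le_trans sb_)// lerDl.
apply: continuous_compact_integrable; first exact: segment_compact.
apply: continuous_in_subspaceT => s; rewrite inE/= in_itv/= => /andP[h1 h2].
apply: (@continuous_comp _ _ _ (fun s => s - c) e).
  by apply: cvgB; [exact: cvg_id|exact: cvg_cst].
by apply: ce; exact: hh.
Qed.

(** [step_ineq] is integrated over sg in [a, b]: the increments are Steklov averages, and
    the cost is V k, which tends to 0. *)
Theorem averaged_ineq : e b - e a + \int[m]_z (kap z * (a <= z.2 <= b)%R%:R) <= 0.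
Proof.
have [ikb Ekb] := kb_int; rewrite -Ekb; set KB := \int[leb]_(s in _) _.
have as0 : 0 < a - s0 by rewrite subr_gt0.
(* a positive value L is contradicted as soon as both errors are at most L / 3 *)
rewrite leNgt; apply/negP => pos.
set L := _ + KB in pos.
have L3 : 0 < L / 3 by rewrite divr_gt0.
have /cvgrPdist_le/(_ _ L3) H1 := steklov_cvg s0a ab bt0 ce.
have H2 : \forall n \near \oo, (V a b lebE n k <= (L / 3)%:E)%E.
  have V0 n : (0 <= V a b lebE n k)%E by apply: V_ge0 => x t s; exact: normr_ge0.
  exact: (proj1 (cvge0P V0) Vk_cvg0).
have H3 : \forall n \near \oo, dl n < a - s0.
  have h0 : (fun n => dl n : R) @ \oo --> (0 : R) by exact: cvg_harmonic.
  move/cvgrPdist_lt : h0 => /(_ _ as0); apply: filterS => n; rewrite sub0r normrN.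
  exact: le_lt_trans (ler_norm _).
have [n [h1 [h2 h3]]] := filter_ex (filterI H1 (filterI H2 H3)).
have i0 : leb.-integrable `[a, b]%classic (EFin \o e).
  have := e_int (lexx 0) as0; apply: eq_integrable => // s _ /=.
  by rewrite subr0.
have i1 := e_int (ltW (dl_gt0 n)) h3.
pose D s := n.+1%:R * (e s - e (s - dl n)).
have iD : leb.-integrable `[a, b]%classic (EFin \o D).
  have i2 := integrableB mab i0 i1.
  by have := integrableZl mab n.+1%:R i2; apply: eq_integrable => // s _ /=.
have iX : leb.-integrable `[a, b]%classic (EFin \o (fun s => D s + kb s)).
  exact: (integrable_addr mab iD ikb).
have EX : \int[leb]_(s in `[a, b]) (D s + kb s) = \int[leb]_(s in `[a, b]) D s + KB.
  exact: (RintegralD mab iD ikb).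
have le1 : ((\int[leb]_(s in `[a, b]) (D s + kb s))%:E <= V a b lebE n k)%E.
  rewrite /Rintegral fineK; last exact: (integrable_fin_num mab iX).
  apply: (@le_trans _ _ (\int[leb]_(s in `[a, b]) (Num.max 0 (D s + kb s))%:E)%E).
    apply: le_integral => //; last by move=> s _; rewrite lee_fin le_max lexx orbT.
    have mX : measurable_fun `[a, b]%classic (fun s : RR => D s + kb s).
      by case/integrableP : iX => /measurable_EFinP.
    apply: (integrable_le mab _ iX).
      by apply: measurable_maxr => //; exact: measurable_cst.
    move=> s _; rewrite /Num.max; case: ifP => // _; by rewrite normr0.
  rewrite /V.
  have mkW : measurable_fun setT (fun s : RR => \int[m]_z (k z.1 z.2 s * W a b n z.2 s)%:E)%E.
    have k0 : forall (w : (E * RR) * RR), (0 <= (k w.1.1 w.2 w.1.2 * W a b n w.2 w.1.2)%:E)%E.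
      by move=> w; rewrite lee_fin mulr_ge0// normr_ge0.
    have mkw : measurable_fun setT (fun w : (E * RR) * RR => (k w.1.1 w.2 w.1.2 * W a b n w.2 w.1.2)%:E).
      apply/measurable_EFinP; apply: measurable_funM; first exact: mk.
      apply: measurable_W; first exact: measurable_snd.
      exact: (measurableT_comp measurable_snd measurable_fst).
    have mg := @measurable_fun_fubini_tonelli_F _ _ (E * RR)%type RR _ leb _ mkw k0.
    have mG := @measurable_fun_fubini_tonelli_G _ _ E RR _ lebE _ mg
      (fun z => integral_ge0 _ (fun t _ => k0 (z, t))).
    apply: eq_measurable_fun mG => s _; rewrite /fubini_G/=.
    have msl : measurable_fun setT (fun z : E * RR => (k z.1 z.2 s * W a b n z.2 s)%:E).
      apply/measurable_EFinP; apply: measurable_funM; first exact: meas3_slice.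
      by apply: measurable_W; [exact: measurable_snd|exact: measurable_cst].
    rewrite (@fubini_tonelli1 _ _ E RR _ lebE leb _ msl (fun z => k0 ((z.1, s), z.2))).
    by apply: eq_integral.
  have inner0 (s : RR) : (0 <= \int[m]_z (k z.1 z.2 s * W a b n z.2 s)%:E)%E.
    by apply: int_ge0 => // z _; rewrite mulr_ge0// normr_ge0.
  rewrite -ge0_integralZl//.
  rewrite [leLHS]integral_mkcond; apply: ge0_le_integral_ae => //.
  - by move=> s _; rewrite patchE; case: ifP => // _; rewrite lee_fin le_max lexx.
  - by move=> s _; apply: mule_ge0 => //; rewrite lee_fin.
  apply: leb_aeS (step_ineq h3) => s hs _; rewrite patchE; case: ifPn => [|_]; last first.
    by apply: mule_ge0 => //; rewrite lee_fin.
  rewrite inE/= in_itv/= => sI; rewrite /Num.max; case: ifP => _; first exact: hs.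
  by apply: mule_ge0 => //; rewrite lee_fin.
move: (le_trans le1 h2); rewrite lee_fin EX.
move: h1; rewrite ler_norml -/D => /andP[h11 h12] h13.
by move: pos h12 h13; rewrite /L; set x := \int[leb]_(s in _) _; lra.
Qed.

End averaged.

(** * Regularised nonlinearities *)

Section one_variable.
Context {R : realType}.
Local Notation leb := (@lebesgue_measure R).

Lemma mvt (f g : R -> R) (a b : R) : (forall x : R, is_derive x 1 f (g x)) -> a <= b ->
  exists2 c, a <= c <= b & f b - f a = g c * (b - a).
Proof.
move=> df ab; have cf : continuous f by exact: is_derive1_continuous df.
have [c + E] := MVT_segment ab (fun x _ => df x) (continuous_subspaceT cf).
by rewrite in_itv/= => cI; exists c.
Qed.

Lemma lip_of_derive (f g : R -> R) (B : R) : (forall x : R, is_derive x 1 f (g x)) ->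
  (forall x, `|g x| <= B) -> forall y z, `|f y - f z| <= B * `|y - z|.
Proof.
move=> df gB y z; wlog zy : y z / z <= y.
  by move=> H; case: (leP z y) => h; [exact: H|rewrite distrC (distrC y); apply: H; exact: ltW].
by have [c _ ->] := mvt df zy; rewrite normrM ler_wpM2r.
Qed.

Lemma cont_supp_bounded (f : R -> R) (M : R) : continuous f ->
  (forall x, M < `|x| -> f x = 0) -> exists2 B : R, 0 <= B & forall x, `|f x| <= B.
Proof.
move=> cf f0; pose K := `|M|.
have KK : - K <= K by rewrite ge0_cp// /K.
have ca : {within `[- K, K], continuous (fun x => `|f x|)}.
  apply: continuous_subspaceT => x; apply: (@continuous_comp _ _ _ f Num.norm); first exact: cf.
  exact: norm_continuous.
have [c cI cmax] := EVT_max KK ca.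
exists `|f c| => // x; have [xK|xK] := leP `|x| K.
  by apply: cmax; rewrite in_itv/= -ler_norml.
by rewrite f0 ?normr0// (le_lt_trans (ler_norm M)).
Qed.

Lemma cont_supp_integrable (f : R -> R) (M : R) : continuous f ->
  (forall x, M < `|x| -> f x = 0) -> leb.-integrable setT (EFin \o f).
Proof.
move=> cf f0; have [B B0 HB] := cont_supp_bounded cf f0.
have mf : measurable_fun setT f by exact: continuous_measurable_fun.
apply: (@integrable_bounded_supp _ _ _ leb `]- (`|M| + 1), `|M| + 1[%classic f B) => //.
  exact: leb_itvoo_lty.
move=> x nI; apply: f0; rewrite ltNge; apply/negP => xM; apply: nI.
rewrite /= in_itv/= -ltr_norml; apply: le_lt_trans xM _.
by rewrite (le_lt_trans (ler_norm M))// ltrDl.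
Qed.

Lemma test_supp1 (phi : R -> R) : test_function setT phi ->
  exists M : R, forall x, M < `|x| -> phi x = 0.
Proof.
move=> [_ [K [cK _ K0]]]; have [M [_ HM]] := compact_bounded cK.
exists (`|M| + 1) => x xM; apply: K0 => Kx.
have := HM (`|M| + 1) _ x Kx; rewrite (le_lt_trans (ler_norm M)) ?ltrDl// => /(_ isT).
by rewrite /= leNgt xM.
Qed.

(** Integration by parts against a test function. *)
Lemma weak_derivative_classical (f g : R -> R) : (forall x : R, is_derive x 1 f (g x)) ->
  continuous g -> weak_derivative f g.
Proof.
move=> df cg phi tphi.
have cf : continuous f by exact: is_derive1_continuous df.
have [M HM] := test_supp1 tphi.
have [M' HM'] := test_supp1 (test_deriv (1 : R) (@Rhausdorff R) tphi).
have sphi : smooth phi by case: tphi.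
have cphi := smooth_continuous sphi.
have cdphi := smooth_continuous (smoothD1 (1 : R) sphi).
have -> : derive1 phi = 'D_1 phi by apply/funext => x; rewrite derive1E.
have c1 : continuous (fun x => f x * 'D_1 phi x) by move=> x; apply: cvgM; [exact: cf|exact: cdphi].
have c2 : continuous (fun x => g x * phi x) by move=> x; apply: cvgM; [exact: cg|exact: cphi].
have i1 : leb.-integrable setT (EFin \o (fun x => f x * 'D_1 phi x)).
  by apply: (@cont_supp_integrable _ M') => // x /HM' ->; rewrite mulr0.
have i2 : leb.-integrable setT (EFin \o (fun x => g x * phi x)).
  by apply: (@cont_supp_integrable _ M) => // x /HM ->; rewrite mulr0.
have dfp (x : R) : is_derive x 1 (fun x => f x * phi x) (f x * 'D_1 phi x + g x * phi x).
  have d := is_deriveM (df x) (derivableP (@smooth_derivable _ _ phi x 1 sphi)).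
  apply: (is_derive_eq (d : is_derive x 1 (fun x => f x * phi x) _)).
  by rewrite /GRing.scale/= (mulrC (phi x)).
have c12 : continuous (fun x => f x * 'D_1 phi x + g x * phi x).
  by move=> x; apply: cvgD; [exact: c1|exact: c2].
have := @FTC2_compact _ _ _ M dfp c12.
have -> : (\int[leb]_x (f x * 'D_1 phi x + g x * phi x)%:E =
  \int[leb]_x (f x * 'D_1 phi x)%:E + \int[leb]_x (g x * phi x)%:E)%E.
  exact: (integralD measurableT i1 i2).
have fin1 : (\int[leb]_x (f x * 'D_1 phi x)%:E)%E \is a fin_num.
  exact: (integrable_fin_num measurableT i1).
have fin2 : (\int[leb]_x (g x * phi x)%:E)%E \is a fin_num.
  exact: (integrable_fin_num measurableT i2).
have out x : M < `|x| -> f x * phi x = 0 by move=> /HM ->; rewrite mulr0.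
move=> /(_ out); rewrite -(fineK fin1) -(fineK fin2) -EFinD -EFinN => -[/eqP].
by rewrite addr_eq0 => /eqP ->.
Qed.

End one_variable.

Section trunc_facts.
Context {R : realType}.
Implicit Types k y : R.

Lemma trunc_id k y : `|y| <= k -> trunc k y = y.
Proof. by rewrite ler_norml => /andP[h1 h2]; rewrite /trunc min_r// max_r. Qed.

Lemma trunc_big k y : 0 <= k -> k < `|y| -> (trunc k y = k /\ k < y) \/ (trunc k y = - k /\ y < - k).
Proof.
move=> k0; rewrite lter_normr => /orP[ky|ky]; [left|right]; split => //; last by rewrite ltrNr.
  by rewrite /trunc min_l ?(ltW ky)// max_r// ge0_cp.
have yk : y < - k by rewrite ltrNr.
by rewrite /trunc min_r ?max_l ?(ltW yk)// (le_trans (ltW yk))// ge0_cp.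
Qed.

Lemma trunc_le k y : 0 <= k -> `|trunc k y| <= k.
Proof.
move=> k0; have [yk|ky] := leP `|y| k; first by rewrite trunc_id.
by have [[-> _]|[-> _]] := trunc_big k0 ky; rewrite ?normrN ger0_norm.
Qed.

End trunc_facts.

Section profile.
Context {R : realType}.
Local Notation leb := (@lebesgue_measure R).
Variables (e k : R) (S1 S2 : R -> R).
Hypothesis e0 : 0 < e.
Hypothesis e1 : e <= 1.
Hypothesis k0 : 0 <= k.
Hypothesis dS1 : forall x : R, is_derive x 1 S1 (S2 x).
Hypothesis cS2 : continuous S2.
Hypothesis S1_out : forall y, k <= `|y| -> S1 y = 0.
Hypothesis S2_out : forall y, k < `|y| -> S2 y = 0.
Hypothesis S1_odd : forall y, S1 (- y) = - S1 y.
Hypothesis S1_ge0 : forall y, 0 <= y -> 0 <= S1 y.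

(** Increasing in |y| from 0 to 1, with limit the indicator of y <> 0 as e tends
    to 0: a smooth function that vanishes at 0 without changing the sign of S'. *)
Definition theta (y : R) : R := y ^+ 2 / (y ^+ 2 + e).
Definition dtheta (y : R) : R := 2 * e * y / (y ^+ 2 + e) ^+ 2.
Definition ddtheta (y : R) : R := 2 * e * (e - 3 * y ^+ 2) / (y ^+ 2 + e) ^+ 3.

Let den (y : R) : 0 < y ^+ 2 + e. Proof. by rewrite ltr_wpDl// sqr_ge0. Qed.

Lemma is_derive_sqr (y : R) : is_derive y 1 (fun y : R => y ^+ 2) (2 * y).
Proof.
have d := is_deriveM (is_derive_id y (1 : R)) (is_derive_id y 1).
apply: (is_derive_eq (d : is_derive y 1 (fun y : R => y ^+ 2) _)).
by rewrite /GRing.scale/= !mulr1; ring.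
Qed.

Lemma is_derive_den (y : R) : is_derive y 1 (fun y : R => y ^+ 2 + e) (2 * y).
Proof. by have := is_deriveD (is_derive_sqr y) (is_derive_cst e y 1); rewrite addr0. Qed.

Lemma is_derive_deninv (y : R) :
  is_derive y 1 (fun y : R => (y ^+ 2 + e)^-1) (- (y ^+ 2 + e) ^- 2 * (2 * y)).
Proof.
have n0 : y ^+ 2 + e != 0 by rewrite gt_eqF.
have d := @is_deriveV _ (fun y : R => y ^+ 2 + e) y _ 1 n0 (is_derive_den y).
by apply: (is_derive_eq (d : is_derive y 1 (fun y : R => (y ^+ 2 + e)^-1) _)).
Qed.

Lemma is_derive_theta (y : R) : is_derive y 1 theta (dtheta y).
Proof.
have d := is_deriveM (is_derive_sqr y) (is_derive_deninv y).
apply: (is_derive_eq (d : is_derive y 1 theta _)).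
by rewrite /GRing.scale/= /dtheta; field; rewrite gt_eqF.
Qed.

Lemma is_derive_dtheta (y : R) : is_derive y 1 dtheta (ddtheta y).
Proof.
have dl : is_derive y 1 (fun y : R => 2 * e * y) (2 * e).
  have := is_deriveM (is_derive_cst (2 * e) y 1) (is_derive_id y (1 : R)).
  by rewrite scaler0 addr0 /GRing.scale/= mulr1.
have di := is_deriveM (is_derive_deninv y) (is_derive_deninv y).
have d := is_deriveM dl di.
have E : dtheta = (fun y : R => 2 * e * y * ((y ^+ 2 + e)^-1 * (y ^+ 2 + e)^-1)).
  by apply/funext => x; rewrite /dtheta expr2 invfM.
rewrite E; apply: (is_derive_eq (d : is_derive y 1 (fun y : R => 2 * e * y * ((y ^+ 2 + e)^-1 * (y ^+ 2 + e)^-1)) _)).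
by rewrite fctE /GRing.scale/= /ddtheta; field; rewrite gt_eqF.
Qed.

Lemma smooth_theta : smooth theta.
Proof.
have sq : smooth (fun y : R => y ^+ 2) by exact: (smoothM smooth_id smooth_id).
apply: (@smoothM _ _ (fun y : R => y ^+ 2) (fun y => (y ^+ 2 + e)^-1)); first exact: sq.
apply: (@smoothV _ _ (fun y : R => y ^+ 2 + e)); first by move=> y; rewrite gt_eqF.
exact: (@smoothD _ _ (fun y : R => y ^+ 2) (cst e) sq (smooth_cst e)).
Qed.

Lemma theta0 : theta 0 = 0. Proof. by rewrite /theta expr0n/= mul0r. Qed.

Lemma theta_ge0 y : 0 <= theta y.
Proof. by rewrite divr_ge0 ?sqr_ge0// ltW. Qed.

Lemma theta_le1 y : `|theta y| <= 1.
Proof. by rewrite ger0_norm ?theta_ge0// ler_pdivrMr// mul1r lerDl ltW. Qed.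

Lemma theta_even y : theta (- y) = theta y.
Proof. by rewrite /theta sqrrN. Qed.

Lemma theta_homo x y : 0 <= x -> x <= y -> theta x <= theta y.
Proof.
move=> x0 xy; rewrite /theta ler_pdivrMr// mulrAC ler_pdivlMr//.
have : x ^+ 2 <= y ^+ 2 by rewrite ler_sqr// nnegrE (le_trans x0).
by move=> h; rewrite !mulrDr (mulrC (y ^+ 2)) lerD2l ler_wpM2r// ltW.
Qed.

Lemma dtheta_bound y : `|dtheta y| <= 1 + e^-1.
Proof.
rewrite /dtheta normrM normfV (ger0_norm (exprn_ge0 _ (ltW (den y)))).
rewrite ler_pdivrMr ?exprn_gt0// !normrM (gtr0_norm e0) ger0_norm//.
have h1 : 2 * `|y| <= 1 + y ^+ 2.
  by rewrite -(real_normK (num_real y)); have := sqr_ge0 (`|y| - 1); rewrite sqrrB1 -subr_ge0 => h; rewrite -subr_ge0; move: h; set a := `|y|; lra.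
have h2 : e * (y ^+ 2 + e) <= (y ^+ 2 + e) ^+ 2.
  by rewrite expr2 ler_wpM2r ?(ltW (den y))// lerDr sqr_ge0.
have ei : 1 <= e^-1 by rewrite invf_ge1.
have h3 : 1 + y ^+ 2 <= (1 + e^-1) * (y ^+ 2 + e).
  have -> : (1 + e^-1) * (y ^+ 2 + e) = y ^+ 2 + e + e^-1 * y ^+ 2 + 1 by field; rewrite gt_eqF.
  by have := sqr_ge0 y; have := ltW e0; nra.
apply: (@le_trans _ _ (e * ((1 + e^-1) * (y ^+ 2 + e)))).
  have -> : 2 * e * `|y| = e * (2 * `|y|) by ring.
  by rewrite ler_wpM2l ?(ltW e0)// (le_trans h1).
rewrite mulrCA ler_wpM2l// addr_ge0// invr_ge0 ltW//.
Qed.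

Lemma ddtheta_bound y : `|ddtheta y| <= 6 / e.
Proof.
rewrite /ddtheta normrM normfV (ger0_norm (exprn_ge0 _ (ltW (den y)))).
rewrite ler_pdivrMr ?exprn_gt0// !normrM (gtr0_norm e0) ger0_norm//.
have h1 : `|e - 3 * y ^+ 2| <= 3 * (y ^+ 2 + e).
  have := sqr_ge0 y; have := e0; rewrite ler_norml; set a := y ^+ 2 => h' h; apply/andP; split; lra.
have h2 : e ^+ 2 <= (y ^+ 2 + e) ^+ 2.
  by rewrite ler_sqr ?nnegrE ?(ltW e0) ?(ltW (den y))// lerDr sqr_ge0.
have -> : 6 / e * (y ^+ 2 + e) ^+ 3 = (6 / e * (y ^+ 2 + e)) * (y ^+ 2 + e) ^+ 2 by ring.
apply: (@le_trans _ _ ((6 / e * (y ^+ 2 + e)) * e ^+ 2)); last first.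
  by rewrite ler_wpM2l// mulr_ge0 ?divr_ge0 ?(ltW e0) ?(ltW (den y)).
have -> : 6 / e * (y ^+ 2 + e) * e ^+ 2 = 2 * e * (3 * (y ^+ 2 + e)) by field; rewrite gt_eqF.
by rewrite ler_wpM2l// mulr_ge0// ltW.
Qed.

Lemma D_theta y : 'D_1 theta y = dtheta y.
Proof. by have [_ ->] := is_derive_theta y. Qed.

Lemma exists_primitive0 (f : R -> R) : continuous f -> (forall y, k < `|y| -> f y = 0) ->
  exists F : R -> R, F 0 = 0 /\ forall x : R, is_derive x 1 F (f x).
Proof.
move=> cf f0.
have [F dF] : exists F : R -> R, forall x : R, is_derive x 1 F (f x).
  apply: (@primitive_left _ f (- k)) => // x xk; apply: f0.
  by rewrite ltNge; apply/negP; rewrite ler_norml => /andP[]; rewrite leNgt xk.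
exists (fun x => F x - F 0); split; first by rewrite subrr.
by move=> x; have := is_deriveB (dF x) (is_derive_cst (F 0) x 1); rewrite subr0.
Qed.

Lemma odd_primitive_even (f F : R -> R) : F 0 = 0 -> (forall x : R, is_derive x 1 F (f x)) ->
  (forall y, f (- y) = - f y) -> forall y, F (- y) = F y.
Proof.
move=> F0 dF fo y.
have dN (x : R) : is_derive x 1 (fun x : R => F (- x)) (f x).
  have dn : is_derive x 1 (fun x : R => - x) (- 1) := is_deriveN (is_derive_id x 1).
  have := is_derive_comp dn (dF (- x)).
  by rewrite fo mulrN mulr1 opprK.
have dd (x : R) : is_derive x 1 (fun x : R => F (- x) - F x) 0.
  by have := is_deriveB (dN x) (dF x); rewrite subrr.
have h0 (x : R) : `|(fun=> 0 : R) x| <= 0 by rewrite normr0.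
have := @lip_of_derive _ _ (fun=> 0) 0 dd h0 y 0.
by rewrite oppr0 F0 subrr subr0 mul0r normr_le0 subr_eq0 => /eqP.
Qed.

(** S and Psi are constant beyond k, so that T_k(u) determines them. *)
Lemma primitive_trunc (f F : R -> R) : (forall x : R, is_derive x 1 F (f x)) ->
  (forall y, k <= `|y| -> f y = 0) -> forall y, F y = F (trunc k y).
Proof.
move=> dF f0 y; have [yk|ky] := leP `|y| k; first by rewrite trunc_id.
have [[-> ky']|[-> ky']] := trunc_big k0 ky.
  have [c /andP[c1 c2] /eqP] := mvt dF (ltW ky').
  rewrite f0 ?mul0r ?subr_eq0; first by move/eqP.
  by rewrite ger0_norm// (le_trans k0).
have [c /andP[c1 c2] /eqP] := mvt dF (ltW ky').
rewrite f0 ?mul0r ?subr_eq0; first by move/eqP.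
by rewrite ler0_norm; [rewrite lerNr|apply: le_trans c2 _; rewrite oppr_le0].
Qed.

Variables (S Psi : R -> R).
Hypothesis S00 : S 0 = 0.
Hypothesis dS : forall x : R, is_derive x 1 S (S1 x).
Hypothesis Psi00 : Psi 0 = 0.
Hypothesis dPsi : forall x : R, is_derive x 1 Psi (S1 x * theta x).

Let cS1 : continuous S1. Proof. exact: is_derive1_continuous dS1. Qed.

Let S1B : exists2 B : R, 0 <= B & forall x, `|S1 x| <= B.
Proof. by apply: (@cont_supp_bounded _ S1 k) => // x /ltW; exact: S1_out. Qed.

Let S2B : exists2 B : R, 0 <= B & forall x, `|S2 x| <= B.
Proof. exact: (@cont_supp_bounded _ S2 k). Qed.

Lemma S_lip : exists2 L : R, 0 <= L & forall y z, `|S y - S z| <= L * `|y - z|.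
Proof. by have [B B0 HB] := S1B; exists B => //; exact: lip_of_derive. Qed.

Lemma Psi_lip : exists2 L : R, 0 <= L & forall y z, `|Psi y - Psi z| <= L * `|y - z|.
Proof.
have [B B0 HB] := S1B; exists B => //; apply: (lip_of_derive dPsi) => x.
by rewrite normrM -[leRHS]mulr1; apply: ler_pM => //; exact: theta_le1.
Qed.

Lemma S_bounded : exists B : R, forall y, `|S y| <= B.
Proof.
have [L L0 HL] := S_lip; exists (L * k) => y.
rewrite (primitive_trunc dS S1_out) -[S _]subr0 -S00.
by apply: le_trans (HL _ _) _; rewrite subr0 ler_wpM2l// trunc_le.
Qed.

Lemma Psi_bounded : exists B : R, forall y, `|Psi y| <= B.
Proof.
have [L L0 HL] := Psi_lip; exists (L * k) => y.
rewrite (primitive_trunc dPsi); last by move=> x /S1_out ->; rewrite mul0r.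
rewrite -[Psi _]subr0 -Psi00.
by apply: le_trans (HL _ _) _; rewrite subr0 ler_wpM2l// trunc_le.
Qed.

Let in_Loo_bounded (f : R -> R) : continuous f -> (exists B : R, forall y, `|f y| <= B) ->
  in_Loo leb setT f.
Proof.
move=> cf [B HB]; split.
  exists f; first exact: continuous_measurable_fun.
  by apply: aeW.
by exists B; apply: aeW => x _; exact: HB.
Qed.

Lemma profile_admissible : admissible S S1 S2.
Proof.
split; last by exists k => y ky; apply: S1_out; exact: ltW.
have cS : continuous S by exact: is_derive1_continuous dS.
split.
- by split.
- by apply: in_Loo_bounded => //; exact: S_bounded.
- by apply: in_Loo_bounded => //; have [B _ HB] := S1B; exists B.
- by apply: in_Loo_bounded => //; have [B _ HB] := S2B; exists B.
- by split; exact: weak_derivative_classical.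
Qed.

Let S_even : forall y, S (- y) = S y. Proof. exact: odd_primitive_even dS S1_odd. Qed.

Let Psi_even : forall y, Psi (- y) = Psi y.
Proof.
apply: (odd_primitive_even Psi00 dPsi) => y.
by rewrite S1_odd theta_even mulNr.
Qed.

(** On the half-line w >= 0 the derivative S1 w (theta w - theta y) of
    Psi - theta(y) S has the sign of w - y: the minimum is at w = y. This is
    the tangent inequality of a convex function with S in place of the identity. *)
Lemma profile_ineq_pos y z : 0 <= y -> 0 <= z -> Psi y - Psi z <= (S y - S z) * theta y.
Proof.
move=> y0 z0; pose f (w : R) := Psi w - S w * theta y.
have df (w : R) : is_derive w 1 f (S1 w * theta w - S1 w * theta y).
  apply: (is_deriveB (dPsi w)).
  have d := is_deriveM (dS w) (is_derive_cst (theta y) w 1).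
  apply: (is_derive_eq (d : is_derive w 1 (fun w : R => S w * theta y) _)).
  by rewrite scaler0 add0r /GRing.scale/= mulrC.
suff : f y <= f z by rewrite /f; lra.
have [yz|zy] := leP y z.
  have [c /andP[c1 c2] E] := mvt df yz.
  rewrite -subr_ge0 E -mulrBr mulr_ge0 ?subr_ge0//.
  by rewrite mulr_ge0 ?subr_ge0 ?S1_ge0 ?theta_homo// (le_trans y0).
have [c /andP[c1 c2] E] := mvt df (ltW zy).
rewrite -subr_le0 E -mulrBr mulr_le0_ge0 ?subr_ge0 ?(ltW zy)//.
by rewrite mulr_ge0_le0 ?subr_le0 ?S1_ge0 ?theta_homo// (le_trans z0).
Qed.

(** S, Psi and theta are even, which reduces the claim to nonnegative arguments. *)
Lemma profile_ineq y z : Psi y - Psi z <= (S y - S z) * theta (trunc k y).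
Proof.
have N (f : R -> R) : (forall w, f (- w) = f w) -> forall w, f w = f `|w|.
  by move=> ev w; case: (ler0P w) => _; rewrite ?ev.
rewrite (primitive_trunc dS S1_out y) (primitive_trunc dPsi _ y); last first.
  by move=> x /S1_out ->; rewrite mul0r.
rewrite (N _ S_even) (N _ Psi_even) (N _ theta_even) (N S S_even z) (N Psi Psi_even z).
exact: profile_ineq_pos.
Qed.

End profile.

(** * Changes of representatives and product test functions *)

Section ae_transfer.
Context {R : realType} d {T : measurableType d}.
Variable mu : {measure set T -> \bar R}.

Lemma cmeasurable_ae (D : set T) (f g : T -> R) : {ae mu, forall z, D z -> f z = g z} ->
  cmeasurable mu D f -> cmeasurable mu D g.
Proof.
move=> fg [h mh fh]; exists h => //.
by apply: filterS2 fg fh => z + + Dz => /(_ Dz) <- /(_ Dz).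
Qed.

Lemma in_Lp_ae (p : R) (D : set T) (f g : T -> R) : measurable D ->
  {ae mu, forall z, D z -> f z = g z} -> in_Lp mu p D f -> in_Lp mu p D g.
Proof.
move=> mD fg [cf fp]; split; first exact: cmeasurable_ae cf.
have <- : (\int[mu]_(z in D) (`|f z| `^ p)%:E = \int[mu]_(z in D) (`|g z| `^ p)%:E)%E.
  apply: integral_eq_ae; first exact: mD.
  by apply: filterS fg => z + Dz => /(_ Dz) ->.
exact: fp.
Qed.

Lemma in_Lp_vec_ae N (p : R) (D : set T) (F G : T -> 'rV[R]_N) : measurable D ->
  {ae mu, forall z, D z -> F z = G z} -> in_Lp_vec mu p D F -> in_Lp_vec mu p D G.
Proof.
move=> mD fg [cf fp]; split.
  by move=> i; apply: cmeasurable_ae (cf i); apply: filterS fg => z + Dz => /(_ Dz) ->.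
have <- : (\int[mu]_(z in D) (enorm (F z) `^ p)%:E = \int[mu]_(z in D) (enorm (G z) `^ p)%:E)%E.
  apply: integral_eq_ae; first exact: mD.
  by apply: filterS fg => z + Dz => /(_ Dz) ->.
exact: fp.
Qed.

End ae_transfer.

Lemma in_W0_ae {R : realType} {N : nat} (Om : set 'rV[R]_N) (p : R) (v v' : 'rV[R]_N -> R)
    (G G' : 'rV[R]_N -> 'rV[R]_N) : open Om ->
  {ae lebesgue_rV N, forall x, Om x -> v x = v' x} ->
  {ae lebesgue_rV N, forall x, Om x -> G x = G' x} ->
  in_W0 Om p v G -> in_W0 Om p v' G'.
Proof.
move=> oOm vv GG [vp Gp [phi [tphi c0 c1]]].
have mOm : measurable Om by exact: open_measurable_rV.
have E0 n : (\int[lebesgue_rV N]_(x in Om) (`|phi n x - v x| `^ p)%:E =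
    \int[lebesgue_rV N]_(x in Om) (`|phi n x - v' x| `^ p)%:E)%E.
  by apply: (integral_eq_ae mOm); apply: filterS vv => z + Dz => /(_ Dz) ->.
have E1 n : (\int[lebesgue_rV N]_(x in Om) (enorm (grad (phi n) x - G x) `^ p)%:E =
    \int[lebesgue_rV N]_(x in Om) (enorm (grad (phi n) x - G' x) `^ p)%:E)%E.
  by apply: (integral_eq_ae mOm); apply: filterS GG => z + Dz => /(_ Dz) ->.
split; first exact: (in_Lp_ae mOm vv vp).
  exact: (in_Lp_vec_ae mOm GG Gp).
exists phi; split; first exact: tphi.
  exact: (eq_ind _ (fun f : nat -> \bar R => f @ \oo --> 0%E) c0 _ (funext E0)).
exact: (eq_ind _ (fun f : nat -> \bar R => f @ \oo --> 0%E) c1 _ (funext E1)).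
Qed.

Section tensor_test.
Context {R : realType} {N : nat}.
Local Notation E := 'rV[R]_N.

Lemma derive_zero (V : normedModType R) (f : V -> R) x : 'D_(0 : V) f x = 0.
Proof.
rewrite /derive; apply: cvg_lim; first exact: Rhausdorff.
have -> : (fun h : R => h^-1 *: (f (h *: (0 : V) + x) - f x)) = (fun=> 0).
  by apply/funext => h; rewrite scaler0 add0r subrr scaler0.
exact: cvg_cst.
Qed.

Lemma smooth_fst (eta : E -> R) : smooth eta ->
  smooth (fun z : E * R => eta z.1) /\
  forall z v, 'D_v (fun z : E * R => eta z.1) z = 'D_(v.1) eta z.1.
Proof.
move=> se; have cf : continuous (fst : E * R -> E) by move=> z; exact: cvg_fst.
have lin (x v : E * R) (t : R) : (t *: v + x).1 = t *: v.1 + x.1 by [].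
have [s1 s2] := @smooth_precomp _ _ _ fst eta cf (ex_intro _ fst lin) se.
by split => // z v; rewrite (s2 fst lin).
Qed.

Lemma smooth_snd (h : R -> R) : smooth h ->
  smooth (fun z : E * R => h z.2) /\
  forall z v, 'D_v (fun z : E * R => h z.2) z = 'D_(v.2) h z.2.
Proof.
move=> se; have cf : continuous (snd : E * R -> R) by move=> z; exact: cvg_snd.
have lin (x v : E * R) (t : R) : (t *: v + x).2 = t *: v.2 + x.2 by [].
have [s1 s2] := @smooth_precomp _ _ _ snd h cf (ex_intro _ snd lin) se.
by split => // z v; rewrite (s2 snd lin).
Qed.

(** Products of a function of time and a function of space suffice to recover the
    equation in integrated form. *)
Lemma tensor_test (Om : set E) (s0 t0 : R) (h : R -> R) (eta : E -> R) :
  test_function `]s0, t0[%classic h -> test_function Om eta ->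
  let phi (z : E * R) := h z.2 * eta z.1 in
  [/\ test_function (cylinder Om s0%:E t0%:E) phi,
      forall z, tderiv phi z = 'D_1 h z.2 * eta z.1 &
      forall z i, xgrad phi z ord0 i = h z.2 * 'D_(delta_mx ord0 i) eta z.1].
Proof.
move=> [sh [Kh [cKh KhI Kh0]]] [se [Ke [cKe KeO Ke0]]] phi.
have [se1 De] := smooth_fst se; have [sh1 Dh] := smooth_snd sh.
have Dphi z v : 'D_v phi z = h z.2 * 'D_(v.1) eta z.1 + eta z.1 * 'D_(v.2) h z.2.
  have -> : phi = (fun z : E * R => h z.2) * (fun z : E * R => eta z.1) by [].
  rewrite deriveM; last 2 first.
  - exact: (@smooth_derivable _ _ _ z v sh1).
  - exact: (@smooth_derivable _ _ _ z v se1).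
  by rewrite De Dh.
split.
- split; first exact: (smoothM sh1 se1).
  exists (Ke `*` Kh); split; first exact: compact_setX.
    move=> z [/KeO z1 /KhI]; rewrite /= in_itv/= => z2; exact: (conj z1 z2).
  move=> z nz; have [k1|k1] := pselect (Ke z.1); last by rewrite /phi Ke0// mulr0.
  by rewrite /phi Kh0 ?mul0r// => k2; apply: nz; split.
- by move=> z; rewrite /tderiv Dphi/= derive_zero mulr0 add0r mulrC.
- by move=> z i; rewrite /xgrad mxE Dphi/= derive_zero mulr0 addr0.
Qed.

End tensor_test.

(** * The energy inequality between two positive times *)

Lemma powR_add_le {R : realType} (q x y : R) : 0 <= q -> 0 <= x -> 0 <= y ->
  (x + y) `^ q <= 2 `^ q * (x `^ q + y `^ q).
Proof.
move=> q0 x0 y0; wlog xy : x y x0 y0 / x <= y.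
  by move=> H; case: (leP x y) => h; [exact: H|rewrite addrC [X in _ * X]addrC; apply: H => //; exact: ltW].
apply: (@le_trans _ _ ((2 * y) `^ q)).
  by apply: le_powR => //; [exact: addr_ge0|rewrite mulr_natl mulr2n lerD2r].
by rewrite powRM// ler_wpM2l ?powR_ge0// lerDr powR_ge0.
Qed.

Lemma ae_imp {R : realType} d (T : measurableType d) (mu : {measure set T -> \bar R})
    (P Q : T -> Prop) : (forall z, P z -> Q z) ->
  {ae mu, forall z, P z} -> {ae mu, forall z, Q z}.
Proof. by move=> PQ; exact: filterS. Qed.

Lemma ae_and {R : realType} d (T : measurableType d) (mu : {measure set T -> \bar R})
    (P Q : T -> Prop) : {ae mu, forall z, P z} -> {ae mu, forall z, Q z} ->
  {ae mu, forall z, P z /\ Q z}.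
Proof. exact: filterI. Qed.

Section window_core.
Context {R : realType} {N : nat}.
Local Notation E := 'rV[R]_N.
Local Notation leb := (@lebesgue_measure R).
Local Notation RR := (measurableTypeR R).
Local Notation lebE := (lebesgue_rV N : {sigma_finite_measure set E -> \bar R}).
Local Notation m := (lebE \x leb)%E.
Variables (Om : set E) (p s0 t0 C : R).
Hypothesis oOm : open Om.
Hypothesis Omfin : (lebE Om < +oo)%E.
Hypothesis p1 : 1 < p.
Hypothesis s0t0 : s0 < t0.
Hypothesis C0 : 0 <= C.
Variables (u : E * RR -> R) (U : R -> E -> R).
Local Notation inQ z := (Om z.1 /\ s0 < z.2 < t0).
Hypothesis mu : measurable_fun setT u.
Hypothesis u0 : forall z, ~ inQ z -> u z = 0.
Hypothesis mU : forall t, measurable_fun setT (U t).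
Hypothesis Ucont : forall sg, s0 < sg < t0 ->
  (fun t => \int[lebE]_(x in Om) `|U t x - U sg x|%:E)%E @ sg --> 0%E.
Hypothesis uU : {ae leb, forall t, s0 < t < t0 ->
  {ae lebE, forall x, Om x -> u (x, t) = U t x}}.
Variables (e k : R) (S1 S2 S Psi : R -> R).
Hypothesis e0 : 0 < e.
Hypothesis e1 : e <= 1.
Hypothesis k0 : 0 <= k.
Hypothesis dS1 : forall x : R, is_derive x 1 S1 (S2 x).
Hypothesis cS2 : continuous S2.
Hypothesis S1_out : forall y, k <= `|y| -> S1 y = 0.
Hypothesis S2_out : forall y, k < `|y| -> S2 y = 0.
Hypothesis S1_odd : forall y, S1 (- y) = - S1 y.
Hypothesis S1_ge0 : forall y, 0 <= y -> 0 <= S1 y.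
Hypothesis S00 : S 0 = 0.
Hypothesis dS : forall x : R, is_derive x 1 S (S1 x).
Hypothesis Psi00 : Psi 0 = 0.
Hypothesis dPsi : forall x : R, is_derive x 1 Psi (S1 x * theta e x).
Variables (A G : E * RR -> E) (g b : E * RR -> R).
Hypothesis mA : forall i, measurable_fun setT (fun z => A z ord0 i).
Hypothesis A0 : forall z, ~ inQ z -> A z = 0.
Hypothesis mG : forall i, measurable_fun setT (fun z => G z ord0 i).
Hypothesis G0 : forall z, ~ inQ z -> G z = 0.
Hypothesis Gp : (\int[m]_z (enorm (G z) `^ p)%:E < +oo)%E.
Hypothesis W0 : {ae leb, forall t, s0 < t < t0 ->
  in_W0 Om p (fun x => trunc k (u (x, t))) (fun x => G (x, t))}.
Hypothesis ig : m.-integrable setT (EFin \o g).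
Hypothesis g0 : forall z, ~ inQ z -> g z = 0.
Hypothesis mb : measurable_fun setT b.
Hypothesis bq : (\int[m]_z (`|b z| `^ (p / (p - 1)))%:E < +oo)%E.
Hypothesis growth : {ae m, forall z, inQ z -> `|u z| <= k ->
  enorm (A z) <= C * (enorm (G z) `^ (p - 1) + `|b z|)}.
Hypothesis eqn : forall (h : R -> R) (eta : E -> R),
  test_function `]s0, t0[%classic h -> test_function Om eta ->
  (\int[m]_z (h z.2 * (\sum_i S1 (u z) * A z ord0 i * 'D_(delta_mx ord0 i) eta z.1
     + (\sum_i S2 (u z) * A z ord0 i * G z ord0 i + S1 (u z) * g z) * eta z.1)
             - S (u z) * 'D_1 h z.2 * eta z.1)%:E = 0)%E.

Let q := p / (p - 1).
Let p0 : 0 < p. Proof. by rewrite (lt_trans ltr01). Qed.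
Let q0 : 0 < q. Proof. by rewrite divr_gt0// subr_gt0. Qed.
Let mOm : measurable Om. Proof. exact: open_measurable_rV. Qed.

Let cS1 : continuous S1. Proof. exact: is_derive1_continuous dS1. Qed.
Let mS1 : measurable_fun setT S1. Proof. exact: continuous_measurable_fun. Qed.
Let mS2 : measurable_fun setT S2. Proof. exact: continuous_measurable_fun. Qed.

(** X(u) vanishes where |u| > k; elsewhere the growth condition bounds the flux by the
    gradient G of T_k(u), which is in L^p. *)
Lemma flux_Lq (X : R -> R) (B : R) i : 0 <= B -> measurable_fun setT X ->
  (forall y, `|X y| <= B) -> (forall y, k < `|y| -> X y = 0) ->
  (\int[m]_z (`|X (u z) * A z ord0 i| `^ q)%:E < +oo)%E.
Proof.
move=> B0 mX XB X0; have mXu : measurable_fun setT (fun z => X (u z)) by exact: (measurableT_comp mX mu).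
have BC0 : 0 <= B * C by exact: mulr_ge0.
have mGp : measurable_fun setT (fun z => enorm (G z) `^ p).
  by apply: measurable_powRl; exact: measurable_enorm.
have mbq : measurable_fun setT (fun z => `|b z| `^ q).
  by apply: measurable_powRl; exact: measurable_abs.
pose K := (B * C) `^ q * 2 `^ q.
have K0 : 0 <= K by rewrite mulr_ge0// powR_ge0.
apply: (@le_lt_trans _ _ (\int[m]_z (K * (enorm (G z) `^ p + `|b z| `^ q))%:E)%E).
  apply: ge0_le_integral_ae => //.
  - by move=> z _; rewrite lee_fin mulr_ge0// addr_ge0// powR_ge0.
  apply: ae_imp growth => z gz _; rewrite lee_fin.
  have RHS0 : 0 <= K * (enorm (G z) `^ p + `|b z| `^ q) by rewrite mulr_ge0// addr_ge0// powR_ge0.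
  have [Qz|nQ] := pselect (inQ z); last by rewrite A0// mxE mulr0 normr0 powR0// gt_eqF.
  have [uk|ku] := leP `|u z| k; last by rewrite X0// mul0r normr0 powR0// gt_eqF.
  have h := gz Qz uk.
  have h1 : `|X (u z) * A z ord0 i| <= (B * C) * (enorm (G z) `^ (p - 1) + `|b z|).
    rewrite normrM -mulrA; apply: ler_pM => //.
    exact: le_trans (coord_le_enorm _ _) h.
  apply: le_trans (le_powR (ltW q0) (normr_ge0 _) h1) _.
  rewrite powRM//; last by rewrite addr_ge0// powR_ge0.
  rewrite /K -mulrA ler_wpM2l ?powR_ge0//.
  have -> : enorm (G z) `^ p = (enorm (G z) `^ (p - 1)) `^ q.
    by rewrite -powRrM /q mulrCA divff ?mulr1// gt_eqF// subr_gt0.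
  by apply: powR_add_le; [exact: ltW|exact: powR_ge0|].
rewrite intZ//; last 2 first.
- exact: measurable_funD.
- by move=> z _; rewrite addr_ge0// powR_ge0.
apply: lte_mul_pinfty; [by rewrite lee_fin|by []|].
rewrite intD//; last by move=> z _; exact: powR_ge0.
by apply: lte_add_pinfty; [exact: Gp|exact: bq].
Qed.

Let F i (z : E * RR) : R := S1 (u z) * A z ord0 i.
Let F2 i (z : E * RR) : R := S2 (u z) * A z ord0 i.
Let K0 (z : E * RR) : R := \sum_i F2 i z * G z ord0 i + S1 (u z) * g z.

Let S1B : exists2 B : R, 0 <= B & forall x, `|S1 x| <= B.
Proof. by apply: (@cont_supp_bounded _ S1 k) => // x /ltW; exact: S1_out. Qed.

Let S2B : exists2 B : R, 0 <= B & forall x, `|S2 x| <= B.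
Proof. exact: (@cont_supp_bounded _ S2 k). Qed.

Let mF i : measurable_fun setT (F i).
Proof. by apply: measurable_funM => //; exact: (measurableT_comp mS1 mu). Qed.

Let mF2 i : measurable_fun setT (F2 i).
Proof. by apply: measurable_funM => //; exact: (measurableT_comp mS2 mu). Qed.

Let Fq i : (\int[m]_z (`|F i z| `^ q)%:E < +oo)%E.
Proof. by have [B B0 HB] := S1B; apply: (@flux_Lq S1 B) => // y /ltW; exact: S1_out. Qed.

Let F2q i : (\int[m]_z (`|F2 i z| `^ q)%:E < +oo)%E.
Proof. by have [B B0 HB] := S2B; exact: (@flux_Lq S2 B). Qed.

Let Gip i : (\int[m]_z (`|G z ord0 i| `^ p)%:E < +oo)%E.
Proof.
apply: le_lt_trans Gp; apply: int_le => // z _.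
by apply: le_powR => //; [exact: ltW|exact: coord_le_enorm].
Qed.

Let iF2G i : m.-integrable setT (EFin \o (fun z => F2 i z * G z ord0 i)).
Proof.
apply: integrable_real => //; first by apply: measurable_funM; [exact: mF2|exact: mG].
have mFq : measurable_fun setT (fun z => `|F2 i z| `^ q).
  exact: measurable_powRl (measurable_abs (mF2 i)).
have mPp : measurable_fun setT (fun z => `|G z ord0 i| `^ p).
  exact: measurable_powRl (measurable_abs (mG i)).
apply: (@le_lt_trans _ _ (\int[m]_z (`|F2 i z| `^ q + `|G z ord0 i| `^ p)%:E)%E).
  apply: int_le => // z _; rewrite normrM.
  have o1 (x : R) : 1 `^ x = 1 by rewrite powR1.
  have := young p1 (@ltr01 R) (normr_ge0 (F2 i z)) (normr_ge0 (G z ord0 i)).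
  by rewrite !o1 !mul1r.
rewrite intD//.
by apply: lte_add_pinfty; [exact: F2q|exact: Gip].
Qed.

Let iK0 : m.-integrable setT (EFin \o K0).
Proof.
apply: (integrable_addr measurableT); first exact: (integrable_sum_real iF2G).
have [B B0 HB] := S1B.
have := integrable_mul_bounded ig (measurableT_comp mS1 mu) (fun z => HB (u z)).
by apply: eq_integrable => // z _ /=; rewrite mulrC.
Qed.

Let F0 i z : ~ inQ z -> F i z = 0. Proof. by move=> h; rewrite /F A0// mxE mulr0. Qed.

Let K00 z : ~ inQ z -> K0 z = 0.
Proof.
move=> h; rewrite /K0 g0// mulr0 addr0 big1// => i _.
by rewrite G0// mxE mulr0.
Qed.

(** The derivative of S' theta_e at u times the flux, plus S' theta_e times the lower order
    term. *)
Definition window_integrand (z : E * RR) : R :=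
  (S2 (u z) * theta e (u z) + S1 (u z) * dtheta e (u z)) * dotv (A z) (G z) +
  S1 (u z) * theta e (u z) * g z.

Let kapE z : \sum_i F i z * Phi k u (theta e) G i z + K0 z * Th k u (theta e) z = window_integrand z.
Proof.
rewrite /window_integrand /Phi /Th /K0 D_theta// /F /F2.
have [uk|ku] := leP `|u z| k; last first.
  rewrite S2_out// (S1_out (ltW ku)) !mul0r !addr0 big1 ?add0r; last by move=> i _; rewrite !mul0r.
  by rewrite big1 ?mul0r// => i _; rewrite !mul0r.
rewrite trunc_id//.
have E1 : \sum_i S1 (u z) * A z ord0 i * (dtheta e (u z) * G z ord0 i) =
    S1 (u z) * dtheta e (u z) * dotv (A z) (G z).
  by rewrite /dotv mulr_sumr; apply: eq_bigr => i _; ring.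
have E2 : \sum_i S2 (u z) * A z ord0 i * G z ord0 i = S2 (u z) * dotv (A z) (G z).
  by rewrite /dotv mulr_sumr; apply: eq_bigr => i _; ring.
by rewrite E1 E2; ring.
Qed.

Let mPsi : measurable_fun setT Psi.
Proof. by apply: continuous_measurable_fun; exact: is_derive1_continuous dPsi. Qed.

Let mS : measurable_fun setT S.
Proof. by apply: continuous_measurable_fun; exact: is_derive1_continuous dS. Qed.

Let th_lip y z : `|theta e y - theta e z| <= (1 + e^-1) * `|y - z|.
Proof. exact: (lip_of_derive (is_derive_theta e0) (dtheta_bound e0 e1)). Qed.

Let dth_lip y z : `|'D_1 (theta e) y - 'D_1 (theta e) z| <= 6 / e * `|y - z|.
Proof. by rewrite !D_theta//; exact: (lip_of_derive (is_derive_dtheta e0) (ddtheta_bound e0)). Qed.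

Let dth_bound y : `|'D_1 (theta e) y| <= 1 + e^-1.
Proof. by rewrite D_theta//; exact: dtheta_bound. Qed.

Let th_meas : measurable_fun setT (theta e).
Proof. by apply: continuous_measurable_fun; apply: smooth_continuous; exact: smooth_theta. Qed.

Let dth_meas : measurable_fun setT ('D_1 (theta e)).
Proof.
by apply: continuous_measurable_fun; apply: smooth_continuous; apply: smoothD1; exact: smooth_theta.
Qed.

Let mTu : measurable_fun setT (fun z => trunc k (u z)).
Proof. exact: (measurableT_comp (measurable_trunc k) mu). Qed.

Lemma energy_continuous sg : s0 < sg < t0 ->
  energy Om U Psi @ sg --> energy Om U Psi sg.
Proof.
move=> sgI.
have [L L0 HL] := Psi_lip e0 dS1 S1_out dPsi.
have [B HB] := Psi_bounded e0 k0 dS1 S1_out Psi00 dPsi.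
have iP t : lebE.-integrable Om (EFin \o (fun x => Psi (U t x))).
  apply: measurable_bounded_integrable; [exact: mOm|exact: Omfin| |].
    exact: measurable_funS (measurableT_comp mPsi (mU t)).
  by exists B; split; [exact: num_real|] => y yM x _; apply: le_trans (HB _) _; exact: ltW.
apply/cvgrPdist_le => d d0.
have L1 : 0 < L + 1 by rewrite ltr_wpDl.
have dL : 0 < d / (L + 1) by rewrite divr_gt0.
have : \forall t \near sg, (\int[lebE]_(x in Om) `|U t x - U sg x|%:E <= (d / (L + 1))%:E)%E.
  have /fine_cvgP[ff fc] := Ucont sgI.
  move/cvgrPdist_le : fc => /(_ _ dL); apply: filterS2 ff => t ff.
  rewrite sub0r normrN /= => h; rewrite -(fineK ff) lee_fin.
  by apply: le_trans h; rewrite ler_norm.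
apply: filterS => t ht; rewrite -lee_fin.
apply: le_trans (Rint_dist mOm (iP sg) (iP t)) _.
apply: (@le_trans _ _ ((L + 1)%:E * (d / (L + 1))%:E)%E); last first.
  by rewrite -EFinM lee_fin mulrC mulfVK// gt_eqF.
apply: (@le_trans _ _ (\int[lebE]_(x in Om) ((L + 1) * `|U t x - U sg x|)%:E)%E).
  apply: int_le => // x Ox; apply: le_trans (HL _ _) _; rewrite distrC ler_wpM2r//.
  by rewrite lerDl.
have mUU : measurable_fun Om (fun x => `|U t x - U sg x|).
  by apply: measurable_abs; apply: measurable_funB; exact: measurable_funS (mU _).
rewrite (@intZ _ _ _ lebE Om mOm (L + 1) _ (ltW L1) mUU) //.
by apply: lee_wpmul2l => //; rewrite lee_fin ltW.
Qed.

Let F1 i : (\int[m]_z `|F i z|%:E < +oo)%E.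
Proof.
have := @Fint R N Om p s0 t0 oOm Omfin p1 s0t0 F mF F0 Fq i.
by case/integrableP.
Qed.

Let Phip i : (\int[m]_z (`|Phi k u (theta e) G i z| `^ p)%:E < +oo)%E.
Proof.
have B0 : 0 <= 1 + e^-1 by rewrite addr_ge0// invr_ge0 ltW.
have mGi : measurable_fun setT (fun z => `|G z ord0 i| `^ p).
  exact: measurable_powRl (measurable_abs (mG i)).
apply: (@le_lt_trans _ _ (\int[m]_z ((1 + e^-1) `^ p * `|G z ord0 i| `^ p)%:E)%E).
  apply: int_le => // z _.
  rewrite -powRM//; apply: le_powR; [exact: ltW|exact: normr_ge0|].
  by rewrite normrM ler_wpM2r.
rewrite (@intZ _ _ _ m setT measurableT _ _ (powR_ge0 _ _) mGi); last by move=> z _; exact: powR_ge0.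
by apply: lte_mul_pinfty; [rewrite lee_fin powR_ge0|by []|exact: Gip].
Qed.

(** The energy inequality for representatives that are measurable and defined
    everywhere; [slice_ineq] feeds [averaged_ineq]. *)
Theorem window_core a b' : s0 < a -> a < b' -> b' < t0 ->
  m.-integrable setT (EFin \o window_integrand) /\
  energy Om U Psi b' - energy Om U Psi a +
    \int[m]_z (window_integrand z * (a <= z.2 <= b')%R%:R) <= 0.
Proof.
move=> sa ab bt.
have [LS LS0 SL] := S_lip dS1 S1_out dS.
have [BS SB] := S_bounded k0 dS1 S1_out S00 dS.
have [BP PB] := Psi_bounded e0 k0 dS1 S1_out Psi00 dPsi.
pose B := Num.max BS BP.
have SB' y : `|S y| <= B by rewrite le_max SB.
have PB' y : `|Psi y| <= B by rewrite le_max PB orbT.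
have eqn' (h : R -> R) (eta : E -> R) :
    test_function `]s0, t0[%classic h -> test_function Om eta ->
    \int[m]_z (h z.2 * (\sum_i F i z * 'D_(delta_mx ord0 i) eta z.1 + K0 z * eta z.1)
             - S (u z) * 'D_1 h z.2 * eta z.1) = 0.
  by move=> th te; rewrite /Rintegral (eqn th te).
have SI := @slice_ineq R N Om p s0 t0 k B LS (1 + e^-1) (6 / e) oOm Omfin p1 s0t0
  u U mu u0 mU Ucont uU S Psi (theta e) LS0 SL SB' S00 mS PB' mPsi (smooth_theta e0) (theta0 e)
  (theta_le1 e0) dth_bound th_lip dth_lip
  (profile_ineq e0 k0 S1_out S1_odd S1_ge0 S00 dS Psi00 dPsi)
  F K0 G mF F0 Fq iK0 K00 mG G0 eqn' k0 W0.
have mPhi i : measurable_fun setT (Phi k u (theta e) G i).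
  by apply: measurable_funM; [exact: (measurableT_comp dth_meas mTu)|exact: mG].
have mThu : measurable_fun setT (Th k u (theta e)) by exact: (measurableT_comp th_meas mTu).
have ThB z : `|Th k u (theta e) z| <= 1 by exact: theta_le1.
have ik := @integrable_kap R N p F (Phi k u (theta e) G) K0 (Th k u (theta e))
  p1 mF Fq mPhi Phip iK0 mThu ThB.
have AI := @averaged_ineq R N p s0 t0 a b' F (Phi k u (theta e) G) K0 (Th k u (theta e))
  (energy Om U Psi) p1 sa ab bt mF F1 Fq mPhi Phip iK0 mThu ThB SI energy_continuous.
split.
  by apply: eq_integrable ik => // z _ /=; rewrite -kapE.
move: AI; congr (_ + _ <= 0).
by apply: eq_Rintegral => z _; rewrite -kapE.
Qed.

End window_core.

Section window.
Context {R : realType} {N : nat}.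
Local Notation E := 'rV[R]_N.
Local Notation leb := (@lebesgue_measure R).
Local Notation RR := (measurableTypeR R).
Local Notation lebE := (lebesgue_rV N : {sigma_finite_measure set E -> \bar R}).
Local Notation m := (lebE \x leb)%E.
Local Notation leb2 := (@spacetime_measure R N).

Lemma cylinderP (Om : set E) (s0 t0 : R) (z : E * R) :
  cylinder Om s0%:E t0%:E z <-> Om z.1 /\ s0 < z.2 < t0.
Proof. by rewrite /cylinder/= !lte_fin. Qed.

Lemma cylinder_measurable (Om : set E) (s0 t0 : R) : open Om ->
  measurable (cylinder Om s0%:E t0%:E : set (E * RR)).
Proof.
move=> oOm; have -> : cylinder Om s0%:E t0%:E = Om `*` `]s0, t0[%classic.
  by apply/seteqP; split => z; rewrite /cylinder/= in_itv/= !lte_fin.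
by apply: measurableX; [exact: open_measurable_rV|exact: measurable_itv].
Qed.

Variables (Om : set E) (p s0 t0 C : R).
Local Notation Q := (cylinder Om s0%:E t0%:E).
Hypothesis oOm : open Om.
Hypothesis Omfin : (lebE Om < +oo)%E.
Hypothesis p1 : 1 < p.
Hypothesis s0t0 : s0 < t0.
Hypothesis C0 : 0 <= C.
Variables (u : E * R -> R) (Du Az : E * R -> E) (gz b : E * R -> R).
Hypothesis cu : cmeasurable leb2 Q u.
Hypothesis uL1 : forall t, s0 < t < t0 -> in_Lp lebE 1 Om (fun x => u (x, t)).
Hypothesis ucont : forall sg, s0 < sg < t0 ->
  (fun t => \int[lebE]_(x in Om) (`|u (x, t) - u (x, sg)| `^ 1)%:E)%E @ sg --> 0%E.
Hypothesis hW : trunc_in_Lp_W0 Om s0 t0 p u Du.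
Hypothesis cA : forall i, cmeasurable leb2 Q (fun z => Az z ord0 i).
Hypothesis hg : in_Lp leb2 1 Q gz.
Hypothesis hb : in_Lp leb2 (p / (p - 1)) Q b.
Hypothesis growth : {ae leb2, forall z, Q z ->
  enorm (Az z) <= C * (enorm (Du z) `^ (p - 1) + b z)}.
Hypothesis ren : forall S S1 S2, admissible S S1 S2 ->
  forall phi : E * R -> R, test_function Q phi ->
  (\int[leb2]_(z in Q)
      (- S (u z) * tderiv phi z + S1 (u z) * dotv (Az z) (xgrad phi z)
       + S2 (u z) * dotv (Az z) (Du z) * phi z - S1 (u z) * (- gz z) * phi z)%:E
     = 0)%E.
Variables (e k : R) (S1 S2 Psi : R -> R).
Hypothesis e0 : 0 < e.
Hypothesis e1 : e <= 1.
Hypothesis k0 : 0 <= k.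
Hypothesis dS1 : forall x : R, is_derive x 1 S1 (S2 x).
Hypothesis cS2 : continuous S2.
Hypothesis S1_out : forall y, k <= `|y| -> S1 y = 0.
Hypothesis S2_out : forall y, k < `|y| -> S2 y = 0.
Hypothesis S1_odd : forall y, S1 (- y) = - S1 y.
Hypothesis S1_ge0 : forall y, 0 <= y -> 0 <= S1 y.
Hypothesis Psi00 : Psi 0 = 0.
Hypothesis dPsi : forall x : R, is_derive x 1 Psi (S1 x * theta e x).

Let mOm : measurable Om. Proof. exact: open_measurable_rV. Qed.
Let mQ : measurable (Q : set (E * RR)). Proof. exact: cylinder_measurable. Qed.
Let p0 : 0 < p. Proof. by rewrite (lt_trans ltr01). Qed.

(** The slices of u are chosen for every time, since continuity in time concerns u
    itself and not its representative in space-time. *)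
Let slices_rep : exists U : R -> E -> R, forall t, measurable_fun setT (U t) /\
  (s0 < t < t0 -> {ae lebE, forall x, Om x -> u (x, t) = U t x}).
Proof.
suff H : forall t : R, exists h : E -> R, measurable_fun setT h /\
    (s0 < t < t0 -> {ae lebE, forall x, Om x -> u (x, t) = h x}).
  by have [U HU] := choice H; exists U.
move=> t; have [tI|tI] := boolP (s0 < t < t0); last first.
  by exists (cst 0); split => [|//]; exact: measurable_cst.
have [h [mh _ hE]] := cmeasurable_rep mOm (uL1 tI).1.
by exists h.
Qed.

Let int_Q (f : E * R -> R) (h : E * RR -> R) : (forall z, ~ Q z -> h z = 0) ->
  {ae leb2, forall z, Q z -> f z = h z} ->
  (\int[leb2]_(z in Q) (f z)%:E = \int[m]_z (h z)%:E)%E.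
Proof.
move=> h0 fh.
have -> : (\int[leb2]_(z in Q) (f z)%:E = \int[leb2]_(z in Q) (h z)%:E)%E.
  by apply: (integral_eq_ae mQ); apply: ae_imp fh => z h1 Qz; rewrite h1.
by apply: (@integral_supp _ _ _ leb2 Q (fun z => (h z)%:E) mQ) => z /h0 ->.
Qed.

(** The hypotheses of a renormalized solution determine u, Du, the flux and the lower
    order term up to null sets only; Z is the integrand of [window_core] for
    measurable representatives. *)
Theorem window_ineq a b' : s0 < a -> a < b' -> b' < t0 ->
  exists Z : E * RR -> R, [/\ m.-integrable setT (EFin \o Z),
    forall z, ~ Q z -> Z z = 0,
    {ae leb2, forall z, Q z -> Z z =
      (S2 (u z) * theta e (u z) + S1 (u z) * dtheta e (u z)) * dotv (Az z) (Du z) +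
      S1 (u z) * theta e (u z) * gz z} &
    \int[lebE]_(x in Om) Psi (u (x, b')) - \int[lebE]_(x in Om) Psi (u (x, a)) +
    \int[m]_z (Z z * (a <= z.2 <= b')%R%:R) <= 0].
Proof.
move=> sa ab bt.
have cS1 : continuous S1 by exact: is_derive1_continuous dS1.
have [S [S00 dS]] := exists_primitive0 cS1 (fun y ky => S1_out (ltW ky)).
have adm := profile_admissible k0 dS1 cS2 S1_out S2_out S00 dS.
have [ut [mut ut0 utE]] := cmeasurable_rep mQ cu.
have [At [mAt At0 AtE]] := vec_rep mQ cA.
have [gt [mgt gt0 gtE]] := cmeasurable_rep mQ hg.1.
have [bt_ [mbt bt0 btE]] := cmeasurable_rep mQ hb.1.
have [U HU] := slices_rep.
have [G0 [[_ [cG0 G0p] G0W] GDu]] := hW k0.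
have [G [mG Gout GE]] := vec_rep mQ cG0.
have nQ z : ~ (Om z.1 /\ s0 < z.2 < t0) -> ~ Q z by move=> h /cylinderP.
have inQ z : Om z.1 /\ s0 < z.2 < t0 -> Q z by move=> h; apply/cylinderP.
have uU : {ae leb, forall t, s0 < t < t0 ->
    {ae lebE, forall x, Om x -> ut (x, t) = U t x}}.
  apply: leb_aeS (ae_slices utE) => t ht tI.
  have [_ /(_ tI) h] := HU t.
  apply: filterS2 ht h => x h1 h2 Ox; rewrite -h1 ?h2//.
have Ucont sg : s0 < sg < t0 ->
    (fun t => \int[lebE]_(x in Om) `|U t x - U sg x|%:E)%E @ sg --> 0%E.
  move=> sgI; have := ucont sgI; apply: cvg_trans; apply: near_eq_cvg.
  have := near_itvoo sgI; apply: filterS => t tI.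
  have [_ /(_ tI) h1] := HU t; have [_ /(_ sgI) h2] := HU sg.
  apply: (integral_eq_ae mOm); apply: filterS2 h1 h2 => x h1 h2 Ox.
  by rewrite h1// h2// powRr1.
have Gp : (\int[m]_z (enorm (G z) `^ p)%:E < +oo)%E.
  have <- := @int_Q (fun z => enorm (G0 z) `^ p) (fun z => enorm (G z) `^ p) _ _.
  - exact: G0p.
  - by move=> z h; rewrite Gout// (proj2 (enorm0_eq _))// powR0// gt_eqF.
  - by apply: ae_imp GE => z h Qz; rewrite h.
have W0 : {ae leb, forall t, s0 < t < t0 ->
    in_W0 Om p (fun x => trunc k (ut (x, t))) (fun x => G (x, t))}.
  apply: leb_aeS (leb_aeI G0W (leb_aeI (ae_slices utE) (ae_slices GE))) => t [h1 [h2 h3]] tI.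
  apply: (in_W0_ae oOm _ _ (h1 tI)).
    by apply: filterS h2 => x h Ox; rewrite h//; exact: inQ.
  by apply: filterS h3 => x h Ox; rewrite h//; exact: inQ.
have ig : m.-integrable setT (EFin \o gt).
  apply: integrable_real => //.
  have <- := @int_Q (fun z => `|gz z| `^ 1) (fun z => `|gt z|) _ _.
  - exact: hg.2.
  - by move=> z h; rewrite gt0// normr0.
  - by apply: ae_imp gtE => z h Qz; rewrite h// powRr1.
have bq : (\int[m]_z (`|bt_ z| `^ (p / (p - 1)))%:E < +oo)%E.
  have q0 : p / (p - 1) != 0 by rewrite gt_eqF// divr_gt0// subr_gt0.
  have <- := @int_Q (fun z => `|b z| `^ (p / (p - 1))) (fun z => `|bt_ z| `^ (p / (p - 1))) _ _.
  - exact: hb.2.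
  - by move=> z h; rewrite bt0// normr0 powR0.
  - by apply: ae_imp btE => z h Qz; rewrite h.
have all_ae : {ae leb2, forall z, Q z -> [/\ u z = ut z, Az z = At z, gz z = gt z & b z = bt_ z] /\
   (`|u z| <= k -> Du z = G z)}.
  have h := ae_and utE (ae_and AtE (ae_and gtE (ae_and btE (ae_and GE GDu)))).
  apply: ae_imp h => z [h1 [h2 [h3 [h4 [h5 h6]]]]] Qz.
  split; first by split; [exact: h1|exact: h2|exact: h3|exact: h4].
  by move=> uk; rewrite -(h6 Qz uk) h5.
have growth' : {ae m, forall z, (Om z.1 /\ s0 < z.2 < t0) -> `|ut z| <= k ->
    enorm (At z) <= C * (enorm (G z) `^ (p - 1) + `|bt_ z|)}.
  apply: ae_imp (ae_and all_ae growth) => z [h1 h2] /inQ Qz uk.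
  have [[e_1 e_2 e_3 e_4] e_5] := h1 Qz.
  rewrite -e_2 -e_5 ?e_1//; apply: le_trans (h2 Qz) _.
  by rewrite ler_wpM2l// lerD2l -e_4 ler_norm.
have eqn' (h : R -> R) (eta : E -> R) :
  test_function `]s0, t0[%classic h -> test_function Om eta ->
  (\int[m]_z (h z.2 * (\sum_i S1 (ut z) * At z ord0 i * 'D_(delta_mx ord0 i) eta z.1
     + (\sum_i S2 (ut z) * At z ord0 i * G z ord0 i + S1 (ut z) * gt z) * eta z.1)
             - S (ut z) * 'D_1 h z.2 * eta z.1)%:E = 0)%E.
  move=> th te; have [tphi dt dx] := tensor_test th te.
  rewrite -(ren adm tphi); apply/esym; apply: int_Q.
    move=> z h1; rewrite ut0// S00 !mul0r subr0 At0// gt0// mulr0 addr0.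
    rewrite big1; last by move=> i _; rewrite mxE mulr0 mul0r.
    by rewrite big1 ?mul0r ?add0r ?mulr0// => i _; rewrite mxE mulr0 mul0r.
  apply: ae_imp all_ae => z h1 Qz; have [[e_1 e_2 e_3 e_4] e_5] := h1 Qz.
  rewrite dt -e_1 -e_2 -e_3.
  have E1 : \sum_i S1 (u z) * Az z ord0 i * 'D_(delta_mx ord0 i) eta z.1 * h z.2 =
     S1 (u z) * dotv (Az z) (xgrad (fun z => h z.2 * eta z.1) z).
    by rewrite /dotv mulr_sumr; apply: eq_bigr => i _; rewrite dx; ring.
  have E2 : \sum_i S2 (u z) * Az z ord0 i * G z ord0 i = S2 (u z) * dotv (Az z) (Du z).
    have [uk|ku] := leP `|u z| k.
      by rewrite e_5// /dotv mulr_sumr; apply: eq_bigr => i _; ring.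
    by rewrite S2_out// mul0r big1// => i _; rewrite !mul0r.
  rewrite -E1 E2 -mulr_suml; ring.
have [iZ ineq] := @window_core R N Om p s0 t0 C oOm Omfin p1 s0t0 C0 ut U mut
  (fun z h => ut0 z (nQ z h)) (fun t => (HU t).1) Ucont uU e k S1 S2 S Psi e0 e1 k0 dS1 cS2
  S1_out S2_out S1_odd S1_ge0 S00 dS Psi00 dPsi At G gt bt_ mAt (fun z h => At0 z (nQ z h))
  mG (fun z h => Gout z (nQ z h)) Gp W0 ig (fun z h => gt0 z (nQ z h)) mbt bq growth' eqn'
  a b' sa ab bt.
exists (window_integrand ut e S1 S2 At G gt); split.
- exact: iZ.
- move=> z h; rewrite /window_integrand ut0// At0// gt0// mulr0 addr0.
  by rewrite /dotv big1 ?mulr0// => i _; rewrite mxE mul0r.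
- apply: ae_imp all_ae => z h1 Qz; have [[e_1 e_2 e_3 e_4] e_5] := h1 Qz.
  rewrite /window_integrand -e_1 -e_2 -e_3.
  have [uk|ku] := leP `|u z| k; first by rewrite e_5.
  by rewrite S2_out// (S1_out (ltW ku)) !(mul0r, addr0).
move: ineq; rewrite /energy.
have EP t : s0 < t < t0 -> \int[lebE]_(x in Om) Psi (U t x) = \int[lebE]_(x in Om) Psi (u (x, t)).
  move=> tI; have [_ /(_ tI) h] := HU t.
  rewrite /Rintegral; congr fine; apply: (integral_eq_ae mOm).
  by apply: filterS h => x h Ox; rewrite h.
rewrite !EP//; first by rewrite sa (lt_trans ab).
by rewrite bt (lt_trans sa).
Qed.

End window.

(** * Smooth approximations of powers *)

Section cutoff.
Context {R : realType}.

Definition cutoff (n : nat) (y : R) : R := step (y + n.+1%:R) * step (n.+1%:R - y).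
Definition dcutoff (n : nat) (y : R) : R :=
  dstep (y + n.+1%:R) * step (n.+1%:R - y) - step (y + n.+1%:R) * dstep (n.+1%:R - y).

Lemma cutoff_ge0 n y : 0 <= cutoff n y. Proof. by rewrite mulr_ge0// step_ge0. Qed.

Lemma cutoff_le1 n y : cutoff n y <= 1.
Proof. by rewrite -[leRHS]mulr1 ler_pM// ?step_ge0 ?step_le1. Qed.

Lemma cutoff_even n y : cutoff n (- y) = cutoff n y.
Proof. by rewrite /cutoff opprK mulrC addrC (addrC n.+1%:R). Qed.

Lemma cutoff1 n y : `|y| <= n%:R -> cutoff n y = 1.
Proof.
rewrite ler_norml => /andP[h1 h2]; have n1 : n.+1%:R = n%:R + 1 :> R by rewrite -natr1.
by rewrite /cutoff !step1 ?mulr1// n1; lra.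
Qed.

Lemma cutoff0 n y : n.+1%:R <= `|y| -> cutoff n y = 0.
Proof.
rewrite ler_normr => /orP[h|h]; first by rewrite /cutoff [X in _ * X]step0 ?mulr0// subr_le0.
by rewrite /cutoff step0 ?mul0r//; rewrite -lerBrDr sub0r lerNr.
Qed.

Lemma is_derive_cutoff n (y : R) : is_derive y 1 (cutoff n) (dcutoff n y).
Proof.
have d1 : is_derive y 1 (fun y : R => y + n.+1%:R) 1.
  by have := is_deriveD (is_derive_id y (1 : R)) (is_derive_cst (n.+1%:R : R) y 1); rewrite addr0.
have d2 : is_derive y 1 (fun y : R => n.+1%:R - y) (- 1).
  by have := is_deriveB (is_derive_cst (n.+1%:R : R) y 1) (is_derive_id y (1 : R)); rewrite sub0r.
have e1 := is_derive_comp d1 (is_derive_step (y + n.+1%:R)).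
have e2 := is_derive_comp d2 (is_derive_step (n.+1%:R - y)).
have d := is_deriveM e1 e2.
apply: (is_derive_eq (d : is_derive y 1 (cutoff n) _)).
by rewrite /GRing.scale/= /dcutoff; ring.
Qed.

Lemma dcutoff_continuous n : continuous (@dcutoff n).
Proof.
have cst_ : continuous (@step R) by exact: smooth_continuous smooth_step.
have c1 : continuous (fun y : R => y + n.+1%:R).
  by move=> y; apply: cvgD; [exact: cvg_id|exact: cvg_cst].
have c2 : continuous (fun y : R => n.+1%:R - y).
  by move=> y; apply: cvgB; [exact: cvg_cst|exact: cvg_id].
have f1 : continuous (fun y : R => dstep (y + n.+1%:R)).
  by move=> y; apply: (@continuous_comp _ _ _ (fun y : R => y + n.+1%:R) dstep); [exact: c1|exact: dstep_continuous].
have f2 : continuous (fun y : R => step (n.+1%:R - y)).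
  by move=> y; apply: (@continuous_comp _ _ _ (fun y : R => n.+1%:R - y) step); [exact: c2|exact: cst_].
have f3 : continuous (fun y : R => step (y + n.+1%:R)).
  by move=> y; apply: (@continuous_comp _ _ _ (fun y : R => y + n.+1%:R) step); [exact: c1|exact: cst_].
have f4 : continuous (fun y : R => dstep (n.+1%:R - y)).
  by move=> y; apply: (@continuous_comp _ _ _ (fun y : R => n.+1%:R - y) dstep); [exact: c2|exact: dstep_continuous].
move=> y; apply: cvgB; apply: cvgM; [exact: f1|exact: f2|exact: f3|exact: f4].
Qed.

Lemma dcutoff0 n y : ~ (n%:R <= `|y| <= n.+1%:R) -> dcutoff n y = 0.
Proof.
have n1 : n.+1%:R = n%:R + 1 :> R by rewrite -natr1.
move=> h; rewrite /dcutoff !dstep0 ?mul0r ?mulr0 ?subrr//.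
- have [yn|yn] := ltP (n.+1%:R - y) 0; [by left|right].
  rewrite ltNge; apply/negP => h'; apply: h; rewrite ger0_norm; last by have := ler0n R n; lra.
  by rewrite n1; apply/andP; split; lra.
- have [yn|yn] := ltP (y + n.+1%:R) 0; [by left|right].
  rewrite ltNge; apply/negP => h'; apply: h; rewrite ler0_norm; last by have := ler0n R n; lra.
  by rewrite n1; apply/andP; split; lra.
Qed.

Lemma dcutoff_bound : exists2 C : R, 0 <= C & forall n y, `|dcutoff n y| <= C.
Proof.
have [C C0 HC] := @dstep_bounded R; exists (C + C); first by rewrite addr_ge0// ltW.
have st (t : R) : `|step t| <= 1 by rewrite ger0_norm ?step_ge0 ?step_le1.
move=> n y; apply: le_trans (ler_normB _ _) _; apply: lerD.
  rewrite (normrM (dstep _) (step _)) -[leRHS]mulr1; apply: ler_pM; [by []|by []|exact: HC|exact: st].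
rewrite (normrM (step _) (dstep _)) -[leRHS]mul1r; apply: ler_pM; [by []|by []|exact: st|exact: HC].
Qed.

End cutoff.

Lemma smooth_exprn {R : realType} n : smooth (fun y : R => y ^+ n).
Proof.
elim: n => [|n IH].
  have -> : (fun y : R => y ^+ 0) = cst 1 by apply/funext => y; rewrite expr0.
  exact: smooth_cst.
have -> : (fun y : R => y ^+ n.+1) = id \* (fun y : R => y ^+ n).
  by apply/funext => y; rewrite exprS.
exact: (smoothM smooth_id IH).
Qed.

Lemma powR_1 {R : realType} (c : R) : 1 `^ c = 1 :> R.
Proof. by rewrite powR1. Qed.

Section weight.
Context {R : realType}.
Variables (r e : R) (j : nat).
Hypothesis r1 : 1 <= r.
Hypothesis e0 : 0 < e.
Hypothesis e1 : e <= 1.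
Hypothesis rj : r <= 2 * j.+1%:R + 2.

Definition wc1 : R := (r - 2) / 2 - j.+1%:R.
Definition wc2 : R := (r - 1) / 2.
(** Behaves like |y|^(r - 2 j - 4) as e tends to 0. The first factor removes the
    singularity at 0, the second one makes [H] bounded for fixed e. *)
Definition weight (y : R) : R := (y ^+ 2 + e) `^ wc1 * (1 + e * y ^+ 2) `^ (- wc2).
Definition dlog_weight (y : R) : R :=
  wc1 * (2 * y) / (y ^+ 2 + e) - wc2 * (2 * e * y) / (1 + e * y ^+ 2).
(** The fraction of r |y|^(r-1) retained by |H y|, see [norm_H]; for y <> 0 it
    increases to 1 as e decreases to 0. *)
Definition retained (y : R) : R :=
  (y ^+ 2 / (y ^+ 2 + e)) `^ (- wc1) * (1 + e * y ^+ 2) `^ (- wc2).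
(** The approximation of r |y|^(r-2) y. The odd power of y allows the
    division by theta_e; j is taken so large that the exponent of y^2 + e in the weight
    is nonpositive, which is what makes |H y| <= r |y|^(r-1). *)
Definition H (y : R) : R := r * y ^+ (j.*2.+3) * weight y.
Definition dH (y : R) : R :=
  r * j.*2.+3%:R * y ^+ (j.*2.+2) * weight y + r * y ^+ (j.*2.+3) * (weight y * dlog_weight y).
(** A lower bound for H' in which the factor r (r - 1) of the limit is explicit, so that
    it vanishes at r = 1. *)
Definition lowH (y : R) : R :=
  r * (r - 1) * `|y| `^ (r - 2) * (retained y *
   (y ^+ 2 / (y ^+ 2 + e) - e * y ^+ 2 / (1 + e * y ^+ 2))).

Let wc1_le0 : wc1 <= 0.
Proof. by rewrite /wc1; move: rj; lra. Qed.

Let wc2_ge0 : 0 <= wc2. Proof. by rewrite /wc2; move: r1; lra. Qed.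

Let den1 (y : R) : 0 < y ^+ 2 + e. Proof. by rewrite ltr_wpDl// sqr_ge0. Qed.
Let den2 (y : R) : 0 < 1 + e * y ^+ 2.
Proof. by rewrite ltr_pwDl// mulr_ge0 ?sqr_ge0// ltW. Qed.

Lemma weight_gt0 y : 0 < weight y. Proof. by rewrite mulr_gt0// powR_gt0. Qed.

Lemma weight_even y : weight (- y) = weight y. Proof. by rewrite /weight sqrrN. Qed.

Lemma is_derive_weight (y : R) : is_derive y 1 weight (weight y * dlog_weight y).
Proof.
have d1 := is_derive_comp (is_derive_den e y) (is_derive1_powR wc1 (den1 y)).
have d2' : is_derive y 1 (fun y : R => 1 + e * y ^+ 2) (2 * e * y).
  have d := is_deriveD (is_derive_cst (1 : R) y 1) (is_deriveZ e (is_derive_sqr y)).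
  apply: (is_derive_eq (d : is_derive y 1 (fun y : R => 1 + e * y ^+ 2) _)).
  by rewrite /GRing.scale/=; ring.
have d2 := is_derive_comp d2' (is_derive1_powR (- wc2) (den2 y)).
have d := is_deriveM d1 d2.
apply: (is_derive_eq (d : is_derive y 1 weight _)).
rewrite /GRing.scale/= /weight /dlog_weight.
have pw (x c : R) : 0 < x -> x `^ (c - 1) = x `^ c / x.
  move=> x0; rewrite powRB ?powRr1//; first exact: ltW.
  by rewrite (gt_eqF x0) implybT.
rewrite !pw//; field; rewrite !gt_eqF//.
Qed.

Lemma H_odd y : H (- y) = - H y.
Proof.
rewrite /H weight_even exprNn -signr_odd /= negbK odd_double/=.
by rewrite expr1 mulN1r; ring.
Qed.

Lemma H_ge0 y : 0 <= y -> 0 <= H y.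
Proof.
move=> y0; apply: mulr_ge0; last exact: ltW (weight_gt0 y).
by apply: mulr_ge0; [exact: le_trans ler01 r1|exact: exprn_ge0].
Qed.

Lemma is_derive_exprn n (y : R) : is_derive y 1 (fun y : R => y ^+ n.+1) (n.+1%:R * y ^+ n).
Proof.
elim: n => [|n IH].
  by have := is_derive_id y (1 : R); rewrite expr0 mulr1.
have d := is_deriveM (is_derive_id y (1 : R)) IH.
have E : (fun y : R => y ^+ n.+2) = id * (fun y : R => y ^+ n.+1).
  by apply/funext => x; rewrite exprS.
rewrite E; apply: (is_derive_eq d).
by rewrite /GRing.scale/= mulr1 mulrCA -exprS -[in RHS](natr1 n.+1); ring.
Qed.

Lemma is_derive_H (y : R) : is_derive y 1 H (dH y).
Proof.
have d1 := is_deriveZ r (is_derive_exprn j.*2.+2 y).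
have d := is_deriveM (d1 : is_derive y 1 (fun y : R => r * y ^+ j.*2.+3) _) (is_derive_weight y).
apply: (is_derive_eq (d : is_derive y 1 H _)).
by rewrite /GRing.scale/= /dH; ring.
Qed.

Lemma retained_ge0 y : 0 <= retained y. Proof. by rewrite mulr_ge0 ?powR_ge0. Qed.

Let frac_ge0 (y : R) : 0 <= y ^+ 2 / (y ^+ 2 + e).
Proof. by rewrite divr_ge0 ?sqr_ge0// ltW. Qed.

Let frac_le1 (y : R) : y ^+ 2 / (y ^+ 2 + e) <= 1.
Proof. by rewrite ler_pdivrMr// mul1r lerDl ltW. Qed.

Let pow_le1 (x c : R) : 0 <= c -> 1 <= x -> x `^ (- c) <= 1.
Proof.
move=> c0 x1; have x0 : 0 < x by exact: lt_le_trans x1.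
rewrite powRN invf_le1 ?powR_gt0//.
by rewrite -[leLHS](powR_1 c); apply: le_powR.
Qed.

Lemma retained_le1 y : retained y <= 1.
Proof.
rewrite -[leRHS]mulr1 ler_pM ?powR_ge0//.
  by rewrite -[leRHS](powR_1 (- wc1)); apply: le_powR => //; rewrite oppr_ge0.
by apply: pow_le1 => //; rewrite lerDl mulr_ge0 ?sqr_ge0// ltW.
Qed.

Lemma weight_retained y : y != 0 -> y ^+ (j.*2.+2) * weight y = `|y| `^ (r - 2) * retained y.
Proof.
move=> y0; rewrite /weight /retained mulrA [RHS]mulrA; congr (_ * _).
have ny : 0 < `|y| by rewrite normr_gt0.
have y2 : y ^+ 2 = `|y| `^ 2.
  by rewrite -(real_normK (num_real y)) -powR_mulrn.
have -> : y ^+ j.*2.+2 = `|y| `^ (2 * j.+1%:R).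
  rewrite (_ : j.*2.+2 = 2 * j.+1)%N; last by rewrite mul2n doubleS.
  by rewrite exprM y2 -powR_mulrn ?powR_ge0// -powRrM.
rewrite powRM ?sqr_ge0 ?invr_ge0 ?(ltW (den1 y))//.
have -> : (y ^+ 2 + e)^-1 `^ (- wc1) = (y ^+ 2 + e) `^ wc1.
  by rewrite -powR_inv1 ?(ltW (den1 y))// -powRrM mulN1r opprK.
rewrite mulrA; congr (_ * _); rewrite y2 -powRrM -powRD; last by rewrite (gt_eqF ny) implybT.
by congr (_ `^ _); rewrite /wc1; field.
Qed.

Lemma norm_H y : y != 0 -> `|H y| = r * `|y| `^ (r - 1) * retained y.
Proof.
move=> y0; have ny : 0 < `|y| by rewrite normr_gt0.
have E : H y = r * y * (`|y| `^ (r - 2) * retained y).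
  by rewrite -weight_retained// /H exprS; ring.
rewrite E normrM [X in _ * X]normrM (ger0_norm (powR_ge0 _ _)) (ger0_norm (retained_ge0 y)).
rewrite normrM (ger0_norm (le_trans ler01 r1)).
rewrite -!mulrA; congr (_ * _); rewrite mulrA; congr (_ * _).
rewrite -[X in X * _](powRr1 (normr_ge0 y)) -powRD; last by rewrite (gt_eqF ny) implybT.
by congr (_ `^ _); ring.
Qed.

Lemma H0 : H 0 = 0. Proof. by rewrite /H expr0n/= mulr0 mul0r. Qed.

Lemma norm_H_le y : `|H y| <= r * `|y| `^ (r - 1).
Proof.
have [->|y0] := eqVneq y 0.
  by rewrite H0 normr0 mulr_ge0 ?powR_ge0// (le_trans ler01).
by rewrite norm_H// ler_piMr ?retained_le1// mulr_ge0 ?powR_ge0// (le_trans ler01).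
Qed.

(** The second factor of the weight compensates |y|^(r-1), as e y^2 <= 1 + e y^2. *)
Lemma norm_H_bounded y : `|H y| <= r * e `^ (- wc2).
Proof.
have r0 : 0 <= r by rewrite (le_trans ler01).
have [->|y0] := eqVneq y 0; first by rewrite H0 normr0 mulr_ge0 ?powR_ge0.
rewrite norm_H// -mulrA ler_wpM2l//.
have ny : 0 < `|y| by rewrite normr_gt0.
apply: (@le_trans _ _ (`|y| `^ (r - 1) * (1 + e * y ^+ 2) `^ (- wc2))).
  rewrite ler_wpM2l ?powR_ge0// /retained ler_piMl ?powR_ge0//.
  by rewrite -[leRHS](powR_1 (- wc1)); apply: le_powR => //; rewrite oppr_ge0.
have -> : e `^ (- wc2) = `|y| `^ (r - 1) * (e * y ^+ 2) `^ (- wc2).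
  rewrite powRM ?sqr_ge0 ?(ltW e0)//.
  have -> : (y ^+ 2) `^ (- wc2) = `|y| `^ (- (r - 1)).
    rewrite -(real_normK (num_real y)) -powR_mulrn// -powRrM; congr (_ `^ _).
    by rewrite /wc2; field.
  have cancel : `|y| `^ (r - 1) * `|y| `^ (- (r - 1)) = 1.
    by rewrite -powRD ?subrr ?powRr0// (gt_eqF ny) implybT.
  by rewrite mulrCA cancel mulr1.
rewrite ler_wpM2l ?powR_ge0// !powRN lef_pV2 ?posrE ?powR_gt0//; last first.
  by rewrite mulr_gt0// lt_neqAle sqr_ge0 eq_sym expf_neq0.
by apply: le_powR => //; [rewrite mulr_ge0 ?sqr_ge0// ltW|rewrite lerDr].
Qed.

Lemma frac_diff_ge0 y : 0 <= y ^+ 2 / (y ^+ 2 + e) - e * y ^+ 2 / (1 + e * y ^+ 2).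
Proof.
have -> : y ^+ 2 / (y ^+ 2 + e) - e * y ^+ 2 / (1 + e * y ^+ 2) =
    y ^+ 2 * (1 - e ^+ 2) / ((y ^+ 2 + e) * (1 + e * y ^+ 2)).
  by field; rewrite !gt_eqF.
apply: divr_ge0; last exact: (mulr_ge0 (ltW (den1 y)) (ltW (den2 y))).
apply: (mulr_ge0 (sqr_ge0 y)); rewrite subr_ge0.
by apply: exprn_ile1 => //; exact: ltW.
Qed.

Lemma lowH_ge0 y : 0 <= lowH y.
Proof.
rewrite /lowH !mulr_ge0 ?powR_ge0 ?retained_ge0 ?frac_diff_ge0//; last by rewrite subr_ge0.
by rewrite (le_trans ler01).
Qed.

(** In the logarithmic derivative of H the exponent 2 j + 3 is bounded from below by
    (2 j + 3) y^2 / (y^2 + e); this combines with the derivative of (y^2 + e)^wc1 to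
    (r - 1) y^2 / (y^2 + e), since 2 j + 3 + 2 wc1 = r - 1. *)
Lemma lowH_le y : lowH y <= dH y.
Proof.
have r0 : 0 <= r by rewrite (le_trans ler01).
have dHE : dH y = r * (y ^+ (j.*2.+2) * weight y) *
   (j.*2.+3%:R * (1 - y ^+ 2 / (y ^+ 2 + e)) +
    (r - 1) * (y ^+ 2 / (y ^+ 2 + e) - e * y ^+ 2 / (1 + e * y ^+ 2))).
  have j2 : j.*2.+3%:R = 2 * j.+1%:R + 1 :> R.
    rewrite (_ : j.*2.+3 = (2 * j.+1).+1)%N; last by rewrite mul2n doubleS.
    by rewrite -natr1 natrM.
  rewrite /dH /dlog_weight j2 (exprS y j.*2.+2) /wc1 /wc2.
  set P := y ^+ j.*2.+2; set w := weight y; set J := j.+1%:R.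
  by field; rewrite !gt_eqF.
have ev : 0 <= y ^+ (j.*2.+2) * weight y.
  by rewrite mulr_ge0 ?(ltW (weight_gt0 y))// exprn_even_ge0//= negbK odd_double.
have fl := frac_le1 y; have fd := frac_diff_ge0 y.
have [y0|y0] := eqVneq y 0.
  have -> : lowH y = 0 by rewrite /lowH y0 expr0n/= !(mul0r, mulr0, subr0).
  rewrite dHE; apply: mulr_ge0; first exact: mulr_ge0.
  apply: addr_ge0; first by apply: mulr_ge0 => //; rewrite subr_ge0.
  by apply: mulr_ge0; [rewrite subr_ge0|exact: fd].
rewrite dHE weight_retained// /lowH.
set X := `|y| `^ (r - 2) * retained y.
have X0 : 0 <= X by rewrite mulr_ge0 ?powR_ge0 ?retained_ge0.
set a := _ - _ in fd *.
have -> : r * (r - 1) * `|y| `^ (r - 2) * (retained y * a) = r * X * ((r - 1) * a) by rewrite /X; ring.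
apply: (ler_wpM2l (mulr_ge0 r0 X0)); rewrite lerDr.
by apply: mulr_ge0 => //; rewrite subr_ge0.
Qed.

End weight.

Section powers.
Context {R : realType}.

Lemma powR_norm_sqr (r y : R) : `|y| `^ r = (y ^+ 2) `^ (r / 2).
Proof.
rewrite -(real_normK (num_real y)) -(powR_mulrn _ (normr_ge0 y)) -powRrM; congr (_ `^ _).
by field.
Qed.

Lemma is_derive_powR_norm (r x : R) : 0 < x ->
  is_derive x 1 (fun y : R => `|y| `^ r) (r * x `^ (r - 1)).
Proof.
move=> x0; have x2 : 0 < x ^+ 2 by rewrite exprn_gt0.
have -> : (fun y : R => `|y| `^ r) = (fun y : R => (y ^+ 2) `^ (r / 2)).
  by apply/funext => y; exact: powR_norm_sqr.
have d := is_derive_comp (is_derive_sqr x) (is_derive1_powR (r / 2) x2).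
apply: (is_derive_eq (d : is_derive x 1 (fun y : R => (y ^+ 2) `^ (r / 2)) _)).
have -> : (x ^+ 2) `^ (r / 2 - 1) = x `^ (r - 2).
  have -> : r / 2 - 1 = (r - 2) / 2 by field.
  by rewrite -powR_norm_sqr gtr0_norm.
have -> : x `^ (r - 1) = x `^ (r - 2) * x.
  rewrite -[X in _ * X](powRr1 (ltW x0)) -powRD; last by rewrite (gt_eqF x0) implybT.
  by congr (_ `^ _); ring.
by field.
Qed.

(** Compares a function with a multiple of a power through their derivatives. *)
Lemma mvt_powR (r K a b : R) (F f : R -> R) : 0 < r -> 0 <= a -> a <= b ->
  (forall x : R, is_derive x 1 F (f x)) ->
  (forall x, a < x -> x < b -> f x <= K * (r * x `^ (r - 1))) ->
  F b - F a <= K * (b `^ r - a `^ r).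
Proof.
move=> r0 a0; rewrite le_eqVlt => /predU1P[<- _ _|ab dF fK]; first by rewrite !subrr mulr0.
pose D x := K * `|x| `^ r - F x.
have dD x : x \in `]a, b[ -> is_derive x 1 D (K * (r * x `^ (r - 1)) - f x).
  rewrite in_itv/= => /andP[ax xb].
  have x0 : 0 < x by exact: le_lt_trans ax.
  exact: (is_deriveB (is_deriveZ K (is_derive_powR_norm r x0)) (dF x)).
have cD : {within `[a, b], continuous D}.
  apply: continuous_subspaceT => x; apply: cvgB.
    by apply: cvgM; [exact: cvg_cst|exact: powR_norm_continuous].
  exact: (is_derive1_continuous dF).
have [c + E] := MVT ab dD cD; rewrite in_itv/= => /andP[ac cb].
have : 0 <= D b - D a.
  by rewrite E mulr_ge0 ?subr_ge0 ?fK// ltW.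
by rewrite /D (ger0_norm a0) (ger0_norm (le_trans a0 (ltW ab))); lra.
Qed.

End powers.

Section profile_functions.
Context {R : realType}.
Variables (r e : R) (j n : nat).
Hypothesis r1 : 1 <= r.
Hypothesis e0 : 0 < e.
Hypothesis e1 : e <= 1.
Hypothesis rj : r <= 2 * j.+1%:R + 2.

Definition ppoly (y : R) : R := r * y ^+ (j.*2.+1) * (y ^+ 2 + e).
(** The quotient of H zeta_n by theta_e, written without division by y^2. *)
Definition S1f (y : R) : R := ppoly y * weight r e j y * cutoff n y.
Definition S2f (y : R) : R :=
  ('D_1 ppoly y * weight r e j y + ppoly y * (weight r e j y * dlog_weight r e j y)) * cutoff n y +
  ppoly y * weight r e j y * dcutoff n y.

Let r0 : 0 <= r. Proof. exact: le_trans ler01 r1. Qed.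
Let den1 (y : R) : 0 < y ^+ 2 + e. Proof. by rewrite ltr_wpDl// sqr_ge0. Qed.
Let den2 (y : R) : 0 < 1 + e * y ^+ 2.
Proof. by rewrite ltr_pwDl// mulr_ge0 ?sqr_ge0// ltW. Qed.

Let smooth_ppoly : smooth ppoly.
Proof.
apply: (@smoothM _ _ (fun y : R => r * y ^+ (j.*2.+1)) (fun y : R => y ^+ 2 + e)).
  exact: (@smoothM _ _ (cst r) (fun y : R => y ^+ (j.*2.+1)) (smooth_cst r) (smooth_exprn _)).
exact: (@smoothD _ _ (fun y : R => y ^+ 2) (cst e) (smooth_exprn 2) (smooth_cst e)).
Qed.

Let dppoly (y : R) : is_derive y 1 ppoly ('D_1 ppoly y).
Proof. exact: (derivableP (@smooth_derivable _ _ ppoly y 1 smooth_ppoly)). Qed.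

Lemma is_derive_S1f (y : R) : is_derive y 1 S1f (S2f y).
Proof.
have d1 := is_deriveM (dppoly y) (is_derive_weight r j e0 y).
have d2 := is_deriveM (d1 : is_derive y 1 (fun y => ppoly y * weight r e j y) _) (is_derive_cutoff n y).
apply: (is_derive_eq (d2 : is_derive y 1 S1f _)).
by rewrite /GRing.scale/= /S2f; ring.
Qed.

Let cont_M (f g : R -> R) : continuous f -> continuous g -> continuous (fun y => f y * g y).
Proof. by move=> cf cg y; apply: cvgM; [exact: cf|exact: cg]. Qed.

Let cont_D (f g : R -> R) : continuous f -> continuous g -> continuous (fun y => f y + g y).
Proof. by move=> cf cg y; apply: cvgD; [exact: cf|exact: cg]. Qed.

Let cont_id : continuous (fun y : R => y). Proof. by move=> y; exact: cvg_id. Qed.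
Let cont_c (c : R) : continuous (fun _ : R => c). Proof. by move=> y; exact: cvg_cst. Qed.

Let dlog_continuous : continuous (dlog_weight r e j).
Proof.
have i1 : continuous (fun y : R => (y ^+ 2 + e)^-1) by exact: is_derive1_continuous (is_derive_deninv e0).
have i2 : continuous (fun y : R => (1 + e * y ^+ 2)^-1).
  have c : continuous (fun y : R => 1 + e * y ^+ 2).
    apply: (@is_derive1_continuous _ _ (fun y => 2 * e * y)) => y.
    have d := is_deriveD (is_derive_cst (1 : R) y 1) (is_deriveZ e (is_derive_sqr y)).
    apply: (is_derive_eq (d : is_derive y 1 (fun y : R => 1 + e * y ^+ 2) _)).
    by rewrite /GRing.scale/=; ring.
  by move=> y; apply: cvgV; [rewrite gt_eqF|exact: c].
have n1 : continuous (fun y : R => wc1 r j * (2 * y)).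
  by apply: cont_M; [exact: cont_c|apply: cont_M; [exact: cont_c|exact: cont_id]].
have n2 : continuous (fun y : R => wc2 r * (2 * e * y)).
  by apply: cont_M; [exact: cont_c|apply: cont_M; [exact: cont_c|exact: cont_id]].
by move=> y; apply: cvgB; apply: cvgM; [exact: n1|exact: i1|exact: n2|exact: i2].
Qed.

Lemma S2f_continuous : continuous S2f.
Proof.
have cw : continuous (weight r e j) by exact: is_derive1_continuous (is_derive_weight r j e0).
have cp : continuous ppoly by exact: smooth_continuous.
have cdp : continuous ('D_1 ppoly) by apply: smooth_continuous; exact: smoothD1.
have cc : continuous (@cutoff R n) by exact: is_derive1_continuous (is_derive_cutoff n).
have cdc := @dcutoff_continuous R n.
apply: cont_D; last exact: (cont_M (cont_M cp cw) cdc).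
apply: (fun h => cont_M h cc); apply: cont_D; first exact: (cont_M cdp cw).
exact: (cont_M cp (cont_M cw dlog_continuous)).
Qed.

Lemma S1f_out y : n.+1%:R <= `|y| -> S1f y = 0.
Proof. by move=> h; rewrite /S1f cutoff0// mulr0. Qed.

Lemma S2f_out y : n.+1%:R < `|y| -> S2f y = 0.
Proof.
move=> h; rewrite /S2f cutoff0 ?(ltW h)// mulr0 add0r dcutoff0 ?mulr0//.
by move=> /andP[_]; rewrite leNgt h.
Qed.

Lemma S1f_odd y : S1f (- y) = - S1f y.
Proof.
rewrite /S1f /ppoly weight_even cutoff_even sqrrN exprNn -signr_odd /= odd_double/=.
by rewrite expr1 mulN1r; ring.
Qed.

Lemma S1f_ge0 y : 0 <= y -> 0 <= S1f y.
Proof.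
move=> y0; apply: mulr_ge0; last exact: cutoff_ge0.
apply: mulr_ge0; last exact: ltW (weight_gt0 r j e0 y).
apply: mulr_ge0; last exact: ltW.
by apply: mulr_ge0 => //; exact: exprn_ge0.
Qed.

Lemma S1f_theta y : S1f y * theta e y = H r e j y * cutoff n y.
Proof.
rewrite /S1f /ppoly /theta /H (exprS y j.*2.+2) (exprS y j.*2.+1).
by field; rewrite gt_eqF.
Qed.

Lemma dS1f_theta y : S2f y * theta e y + S1f y * dtheta e y =
  dH r e j y * cutoff n y + H r e j y * dcutoff n y.
Proof.
have d1 := is_deriveM (is_derive_S1f y) (is_derive_theta e0 y).
have d2 := is_deriveM (is_derive_H r j e0 y) (is_derive_cutoff n y).
have E : S1f * theta e = H r e j * cutoff n by apply/funext => z; exact: S1f_theta.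
have [_ D1] := d1; have [_ D2] := d2; rewrite E D2 in D1.
move: D1; rewrite /GRing.scale/= => D1.
by rewrite (mulrC (S2f y)) addrC -D1; ring.
Qed.

Variable Psi : R -> R.
Hypothesis Psi00 : Psi 0 = 0.
Hypothesis dPsi : forall x : R, is_derive x 1 Psi (S1f x * theta e x).

Let dPsi' : forall x : R, is_derive x 1 Psi (H r e j x * cutoff n x).
Proof. by move=> x; rewrite -S1f_theta. Qed.

Let Psi_even : forall y, Psi (- y) = Psi y.
Proof.
apply: (odd_primitive_even Psi00 dPsi') => y.
by rewrite H_odd cutoff_even mulNr.
Qed.

Let Psi_norm y : Psi y = Psi `|y|.
Proof. by case: (ler0P y) => _; rewrite ?Psi_even. Qed.

Lemma Psi_ge0 y : 0 <= Psi y.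
Proof.
rewrite Psi_norm; have [c /andP[c0 _]] := mvt dPsi' (normr_ge0 y).
rewrite Psi00 !subr0 => ->; rewrite mulr_ge0// mulr_ge0 ?cutoff_ge0//.
exact: H_ge0.
Qed.

Lemma Psi_lipschitz y z : `|Psi y - Psi z| <= (r * e `^ (- wc2 r)) * `|y - z|.
Proof.
apply: (lip_of_derive dPsi') => x.
rewrite normrM -[leRHS]mulr1; apply: ler_pM => //; first exact: norm_H_bounded.
by rewrite ger0_norm ?cutoff_ge0 ?cutoff_le1.
Qed.

Lemma Psi_le_powR y : Psi y <= `|y| `^ r.
Proof.
have rr : 0 < r by exact: lt_le_trans r1.
have h x : 0 < x -> x < `|y| -> H r e j x * cutoff n x <= 1 * (r * x `^ (r - 1)).
  move=> x0 _; rewrite mul1r.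
  have hx : 0 <= H r e j x by apply: H_ge0 => //; exact: ltW.
  apply: (@le_trans _ _ (H r e j x)); first by rewrite ler_piMr// cutoff_le1.
  have := norm_H_le r1 e0 rj x; rewrite (ger0_norm hx) (gtr0_norm x0).
  by [].
have := mvt_powR rr (lexx 0) (normr_ge0 y) dPsi' h.
have rn : r != 0 by rewrite gt_eqF.
by rewrite -Psi_norm Psi00 subr0 (powR0 rn) subr0 mul1r.
Qed.

(** For |x| >= rho^(1/2) and e = rho^2 the fraction x^2 / (x^2 + e) is at least
    1 / (1 + rho), which bounds the derivative of Psi from below by a multiple of that
    of |x|^r; this is integrated from rho^(1/2) to |y|, whence the term rho^(r/2). *)
Lemma Psi_lower (rho : R) y : e = rho ^+ 2 -> 0 < rho -> `|y| <= n%:R ->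
  (1 + rho) `^ (wc1 r j) * (1 + e * y ^+ 2) `^ (- wc2 r) * (`|y| `^ r - rho `^ (r / 2)) <= Psi y.
Proof.
move=> erho rho0 yn.
have rr : 0 < r by exact: lt_le_trans r1.
have c1 : wc1 r j <= 0 by rewrite /wc1; move: rj; lra.
have c2 : 0 <= wc2 r by rewrite /wc2; move: r1; lra.
set K := _ * _ `^ (- wc2 r).
have K0 : 0 <= K by rewrite mulr_ge0 ?powR_ge0.
(* below eta = rho^(1/2) the left-hand side is nonpositive *)
pose eta := rho `^ 2^-1.
have eta0 : 0 < eta by rewrite powR_gt0.
have eta2 : eta ^+ 2 = rho.
  rewrite -(powR_mulrn _ (ltW eta0)) /eta -powRrM mulVf//.
  by rewrite powRr1// ltW.
have etar : eta `^ r = rho `^ (r / 2) by rewrite /eta -powRrM mulrC.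
rewrite -etar; have [ye|ey] := leP `|y| eta.
  apply: le_trans (Psi_ge0 y); rewrite mulr_ge0_le0// subr_le0.
  by apply: le_powR => //; exact: ltW.
have h x : eta < x -> x < `|y| -> - (H r e j x * cutoff n x) <= (- K) * (r * x `^ (r - 1)).
  move=> ex xy; have x0 : 0 < x by exact: lt_trans ex.
  have xn : `|x| <= n%:R by rewrite gtr0_norm// (le_trans (ltW xy)).
  rewrite mulNr lerN2 cutoff1// mulr1.
  have hx : 0 <= H r e j x by apply: H_ge0 => //; exact: ltW.
  rewrite -[leRHS](ger0_norm hx) norm_H ?gt_eqF// (gtr0_norm x0) mulrC.
  rewrite ler_wpM2l ?mulr_ge0 ?powR_ge0// /K /retained.
  apply: ler_pM; rewrite ?powR_ge0//.
    have -> : (1 + rho) `^ wc1 r j = (1 + rho)^-1 `^ (- wc1 r j).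
      have rho1 : 0 <= 1 + rho by rewrite addr_ge0// ltW.
      by rewrite -powR_inv1// -powRrM mulN1r opprK.
    apply: le_powR; [by rewrite oppr_ge0|by rewrite invr_ge0 addr_ge0// ltW|].
    have x2 : rho <= x ^+ 2.
      rewrite -eta2 ler_sqr ?nnegrE; [exact: ltW|exact: ltW|exact: ltW].
    rewrite -[leLHS]div1r ler_pdivrMr; last by rewrite ltr_wpDl.
    rewrite mulrAC ler_pdivlMr// mul1r erho.
    have : rho * rho <= rho * x ^+ 2 by rewrite ler_wpM2l// ltW.
    by rewrite mulrDr mulr1 (mulrC (x ^+ 2)) lerD2l expr2.
  rewrite !powRN lef_pV2 ?posrE ?powR_gt0//.
  apply: le_powR => //; first by rewrite addr_ge0// mulr_ge0 ?sqr_ge0// ltW.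
  rewrite lerD2l ler_wpM2l ?(ltW e0)//.
  by rewrite -(real_normK (num_real y)) ler_sqr ?nnegrE ?(ltW x0)// ltW.
have dN (x : R) : is_derive x 1 (fun x => - Psi x) (- (H r e j x * cutoff n x)).
  exact: is_deriveN (dPsi' x).
have := mvt_powR rr (ltW eta0) (ltW ey) dN h.
rewrite mulNr -opprD lerN2 -Psi_norm => hh.
have := Psi_ge0 eta; move: hh; lra.
Qed.

End profile_functions.

(** * Limits of the approximations *)

Section limits.
Context {R : realType}.
Variables (r : R) (j : nat).

Lemma dl_cvg0 : (fun i => dl i : R) @ \oo --> (0 : R). Proof. exact: cvg_harmonic. Qed.

(** A square, as [Psi_lower] requires. *)
Definition eps (i : nat) : R := dl i ^+ 2.

Lemma eps_gt0 i : 0 < eps i. Proof. by rewrite exprn_gt0// dl_gt0. Qed.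

Lemma eps_le1 i : eps i <= 1.
Proof. by apply: exprn_ile1; [exact: ltW (dl_gt0 i)|exact: dl_le1]. Qed.

Lemma eps_cvg0 : eps @ \oo --> (0 : R).
Proof.
have -> : (0 : R) = 0 * 0 by rewrite mulr0.
by apply: cvgM; exact: dl_cvg0.
Qed.

Lemma powR_cvg1 (f : nat -> R) (c : R) : f @ \oo --> (1 : R) -> (fun i => f i `^ c) @ \oo --> (1 : R).
Proof.
move=> f1; have cp : {for (1 : R), continuous (fun x : R => x `^ c)}.
  apply: differentiable_continuous; apply/derivable1_diffP.
  exact: (@ex_derive _ _ _ _ _ _ _ (is_derive1_powR c (@ltr01 R))).
rewrite -[X in _ --> X](powR_1 c).
exact: (cvg_comp _ _ f1 cp).
Qed.

Lemma frac_cvg1 (y : R) : y != 0 -> (fun i => y ^+ 2 / (y ^+ 2 + eps i)) @ \oo --> (1 : R).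
Proof.
move=> y0; have y2 : y ^+ 2 != 0 by rewrite expf_neq0.
rewrite -[X in _ --> X](mulfV y2); apply: cvgM; first exact: cvg_cst.
apply: cvgV => //; rewrite -[X in _ --> X](addr0 (y ^+ 2)).
by apply: cvgD; [exact: cvg_cst|exact: eps_cvg0].
Qed.

Lemma den_cvg1 (y : R) : (fun i => 1 + eps i * y ^+ 2) @ \oo --> (1 : R).
Proof.
rewrite -[X in _ --> X](addr0 1); apply: cvgD; first exact: cvg_cst.
by rewrite -[X in _ --> X](mul0r (y ^+ 2)); apply: cvgM; [exact: eps_cvg0|exact: cvg_cst].
Qed.

Lemma retained_cvg1 (y : R) : y != 0 -> (fun i => retained r (eps i) j y) @ \oo --> (1 : R).
Proof.
move=> y0; rewrite -[X in _ --> X](mulr1 1); apply: cvgM.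
  by apply: powR_cvg1; exact: frac_cvg1.
by apply: powR_cvg1; exact: den_cvg1.
Qed.

Lemma lowH_cvg (y : R) : y != 0 ->
  (fun i => lowH r (eps i) j y) @ \oo --> r * (r - 1) * `|y| `^ (r - 2).
Proof.
move=> y0; rewrite -[X in _ --> X](mulr1 (r * (r - 1) * `|y| `^ (r - 2))).
apply: cvgM; first exact: cvg_cst.
rewrite -[X in _ --> X](mulr1 1); apply: cvgM; first exact: retained_cvg1.
rewrite -[X in _ --> X](subr0 1); apply: cvgB; first exact: frac_cvg1.
have -> : (0 : R) = 0 * y ^+ 2 / 1 by rewrite !mul0r.
apply: cvgM; first by apply: cvgM; [exact: eps_cvg0|exact: cvg_cst].
by apply: cvgV; [exact: oner_neq0|exact: den_cvg1].
Qed.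

Hypothesis r1 : 1 <= r.

Lemma norm_H_cvg (y : R) : y != 0 ->
  (fun i => `|H r (eps i) j y|) @ \oo --> r * `|y| `^ (r - 1).
Proof.
move=> y0; rewrite -[X in _ --> X](mulr1 (r * `|y| `^ (r - 1))).
under eq_fun do rewrite (norm_H _ r1 (eps_gt0 _) y0).
by apply: cvgM; [exact: cvg_cst|exact: retained_cvg1].
Qed.

Lemma lower_cvg (y : R) : (fun i => (1 + dl i) `^ (wc1 r j) * (1 + eps i * y ^+ 2) `^ (- wc2 r) *
   (`|y| `^ r - dl i `^ (r / 2))) @ \oo --> `|y| `^ r.
Proof.
have r2 : 0 < r / 2 by rewrite divr_gt0// (lt_le_trans ltr01).
have c0 : (fun i => dl i `^ (r / 2)) @ \oo --> (0 : R).
  have h := @powR_norm_continuous R _ r2 0.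
  rewrite /continuous_at normr0 powR0 ?gt_eqF// in h.
  have := cvg_comp _ _ dl_cvg0 h; apply: cvg_trans; apply: near_eq_cvg; apply: nearW => i /=.
  by rewrite gtr0_norm ?dl_gt0.
rewrite -[X in _ --> X]mul1r; apply: cvgM.
  rewrite -[X in _ --> X](mulr1 1); apply: cvgM; last by apply: powR_cvg1; exact: den_cvg1.
  apply: powR_cvg1; rewrite -[X in _ --> X](addr0 1).
  by apply: cvgD; [exact: cvg_cst|exact: dl_cvg0].
by rewrite -[X in _ --> X](subr0 (`|y| `^ r)); apply: cvgB; [exact: cvg_cst|exact: c0].
Qed.

End limits.

(** * Fatou's lemma for two integrals *)

Section fatou_pair.
Context {R : realType}.

Lemma limn_einf_ge (u : nat -> \bar R) (x : \bar R) : (\forall i \near \oo, (x <= u i)%E) ->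
  (x <= limn_einf u)%E.
Proof.
move=> [N _ HN]; rewrite limn_einf_lim; apply: lime_ge; first exact: is_cvg_einfs.
exists N => // n /= Nn; rewrite /einfs; apply: le_ereal_inf_tmp => _ [k /= nk <-].
by apply: HN => /=; exact: leq_trans nk.
Qed.

Lemma limn_einf_gt (u : nat -> \bar R) (x : \bar R) : (x < limn_einf u)%E ->
  \forall i \near \oo, (x <= u i)%E.
Proof.
rewrite limn_einf_lim => xu; apply: contrapT => nx.
have le n : (einfs u n <= x)%E.
  rewrite leNgt; apply/negP => h; apply: nx; exists n => // k /= nk.
  apply: le_trans (ltW h) _; apply: ereal_inf_lbound; exists k => //.
have : (limn (einfs u) <= x)%E.
  by apply: lime_le; [exact: is_cvg_einfs|exact: nearW].
by rewrite leNgt xu.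
Qed.

Context d1 d2 {T1 : measurableType d1} {T2 : measurableType d2}.
Variables (m1 : {measure set T1 -> \bar R}) (m2 : {measure set T2 -> \bar R}).

Lemma fatou_ae d {T : measurableType d} (mu : {measure set T -> \bar R})
    (f : nat -> T -> R) (F : T -> R) :
  (forall i, measurable_fun setT (f i)) -> (forall i x, 0 <= f i x) -> (forall x, 0 <= F x) ->
  {ae mu, forall x, forall e : R, 0 < e -> \forall i \near \oo, F x - e <= f i x} ->
  (\int[mu]_x (F x)%:E <= limn_einf (fun i => \int[mu]_x (f i x)%:E))%E.
Proof.
move=> mf f0 F0 lim.
apply: le_trans (fatou mu measurableT (f := fun i x => (f i x)%:E) _ _); last 2 first.
- by move=> i; apply/measurable_EFinP; exact: mf.
- by move=> i x _; rewrite lee_fin.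
apply: ge0_le_integral_ae; first exact: measurableT.
- by move=> x _; rewrite lee_fin.
- by move=> x _; apply: limn_einf_ge; apply: nearW => i; rewrite lee_fin.
apply: ae_imp lim => x h _; apply/lee_addgt0Pr => e e0.
rewrite -leeBlDr//; apply: limn_einf_ge; have := h e e0; apply: filterS => i.
by rewrite -EFinB lee_fin.
Qed.

(** Only the sum of the two integrals is bounded: a bound for both is extracted from
    values strictly below the two lower limits. *)
Lemma fatou_pair (f : nat -> T1 -> R) (F : T1 -> R) (g : nat -> T2 -> R) (G : T2 -> R)
    (c : R) (k : nat -> R) :
  (forall i, measurable_fun setT (f i)) -> (forall i x, 0 <= f i x) -> (forall x, 0 <= F x) ->
  {ae m1, forall x, forall e : R, 0 < e -> \forall i \near \oo, F x - e <= f i x} ->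
  (forall i, measurable_fun setT (g i)) -> (forall i x, 0 <= g i x) -> (forall x, 0 <= G x) ->
  {ae m2, forall x, forall e : R, 0 < e -> \forall i \near \oo, G x - e <= g i x} ->
  k @ \oo --> (0 : R) ->
  (forall i, \int[m1]_x (f i x)%:E + \int[m2]_x (g i x)%:E <= (c + k i)%:E)%E ->
  (\int[m1]_x (F x)%:E + \int[m2]_x (G x)%:E <= c%:E)%E.
Proof.
move=> mf f0 F0 lf mg g0 G0 lg k0 le.
have HF := fatou_ae mf f0 F0 lf; have HG := fatou_ae mg g0 G0 lg.
set IF := (\int[m1]_x (F x)%:E)%E in HF *; set IG := (\int[m2]_x (G x)%:E)%E in HG *.
have IF0 : (0 <= IF)%E by exact: int_ge0.
have IG0 : (0 <= IG)%E by exact: int_ge0.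
have main (x y : R) : (x%:E < IF)%E -> (y%:E < IG)%E -> x + y <= c.
  move=> xF yG.
  have h1 := limn_einf_gt (lt_le_trans xF HF).
  have h2 := limn_einf_gt (lt_le_trans yG HG).
  apply/ler_addgt0Pr => e e0.
  have h3 : \forall i \near \oo, k i <= e.
    move/cvgrPdist_le : k0 => /(_ _ e0); apply: filterS => i; rewrite sub0r normrN.
    exact: le_trans (ler_norm _).
  have [i [a1 [a2 a3]]] := filter_ex (filterI h1 (filterI h2 h3)).
  have := le_trans (leeD a1 a2) (le i); rewrite -EFinD lee_fin; lra.
have c0 : 0 <= c.
  apply/ler_addgt0Pr => e e0.
  have h3 : \forall i \near \oo, k i <= e.
    move/cvgrPdist_le : k0 => /(_ _ e0); apply: filterS => i; rewrite sub0r normrN.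
    exact: le_trans (ler_norm _).
  have [i hi] := filter_ex h3.
  have h : (0 <= (c + k i)%:E)%E.
    by apply: le_trans (le i); apply: adde_ge0; apply: int_ge0.
  by move: h; rewrite lee_fin => h; rewrite (le_trans h)// lerD2l.
have neg (I : \bar R) : (0 <= I)%E -> ((- 1)%:E < I)%E.
  by apply: lt_le_trans; rewrite lte_fin ltrN10.
have IFf : IF \is a fin_num.
  rewrite ge0_fin_numE// ltey; apply/negP => /eqP E.
  have := main (c + 2) (- 1); rewrite E ltry => /(_ isT (neg _ IG0)); lra.
have IGf : IG \is a fin_num.
  rewrite ge0_fin_numE// ltey; apply/negP => /eqP E.
  have := main (- 1) (c + 2); rewrite E ltry => /(_ (neg _ IF0) isT); lra.
rewrite -(fineK IFf) -(fineK IGf) -EFinD lee_fin; apply/ler_addgt0Pr => e e0.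
have e2 : 0 < e / 2 by rewrite divr_gt0.
have := main (fine IF - e / 2) (fine IG - e / 2).
rewrite -[X in (_ < X)%E -> _](fineK IFf) -[X in _ -> (_ < X)%E -> _](fineK IGf) !lte_fin.
have h (x : R) : x - e / 2 < x by rewrite ltrBlDr ltrDl.
by move=> /(_ (h _) (h _)); lra.
Qed.

End fatou_pair.

Lemma powR_pred_mul {R : realType} (p x : R) : 1 < p -> 0 <= x -> x `^ (p - 1) * x = x `^ p.
Proof.
move=> p1; rewrite le_eqVlt => /predU1P[<-|x0].
  by rewrite mulr0 powR0// gt_eqF// (lt_trans ltr01).
rewrite -[X in _ * X](powRr1 (ltW x0)) -powRD ?subrK//.
by rewrite (gt_eqF x0) implybT.
Qed.

(** * The energy inequality from time 0 *)

Lemma ge0_subset_int {R : realType} d (T : measurableType d) (mu : {measure set T -> \bar R})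
    (D1 D2 : set T) (f : T -> \bar R) : D1 `<=` D2 -> (forall x, 0 <= f x)%E ->
  (\int[mu]_(x in D1) f x <= \int[mu]_(x in D2) f x)%E.
Proof.
move=> D12 f0; rewrite integral_mkcond [leRHS]integral_mkcond.
apply: ge0_le_integral_ae; first exact: measurableT.
- by move=> x _; rewrite patchE; case: ifP.
- by move=> x _; rewrite patchE; case: ifP.
apply: aeW => x _; rewrite !patchE; case: ifPn => [/set_mem/D12 Dx|_]; first by rewrite mem_set.
by case: ifP.
Qed.

Section energy_step.
Context {R : realType} {N : nat}.
Local Notation E := 'rV[R]_N.
Local Notation leb := (@lebesgue_measure R).
Local Notation RR := (measurableTypeR R).
Local Notation lebE := (lebesgue_rV N : {sigma_finite_measure set E -> \bar R}).
Local Notation m := (lebE \x leb)%E.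
Local Notation leb2 := (@spacetime_measure R N).
Variables (Om : set E) (t0 p q C nu lambda gamma r : R) (j : nat).
Local Notation Q s := (cylinder Om s%:E t0%:E).
Hypothesis oOm : open Om.
Hypothesis Omfin : (lebE Om < +oo)%E.
Hypothesis p1 : 1 < p.
Hypothesis q1 : 1 < q.
Hypothesis C0 : 0 <= C.
Hypothesis nu0 : 0 <= nu.
Hypothesis gamma0 : 0 <= gamma.
Hypothesis r1 : 1 <= r.
Hypothesis rj : r <= 2 * j.+1%:R + 2.
Variables (u : E * R -> R) (Du Az : E * R -> E) (gz b : E * R -> R).
Hypothesis cu : forall s, 0 < s -> s < t0 -> cmeasurable leb2 (Q s) u.
Hypothesis hW : forall s, 0 < s -> s < t0 -> trunc_in_Lp_W0 Om s t0 p u Du.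
Hypothesis hg : forall s, 0 < s -> s < t0 -> in_Lp leb2 1 (Q s) gz.
Hypothesis ren : forall s, 0 < s -> s < t0 -> forall S S1 S2, admissible S S1 S2 ->
  forall phi : E * R -> R, test_function (Q s) phi ->
  (\int[leb2]_(z in Q s)
      (- S (u z) * tderiv phi z + S1 (u z) * dotv (Az z) (xgrad phi z)
       + S2 (u z) * dotv (Az z) (Du z) * phi z - S1 (u z) * (- gz z) * phi z)%:E
     = 0)%E.
Hypothesis tails : forall s, 0 < s -> s < t0 ->
  (fun n : nat => \int[leb2]_(z in Q s `&` [set z : E * R | (n%:R <= `|u z| <= n.+1%:R)%R])
          (enorm (Du z) `^ p)%:E)%E @ \oo --> 0%E.
Hypothesis uL1 : forall t, 0 < t < t0 -> in_Lp lebE 1 Om (fun x => u (x, t)).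
Hypothesis ucont : forall sg, 0 < sg < t0 ->
  (fun t => \int[lebE]_(x in Om) (`|u (x, t) - u (x, sg)| `^ 1)%:E)%E @ sg --> 0%E.
Hypothesis cA : forall i, cmeasurable leb2 (Q 0) (fun z => Az z ord0 i).
Hypothesis hb : in_Lp leb2 (p / (p - 1)) (Q 0) b.
Hypothesis growth : {ae leb2, forall z, Q 0 z ->
  enorm (Az z) <= C * (enorm (Du z) `^ (p - 1) + b z)}.
Hypothesis coercive : {ae leb2, forall z, Q 0 z ->
  nu * enorm (Du z) `^ p <= dotv (Az z) (Du z)}.
Hypothesis sign : {ae leb2, forall z, Q 0 z ->
  gamma * `|u z| `^ (lambda + 1) * enorm (Du z) `^ q <= gz z * u z}.
(* everywhere defined representatives, so that the integrands below may be integrated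
   over the whole space-time *)
Variables (ut bt : E * RR -> R) (Dt : E * RR -> E).
Hypothesis mut : measurable_fun setT ut.
Hypothesis mbt : measurable_fun setT bt.
Hypothesis mDt : forall i, measurable_fun setT (fun z => Dt z ord0 i).
Hypothesis Dt0 : forall z, ~ Q 0 z -> Dt z = 0.
Hypothesis bt0 : forall z, ~ Q 0 z -> bt z = 0.
Hypothesis utE : {ae leb2, forall z, Q 0 z -> u z = ut z}.
Hypothesis DtE : {ae leb2, forall z, Q 0 z -> Du z = Dt z}.
Hypothesis btE : {ae leb2, forall z, Q 0 z -> b z = bt z}.

(** The part of the energy inequality with a sign: diffusion and absorption,
    regularised and cut at height n. *)
Definition dissipation (e : R) (n : nat) (z : E * RR) : R :=
  cutoff n (ut z) * (nu * (lowH r e j (ut z) * enorm (Dt z) `^ p) +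
    gamma * (`|H r e j (ut z)| * `|ut z| `^ lambda * enorm (Dt z) `^ q)).
(** Bounds the error of the cutoff: by the growth condition and Young's inequality the
    product of the flux and Du is at most C times the first factor. *)
Definition tail_integrand (s : R) (n : nat) (z : E * RR) : R :=
  (2 * enorm (Dt z) `^ p + `|bt z| `^ (p / (p - 1))) *
  ((n%:R <= `|ut z| <= n.+1%:R)%R%:R * \1_(Q s) z).

Let p0 : 0 < p. Proof. by rewrite (lt_trans ltr01). Qed.
Let q0 : 0 < q. Proof. by rewrite (lt_trans ltr01). Qed.
Let pp0 : 0 < p / (p - 1). Proof. by rewrite divr_gt0// subr_gt0. Qed.
Let mOm : measurable Om. Proof. exact: open_measurable_rV. Qed.
Let mQ s : measurable (Q s : set (E * RR)). Proof. exact: cylinder_measurable. Qed.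
Let QS s : 0 <= s -> Q s `<=` Q 0.
Proof.
move=> s0 z /cylinderP[z1 /andP[z2 z3]]; apply/cylinderP; split => //.
by rewrite z3 (le_lt_trans s0).
Qed.

Lemma tail_integrand_ge0 s n z : 0 <= tail_integrand s n z.
Proof. by rewrite /tail_integrand mulr_ge0// addr_ge0 ?powR_ge0// mulr_ge0 ?powR_ge0. Qed.

Lemma measurable_tail_integrand s n : measurable_fun setT (tail_integrand s n).
Proof.
apply: measurable_funM.
  apply: measurable_funD.
    by apply: measurable_funM => //; apply: measurable_powRl; exact: measurable_enorm.
  by apply: measurable_powRl; exact: measurable_abs.
apply: measurable_funM; last by apply: measurable_indic; exact: mQ.
apply: (@measurableT_comp _ _ _ _ _ _ (fun b : bool => b%:R : R)) => //.
have mau : measurable_fun setT (fun z => `|ut z|) by exact: measurable_abs.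
by apply: measurable_and; apply: measurable_fun_ler => //; exact: measurable_cst.
Qed.

Lemma dissipation_ge0 e n z : 0 < e -> e <= 1 -> 0 <= dissipation e n z.
Proof.
move=> e0 e1; rewrite /dissipation mulr_ge0 ?cutoff_ge0//.
apply: addr_ge0; apply: mulr_ge0 => //.
  by apply: mulr_ge0; [exact: lowH_ge0|exact: powR_ge0].
by apply: mulr_ge0; [apply: mulr_ge0; rewrite ?powR_ge0|exact: powR_ge0].
Qed.

Lemma tail_cvg0 s : 0 < s -> s < t0 ->
  (fun n => \int[m]_z (tail_integrand s n z)%:E)%E @ \oo --> 0%E.
Proof.
move=> s0 st.
have H1 := cvge0Z 2 (tails s0 st).
pose f n (z : E * RR) := `|bt z| `^ (p / (p - 1)) * ((n%:R <= `|ut z| <= n.+1%:R)%R%:R * \1_(Q s) z).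
have mind n : measurable_fun setT (fun z : E * RR => (n%:R <= `|ut z| <= n.+1%:R)%R%:R * \1_(Q s) z : R).
  apply: measurable_funM; last by apply: measurable_indic; exact: mQ.
  apply: (@measurableT_comp _ _ _ _ _ _ (fun b : bool => b%:R : R)) => //.
  have mau : measurable_fun setT (fun z => `|ut z|) by exact: measurable_abs.
  by apply: measurable_and; apply: measurable_fun_ler => //; exact: measurable_cst.
have mbp : measurable_fun setT (fun z => `|bt z| `^ (p / (p - 1))).
  by apply: measurable_powRl; exact: measurable_abs.
have mDp : measurable_fun setT (fun z => enorm (Dt z) `^ p).
  by apply: measurable_powRl; exact: measurable_enorm.
have mf n : measurable_fun setT (f n) by exact: measurable_funM.
have ib : m.-integrable setT (EFin \o (fun z => `|bt z| `^ (p / (p - 1)))).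
  apply: integrable_real => //.
  have [_ bfin] := hb.
  apply: le_lt_trans bfin.
  rewrite -(@integral_supp _ _ _ m (Q 0) (fun z => `| `|bt z| `^ (p / (p - 1))|%:E) (@mQ 0)); last first.
    by move=> z nQ; rewrite bt0// normr0 powR0 ?normr0// gt_eqF.
  apply: ge0_le_integral_ae.
  - exact: mQ.
  - by move=> z _; rewrite lee_fin.
  - by move=> z _; rewrite lee_fin powR_ge0.
  - by apply: ae_imp btE => z h Qz; rewrite h// ger0_norm ?powR_ge0.
have H2 : (fun n => \int[m]_z (f n z)%:E)%E @ \oo --> 0%E.
  have hc : {ae m, forall z, setT z -> (fun n => (f n z)%:E) @ \oo --> (0 : R)%:E}.
    apply: aeW => z _; apply: cvg_EFin; first exact: nearW.
    apply: cvg_near_cst; exists (Num.bound `|ut z|) => // n /= hn.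
    have nb : (n%:R <= `|ut z| <= n.+1%:R) = false.
      apply/negP => /andP[h _].
      have := archi_boundP (normr_ge0 (ut z)); rewrite ltNge => /negP; apply.
      by apply: le_trans h; rewrite ler_nat.
    by rewrite /f nb mul0r mulr0.
  have dom : {ae m, forall z n, setT z -> (`|(f n z)%:E| <= (`|bt z| `^ (p / (p - 1)))%:E)%E}.
    apply: aeW => z n _; rewrite lee_fin /f normrM (ger0_norm (powR_ge0 _ _)).
    rewrite ler_piMr ?powR_ge0// normrM -[leRHS]mulr1; apply: ler_pM => //.
      by case: (_ <= _ <= _); rewrite ?normr1 ?normr0.
    by rewrite indicE; case: (_ \in _); rewrite ?normr1 ?normr0.
  have mfE n : measurable_fun setT (fun z => (f n z)%:E) by apply/measurable_EFinP; exact: mf.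
  have [_ _] := dominated_convergence measurableT mfE
    (measurable_cst _) hc ib dom.
  by rewrite integral0.
apply: (cvge0_le _ _ (cvge0D H1 H2)) => n; first by apply: int_ge0 => // z _; exact: tail_integrand_ge0.
pose f1 (z : E * RR) := enorm (Dt z) `^ p * ((n%:R <= `|ut z| <= n.+1%:R)%R%:R * \1_(Q s) z).
have mf1 : measurable_fun setT f1 by exact: measurable_funM.
have f10 z : 0 <= f1 z by rewrite /f1 mulr_ge0 ?powR_ge0// mulr_ge0.
have -> : (\int[m]_z (tail_integrand s n z)%:E = 2%:E * \int[m]_z (f1 z)%:E + \int[m]_z (f n z)%:E)%E.
  rewrite -(@intZ _ _ _ m setT measurableT 2 f1)//.
  rewrite -(@intD _ _ _ m setT measurableT (fun z => 2 * f1 z) (f n)).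
  - by apply: eq_integral => z _; congr EFin; rewrite /tail_integrand /f1 /f; ring.
  - exact: measurable_funM.
  - exact: mf.
  - by move=> z _; rewrite mulr_ge0.
  - by move=> z _; rewrite /f mulr_ge0 ?powR_ge0// mulr_ge0.
apply: leeD => //; apply: lee_wpmul2l => //.
rewrite [leRHS]integral_mkcond; apply: ge0_le_integral_ae.
- exact: measurableT.
- by move=> z _; rewrite lee_fin.
- by move=> z _; rewrite patchE; case: ifP => // _; rewrite lee_fin powR_ge0.
apply: ae_imp (ae_and utE DtE) => z [h1 h2] _; rewrite patchE.
have [Qz|nQ] := pselect (Q s z); last first.
  rewrite /f1 indicE memNset// !mulr0.
  by case: ifP => // _; rewrite lee_fin powR_ge0.
have Q0z := QS (ltW s0) Qz.
rewrite /f1 -h1// -h2// indicE mem_set// mulr1.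
case: ifPn => [_|].
  by rewrite lee_fin ler_piMr ?powR_ge0//; case: (_ <= _ <= _).
rewrite notin_setE => nin.
have -> : (n%:R <= `|u z| <= n.+1%:R) = false by apply/negP => hh; apply: nin; split.
by rewrite mulr0.
Qed.

Lemma measurable_dissipation e n : 0 < e -> measurable_fun setT (dissipation e n).
Proof.
move=> e0.
have cH : continuous (H r e j) by exact: is_derive1_continuous (is_derive_H r j e0).
have mH : measurable_fun setT (fun z => `|H r e j (ut z)|).
  by apply: measurable_abs; apply: (@measurableT_comp _ _ _ _ _ _ (H r e j) _ ut) => //; exact: continuous_measurable_fun.
have mD (c : R) : measurable_fun setT (fun z => enorm (Dt z) `^ c).
  by apply: measurable_powRl; exact: measurable_enorm.
have mL : measurable_fun setT (fun z => lowH r e j (ut z)).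
  have mu2 : measurable_fun setT (fun z => ut z ^+ 2) by exact: measurable_funM.
  have m1 : measurable_fun setT (fun z => (ut z ^+ 2 + e)^-1).
    apply: (@measurableT_comp _ _ _ _ _ _ (fun y : R => (y ^+ 2 + e)^-1) _ ut) => //.
    by apply: continuous_measurable_fun; exact: is_derive1_continuous (is_derive_deninv e0).
  have m2 : measurable_fun setT (fun z => (1 + e * ut z ^+ 2)^-1).
    have E z : (1 + e * ut z ^+ 2)^-1 = (1 + e * ut z ^+ 2) `^ (- 1).
      by rewrite powR_inv1// addr_ge0// mulr_ge0 ?sqr_ge0// ltW.
    under eq_fun do rewrite E; apply: measurable_powRl.
    by apply: measurable_funD => //; exact: measurable_funM.
  apply: measurable_funM.
    apply: measurable_funM => //; apply: measurable_powRl; exact: measurable_abs.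
  have m3 : measurable_fun setT (fun z => ut z ^+ 2 / (ut z ^+ 2 + e)) by exact: measurable_funM.
  apply: measurable_funM.
    apply: measurable_funM; apply: measurable_powRl => //.
    by apply: measurable_funD => //; exact: measurable_funM.
  apply: measurable_funB => //.
  by apply: measurable_funM => //; exact: measurable_funM.
have mc : measurable_fun setT (fun z => cutoff n (ut z)).
  apply: (@measurableT_comp _ _ _ _ _ _ (@cutoff R n) _ ut) => //.
  by apply: continuous_measurable_fun; exact: is_derive1_continuous (is_derive_cutoff n).
apply: measurable_funM => //; apply: measurable_funD.
  by apply: measurable_funM => //; exact: measurable_funM.
apply: measurable_funM => //; apply: measurable_funM => //; apply: measurable_funM => //.
by apply: measurable_powRl; exact: measurable_abs.
Qed.

(** The derivative of the cutoff only acts on n <= |u| <= n + 1; K bounds its product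
    with H. *)
Lemma integrand_lower e n s K (Z : E * RR -> R) : 0 < e -> e <= 1 -> 0 < s -> 0 <= K ->
  (forall y : R, `|dcutoff n y| * `|H r e j y| <= K) ->
  {ae leb2, forall z, Q s z -> Z z =
      (S2f r e j n (u z) * theta e (u z) + S1f r e j n (u z) * dtheta e (u z)) * dotv (Az z) (Du z) +
      S1f r e j n (u z) * theta e (u z) * gz z} ->
  {ae leb2, forall z, Q s z -> dissipation e n z <= Z z + (K * C) * tail_integrand s n z}.
Proof.
move=> e0 e1 s0 K0 HK ZE.
apply: ae_imp (ae_and ZE (ae_and utE (ae_and DtE (ae_and btE (ae_and growth (ae_and coercive sign)))))).
move=> z [h1 [h2 [h3 [h4 [h5 [h6 h7]]]]]] Qs; have Q0z := QS (ltW s0) Qs.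
rewrite (h1 Qs) dS1f_theta// S1f_theta// /dissipation /tail_integrand.
rewrite -(h2 Q0z) -(h3 Q0z) -(h4 Q0z) indicE mem_set// mulr1.
have {}h5 := h5 Q0z; have {}h6 := h6 Q0z; have {}h7 := h7 Q0z.
set y := u z in h7 *; set D := Du z in h5 h6 h7 *; set X := Az z in h5 h6 *.
set ze := cutoff n y.
have ze0 : 0 <= ze by exact: cutoff_ge0.
have D0 : 0 <= enorm D by exact: enorm_ge0.
have Dp0 : 0 <= enorm D `^ p by exact: powR_ge0.
have XD0 : 0 <= dotv X D by apply: le_trans h6; rewrite mulr_ge0.
have L0 := lowH_ge0 j r1 e0 e1 y.
have diff : ze * (nu * (lowH r e j y * enorm D `^ p)) <= ze * (dH r e j y * dotv X D).
  rewrite ler_wpM2l//; apply: (@le_trans _ _ (lowH r e j y * dotv X D)).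
    by rewrite mulrCA ler_wpM2l.
  by rewrite ler_wpM2r// lowH_le.
have abso : ze * (gamma * (`|H r e j y| * `|y| `^ lambda * enorm D `^ q)) <= ze * (H r e j y * gz z).
  rewrite ler_wpM2l//.
  have [y0|y0] := eqVneq y 0; first by rewrite y0 H0 normr0 !mul0r mulr0.
  have ny : 0 < `|y| by rewrite normr_gt0.
  have Hy : H r e j y * `|y| = `|H r e j y| * y.
    case: (ler0P y) => yy.
      have : H r e j y <= 0 by rewrite -oppr_ge0 -H_odd; apply: H_ge0 => //; rewrite oppr_ge0.
      by move=> /ler0_norm ->; rewrite mulrN mulNr.
    by rewrite ger0_norm// H_ge0// ltW.
  rewrite -(ler_pM2r ny) [leRHS]mulrAC Hy.
  have -> : gamma * (`|H r e j y| * `|y| `^ lambda * enorm D `^ q) * `|y| =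
     `|H r e j y| * (gamma * `|y| `^ (lambda + 1) * enorm D `^ q).
    rewrite powRD; last by rewrite (gt_eqF ny) implybT.
    by rewrite powRr1//; ring.
  by rewrite -[leRHS]mulrA ler_wpM2l// (mulrC y).
have err : - ((K * C) * ((2 * enorm D `^ p + `|b z| `^ (p / (p - 1))) *
    (n%:R <= `|y| <= n.+1%:R)%R%:R)) <= H r e j y * dcutoff n y * dotv X D.
  (* outside this region the cutoff is locally constant *)
  have [yI|yI] := boolP (n%:R <= `|y| <= n.+1%:R); last first.
    by rewrite dcutoff0; [rewrite !(mulr0, mul0r) oppr0|exact/negP].
  rewrite mulr1 lerNl; apply: le_trans (ler_norm _) _; rewrite normrN.
  rewrite (normrM (H r e j y * dcutoff n y)) (normrM (H r e j y)).
  apply: (@le_trans _ _ (K * `|dotv X D|)).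
    by rewrite ler_wpM2r// mulrC; exact: HK.
  rewrite -[leRHS]mulrA ler_wpM2l//; apply: le_trans (dotv_le _ _) _.
  apply: le_trans (ler_wpM2r D0 h5) _; rewrite -mulrA ler_wpM2l// mulrDl.
  rewrite powR_pred_mul// mulr2n mulrDl mul1r -addrA lerD2l.
  have yg := young p1 (@ltr01 R) (normr_ge0 (b z)) D0.
  rewrite !powR_1 !mul1r in yg.
  apply: le_trans (_ : `|b z| * enorm D <= _); first by rewrite ler_wpM2r// ler_norm.
  by rewrite addrC.
move: diff abso err; set P := (K * C) * _; lra.
Qed.

Let Psi_integral (Psi : R -> R) (B t : R) : 0 < t < t0 -> measurable_fun setT Psi ->
  (forall y, `|Psi y| <= B) ->
  (\int[lebE]_(x in Om) (Psi (u (x, t)))%:E = (\int[lebE]_(x in Om) Psi (u (x, t)))%:E)%E.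
Proof.
move=> tI mPsi PB; rewrite /Rintegral fineK//.
have [h [mh _ hE]] := cmeasurable_rep mOm (uL1 tI).1.
have -> : (\int[lebE]_(x in Om) (Psi (u (x, t)))%:E = \int[lebE]_(x in Om) (Psi (h x))%:E)%E.
  by apply: (integral_eq_ae mOm); apply: filterS hE => x hx Ox; rewrite hx.
apply: (integrable_fin_num mOm); apply: measurable_bounded_integrable; [exact: mOm|exact: Omfin| |].
  exact: measurable_funS (measurableT_comp mPsi mh).
by exists B; split; [exact: num_real|] => y yM x _; apply: le_trans (PB _) _; exact: ltW.
Qed.

Lemma energy_step e n s a tau K (Psi : R -> R) : 0 < e -> e <= 1 -> 0 < s -> s < a -> a < tau ->
  tau < t0 -> 0 <= K -> (forall y : R, `|dcutoff n y| * `|H r e j y| <= K) ->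
  Psi 0 = 0 -> (forall x : R, is_derive x 1 Psi (S1f r e j n x * theta e x)) ->
  (\int[lebE]_(x in Om) (Psi (u (x, tau)))%:E +
   \int[m]_z (dissipation e n z * (a <= z.2 <= tau)%R%:R)%:E <=
   \int[lebE]_(x in Om) (Psi (u (x, a)))%:E +
   \int[m]_z ((K * C) * tail_integrand s n z)%:E)%E.
Proof.
move=> e0 e1 s0 sa atau taut K0 HK Psi00 dPsi.
have st : s < t0 by exact: lt_trans (lt_trans sa atau) taut.
have ae_Q (P : E * R -> Prop) : {ae leb2, forall z, Q 0 z -> P z} -> {ae leb2, forall z, Q s z -> P z}.
  by apply: ae_imp => z h /(QS (ltW s0)).
have hbs : in_Lp leb2 (p / (p - 1)) (Q s) b.
  have [cb fb] := hb; split; first exact: (cmeasurableS (@mQ 0) (QS (ltW s0)) cb).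
  apply: le_lt_trans fb; apply: ge0_subset_int; first exact: (QS (ltW s0)).
  by move=> z; rewrite lee_fin powR_ge0.
have sI t : s < t < t0 -> 0 < t < t0 by move=> /andP[h1 ->]; rewrite (lt_trans s0).
have [Z [iZ Z0 ZE ineq]] := @window_ineq R N Om p s t0 C oOm Omfin p1 st C0 u Du Az gz b
  (cu s0 st) (fun t tI => uL1 (sI t tI)) (fun t tI => ucont (sI t tI)) (hW s0 st)
  (fun i => cmeasurableS (@mQ 0) (QS (ltW s0)) (cA i)) (hg s0 st) hbs (ae_Q _ growth) (ren s0 st)
  e n.+1%:R (S1f r e j n) (S2f r e j n) Psi e0 e1 (ler0n _ _) (is_derive_S1f r j n e0)
  (@S2f_continuous _ r e j n e0) (@S1f_out _ r e j n) (@S2f_out _ r e j n) (@S1f_odd _ r e j n)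
  (S1f_ge0 j n r1 e0) Psi00 dPsi a tau sa atau taut.
pose T z := (K * C) * tail_integrand s n z.
have mT : measurable_fun setT T by apply: measurable_funM => //; exact: measurable_tail_integrand.
have T0 z : 0 <= T z by apply: mulr_ge0; [exact: mulr_ge0|exact: tail_integrand_ge0].
pose win (z : E * RR) : R := (a <= z.2 <= tau)%R%:R.
have win0 z : 0 <= win z by [].
have win1 z : `|win z| <= 1 by rewrite /win; case: (_ <= _ <= _); rewrite ?normr1 ?normr0.
have mwin : measurable_fun setT win.
  apply: (@measurableT_comp _ _ _ _ _ _ (fun b : bool => b%:R : R)) => //.
  by apply: measurable_and; apply: measurable_fun_ler => //; exact: measurable_snd.
have [B HB] := Psi_bounded e0 (ler0n _ n.+1) (is_derive_S1f r j n e0) (@S1f_out _ r e j n) Psi00 dPsi.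
have mPsi : measurable_fun setT Psi.
  by apply: continuous_measurable_fun; exact: is_derive1_continuous dPsi.
have tauI : 0 < tau < t0 by rewrite taut (lt_trans _ atau)// (lt_trans s0).
have aI : 0 < a < t0 by rewrite (lt_trans s0)// (lt_trans atau).
rewrite (Psi_integral tauI mPsi HB) (Psi_integral aI mPsi HB) -/(T _).
have [Toof|Tfin] := eqVneq (\int[m]_z (T z)%:E)%E +oo%E.
  by rewrite Toof addey ?leey//.
have iT : m.-integrable setT (EFin \o T).
  apply: integrable_real => //.
  have -> : (\int[m]_z `|T z|%:E = \int[m]_z (T z)%:E)%E.
    by apply: eq_integral => z _; rewrite ger0_norm.
  by rewrite ltey.
have iZw := integrable_mul_bounded iZ mwin win1.
have iTw := integrable_mul_bounded iT mwin win1.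
pose X z := Z z * win z + T z * win z.
have iX : m.-integrable setT (EFin \o X) by exact: (integrable_addr measurableT iZw iTw).
have EX : \int[m]_z X z = \int[m]_z (Z z * win z) + \int[m]_z (T z * win z).
  exact: (RintegralD measurableT iZw iTw).
have dis0 z : 0 <= dissipation e n z * win z by rewrite mulr_ge0// dissipation_ge0.
have low : {ae m, forall z, dissipation e n z * win z <= X z}.
  apply: ae_imp (integrand_lower e0 e1 s0 K0 HK ZE) => z h.
  have [Qz|nQ] := pselect (Q s z); first by rewrite /X -mulrDl ler_wpM2r// h.
  rewrite /X Z0// mul0r add0r; have [wz|wz] := boolP (a <= z.2 <= tau); last first.
    by rewrite /win (negbTE wz) !mulr0.
  have nQ0 : ~ Q 0 z.
    move=> /cylinderP[z1 _]; apply: nQ; apply/cylinderP; split => //.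
    by have /andP[w1 w2] := wz; rewrite (lt_le_trans sa)//= (le_lt_trans w2).
  have D00 : enorm (Dt z) = 0 by rewrite Dt0//; apply/enorm0_eq.
  have pn : p != 0 by rewrite gt_eqF.
  have qn : q != 0 by rewrite gt_eqF.
  rewrite /dissipation D00 (powR0 pn) (powR0 qn) !mulr0 addr0 mulr0 mul0r.
  exact: mulr_ge0.
have XE : (\int[m]_z (X z)%:E = (\int[m]_z X z)%:E)%E.
  by rewrite /Rintegral fineK//; exact: (integrable_fin_num measurableT iX).
have DX : (\int[m]_z (dissipation e n z * win z)%:E <= (\int[m]_z X z)%:E)%E.
  rewrite -XE.
  have -> : (\int[m]_z (X z)%:E = \int[m]_z (Num.max 0 (X z))%:E)%E.
    apply: (integral_eq_ae measurableT); apply: ae_imp low => z h _.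
    by rewrite max_r// (le_trans (dis0 z)).
  apply: ge0_le_integral_ae.
  - exact: measurableT.
  - by move=> z _; rewrite lee_fin.
  - by move=> z _; rewrite lee_fin le_max lexx.
  - by apply: ae_imp low => z h _; rewrite lee_fin le_max h orbT.
have TX : ((\int[m]_z (T z * win z))%:E <= \int[m]_z (T z)%:E)%E.
  rewrite /Rintegral fineK; last exact: (integrable_fin_num measurableT iTw).
  apply: int_le => // z _; first by rewrite mulr_ge0.
  by rewrite ler_piMr// (le_trans (ler_norm _)).
have P1 : \int[lebE]_(x in Om) Psi (u (x, tau)) + \int[m]_z X z <=
  \int[lebE]_(x in Om) Psi (u (x, a)) + \int[m]_z (T z * win z) by rewrite EX addrA lerD2r -subr_le0 addrAC; exact: ineq.
apply: (@le_trans _ _ (\int[lebE]_(x in Om) Psi (u (x, tau)) + \int[m]_z X z)%:E).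
  by rewrite EFinD; apply: leeD.
apply: (@le_trans _ _ (\int[lebE]_(x in Om) Psi (u (x, a)) + \int[m]_z (T z * win z))%:E).
  by rewrite lee_fin.
by rewrite EFinD; apply: leeD.
Qed.

(** The order of the choices matters: e fixes the Lipschitz constant of Psi, which the
    initial hypothesis needs in order to provide a; then a fixes the window on which
    the tails tend to 0, and n is chosen last. *)
Lemma diagonal_step tau M i : 0 < tau < t0 ->
  (forall L ka de : R, 0 < ka -> 0 < de -> exists2 a, 0 < a < de &
     forall Psi : R -> R, (forall y, 0 <= Psi y) -> (forall y, Psi y <= `|y| `^ r) ->
       (forall y z, `|Psi y - Psi z| <= L * `|y - z|) ->
       (\int[lebE]_(x in Om) (Psi (u (x, a)))%:E <= (M + ka)%:E)%E) ->
  exists (a : R) (n : nat) (Psi : R -> R),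
    [/\ [/\ 0 < a, a < dl i & (i <= n)%N],
        [/\ measurable_fun setT Psi, Psi 0 = 0, (forall y, 0 <= Psi y) &
            forall y, `|y| <= n%:R ->
              (1 + dl i) `^ (wc1 r j) * (1 + eps i * y ^+ 2) `^ (- wc2 r) *
                (`|y| `^ r - dl i `^ (r / 2)) <= Psi y] &
        (\int[lebE]_(x in Om) (Psi (u (x, tau)))%:E +
         \int[m]_z (dissipation (eps i) n z * (a <= z.2 <= tau)%R%:R)%:E <=
         (M + 2 * dl i)%:E)%E].
Proof.
move=> /andP[tau0 taut] init.
have [Cd Cd0 HCd] := @dcutoff_bound R.
have e0 := @eps_gt0 R i; have e1 := @eps_le1 R i; have d0 := @dl_gt0 R i.
set e := eps i in e0 e1 *.
pose L := r * e `^ (- wc2 r); pose K := Cd * L.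
have L0 : 0 <= L by rewrite mulr_ge0 ?powR_ge0// (le_trans ler01).
have K0 : 0 <= K by exact: mulr_ge0.
have HK n (y : R) : `|dcutoff n y| * `|H r e j y| <= K.
  by apply: ler_pM => //; exact: norm_H_bounded.
have [a /andP[a0 am] Ha] := init L (dl i) (Num.min (dl i) tau) d0 (ltac:(by rewrite lt_min d0 tau0)).
move: am; rewrite lt_min => /andP[ad atau].
have s0 : 0 < a / 2 by rewrite divr_gt0.
have sa : a / 2 < a by rewrite ltr_pdivrMr// ltr_pMr// ltrDl ltr01.
have st : a / 2 < t0 by exact: lt_trans (lt_trans sa atau) taut.
have tail0 := cvge0Z (K * C) (tail_cvg0 s0 st).
have tail_ge0 n : (0 <= (K * C)%:E * \int[m]_z (tail_integrand (a / 2) n z)%:E)%E.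
  by apply: mule_ge0; [rewrite lee_fin mulr_ge0|apply: int_ge0 => z _; rewrite ?lee_fin tail_integrand_ge0].
have near0 := (cvge0P tail_ge0).1 tail0 _ d0.
have [n [ni Hn]] := filter_ex (filterI (nbhs_infty_ge i) near0).
have cP : continuous (fun y : R => S1f r e j n y * theta e y).
  move=> y; apply: cvgM; first exact: (is_derive1_continuous (is_derive_S1f r j n e0)).
  exact: (is_derive1_continuous (is_derive_theta e0)).
have oP (y : R) : n.+1%:R < `|y| -> S1f r e j n y * theta e y = 0.
  by move=> /ltW/(S1f_out r e j) ->; rewrite mul0r.
have [Psi [Psi00 dPsi]] := exists_primitive0 cP oP.
exists a, n, Psi; split; first by split.
  split; [|by []|exact: (Psi_ge0 r1 e0 Psi00 dPsi)|].
    by apply: continuous_measurable_fun; exact: is_derive1_continuous dPsi.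
  by move=> y yn; exact: (Psi_lower r1 e0 rj Psi00 dPsi (erefl : e = dl i ^+ 2) d0 yn).
have step := energy_step e0 e1 s0 sa atau taut K0 (HK n) Psi00 dPsi.
apply: le_trans step _.
have {}Ha := Ha Psi (Psi_ge0 r1 e0 Psi00 dPsi) (Psi_le_powR r1 e0 rj Psi00 dPsi)
  (Psi_lipschitz r1 e0 rj dPsi).
have -> : M + 2 * dl i = (M + dl i) + dl i by ring.
rewrite EFinD; apply: leeD => //.
have -> : (\int[m]_z (K * C * tail_integrand (a / 2) n z)%:E =
  (K * C)%:E * \int[m]_z (tail_integrand (a / 2) n z)%:E)%E.
  exact: (@intZ _ _ _ m setT measurableT (K * C) (tail_integrand (a / 2) n) (mulr_ge0 K0 C0) (measurable_tail_integrand _ _) (fun z _ => tail_integrand_ge0 _ _ z)).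
exact: Hn.
Qed.

(** Fatou's lemma along the sequence of [diagonal_step]. Where u = 0 the limit is not
    determined by the approximations, but there Du = 0 and both terms vanish. *)
Lemma energy_limit tau M : 0 < tau < t0 ->
  {ae leb2, forall z, Q 0 z -> u z = 0 -> Du z = 0} ->
  (forall L ka de : R, 0 < ka -> 0 < de -> exists2 a, 0 < a < de &
     forall Psi : R -> R, (forall y, 0 <= Psi y) -> (forall y, Psi y <= `|y| `^ r) ->
       (forall y z, `|Psi y - Psi z| <= L * `|y - z|) ->
       (\int[lebE]_(x in Om) (Psi (u (x, a)))%:E <= (M + ka)%:E)%E) ->
  (\int[lebE]_(x in Om) (`|u (x, tau)| `^ r)%:E +
   \int[leb2]_(z in cylinder Om 0%:E tau%:E)
     (r * gamma * (`|u z| `^ (lambda + r - 1) * enorm (Du z) `^ q) +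
      r * (r - 1) * nu * (`|u z| `^ (r - 2) * enorm (Du z) `^ p))%:E <= M%:E)%E.
Proof.
move=> tauI Dzero init; have /andP[tau0 taut] := tauI.
have rr : 0 < r by exact: lt_le_trans r1.
have pn : p != 0 by rewrite gt_eqF.
have qn : q != 0 by rewrite gt_eqF.
have /choice[a /choice[n /choice[Psi HP]]] := fun i => diagonal_step i tauI init.
have [h [mh hout hE]] := cmeasurable_rep mOm (uL1 tauI).1.
pose F (y : R) (D : E) := r * gamma * (`|y| `^ (lambda + r - 1) * enorm D `^ q) +
  r * (r - 1) * nu * (`|y| `^ (r - 2) * enorm D `^ p).
have F0 y D : 0 <= F y D.
  have nn : 0 <= r * (r - 1) * nu.
    by apply: mulr_ge0 => //; apply: mulr_ge0; [exact: ltW|rewrite subr_ge0].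
  apply: addr_ge0; apply: mulr_ge0 => //; try by apply: mulr_ge0; exact: powR_ge0.
  by apply: mulr_ge0 => //; exact: ltW.
pose G (z : E * RR) := F (ut z) (Dt z) * (z.2 <= tau)%R%:R.
have main : (\int[lebE]_x (`|h x| `^ r)%:E + \int[m]_z (G z)%:E <= M%:E)%E.
  apply: (@fatou_pair _ _ _ _ _ _ _ (fun i x => Psi i (h x)) _
    (fun i z => dissipation (eps i) (n i) z * (a i <= z.2 <= tau)%R%:R) _ M (fun i => 2 * dl i)).
  - by move=> i; have [_ [mP _ _ _] _] := HP i; exact: measurableT_comp.
  - by move=> i x; have [_ [_ _ P0 _] _] := HP i; exact: P0.
  - by move=> x; exact: powR_ge0.
  - apply: aeW => x e e0.
    have l1 : \forall i \near \oo, `|h x| <= (n i)%:R.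
      have [k hk] : exists k : nat, `|h x| <= k%:R.
        by exists (Num.bound `|h x|); apply: ltW; exact: archi_boundP.
      near=> i; apply: le_trans hk _; rewrite ler_nat.
      have [[_ _ ni] _ _] := HP i; apply: leq_trans ni.
      by near: i; exact: nbhs_infty_ge.
    have /cvgrPdist_le/(_ _ e0) l2 := @lower_cvg R r j r1 (h x).
    apply: filterS2 l1 l2 => i l1; rewrite ler_distl => /andP[_ l2].
    have [_ [_ _ _ low] _] := HP i; apply: le_trans (low _ l1).
    by rewrite lerBlDr.
  - move=> i; apply: measurable_funM; first exact: (measurable_dissipation _ (eps_gt0 _) ).
    apply: (@measurableT_comp _ _ _ _ _ _ (fun b : bool => b%:R : R)) => //.
    by apply: measurable_and; apply: measurable_fun_ler => //; exact: measurable_snd.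
  - by move=> i z; apply: mulr_ge0 => //; apply: dissipation_ge0; [exact: eps_gt0|exact: eps_le1].
  - by move=> z; apply: mulr_ge0.
  - apply: ae_imp (ae_and Dzero (ae_and utE DtE)) => z [dz [uz Dz]] e e0.
    have triv : G z = 0 -> \forall i \near \oo,
        G z - e <= dissipation (eps i) (n i) z * (a i <= z.2 <= tau)%R%:R.
      move=> ->; apply: nearW => i; rewrite sub0r; apply: (@le_trans _ _ 0).
        by rewrite oppr_le0 ltW.
      by apply: mulr_ge0 => //; apply: dissipation_ge0; [exact: eps_gt0|exact: eps_le1].
    have F00 : Dt z = 0 -> G z = 0.
      move=> D0; have D00 : enorm (Dt z) = 0 by rewrite D0; apply/enorm0_eq.
      by rewrite /G /F D00 (powR0 pn) (powR0 qn) !mulr0 addr0 mul0r.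
    have [Qz|nQ] := pselect (Q 0 z); last by apply: triv; apply: F00; exact: Dt0.
    have [y0|y0] := eqVneq (ut z) 0.
      by apply: triv; apply: F00; rewrite -Dz// dz// uz.
    have [zt|/negP zt] := pselect (z.2 <= tau); last by apply: triv; rewrite /G (negbTE zt) mulr0.
    have /cylinderP[_ /andP[z0 _]] := Qz.
    have lim : (fun i => nu * (lowH r (eps i) j (ut z) * enorm (Dt z) `^ p) +
       gamma * (`|H r (eps i) j (ut z)| * `|ut z| `^ lambda * enorm (Dt z) `^ q)) @ \oo --> G z.
      have -> : G z = nu * (r * (r - 1) * `|ut z| `^ (r - 2) * enorm (Dt z) `^ p) +
         gamma * (r * `|ut z| `^ (r - 1) * `|ut z| `^ lambda * enorm (Dt z) `^ q).
        have E0 : `|ut z| `^ (r - 1) * `|ut z| `^ lambda = `|ut z| `^ (lambda + r - 1) :> R.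
          rewrite -powRD; last by rewrite normr_eq0 (negbTE y0) implybT.
          by congr (_ `^ _); ring.
        by rewrite /G /F zt mulr1 -E0; ring.
      apply: cvgD; apply: cvgM; [exact: cvg_cst| |exact: cvg_cst|].
        by apply: cvgM; [exact: lowH_cvg|exact: cvg_cst].
      apply: cvgM; last exact: cvg_cst.
      by apply: cvgM; [exact: norm_H_cvg|exact: cvg_cst].
    have l1 : \forall i \near \oo, `|ut z| <= (n i)%:R.
      have [k hk] : exists k : nat, `|ut z| <= k%:R.
        by exists (Num.bound `|ut z|); apply: ltW; exact: archi_boundP.
      near=> i; apply: le_trans hk _; rewrite ler_nat.
      have [[_ _ ni] _ _] := HP i; apply: leq_trans ni.
      by near: i; exact: nbhs_infty_ge.
    have l3 : \forall i \near \oo, dl i <= z.2.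
      have /cvgrPdist_le/(_ _ z0) := @dl_cvg0 R; apply: filterS => i.
      by rewrite sub0r normrN; apply: le_trans; exact: ler_norm.
    move/cvgrPdist_le : lim => /(_ _ e0) l2.
    apply: filterS3 l1 l2 l3 => i l1 l2 l3.
    have [[_ ai _] _ _] := HP i.
    rewrite zt andbT (le_trans (ltW ai) l3) mulr1 /dissipation cutoff1// mul1r.
    by move: l2; rewrite ler_distl => /andP[_]; rewrite lerBlDr.
  - rewrite -[X in _ --> X](mulr0 2); apply: cvgM; [exact: cvg_cst|exact: dl_cvg0].
  - move=> i; have [_ [_ P0 _ _] le] := HP i.
    have E1 : (\int[lebE]_(x in Om) (Psi i (u (x, tau)))%:E = \int[lebE]_x (Psi i (h x))%:E)%E.
      transitivity (\int[lebE]_(x in Om) (Psi i (h x))%:E)%E.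
        by apply: (integral_eq_ae mOm); apply: filterS hE => x hx Ox; rewrite hx.
      by apply: (integral_supp _ mOm) => x /hout ->; rewrite P0.
    rewrite -E1; exact: le.
apply: le_trans main; apply: leeD.
  have -> : (\int[lebE]_(x in Om) (`|u (x, tau)| `^ r)%:E = \int[lebE]_(x in Om) (`|h x| `^ r)%:E)%E.
    by apply: (integral_eq_ae mOm); apply: filterS hE => x hx Ox; rewrite hx.
  by apply: ge0_subset_int => // x; rewrite lee_fin powR_ge0.
have mcyl : measurable (cylinder Om 0%:E tau%:E : set (E * RR)) by exact: cylinder_measurable.
have -> : (\int[leb2]_(z in cylinder Om 0%:E tau%:E) (F (u z) (Du z))%:E =
   \int[m]_(z in cylinder Om 0%:E tau%:E) (G z)%:E)%E.
  apply: (integral_eq_ae mcyl); apply: ae_imp (ae_and utE DtE) => z [h1 h2] cz.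
  have /cylinderP[z1 /andP[z2 z3]] := cz.
  have Qz : Q 0 z by apply/cylinderP; split => //; rewrite z2 (lt_trans z3).
  by rewrite /G (ltW z3) mulr1 (h1 Qz) (h2 Qz).
by apply: ge0_subset_int => // z; rewrite lee_fin mulr_ge0.
Unshelve. all: by end_near.
Qed.

End energy_step.

(** * Solutions under the structure conditions *)

Lemma continuous_dotv {R : realType} {N : nat} (U : topologicalType) (f g : U -> 'rV[R]_N) :
  (forall i, continuous (fun w => f w ord0 i)) -> (forall i, continuous (fun w => g w ord0 i)) ->
  continuous (fun w => dotv (f w) (g w)).
Proof.
move=> cf cg w; rewrite /continuous_at /dotv.
elim: (index_enum _) => [|i s IH].
  by under eq_fun do rewrite big_nil; rewrite big_nil; exact: cvg_cst.
under eq_fun do rewrite big_cons; rewrite big_cons; apply: cvgD; last exact: IH.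
by apply: cvgM; [exact: cf|exact: cg].
Qed.

Lemma continuous_enorm {R : realType} {N : nat} (U : topologicalType) (f : U -> 'rV[R]_N) :
  (forall i, continuous (fun w => f w ord0 i)) -> continuous (fun w => enorm (f w)).
Proof.
move=> cf w; apply: (@continuous_comp _ _ _ (fun w => dotv (f w) (f w)) (@Num.sqrt R)).
  exact: continuous_dotv.
exact: sqrt_continuous.
Qed.

Lemma continuous_powR_enorm {R : realType} {N : nat} (U : topologicalType) (f : U -> 'rV[R]_N) (c : R) :
  0 < c -> (forall i, continuous (fun w => f w ord0 i)) -> continuous (fun w => enorm (f w) `^ c).
Proof.
move=> c0 cf w.
have -> : (fun w => enorm (f w) `^ c) = (fun w => `|enorm (f w)| `^ c).
  by apply/funext => v; rewrite ger0_norm// enorm_ge0.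
apply: (@continuous_comp _ _ _ (fun w => enorm (f w)) (fun y => `|y| `^ c)).
  exact: continuous_enorm.
exact: powR_norm_continuous.
Qed.

Lemma continuous_pr2 {R : realType} {N : nat} (i : 'I_N) :
  continuous (fun w : R * 'rV[R]_N => w.2 ord0 i).
Proof.
move=> w; apply: (@continuous_comp _ _ _ (fun w : R * 'rV[R]_N => w.2) (fun v : 'rV[R]_N => v ord0 i)).
  exact: cvg_snd.
exact: coord_continuous.
Qed.

Section solution.
Context {R : realType} {N : nat}.
Local Notation E := 'rV[R]_N.
Local Notation leb := (@lebesgue_measure R).
Local Notation RR := (measurableTypeR R).
Local Notation lebE := (lebesgue_rV N : {sigma_finite_measure set E -> \bar R}).
Local Notation m := (lebE \x leb)%E.
Local Notation leb2 := (@spacetime_measure R N).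
Variables (Om : set E) (T : \bar R) (p q C nu lambda gamma : R).
Variables (A : E -> R -> R -> E -> E) (g : E -> R -> R -> E -> R) (b : E * R -> R).
Hypothesis oOm : open Om.
Hypothesis Omfin : (lebE Om < +oo)%E.
Hypothesis p1 : 1 < p.
Hypothesis q1 : 1 < q.
Hypothesis C0 : 0 <= C.
Hypothesis nu0 : 0 <= nu.
Hypothesis lambda0 : 0 <= lambda.
Hypothesis gamma0 : 0 <= gamma.
Hypothesis hb : in_Lp leb2 (p / (p - 1)) (cylinder Om 0%E +oo%E) b.
Hypothesis carA : forall i, caratheodory Om (fun x t y eta => A x t y eta ord0 i).
Hypothesis carg : caratheodory Om g.
Hypothesis growth : forall (y : R) (eta : E), {ae leb2, forall z, cylinder Om 0%E +oo%E z ->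
  enorm (A z.1 z.2 y eta) <= C * (enorm eta `^ (p - 1) + b z)}.
Hypothesis coercive : forall (y : R) (eta : E), {ae leb2, forall z, cylinder Om 0%E +oo%E z ->
  nu * enorm eta `^ p <= dotv (A z.1 z.2 y eta) eta}.
Hypothesis sign : forall (y : R) (eta : E), {ae leb2, forall z, cylinder Om 0%E +oo%E z ->
  gamma * `|y| `^ (lambda + 1) * enorm eta `^ q <= g z.1 z.2 y eta * y}.
Variables (u : E * R -> R) (Du : E * R -> E).
Hypothesis solu : renormalized_solution Om T A g p u Du.

Local Notation Q s t := (cylinder Om s%:E t%:E).
Local Notation Qoo := (cylinder Om 0%E +oo%E).

Let mOm : measurable Om. Proof. exact: open_measurable_rV. Qed.
Let mQ s t : measurable (Q s t : set (E * RR)). Proof. exact: cylinder_measurable. Qed.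

Lemma measurable_cylinder_oo : measurable (Qoo : set (E * RR)).
Proof.
have -> : Qoo = Om `*` `]0, +oo[%classic :> set (E * RR).
  by apply/seteqP; split => z; rewrite /cylinder/= in_itv/= andbT lte_fin ltry andbT.
by apply: measurableX; [exact: mOm|exact: measurable_itv].
Qed.

Lemma cylinder_sub_oo s t : 0 <= s -> Q s t `<=` Qoo.
Proof.
move=> s0 z /cylinderP[z1 /andP[z2 z3]]; split => //.
by rewrite lte_fin (le_lt_trans s0 z2) ltry.
Qed.

(** Solutions are given on windows away from time 0; their properties up to null
    sets pass to this countable union. *)
Lemma cylinder_exhaustion t : 0 < t -> Q 0 t = \bigcup_n Q (t / n.+2%:R) t.
Proof.
move=> t0; apply/seteqP; split => [z /cylinderP[z1 /andP[z2 z3]]|z [n _] /cylinderP[z1 /andP[z2 z3]]].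
  have /cvgrPdist_lt/(_ _ (divr_gt0 z2 t0)) [n _ /(_ n (leqnn n))] := @dl_cvg0 R.
  rewrite sub0r normrN gtr0_norm ?dl_gt0// => H.
  exists n => //; apply/cylinderP; split => //; rewrite z3 andbT.
  rewrite mulrC -ltr_pdivlMr//; apply: le_lt_trans H.
  by rewrite lef_pV2 ?posrE ?ltr0n// ler_nat.
apply/cylinderP; split => //; rewrite z3 andbT; apply: lt_trans z2.
by rewrite divr_gt0// ltr0n.
Qed.

Lemma exhaustion_time (t : R) n : 0 < t -> 0 < t / n.+2%:R /\ t / n.+2%:R < t.
Proof.
move=> t0; rewrite divr_gt0 ?ltr0n//; split => //.
by rewrite ltr_pdivrMr ?ltr0n// ltr_pMr// ltr1n.
Qed.

Section window.
Variable t : R.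
Hypothesis t0 : 0 < t.
Hypothesis tT : (t%:E < T)%E.

Lemma window_cmeasurable s : 0 < s -> s < t -> cmeasurable leb2 (Q s t) u.
Proof. by move=> s0 st; have [_ _ [_ [[h _] _] _ _ _]] := solu.2 s t s0 st tT. Qed.

Lemma cmeasurable_u : cmeasurable leb2 (Q 0 t) u.
Proof.
rewrite (cylinder_exhaustion t0); apply: cmeasurable_bigcup => [n|n]; first exact: mQ.
by have [h1 h2] := exhaustion_time n t0; exact: window_cmeasurable.
Qed.

(** Du is the gradient of T_n(u) where |u| <= n. *)
Lemma cmeasurable_Du i : cmeasurable leb2 (Q 0 t) (fun z => Du z ord0 i).
Proof.
have [ut [mut _ utE]] := cmeasurable_rep (@mQ 0 t : measurable (_ : set (E * RR))) cmeasurable_u.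
have Qs n : Q (t / n.+2%:R) t `<=` Q 0 t.
  by rewrite (cylinder_exhaustion t0) => z Qz; exists n.
pose F n : set (E * RR) := Q (t / n.+2%:R) t `&` [set z | `|ut z| <= n%:R].
have mF n : measurable (F n).
  apply: measurableI; first exact: mQ.
  rewrite -[X in measurable X]setTI.
  exact: (measurable_fun_le measurableT (measurable_abs mut) (measurable_cst _)).
have -> : Q 0 t = \bigcup_n F n.
  apply/seteqP; split => [z Qz|z [n _] [/Qs]//].
  have := Qz; rewrite {1}(cylinder_exhaustion t0) => -[n _ /cylinderP[z1 /andP[z2 z3]]].
  have [k hk] : exists k : nat, `|ut z| <= k%:R.
    by exists (Num.bound `|ut z|); apply: ltW; exact: archi_boundP.
  exists (maxn n k) => //; split.
    apply/cylinderP; split => //; rewrite z3 andbT; apply: le_lt_trans z2.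
    by rewrite ler_pM2l// lef_pV2 ?posrE ?ltr0n// ler_nat !ltnS leq_maxl.
  by rewrite /= (le_trans hk)// ler_nat leq_maxr.
apply: cmeasurable_bigcup => // n; have [s0 st] := exhaustion_time n t0.
have [hW _ _] := solu.2 _ _ s0 st tT.
have [G [[_ [cG _] _] GE]] := hW n%:R (ler0n _ n).
apply: (@cmeasurable_ae _ _ _ leb2 (F n) (fun z => G z ord0 i)); last first.
  by apply: (cmeasurableS (mQ (t / n.+2%:R) t)); [exact: subIsetl|exact: cG].
apply: ae_imp (ae_and GE utE) => z [h1 h2] [Qz uz].
by rewrite (h1 Qz)// (h2 (Qs _ _ Qz)).
Qed.

(** T_0(u) = 0, and Du is by definition the gradient of T_0(u) where u = 0. *)
Lemma Du_zero : {ae leb2, forall z, Q 0 t z -> u z = 0 -> Du z = 0}.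
Proof.
rewrite (cylinder_exhaustion t0).
have H n : {ae leb2, forall z, Q (t / n.+2%:R) t z -> u z = 0 -> Du z = 0}.
  have [s0 st] := exhaustion_time n t0; set s := t / _ in s0 st *.
  have [hW _ _] := solu.2 _ _ s0 st tT.
  have [G [[_ [cG _] W0] GE]] := hW 0 (lexx _).
  have [Gt [mGt _ GtE]] := vec_rep (mQ s t : measurable (_ : set (E * RR))) cG.
  pose P (z : E * RR) := Q s t z -> enorm (Gt z) = 0.
  have mP : measurable [set z | P z].
    have -> : [set z | P z] = ~` Q s t `|` [set z : E * RR | enorm (Gt z) <= 0].
      apply/seteqP; split => z.
        move=> Pz; have [Qz|nQ] := pselect (Q s t z); last by left.
        by right; rewrite /= Pz.
      case=> [nQ //|/= h _]; apply/eqP; by rewrite eq_le h enorm_ge0.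
    apply: measurableU; first by apply: measurableC; exact: mQ.
    rewrite -[X in measurable X]setTI.
    by apply: (measurable_fun_le measurableT _ (measurable_cst _)); exact: measurable_enorm.
  have PP : {ae m, forall z, P z}.
    apply: (slices_ae mP); have sl := ae_slices GtE.
    apply: leb_aeS (leb_aeI W0 sl) => sg [W0s sls].
    have [sI|sI] := pselect (s < sg < t); last first.
      by apply: aeW => x /cylinderP[_ ?].
    have zG i : {ae lebE, forall x, Om x -> G (x, sg) ord0 i = 0}.
      apply: (zero_gradient i oOm Omfin (ltW p1) (W0s sI)); apply: aeW => x _.
      by apply/eqP; rewrite -normr_le0; exact: trunc_le.
    have zGa : {ae lebE, forall x, forall i, Om x -> G (x, sg) ord0 i = 0} by exact: ae_countable.
    apply: filterS2 zGa sls => x h1 h2 Qx; apply/enorm0_eq.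
    rewrite -h2//; apply/rowP => i; rewrite mxE h1//; have /cylinderP[] := Qx => //.
  apply: ae_imp (ae_and PP (ae_and GtE GE)) => z [h1 [h2 h3]] Qz uz.
  rewrite -h3//; last by rewrite uz normr0.
  by rewrite h2//; apply/enorm0_eq; exact: h1.
by apply: ae_imp (ae_countable H) => z h [n _ Qz]; exact: (h n Qz).
Qed.

Let ae_sub (P : E * R -> Prop) : {ae leb2, forall z, Qoo z -> P z} -> {ae leb2, forall z, Q 0 t z -> P z}.
Proof. by apply: ae_imp => z h /(cylinder_sub_oo (lexx 0)). Qed.

Let contA : {ae leb2, forall z, Qoo z -> forall i, continuous (fun w : R * E => A z.1 z.2 w.1 w.2 ord0 i)}.
Proof.
have := ae_countable (fun i => (carA i).2); apply: ae_imp => z h Qz i; exact: h.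
Qed.

(** The structure conditions hold for each (y, eta) outside a null set that depends on
    (y, eta); continuity makes this set uniform, so that u and Du may be inserted. *)
Lemma growth_solution : {ae leb2, forall z, Q 0 t z ->
  enorm (A z.1 z.2 (u z) (Du z)) <= C * (enorm (Du z) `^ (p - 1) + b z)}.
Proof.
have H := @ae_le_all R N _ _ leb2 Qoo (fun z w => enorm (A z.1 z.2 w.1 w.2))
  (fun z w => C * (enorm w.2 `^ (p - 1) + b z)) _ _ (fun w => growth w.1 w.2).
apply: ae_sub; apply: ae_imp (H _ _) => [z h Qz| |].
- exact: (h Qz (u z, Du z)).
- by apply: ae_imp contA => z h Qz; exact: (continuous_enorm (h Qz)).
- apply: aeW => z _ w; apply: cvgM; first exact: cvg_cst.
  apply: cvgD; last exact: cvg_cst.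
  by apply: (@continuous_powR_enorm _ _ _ (fun w : R * E => w.2)); [rewrite subr_gt0|exact: continuous_pr2].
Qed.

Lemma coercive_solution : {ae leb2, forall z, Q 0 t z ->
  nu * enorm (Du z) `^ p <= dotv (A z.1 z.2 (u z) (Du z)) (Du z)}.
Proof.
have H := @ae_le_all R N _ _ leb2 Qoo (fun z w => nu * enorm w.2 `^ p)
  (fun z w => dotv (A z.1 z.2 w.1 w.2) w.2) _ _ (fun w => coercive w.1 w.2).
apply: ae_sub; apply: ae_imp (H _ _) => [z h Qz| |].
- exact: (h Qz (u z, Du z)).
- apply: aeW => z _ w; apply: cvgM; first exact: cvg_cst.
  by apply: (@continuous_powR_enorm _ _ _ (fun w : R * E => w.2)); [exact: lt_trans p1|exact: continuous_pr2].
- by apply: ae_imp contA => z h Qz; apply: continuous_dotv; [exact: (h Qz)|exact: continuous_pr2].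
Qed.

Lemma sign_solution : {ae leb2, forall z, Q 0 t z ->
  gamma * `|u z| `^ (lambda + 1) * enorm (Du z) `^ q <= g z.1 z.2 (u z) (Du z) * u z}.
Proof.
have H := @ae_le_all R N _ _ leb2 Qoo (fun z w => gamma * `|w.1| `^ (lambda + 1) * enorm w.2 `^ q)
  (fun z w => g z.1 z.2 w.1 w.2 * w.1) _ _ (fun w => sign w.1 w.2).
apply: ae_sub; apply: ae_imp (H _ _) => [z h Qz| |].
- exact: (h Qz (u z, Du z)).
- apply: aeW => z _ w; apply: cvgM.
    apply: cvgM; first exact: cvg_cst.
    apply: (@continuous_comp _ _ _ (fun w : R * E => w.1) (fun y => `|y| `^ (lambda + 1))).
      exact: cvg_fst.
    by apply: powR_norm_continuous; rewrite ltr_wpDl.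
  by apply: (@continuous_powR_enorm _ _ _ (fun w : R * E => w.2)); [exact: lt_trans q1|exact: continuous_pr2].
- apply: ae_imp carg.2 => z h Qz w; apply: cvgM; last exact: cvg_fst.
  exact: (h Qz).
Qed.

Lemma cmeasurable_flux i : cmeasurable leb2 (Q 0 t) (fun z => A z.1 z.2 (u z) (Du z) ord0 i).
Proof.
have mQ0 := @mQ 0 t : measurable (_ : set (E * RR)).
have [ut [mut _ utE]] := cmeasurable_rep mQ0 cmeasurable_u.
have [Dt [mDt _ DtE]] := vec_rep mQ0 cmeasurable_Du.
have := @superposition_cmeasurable R N _ _ leb2 Qoo (fun z w => A z.1 z.2 w.1 w.2 ord0 i)
  (Q 0 t) ut Dt measurable_cylinder_oo mQ0 (cylinder_sub_oo (lexx 0))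
  (fun w => (carA i).1 w.1 w.2) (carA i).2 mut mDt.
apply: cmeasurable_ae; apply: ae_imp (ae_and utE DtE) => z [h1 h2] Qz /=.
by rewrite (h1 Qz) (h2 Qz).
Qed.

End window.
Lemma time_beyond (tau : R) : (tau%:E < T)%E -> exists2 t, tau < t & (t%:E < T)%E.
Proof.
case: T => [T'|_|//]; last by exists (tau + 1); [rewrite ltrDl|rewrite ltry].
rewrite lte_fin => h; exists ((tau + T') / 2); rewrite ?lte_fin; lra.
Qed.

Lemma u_L1 t : 0 < t -> (t%:E < T)%E -> in_Lp lebE 1 Om (fun x => u (x, t)).
Proof. by move=> t0 tT; apply: solu.1.1; rewrite /= lte_fin t0. Qed.

Lemma u_continuous t : 0 < t -> (t%:E < T)%E ->
  (fun t' => \int[lebE]_(x in Om) (`|u (x, t') - u (x, t)| `^ 1)%:E)%E @ t --> 0%E.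
Proof.
move=> t0 tT; have := solu.1.2 t; rewrite /= lte_fin t0 => /(_ tT).
rewrite within_interior//; have [t1 tt1 t1T] := time_beyond tT.
apply: (@filterS _ _ _ `]0, t1[%classic).
  move=> y; rewrite /= in_itv/= lte_fin => /andP[-> y1].
  by apply: lt_trans t1T; rewrite lte_fin.
by apply: near_in_itvoo; rewrite in_itv/= t0.
Qed.

Lemma solution_energy r M tau : 1 <= r -> 0 < tau -> (tau%:E < T)%E ->
  (forall L ka de : R, 0 < ka -> 0 < de -> exists2 a, 0 < a < de &
     forall Psi : R -> R, (forall y, 0 <= Psi y) -> (forall y, Psi y <= `|y| `^ r) ->
       (forall y z, `|Psi y - Psi z| <= L * `|y - z|) ->
       (\int[lebE]_(x in Om) (Psi (u (x, a)))%:E <= (M + ka)%:E)%E) ->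
  (\int[lebE]_(x in Om) (`|u (x, tau)| `^ r)%:E +
   \int[leb2]_(z in Q 0 tau)
     (r * gamma * (`|u z| `^ (lambda + r - 1) * enorm (Du z) `^ q) +
      r * (r - 1) * nu * (`|u z| `^ (r - 2) * enorm (Du z) `^ p))%:E <= M%:E)%E.
Proof.
move=> r1 tau0 tauT init; have [t taut tT] := time_beyond tauT.
have t0 : 0 < t by exact: lt_trans taut.
have mQ0 := @mQ 0 t : measurable (_ : set (E * RR)).
have [j rj] : exists j : nat, r <= 2 * j.+1%:R + 2.
  exists (Num.bound r); have := archi_boundP (le_trans ler01 r1).
  by rewrite -natr1; have := ler0n R (Num.bound r); lra.
have hbt : in_Lp leb2 (p / (p - 1)) (Q 0 t) b.
  have [cb fb] := hb; split.
    exact: (cmeasurableS measurable_cylinder_oo (cylinder_sub_oo (lexx 0)) cb).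
  apply: le_lt_trans fb; apply: ge0_subset_int; first exact: (cylinder_sub_oo (lexx 0)).
  by move=> z; rewrite lee_fin powR_ge0.
have [ut [mut _ utE]] := cmeasurable_rep mQ0 (cmeasurable_u t0 tT).
have [Dt [mDt Dt0 DtE]] := vec_rep mQ0 (cmeasurable_Du t0 tT).
have [bt [mbt bt0 btE]] := cmeasurable_rep mQ0 hbt.1.
have wt s : s < t -> (s%:E < T)%E by move=> st; apply: lt_trans tT; rewrite lte_fin.
apply: (@energy_limit R N Om t p q C nu lambda gamma r j oOm Omfin p1 q1 C0 nu0 gamma0 r1 rj
  u Du (fun z => A z.1 z.2 (u z) (Du z)) (fun z => g z.1 z.2 (u z) (Du z)) b
  (@window_cmeasurable t tT) _ _ _ _ _ _ (cmeasurable_flux t0 tT) hbt (growth_solution t)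
  (coercive_solution t) (sign_solution t) ut bt Dt mut mbt mDt Dt0 bt0 utE DtE btE).
- by move=> s s0 st; have [] := solu.2 s t s0 st tT.
- by move=> s s0 st; have [] := solu.2 s t s0 st tT.
- by move=> s s0 st; have [_ _ [_ _ h _ _]] := solu.2 s t s0 st tT; exact: h.
- by move=> s s0 st; have [_ _ [_ _ _ _ h]] := solu.2 s t s0 st tT; exact: h.
- by move=> s /andP[s0 /wt sT]; exact: u_L1.
- by move=> s /andP[s0 /wt sT]; exact: u_continuous.
- by rewrite tau0.
- exact: Du_zero.
- exact: init.
Qed.

End solution.

(** * The estimates *)

Section estimates.
Context {R : realType} {N : nat}.
Local Notation E := 'rV[R]_N.
Local Notation RR := (measurableTypeR R).
Local Notation lebE := (lebesgue_rV N : {sigma_finite_measure set E -> \bar R}).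
Local Notation leb2 := (@spacetime_measure R N).
Variables (Om : set E) (T : \bar R) (p q nu lambda gamma r : R).
Variables (u : E * R -> R) (Du : E * R -> E) (M : \bar R).
Hypothesis oOm : open Om.
Hypothesis nu0 : 0 <= nu.
Hypothesis gamma0 : 0 <= gamma.
Hypothesis r1 : 1 <= r.
Local Notation Q t := (cylinder Om 0%:E t%:E).
Hypothesis cu : forall t, 0 < t -> (t%:E < T)%E -> cmeasurable leb2 (Q t) u.
Hypothesis cD : forall t, 0 < t -> (t%:E < T)%E ->
  forall i, cmeasurable leb2 (Q t) (fun z => Du z ord0 i).
Hypothesis Mfin : M \is a fin_num.
Hypothesis energy : forall t, 0 < t -> (t%:E < T)%E ->
  (\int[lebE]_(x in Om) (`|u (x, t)| `^ r)%:E +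
   \int[leb2]_(z in Q t)
     (r * gamma * (`|u z| `^ (lambda + r - 1) * enorm (Du z) `^ q) +
      r * (r - 1) * nu * (`|u z| `^ (r - 2) * enorm (Du z) `^ p))%:E <= M)%E.

Let absorption (z : E * R) := `|u z| `^ (lambda + r - 1) * enorm (Du z) `^ q.
Let diffusion (z : E * R) := `|u z| `^ (r - 2) * enorm (Du z) `^ p.

Let abs0 z : 0 <= absorption z. Proof. by rewrite mulr_ge0 ?powR_ge0. Qed.
Let dif0 z : 0 <= diffusion z. Proof. by rewrite mulr_ge0 ?powR_ge0. Qed.
Let r0 : 0 < r. Proof. exact: lt_le_trans r1. Qed.
Let ca0 : 0 <= r * gamma. Proof. by rewrite mulr_ge0// ltW. Qed.
Let cd0 : 0 <= r * (r - 1) * nu.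
Proof. by apply: mulr_ge0 => //; apply: mulr_ge0; [exact: ltW|rewrite subr_ge0]. Qed.

Let reps t : 0 < t -> (t%:E < T)%E -> exists a d : E * RR -> R,
  [/\ measurable_fun setT a, measurable_fun setT d,
      {ae leb2, forall z, Q t z -> absorption z = a z},
      {ae leb2, forall z, Q t z -> diffusion z = d z} &
      (forall z, 0 <= a z) /\ (forall z, 0 <= d z)].
Proof.
move=> t0 tT; have mQ := cylinder_measurable 0 t oOm.
have [ut [mut _ utE]] := cmeasurable_rep mQ (cu t0 tT).
have [Dt [mDt _ DtE]] := vec_rep mQ (cD t0 tT).
exists (fun z => `|ut z| `^ (lambda + r - 1) * enorm (Dt z) `^ q),
  (fun z => `|ut z| `^ (r - 2) * enorm (Dt z) `^ p); split.
- by apply: measurable_funM; apply: measurable_powRl; [exact: measurable_abs|exact: measurable_enorm].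
- by apply: measurable_funM; apply: measurable_powRl; [exact: measurable_abs|exact: measurable_enorm].
- by apply: ae_imp (ae_and utE DtE) => z [h1 h2] Qz; rewrite /absorption (h1 Qz) (h2 Qz).
- by apply: ae_imp (ae_and utE DtE) => z [h1 h2] Qz; rewrite /diffusion (h1 Qz) (h2 Qz).
- by split => z; rewrite mulr_ge0 ?powR_ge0.
Qed.

(** The single integral of the energy inequality is split into the two integrals of
    the estimate; both integrands are nonnegative. *)
Lemma energy_split t : 0 < t -> (t%:E < T)%E ->
  (\int[lebE]_(x in Om) (`|u (x, t)| `^ r)%:E
   + (r * gamma)%:E * \int[leb2]_(z in Q t) (absorption z)%:E
   + (r * (r - 1) * nu)%:E * \int[leb2]_(z in Q t) (diffusion z)%:E <= M)%E.
Proof.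
move=> t0 tT; apply: le_trans (energy t0 tT); rewrite -addeA; apply: leeD => //.
have mQ : measurable (Q t : set (E * RR)) := cylinder_measurable 0 t oOm.
have [a [d [ma md aE dE [a0 d0]]]] := reps t0 tT.
have -> : (\int[leb2]_(z in Q t) (absorption z)%:E = \int[leb2]_(z in Q t) (a z)%:E)%E.
  by apply: (integral_eq_ae mQ); apply: ae_imp aE => z h Qz; rewrite (h Qz).
have -> : (\int[leb2]_(z in Q t) (diffusion z)%:E = \int[leb2]_(z in Q t) (d z)%:E)%E.
  by apply: (integral_eq_ae mQ); apply: ae_imp dE => z h Qz; rewrite (h Qz).
have -> : (\int[leb2]_(z in Q t) (r * gamma * absorption z + r * (r - 1) * nu * diffusion z)%:E =
    \int[leb2]_(z in Q t) (r * gamma * a z + r * (r - 1) * nu * d z)%:E)%E.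
  apply: (integral_eq_ae mQ); apply: ae_imp (ae_and aE dE) => z [h1 h2] Qz.
  by rewrite (h1 Qz) (h2 Qz).
have ma' : measurable_fun (Q t) a by exact: measurable_funS ma.
have md' : measurable_fun (Q t) d by exact: measurable_funS md.
rewrite -(@intZ _ _ _ leb2 (Q t) mQ _ a ca0 ma' (fun z _ => a0 z)).
rewrite -(@intZ _ _ _ leb2 (Q t) mQ _ d cd0 md' (fun z _ => d0 z)).
rewrite -(@intD _ _ _ leb2 (Q t) mQ (fun z => r * gamma * a z) (fun z => r * (r - 1) * nu * d z)).
- exact: lexx.
- exact: measurable_funM.
- exact: measurable_funM.
- by move=> z _; apply: mulr_ge0 => //.
- by move=> z _; apply: mulr_ge0 => //.
Qed.

(** A combination of absorption and diffusion dominated by a multiple of the integrand of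
    the energy inequality. *)
Let L1loc (F : E * R -> R) (c1 c2 c : R) : 0 <= c1 -> 0 <= c2 -> 0 <= c ->
  (forall z, F z = c1 * absorption z + c2 * diffusion z) ->
  c1 <= c * (r * gamma) -> c2 <= c * (r * (r - 1) * nu) -> in_L1loc0 Om T F.
Proof.
move=> c10 c20 c0 FE le1 le2 t t0 tT.
have mQ : measurable (Q t : set (E * RR)) := cylinder_measurable 0 t oOm.
have [a [d [ma md aE dE [a0 d0]]]] := reps t0 tT.
pose G z := r * gamma * a z + r * (r - 1) * nu * d z.
have G0 z : 0 <= G z by apply: addr_ge0; exact: mulr_ge0.
have mG : measurable_fun (Q t) G.
  by apply: measurable_funS (measurableT) _ _ => //; apply: measurable_funD; exact: measurable_funM.
have FG : {ae leb2, forall z, Q t z -> F z = c1 * a z + c2 * d z}.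
  by apply: ae_imp (ae_and aE dE) => z [h1 h2] Qz; rewrite FE (h1 Qz) (h2 Qz).
split.
  exists (fun z => c1 * a z + c2 * d z) => //.
  by apply: measurable_funS (measurableT) _ _ => //; apply: measurable_funD; exact: measurable_funM.
have -> : (\int[leb2]_(z in Q t) (`|F z| `^ 1)%:E = \int[leb2]_(z in Q t) (c1 * a z + c2 * d z)%:E)%E.
  apply: (integral_eq_ae mQ); apply: ae_imp FG => z h Qz; rewrite (h Qz) powRr1//.
  by rewrite ger0_norm//; apply: addr_ge0; exact: mulr_ge0.
apply: (@le_lt_trans _ _ (\int[leb2]_(z in Q t) (c * G z)%:E)%E).
  apply: int_le => // z _; first by apply: addr_ge0; exact: mulr_ge0.
  by rewrite /G mulrDr; apply: lerD; rewrite mulrA ler_wpM2r.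
rewrite (@intZ _ _ _ leb2 (Q t) mQ c G c0 mG (fun z _ => G0 z)).
have EG : (\int[leb2]_(z in Q t) (G z)%:E = \int[leb2]_(z in Q t)
     (r * gamma * absorption z + r * (r - 1) * nu * diffusion z)%:E)%E.
  apply: (integral_eq_ae mQ); apply: ae_imp (ae_and aE dE) => z [h1 h2] Qz.
  by rewrite (h1 Qz) (h2 Qz).
apply: lte_mul_pinfty; rewrite ?lee_fin//.
rewrite EG; apply: le_lt_trans (_ : (_ <= M)%E) _; last by rewrite ltey_eq Mfin.
apply: le_trans (energy t0 tT); rewrite leeDr//.
by apply: int_ge0 => x _; exact: powR_ge0.
Qed.

Lemma energy_estimates_of (I : set R) (w : R -> E -> R) :
  (forall t, I t -> (0 < t /\ (t%:E < T)%E /\ w t = fun x => u (x, t)) \/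
     (t = 0 /\ (\int[lebE]_(x in Om) (`|w t x| `^ r)%:E <= M)%E)) ->
  energy_estimates Om T p q lambda gamma nu r I w u Du M.
Proof.
move=> HI; split.
- move=> t /HI[[t0 [tT ->]]|[_ //]]; apply: le_trans (energy t0 tT); rewrite leeDl//.
  apply: int_ge0 => z _; apply: addr_ge0.
    exact: (mulr_ge0 ca0 (abs0 z)).
  exact: (mulr_ge0 cd0 (dif0 z)).
- move=> r1'; have h : 0 < r - 1 by rewrite subr_gt0.
  have hh : 0 < r * (r - 1) by exact: mulr_gt0.
  have ih : 0 <= (r * (r - 1))^-1 by rewrite invr_ge0 ltW.
  apply: (@L1loc _ gamma nu (1 + (r * (r - 1))^-1)) => //.
  + exact: addr_ge0.
  + rewrite mulrA ler_peMl// mulrDl mul1r; apply: le_trans r1 _; rewrite lerDl.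
    by apply: mulr_ge0 => //; exact: ltW.
  + rewrite mulrA ler_peMl// mulrDl mulVf ?gt_eqF// lerDr mul1r.
    exact: ltW.
- move=> g0; apply: (@L1loc _ gamma 0 1) => //.
  + by move=> z; rewrite mul0r addr0.
  + by rewrite mul1r ler_peMl.
  + by rewrite mul1r.
- move=> _ t /HI[[t0 [tT ->]]|[-> wM]]; first exact: energy_split.
  have -> : Q 0 = set0 :> set (E * R).
    by apply/seteqP; split => // z /cylinderP[_ /andP[z1 z2]]; move: (lt_trans z1 z2); rewrite ltxx.
  by rewrite !integral_set0 !mule0 !adde0.
Qed.

End estimates.

Section initial.
Context {R : realType} {N : nat}.
Local Notation E := 'rV[R]_N.
Local Notation leb := (@lebesgue_measure R).
Local Notation RR := (measurableTypeR R).
Local Notation lebE := (lebesgue_rV N : {sigma_finite_measure set E -> \bar R}).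
Local Notation leb2 := (@spacetime_measure R N).
Variables (Om : set E) (T : \bar R) (r : R) (u : E * R -> R).
Hypothesis oOm : open Om.
Hypothesis Omfin : (lebE Om < +oo)%E.
Hypothesis r1 : 1 <= r.
Hypothesis T0 : (0 < T)%E.

Let mOm : measurable Om. Proof. exact: open_measurable_rV. Qed.

(** |Psi(u(a)) - Psi(u0)| <= L |u(a) - u0|, and on a set of finite measure
    convergence in L^r implies convergence in L^1. *)
Lemma initial_bound_Lr (u0 : E -> R) : in_Lp lebE r Om u0 -> initial_Lr Om T r u u0 ->
  forall L ka de : R, 0 < ka -> 0 < de -> exists2 a, 0 < a < de &
     forall Psi : R -> R, (forall y, 0 <= Psi y) -> (forall y, Psi y <= `|y| `^ r) ->
       (forall y z, `|Psi y - Psi z| <= L * `|y - z|) ->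
       (\int[lebE]_(x in Om) (Psi (u (x, a)))%:E <=
        (fine (\int[lebE]_(x in Om) (`|u0 x| `^ r)%:E) + ka)%:E)%E.
Proof.
move=> [cu0 fu0] [inLr cont] L ka de ka0 de0.
have [t1 t10 t1T] := time_beyond T0.
pose d := Num.min de t1.
have d0 : 0 < d by rewrite lt_min de0.
pose a n := d / 2 * dl n.
have a0 n : 0 < a n by rewrite mulr_gt0 ?dl_gt0 ?divr_gt0.
have ad n : a n < d.
  apply: (@le_lt_trans _ _ (d / 2)); last by rewrite ltr_pdivrMr// ltr_pMr// ltrDl.
  by rewrite ler_piMr ?dl_le1// divr_ge0// ltW.
have ade n : a n < de by apply: lt_le_trans (ad n) _; rewrite ge_min lexx.
have aT n : ((a n)%:E < T)%E.
  by apply: lt_trans t1T; rewrite lte_fin; apply: lt_le_trans (ad n) _; rewrite ge_min lexx orbT.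
have a_cvg : a @ \oo --> (0 : R).
  by rewrite -[X in _ --> X](mulr0 (d / 2)); apply: cvgM; [exact: cvg_cst|exact: dl_cvg0].
have I0 : [set t : R | (0%:E <= t%:E < T)%E] 0 by rewrite /= lee_fin lexx.
have Ia n : [set t : R | (0%:E <= t%:E < T)%E] (a n) by rewrite /= lee_fin (ltW (a0 n)) aT.
have a_within : a @ \oo --> within [set t : R | (0%:E <= t%:E < T)%E] (nbhs (0 : R)).
  move=> P /a_cvg h; have {}h : \forall n \near \oo, [set t : R | (0%:E <= t%:E < T)%E] (a n) -> P (a n).
    exact: h.
  have : \forall n \near \oo, P (a n) by apply: filterS h => n; exact.
  by [].
have lim := cvg_comp _ _ a_within (cont 0 I0).
have ext n : extend0 u0 u (a n) = fun x => u (x, a n).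
  by apply/funext => x; rewrite /extend0 gt_eqF.
have [h [mh _ hE]] := cmeasurable_rep mOm cu0.
have /choice[k kP] n : exists k : E -> R, measurable_fun setT k /\
    {ae lebE, forall x, Om x -> u (x, a n) = k x}.
  have := (inLr _ (Ia n)).1; rewrite ext => /(cmeasurable_rep mOm)[k [mk _ kE]].
  by exists k.
have diffE n : {ae lebE, forall x, Om x -> u (x, a n) - u0 x = k n x - h x}.
  by apply: ae_imp (ae_and (kP n).2 hE) => x [h1 h2] Ox; rewrite (h1 Ox) (h2 Ox).
have L1lim : (fun n => \int[lebE]_(x in Om) `|k n x - h x|%:E)%E @ \oo --> 0%E.
  apply: (@Lp_L1_cvg0 _ _ _ lebE Om mOm r (fun n x => k n x - h x) r1 Omfin).
    move=> n; apply: measurable_funS (measurableT) _ _ => //.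
    by apply: measurable_funB => //; exact: (kP n).1.
  move: lim; apply: cvg_trans; apply: near_eq_cvg; apply: nearW => n /=.
  apply: (integral_eq_ae mOm); apply: ae_imp (diffE n) => x hx Ox.
  by rewrite ext /extend0 eqxx -(hx Ox).
have L1 : (0 <= `|L| :> R) by [].
have lim0 := cvge0Z `|L| L1lim.
have ge0 n : (0 <= `|L|%:E * \int[lebE]_(x in Om) `|k n x - h x|%:E)%E.
  by apply: mule_ge0; [rewrite lee_fin|apply: int_ge0].
have [n Hn] := filter_ex ((cvge0P ge0).1 lim0 _ ka0).
exists (a n); first by rewrite a0 ade.
move=> Psi Psi0 Psir PsiL.
have mk : measurable_fun setT (k n) by exact: (kP n).1.
have md : measurable_fun Om (fun x => `|k n x - h x|).
  apply: measurable_funS (measurableT) _ _ => //; apply: measurable_abs.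
  exact: measurable_funB.
have mhr : measurable_fun Om (fun x => `|h x| `^ r).
  apply: measurable_funS (measurableT) _ _ => //; apply: measurable_powRl; exact: measurable_abs.
have u0E : (\int[lebE]_(x in Om) (`|u0 x| `^ r)%:E = \int[lebE]_(x in Om) (`|h x| `^ r)%:E)%E.
  by apply: (integral_eq_ae mOm); apply: ae_imp hE => x hx Ox; rewrite (hx Ox).
apply: (@le_trans _ _ (\int[lebE]_(x in Om) (`|h x| `^ r + `|L| * `|k n x - h x|)%:E)%E).
  have -> : (\int[lebE]_(x in Om) (Psi (u (x, a n)))%:E = \int[lebE]_(x in Om) (Psi (k n x))%:E)%E.
    by apply: (integral_eq_ae mOm); apply: ae_imp (kP n).2 => x hx Ox; rewrite (hx Ox).
  apply: int_le => // x _; have := PsiL (k n x) (h x); have := Psir (h x).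
  have := ler_wpM2r (normr_ge0 (k n x - h x)) (ler_norm L).
  by have := ler_norm (Psi (k n x) - Psi (h x)); lra.
rewrite (@intD _ _ _ lebE Om mOm (fun x => `|h x| `^ r) (fun x => `|L| * `|k n x - h x|)) //;
  last by apply: measurable_funM.
rewrite (@intZ _ _ _ lebE Om mOm `|L| (fun x => `|k n x - h x|)) // -u0E.
rewrite EFinD fineK; first exact: leeD.
rewrite ge0_fin_numE//; apply: int_ge0 => x _; exact: powR_ge0.
Qed.

(** At a time a where u(., a) >= 0 almost everywhere, the integral of Psi(u(., a)) is
    at most that of u(., a), which converges to the mass of u0; such times are dense. *)
Lemma initial_bound_measure (u0 : {finite_measure set E -> \bar R}) :
  {ae leb2, forall z, cylinder Om 0%E T z -> 0 <= u z} ->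
  (forall t, 0 < t -> (t%:E < T)%E -> in_Lp lebE 1 Om (fun x => u (x, t))) ->
  initial_measure Om u u0 ->
  forall L ka de : R, 0 < ka -> 0 < de -> exists2 a, 0 < a < de &
     forall Psi : R -> R, (forall y, 0 <= Psi y) -> (forall y, Psi y <= `|y| `^ 1) ->
       (forall y z, `|Psi y - Psi z| <= L * `|y - z|) ->
       (\int[lebE]_(x in Om) (Psi (u (x, a)))%:E <= (fine (u0 Om) + ka)%:E)%E.
Proof.
move=> upos uL1 init L ka de ka0 de0.
have [t1 t10 t1T] := time_beyond T0.
have c1 : {within Om, continuous (cst 1 : E -> R)} by apply: continuous_subspaceT; exact: cst_continuous.
have /(_ (ex_intro _ 1 _))lim := init (cst 1) c1.
have {}lim : (fun t => \int[lebE]_(x in Om) (u (x, t) * cst 1 x)%:E)%E @ 0^'+ --> u0 Om.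
  have -> : u0 Om = (\int[u0]_(x in Om) (cst 1 x : R)%:E)%E.
    rewrite (eq_integral (cst 1%E)) ?integral_cst// ?mul1e//.
  by apply: lim => x _; rewrite normr1.
have u0fin : u0 Om \is a fin_num by exact: fin_num_measure.
have lt0 : (u0 Om < (fine (u0 Om) + ka)%:E)%E.
  by rewrite -[X in (X < _)%E](fineK u0fin) lte_fin ltrDl.
have near0 : \forall t \near 0^'+, (\int[lebE]_(x in Om) (u (x, t) * cst 1 x)%:E < (fine (u0 Om) + ka)%:E)%E.
  apply: (lim [set x | (x < (fine (u0 Om) + ka)%:E)%E]).
  exact: (open_ereal_lt' lt0).
have [e /= e0 He] : exists2 e : R, 0 < e & forall t, 0 < t -> t < e ->
    (\int[lebE]_(x in Om) (u (x, t) * cst 1 x)%:E < (fine (u0 Om) + ka)%:E)%E.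
  move: near0; rewrite /at_right near_withinE => /nbhs_ballP[e /= e0 He]; exists e => // t t0 te.
  by apply: He => //; rewrite /ball/= sub0r normrN gtr0_norm.
pose d := Num.min e (Num.min de t1).
have d0 : 0 < d by rewrite !lt_min e0 de0.
have sl : {ae leb, forall t, {ae lebE, forall x, cylinder Om 0%E T (x, t) -> 0 <= u (x, t)}}.
  exact: (ae_slices upos).
(* an interval is not contained in a null set *)
have [a /andP[a0 ad] Ha] : exists2 a, 0 < a < d &
    {ae lebE, forall x, cylinder Om 0%E T (x, a) -> 0 <= u (x, a)}.
  apply: contrapT => no; have [Nn [mN N0 sN]] := sl.
  have sub : `]0, d[%classic `<=` Nn.
    move=> t; rewrite /= in_itv/= => tI; apply: sN => h; apply: no; by exists t.
  have : (leb `]0%R, d[%classic <= leb Nn)%E by apply: le_measure => //; rewrite inE//; exact: measurable_itv.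
  rewrite N0 lebesgue_measure_itv/= lte_fin d0 sube0 lee_fin.
  by rewrite leNgt d0.
move: ad; rewrite !lt_min => /and3P[ae ade at1].
have aT : (a%:E < T)%E by apply: lt_trans t1T; rewrite lte_fin.
exists a; first by rewrite a0.
move=> Psi Psi0 Psi1 _; apply: le_trans (ltW (He a a0 ae)).
have [h [mh _ hE]] := cmeasurable_rep mOm (uL1 a a0 aT).1.
have hpos : {ae lebE, forall x, Om x -> u (x, a) = `|h x|}.
  apply: ae_imp (ae_and Ha hE) => x [h1 h2] Ox; rewrite -(h2 Ox) ger0_norm//.
  by apply: h1; rewrite /cylinder/= lte_fin a0.
have -> : (\int[lebE]_(x in Om) (u (x, a) * cst 1 x)%:E = \int[lebE]_(x in Om) `|h x|%:E)%E.
  by apply: (integral_eq_ae mOm); apply: ae_imp hpos => x hx Ox; rewrite (hx Ox) mulr1.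
have -> : (\int[lebE]_(x in Om) (Psi (u (x, a)))%:E = \int[lebE]_(x in Om) (Psi `|h x|)%:E)%E.
  by apply: (integral_eq_ae mOm); apply: ae_imp hpos => x hx Ox; rewrite (hx Ox).
by apply: int_le => // x _; have := Psi1 `|h x|; rewrite powRr1// normr_id.
Qed.

End initial.

Theorem theorem6p6 (R : realType) (N : nat) (Om : set 'rV[R]_N) (T : \bar R)
    (p q C nu lambda gamma : R)
    (A : 'rV[R]_N -> R -> R -> 'rV[R]_N -> 'rV[R]_N)
    (g : 'rV[R]_N -> R -> R -> 'rV[R]_N -> R)
    (b : 'rV[R]_N * R -> R) :
  (0 < N)%N -> smooth_bounded_domain Om -> (0 < T)%E -> 1 < p -> 1 < q ->
  0 < C -> 0 <= nu -> 0 <= lambda -> 0 <= gamma ->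
  in_Lp spacetime_measure (p / (p - 1)) (cylinder Om 0%E +oo%E) b ->
  (forall i, caratheodory Om (fun x t y eta => A x t y eta ord0 i)) ->
  caratheodory Om g ->
  (forall (y : R) (eta : 'rV[R]_N),
    {ae spacetime_measure, forall z, cylinder Om 0%E +oo%E z ->
      enorm (A z.1 z.2 y eta) <= C * (enorm eta `^ (p - 1) + b z)}) ->
  (forall (y : R) (eta : 'rV[R]_N),
    {ae spacetime_measure, forall z, cylinder Om 0%E +oo%E z ->
      nu * enorm eta `^ p <= dotv (A z.1 z.2 y eta) eta}) ->
  (forall (y : R) (eta : 'rV[R]_N),
    {ae spacetime_measure, forall z, cylinder Om 0%E +oo%E z ->
      gamma * `|y| `^ (lambda + 1) * enorm eta `^ q <= g z.1 z.2 y eta * y}) ->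
  (forall (r : R) (u0 : 'rV[R]_N -> R)
      (u : 'rV[R]_N * R -> R) (Du : 'rV[R]_N * R -> 'rV[R]_N),
    1 <= r -> in_Lp (lebesgue_rV N) r Om u0 ->
    renormalized_solution Om T A g p u Du -> initial_Lr Om T r u u0 ->
    energy_estimates Om T p q lambda gamma nu r
      [set t | (0%:E <= t%:E < T)%E] (extend0 u0 u) u Du
      (\int[lebesgue_rV N]_(x in Om) (`|u0 x| `^ r)%:E)%E) /\
  (forall (u0 : {finite_measure set 'rV[R]_N -> \bar R})
      (u : 'rV[R]_N * R -> R) (Du : 'rV[R]_N * R -> 'rV[R]_N),
    {ae spacetime_measure, forall z, cylinder Om 0%E T z -> 0 <= u z} ->
    renormalized_solution Om T A g p u Du -> initial_measure Om u u0 ->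
    energy_estimates Om T p q lambda gamma nu 1
      [set t | (0%:E < t%:E < T)%E] (fun t x => u (x, t)) u Du (u0 Om)).
Proof.
move=> _ [oOm _ _ bOm _] T0 p1 q1 C0 nu0 lam0 gam0 hb carA carg growth coercive sign.
have Omfin := bounded_finite_rV oOm bOm.
have mOm := open_measurable_rV oOm.
split => [r u0 u Du r1 hu0 sol init|u0 u Du upos sol init].
- have Mfin : (\int[lebesgue_rV N]_(x in Om) (`|u0 x| `^ r)%:E)%E \is a fin_num.
    by rewrite ge0_fin_numE; [exact: hu0.2|apply: int_ge0 => x _; exact: powR_ge0].
  apply: (energy_estimates_of oOm nu0 gam0 r1 (cmeasurable_u oOm sol)
    (cmeasurable_Du oOm sol) Mfin).
    move=> t t0 tT; rewrite -(fineK Mfin).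
    apply: (solution_energy oOm Omfin p1 q1 (ltW C0) nu0 lam0 gam0 hb carA carg growth coercive
      sign sol r1 t0 tT).
    exact: (initial_bound_Lr oOm Omfin r1 T0 hu0 init).
  move=> t /andP[]; rewrite lee_fin le_eqVlt => /predU1P[<- _|t0 tT].
    by right; split => //; rewrite /extend0 eqxx.
  left; split => //; split => //; apply/funext => x; by rewrite /extend0 gt_eqF.
- have Mfin : u0 Om \is a fin_num by exact: fin_num_measure.
  apply: (energy_estimates_of oOm nu0 gam0 (lexx 1) (cmeasurable_u oOm sol)
    (cmeasurable_Du oOm sol) Mfin).
    move=> t t0 tT; rewrite -(fineK Mfin).
    apply: (solution_energy oOm Omfin p1 q1 (ltW C0) nu0 lam0 gam0 hb carA carg growth coercive
      sign sol (lexx 1) t0 tT).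
    exact: (initial_bound_measure oOm T0 upos (u_L1 sol) init).
  by move=> t /andP[]; rewrite lte_fin => t0 tT; left.
Qed.
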